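(* Let $\alpha>1$, $\beta\in\mathbb{C}$, and let $F_{\alpha,\beta}$ be the entire function defined in the context. There are constants $c_{n,\alpha,\beta},d_{n,\alpha,\beta}\in\mathbb{C}$ such that, as $x\to\infty$ (with $x$ real and positive), $$ \begin{aligned} F_{\alpha,\beta}(x)&+\sum_{\beta+n\alpha+m+1=0}\frac{\mathrm{i}^{n-m}x^m}{n!\,m!}(\log x+\pi\mathrm{i}/2)\sim\sum_{n=0}^\infty\frac{c_{n,\alpha,\beta}}{x^{\beta+n\alpha+1}}\\ &+\exp\bigl(-\mathrm{i}\alpha^{-1/(\alpha-1)}(1-1/\alpha)x^{\frac{\alpha}{\alpha-1}}\bigr)x^{\frac{\beta+1-\alpha/2}{\alpha-1}}\sum_{n=0}^\infty\frac{d_{n,\alpha,\beta}}{x^{n\alpha/(\alpha-1)}}. \end{aligned} $$ The coefficients are given by $$c_{n,\alpha,\beta}=\frac{1}{n!}\exp\Bigl(-\frac{\mathrm{i}\pi}{2}\bigl(\beta+1+n(\alpha-1)\bigr)\Bigr)\Gamma^{*}(\beta+n\alpha+1),$$ $$d_{n,\alpha,\beta}=\frac{1}{(2n)!}\exp\bigl(\mathrm{i}\pi(2n+1)/4\bigr)\Gamma(n+1/2)\,\bigl\langle\delta^{(2n)}\bigl(\operatorname{sgn}(s-s_0)\sqrt{h(s_0)-h(s)}\bigr),s^\beta\bigr\rangle,$$ where $h(s)=s-s^\alpha$ and $s_0=\alpha^{-1/(\alpha-1)}$.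
   Context: For $\operatorname{Im}z<0$, $$ \begin{aligned} F_{\alpha,\beta}(z)=\mathrm{F.p.}\int_0^\infty t^\beta \mathrm{e}^{\mathrm{i}t^\alpha-\mathrm{i}zt}\,\mathrm{d}t:={}&\int_1^\infty t^\beta \mathrm{e}^{\mathrm{i}t^\alpha-\mathrm{i}zt}\,\mathrm{d}t+\int_0^1t^\beta\Bigl(\mathrm{e}^{\mathrm{i}t^\alpha-\mathrm{i}zt}-\sum_{m+n\alpha+\operatorname{Re}\beta\le-1}\frac{\mathrm{i}^n(-\mathrm{i}z)^m}{n!\,m!}t^{n\alpha+m}\Bigr)\mathrm{d}t\\ &+\sum'_{m+n\alpha+\operatorname{Re}\beta\le-1}\frac{\mathrm{i}^n(-\mathrm{i}z)^m}{n!\,m!}\,\frac{1}{\beta+n\alpha+m+1}, \end{aligned} $$ where $\sum'$ omits terms with $\beta+n\alpha+m+1=0$ (Hadamard finite part; the ordinary integral if $\operatorname{Re}\beta>-1$). This function extends to an entire function, also denoted $F_{\alpha,\beta}$. Sums with a condition involving $m,n$ run over pairs of integers $m,n\ge0$ satisfying it (finite, possibly empty). $\Gamma^{*}(z)=\Gamma(z)$ if $z\notin\{0,-1,-2,\dots\}$, and for integers $k\ge0$, $\Gamma^{*}(-k)=\mathrm{F.p.}\int_0^\infty\mathrm{e}^{-t}t^{-k-1}\,\mathrm{d}t=\frac{(-1)^k}{k!}\bigl(-\gamma+\sum_{j=1}^k\frac1j\bigr)$, with $\gamma$ the Euler–Mascheroni constant. The function $h(s)=s-s^\alpha$ on $(0,\infty)$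 has its unique stationary point (a maximum) at $s_0$; $\psi(s)=\operatorname{sgn}(s-s_0)\sqrt{h(s_0)-h(s)}$ is smooth and increasing near $s_0$ with $\psi(s_0)=0$, and $$\bigl\langle\delta^{(2n)}(\psi(s)),s^\beta\bigr\rangle:=\frac{\mathrm{d}^{2n}}{\mathrm{d}\omega^{2n}}\left.\left(\frac{(\psi^{-1}(\omega))^\beta}{\psi'(\psi^{-1}(\omega))}\right)\right|_{\omega=0}.$$ The relation $\sim$ with a sum of two asymptotic series on the right means: for every $M>0$, if both series are truncated after sufficiently many terms, the difference between the left-hand side and the truncated right-hand side is $O(x^{-M})$ as $x\to\infty$. *)

(* Defs.v *)
(* Classical real numbers of the standard library, with Coquelicot. *)
From Stdlib Require Import Reals ZArith Lia Lra.
From Coquelicot Require Import Coquelicot.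

Open Scope C_scope.

Definition Cexp (z : C) : C := ((exp (Re z) * cos (Im z))%R, (exp (Re z) * sin (Im z))%R).

(* Principal complex power [x ^ w] of a real [x > 0]. *)
Definition Cpower (x : R) (w : C) : C := Cexp (w * RtoC (ln x)).

(* Improper Riemann integral of a complex-valued function of a real variable. *)
Definition CInt (f : R -> C) (a b : (R -> Prop) -> Prop) : C :=
  RInt_gen (V := C_R_CompleteNormedModule) f a b.

Definition entire (F : C -> C) : Prop :=
  forall z : C, @ex_derive C_AbsRing C_NormedModule F z.

(** * Finite sums over pairs *)

(* Sum of [f n m] over the pairs with [n, m <= B] that satisfy [P].  It is
   used with [B := pair_bound beta], which is large enough to reach every pair
   satisfying the conditions at hand, see [pair_bound_le] and [pair_bound_eq]. *)
Definition pair_sum (B : nat) {P : nat -> nat -> Prop}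
    (P_dec : forall n m, {P n m} + {~ P n m}) (f : nat -> nat -> C) : C :=
  sum_n (fun n => sum_n (fun m => if P_dec n m then f n m else RtoC 0) B) B.

Definition pair_bound (beta : C) : nat := Z.to_nat (up (- Re beta)).

Definition pair_le (alpha : R) (beta : C) (n m : nat) : Prop :=
  (INR m + INR n * alpha + Re beta <= -1)%R.

Definition pair_le_dec alpha beta n m :
    {pair_le alpha beta n m} + {~ pair_le alpha beta n m} :=
  Rle_dec (INR m + INR n * alpha + Re beta) (-1).

Definition pair_exponent (alpha : R) (beta : C) (n m : nat) : C :=
  beta + RtoC (INR n * alpha) + RtoC (INR m) + 1.

Definition pair_eq (alpha : R) (beta : C) (n m : nat) : Prop :=
  pair_exponent alpha beta n m = 0.

Definition pair_eq_dec alpha beta n m :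
    {pair_eq alpha beta n m} + {~ pair_eq alpha beta n m} :=
  Ceq_dec (pair_exponent alpha beta n m) 0.

Lemma pair_bound_le (alpha : R) (beta : C) (n m : nat) :
  (1 < alpha)%R -> pair_le alpha beta n m ->
  (n <= pair_bound beta)%nat /\ (m <= pair_bound beta)%nat.
Proof.
unfold pair_le, pair_bound; intros Ha H.
pose proof (pos_INR n) as Hn; pose proof (pos_INR m) as Hm.
destruct (archimed (- Re beta)) as [Hup _].
assert (Hna : (INR n <= INR n * alpha)%R) by nra.
rewrite INR_IZR_INZ in Hn, Hm.
assert (n_up : (Z.of_nat n <= up (- Re beta))%Z).
{ apply le_IZR; rewrite <- INR_IZR_INZ; rewrite <- INR_IZR_INZ in Hn, Hm; lra. }
assert (m_up : (Z.of_nat m <= up (- Re beta))%Z).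
{ apply le_IZR; rewrite <- INR_IZR_INZ; rewrite <- INR_IZR_INZ in Hn, Hm; lra. }
split; lia.
Qed.

Lemma pair_bound_eq (alpha : R) (beta : C) (n m : nat) :
  (1 < alpha)%R -> pair_eq alpha beta n m ->
  (n <= pair_bound beta)%nat /\ (m <= pair_bound beta)%nat.
Proof.
intros Ha H; apply (pair_bound_le alpha); [exact Ha|].
apply (f_equal Re) in H; unfold pair_exponent in H; unfold pair_le.
destruct beta as [b1 b2]; simpl in *; lra.
Qed.

(** * The function [F] in the lower half-plane *)

(* Coefficient of [t ^ (n alpha + m)] in the expansion of
   [exp (i t ^ alpha - i z t)] at [t = 0]. *)
Definition phase_coef (z : C) (n m : nat) : C :=
  Ci ^ n * (- Ci * z) ^ m / (RtoC (INR (fact n)) * RtoC (INR (fact m))).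

Definition phase_exp (alpha : R) (z : C) (t : R) : C :=
  Cexp (Ci * RtoC (Rpower t alpha) - Ci * z * RtoC t).

(* Hadamard finite part of the integral of [t ^ beta exp (i t ^ alpha - i z t)]
   over [(0, oo)], for [Im z < 0]. *)
Definition F_finite_part (alpha : R) (beta z : C) : C :=
  CInt (fun t => Cpower t beta * phase_exp alpha z t)
       (at_point 1%R) (Rbar_locally p_infty)
  + CInt (fun t => Cpower t beta *
            (phase_exp alpha z t
             - pair_sum (pair_bound beta) (pair_le_dec alpha beta)
                 (fun n m => phase_coef z n m
                             * RtoC (Rpower t (INR n * alpha + INR m)))))
         (at_right 0%R) (at_point 1%R)
  + pair_sum (pair_bound beta) (pair_le_dec alpha beta)
      (fun n m => if pair_eq_dec alpha beta n m then RtoC 0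
                  else phase_coef z n m * (1 / pair_exponent alpha beta n m)).

(** * Gamma functions *)

Definition Gamma_integral (z : C) : C :=
  CInt (fun t => RtoC (exp (- t)) * Cpower t (z - 1))
       (at_right 0%R) (Rbar_locally p_infty).

Fixpoint rising_factorial (z : C) (n : nat) : C :=
  match n with
  | O => 1
  | S k => rising_factorial z k * (z + RtoC (INR k))
  end.

(* Euler's integral, continued meromorphically by
   [Gamma z = Gamma (z + N) / (z (z + 1) ... (z + N - 1))] with [N] such that
   [Re (z + N) > 0].  The value at the poles [0, -1, -2, ...] is irrelevant. *)
Definition CGamma (z : C) : C :=
  let N := Z.to_nat (up (- Re z)) in
  Gamma_integral (z + RtoC (INR N)) / rising_factorial z N.

Definition harmonic (k : nat) : R := sum_n_m (fun j => (/ INR j)%R) 1 k.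

Definition euler_gamma : R :=
  real (Lim_seq (fun n => (harmonic n - ln (INR n))%R)).

Definition Gamma_star_pole (k : nat) : R :=
  ((-1) ^ k / INR (fact k) * (- euler_gamma + harmonic k))%R.

(* [z] is a nonpositive integer iff it equals [- k] for this particular [k];
   see [Gamma_star_opp_nat] and [Gamma_star_regular]. *)
Definition Gamma_star (z : C) : C :=
  let k := Z.to_nat (Int_part (- Re z)) in
  if Ceq_dec z (RtoC (- INR k)) then RtoC (Gamma_star_pole k) else CGamma z.

Lemma Gamma_star_opp_nat (k : nat) :
  Gamma_star (RtoC (- INR k)) = RtoC (Gamma_star_pole k).
Proof.
unfold Gamma_star; simpl Re.
rewrite Ropp_involutive, Int_part_INR, Nat2Z.id.
now destruct (Ceq_dec _ _).
Qed.

Lemma Gamma_star_regular (z : C) :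
  (forall k : nat, z <> RtoC (- INR k)) -> Gamma_star z = CGamma z.
Proof.
intros H; unfold Gamma_star.
destruct (Ceq_dec _ _) as [E|_]; [now destruct (H _ E)|reflexivity].
Qed.

(** * The stationary point *)

Definition h (alpha s : R) : R := (s - Rpower s alpha)%R.

Definition s0 (alpha : R) : R := Rpower alpha (- (1 / (alpha - 1))).

Definition psi (alpha s : R) : R :=
  (sign (s - s0 alpha) * sqrt (h alpha (s0 alpha) - h alpha s))%R.

(* [iota] picks the unique such [s]: [psi alpha] is strictly increasing on
   [(0, oo)]. *)
Definition psi_inv (alpha omega : R) : R :=
  iota (T := R_CompleteNormedModule) (fun s : R => (0 < s)%R /\ psi alpha s = omega).

(* Iterated derivative of a complex-valued function of a real variable. *)
Definition CDerive_n (f : R -> C) (n : nat) (x : R) : C :=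
  (Derive_n (fun y => Re (f y)) n x, Derive_n (fun y => Im (f y)) n x).

(* The pairing of [delta ^ (k) (psi s)] with [s ^ beta]. *)
Definition delta_pairing (alpha : R) (beta : C) (k : nat) : C :=
  CDerive_n (fun omega => Cpower (psi_inv alpha omega) beta
                          / RtoC (Derive (psi alpha) (psi_inv alpha omega))) k 0.

(** * Asymptotics *)

(* [L x ~ sum_n a n x + E x * sum_n b n x] as [x -> +oo]: once both series are
   cut after sufficiently many terms, independently of each other, the error is
   [O (x ^ - M)]. *)
Definition asymptotic_sum (L : R -> C) (a : nat -> R -> C) (E : R -> C)
    (b : nat -> R -> C) : Prop :=
  forall M : R, (0 < M)%R ->
  exists N0 : nat, forall N1 N2 : nat, (N0 <= N1)%nat -> (N0 <= N2)%nat ->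
  exists K : R, Rbar_locally p_infty (fun x =>
    (Cmod (L x - (sum_n (fun n => a n x) N1 + E x * sum_n (fun n => b n x) N2))
     <= K * Rpower x (- M))%R).

(* Main.v *)
Require Import Defs.
From Stdlib Require Import Arith ZArith Reals Lra Lia Psatz.
From Coquelicot Require Import Coquelicot.

Open Scope C_scope.

(** By continuity, [F x] is the limit of [F (x - i eps)] as [eps > 0] tends to [0].  The finite part at
    [z = x - i eps] is expanded with error bounds uniform in [eps], and then [eps] tends to [0].

    Replace [e^(i t^alpha)] by its Taylor polynomial of degree [N] and integrate term by term.  This
    leads to the finite parts of the integrals of [t^(s-1) e^(-wt)] over [(0, oo)] with [w = i z] and
    [s = beta + n alpha + 1], which are [w^(-s) Gamma_star s], minus [(-w)^k / k! Log w] if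
    [s = - k] ([laplace_fp_value]; the logarithmic case rests on the value [- gamma] of the finite part
    of [e^(-t) / t], [exponential_integral_gamma]).  At [w = i x] these are the terms with
    coefficients [c n] and the logarithmic sum ([algebraic_part]).  What is left is a convergent
    integral in which the Taylor remainder replaces the exponential
    ([F_finite_part_decomposition]).

    The substitution [t = x^(1/(alpha-1)) s] gives both phases the same large parameter
    [lam = x^(alpha/(alpha-1))]: the remainder becomes a power of [x] times the integral of
    [s^beta (e^(i lam s^alpha) - Taylor) e^(- i lam s)], slightly damped.  A partition of unity
    separates three regions.  Below the stationary point [s0] of [h], repeated integration by parts
    is possible because the Taylor remainder vanishes at [0] to an order that grows like [alpha N],
    faster than the number of integrations needed to compensate its size [lam^N]
    ([rem_phase_zero]).  Above [s0] the full phase has no stationary point ([full_phase_inf]), and the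
    Taylor polynomial meets the linear phase only ([lin_phase_inf]).  All these contributions are
    smaller than any given power of [lam] ([off_stationary_bound]).

    Near [s0] the variable [om = psi s] turns the phase into [om^2].  It is a smooth coordinate since
    [h (s0) - h (s)] is [(s - s0)^2] times a smooth positive function (Hadamard's lemma, [psi_eq],
    [dpsi_pos]).  The amplitude becomes [(psi_inv om)^beta / psi'(psi_inv om)]; its even Taylor
    coefficients at [om = 0], multiplied by Fresnel integrals, are the coefficients [d n]
    ([stationary_expansion]).

    Improper integrals are treated through primitives ([is_fp]) and amplitudes through estimates on
    their derivatives ([sym]), so that every bound reduces to a mean value inequality. *)

(** * Derivatives and limits of complex functions of a real variable *)

(** Derivatives and limits are taken componentwise, which reduces them to real calculus. *)
Definition Cder (f : R -> C) (t : R) (l : C) : Prop :=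
  is_derive (fun x => Re (f x)) t (Re l) /\ is_derive (fun x => Im (f x)) t (Im l).

Definition Clim (f : R -> C) (F : (R -> Prop) -> Prop) (l : C) : Prop :=
  filterlim (fun x => Re (f x)) F (locally (Re l)) /\
  filterlim (fun x => Im (f x)) F (locally (Im l)).

Lemma C_eq (a b : C) : Re a = Re b -> Im a = Im b -> a = b.
Proof. destruct a, b; simpl; congruence. Qed.

Lemma Cder_eq f t l l' : Cder f t l -> l = l' -> Cder f t l'.
Proof. now intros H <-. Qed.

Lemma Cder_unique f t l l' : Cder f t l -> Cder f t l' -> l = l'.
Proof.
intros [a b] [c d]; apply C_eq.
- rewrite <- (is_derive_unique _ _ _ a); now apply is_derive_unique.
- rewrite <- (is_derive_unique _ _ _ b); now apply is_derive_unique.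
Qed.

Lemma Cder_ext_loc f g t l : locally t (fun x => f x = g x) -> Cder f t l -> Cder g t l.
Proof.
intros H [a b]; split.
- apply (is_derive_ext_loc (fun x => Re (f x))); [|exact a].
  revert H; apply filter_imp; intros x E; now rewrite E.
- apply (is_derive_ext_loc (fun x => Im (f x))); [|exact b].
  revert H; apply filter_imp; intros x E; now rewrite E.
Qed.

Lemma Cder_ext f g t l : (forall x, f x = g x) -> Cder f t l -> Cder g t l.
Proof. intros H; apply Cder_ext_loc; now apply filter_forall. Qed.

Lemma locally_pos (t : R) : (0 < t)%R -> locally t (fun x => (0 < x)%R).
Proof. intros H; now apply (open_gt 0%R). Qed.

Lemma Cder_ext_pos f g t l : (0 < t)%R -> (forall x, (0 < x)%R -> f x = g x) ->
  Cder f t l -> Cder g t l.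
Proof.
intros Ht H; apply Cder_ext_loc.
generalize (locally_pos t Ht); apply filter_imp; exact H.
Qed.

Lemma Cder_const c t : Cder (fun _ => c) t 0.
Proof. split; simpl; apply @is_derive_const. Qed.

Lemma Cder_RtoC f t l : is_derive f t l -> Cder (fun x => RtoC (f x)) t (RtoC l).
Proof. intros H; split; simpl; [exact H|apply @is_derive_const]. Qed.

Lemma Cder_plus f g t a b : Cder f t a -> Cder g t b -> Cder (fun x => f x + g x) t (a + b).
Proof.
intros [Hf Hf'] [Hg Hg']; split; simpl.
- now apply (is_derive_plus (fun x => Re (f x)) (fun x => Re (g x))).
- now apply (is_derive_plus (fun x => Im (f x)) (fun x => Im (g x))).
Qed.

Lemma Cder_opp f t a : Cder f t a -> Cder (fun x => - f x) t (- a).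
Proof.
intros [Hf Hf']; split; simpl.
- now apply (is_derive_opp (fun x => Re (f x))).
- now apply (is_derive_opp (fun x => Im (f x))).
Qed.

Lemma Cder_minus f g t a b : Cder f t a -> Cder g t b -> Cder (fun x => f x - g x) t (a - b).
Proof. intros Hf Hg; apply Cder_plus; [|apply Cder_opp]; assumption. Qed.

Lemma Cder_mult f g t a b : Cder f t a -> Cder g t b ->
  Cder (fun x => f x * g x) t (a * g t + f t * b).
Proof.
intros [Hf Hf'] [Hg Hg']; split; simpl.
- evar_last. apply (is_derive_minus (fun x => Re (f x) * Re (g x))%R (fun x => Im (f x) * Im (g x))%R).
  + apply (is_derive_mult (fun x => Re (f x)) (fun x => Re (g x))); eauto. intros; apply Rmult_comm.
  + apply (is_derive_mult (fun x => Im (f x)) (fun x => Im (g x))); eauto. intros; apply Rmult_comm.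
  + unfold minus, plus, opp, mult; simpl; unfold Re, Im; ring.
- evar_last. apply (is_derive_plus (fun x => Re (f x) * Im (g x))%R (fun x => Im (f x) * Re (g x))%R).
  + apply (is_derive_mult (fun x => Re (f x)) (fun x => Im (g x))); eauto. intros; apply Rmult_comm.
  + apply (is_derive_mult (fun x => Im (f x)) (fun x => Re (g x))); eauto. intros; apply Rmult_comm.
  + unfold plus, mult; simpl; unfold Re, Im; ring.
Qed.

Lemma Cder_scal c f t a : Cder f t a -> Cder (fun x => c * f x) t (c * a).
Proof.
intros H; eapply Cder_eq; [apply Cder_mult; [apply Cder_const|exact H]|cbv beta; ring].
Qed.

Lemma Cder_comp f (g : R -> R) t l d : Cder f (g t) l -> is_derive g t d ->
  Cder (fun x => f (g x)) t (RtoC d * l).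
Proof.
intros [a b] H; split; simpl.
- evar_last; [apply (is_derive_comp (fun x => Re (f x)) g); eassumption|].
  unfold scal; simpl; unfold mult; simpl; unfold Re, Im; simpl; ring.
- evar_last; [apply (is_derive_comp (fun x => Im (f x)) g); eassumption|].
  unfold scal; simpl; unfold mult; simpl; unfold Re, Im; simpl; ring.
Qed.

Lemma Cexp_plus a b : Cexp (a + b) = Cexp a * Cexp b.
Proof.
apply C_eq; unfold Cexp; simpl; rewrite exp_plus, ?cos_plus, ?sin_plus; unfold Re, Im; ring.
Qed.

Lemma Cexp_0 : Cexp 0 = 1.
Proof. unfold Cexp; simpl; rewrite exp_0, cos_0, sin_0; apply C_eq; simpl; ring. Qed.

Lemma Cexp_opp a : Cexp (- a) * Cexp a = 1.
Proof. rewrite <- Cexp_plus, <- Cexp_0; f_equal; ring. Qed.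

Lemma Cexp_neq0 a : Cexp a <> 0.
Proof.
intros E; apply C1_nz; rewrite <- (Cexp_opp a), E; ring.
Qed.

Lemma Cexp_inv a : / Cexp a = Cexp (- a).
Proof.
rewrite <- (Cmult_1_r (/ Cexp a)), <- (Cexp_opp a).
field; apply Cexp_neq0.
Qed.

Lemma Cexp_RtoC x : Cexp (RtoC x) = RtoC (exp x).
Proof. unfold Cexp; simpl; rewrite cos_0, sin_0; apply C_eq; simpl; ring. Qed.

Lemma Cmod_Cexp a : Cmod (Cexp a) = exp (Re a).
Proof.
unfold Cmod, Cexp; simpl fst; simpl snd.
replace (_ + _)%R with ((exp (Re a))^2 * (Rsqr (sin (Im a)) + Rsqr (cos (Im a))))%R
  by (unfold Rsqr; ring).
rewrite sin2_cos2, Rmult_1_r, sqrt_pow2; [reflexivity|left; apply exp_pos].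
Qed.

Lemma Cexp_pow a n : Cexp a ^ n = Cexp (RtoC (INR n) * a).
Proof.
induction n as [|n IH]; [simpl; rewrite Cmult_0_l, Cexp_0; reflexivity|].
rewrite S_INR, RtoC_plus, Cpow_S, IH, <- Cexp_plus; f_equal; ring.
Qed.

Lemma Cder_Cexp f t l : Cder f t l -> Cder (fun x => Cexp (f x)) t (l * Cexp (f t)).
Proof.
intros [a b]; split; simpl.
- evar_last.
  + apply (is_derive_mult (fun x => exp (Re (f x))) (fun x => cos (Im (f x)))).
    * apply (is_derive_comp exp (fun x => Re (f x))); [apply is_derive_exp|exact a].
    * apply (is_derive_comp cos (fun x => Im (f x))); [apply is_derive_cos|exact b].
    * intros; apply Rmult_comm.
  + unfold scal, plus, mult; simpl; unfold mult, Re, Im; simpl; ring.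
- evar_last.
  + apply (is_derive_mult (fun x => exp (Re (f x))) (fun x => sin (Im (f x)))).
    * apply (is_derive_comp exp (fun x => Re (f x))); [apply is_derive_exp|exact a].
    * apply (is_derive_comp sin (fun x => Im (f x))); [apply is_derive_sin|exact b].
    * intros; apply Rmult_comm.
  + unfold scal, plus, mult; simpl; unfold mult, Re, Im; simpl; ring.
Qed.

Lemma Cpower_plus x a b : Cpower x (a + b) = Cpower x a * Cpower x b.
Proof. unfold Cpower; rewrite <- Cexp_plus; f_equal; ring. Qed.

Lemma Cpower_0 x : Cpower x 0 = 1.
Proof. unfold Cpower; rewrite Cmult_0_l; apply Cexp_0. Qed.

Lemma Cpower_RtoC x r : Cpower x (RtoC r) = RtoC (Rpower x r).
Proof. unfold Cpower, Rpower; rewrite <- RtoC_mult; apply Cexp_RtoC. Qed.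

Lemma Cpower_1 x : (0 < x)%R -> Cpower x 1 = RtoC x.
Proof. intros H; rewrite (Cpower_RtoC x 1), Rpower_1; easy. Qed.

Lemma Cpower_neq0 x a : Cpower x a <> 0.
Proof. apply Cexp_neq0. Qed.

Lemma Cpower_opp x a : Cpower x (- a) = / Cpower x a.
Proof. unfold Cpower; rewrite Cexp_inv; f_equal; ring. Qed.

Lemma Cmod_Cpower x a : Cmod (Cpower x a) = Rpower x (Re a).
Proof. unfold Cpower, Rpower; rewrite Cmod_Cexp; simpl; f_equal; unfold Re, Im; ring. Qed.

Lemma Cpower_mult_base x y a : (0 < x)%R -> (0 < y)%R ->
  Cpower (x * y) a = Cpower x a * Cpower y a.
Proof.
intros; unfold Cpower; rewrite <- Cexp_plus, ln_mult, RtoC_plus by assumption; f_equal; ring.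
Qed.

Lemma Cpower_succ x a : (0 < x)%R -> Cpower x (a + 1) = Cpower x a * RtoC x.
Proof. intros H; rewrite Cpower_plus, Cpower_1; easy. Qed.

Lemma Cpower_pred x a : (0 < x)%R -> Cpower x (a - 1) = Cpower x a / RtoC x.
Proof.
intros H; unfold Cminus; rewrite Cpower_plus, Cpower_opp, Cpower_1; easy.
Qed.

Lemma Cder_Cpower a t : (0 < t)%R ->
  Cder (fun x => Cpower x a) t (a * Cpower t (a - 1)).
Proof.
intros Ht; eapply Cder_eq.
- apply (Cder_Cexp (fun x => a * RtoC (ln x))).
  apply Cder_scal, Cder_RtoC, is_derive_Reals, derivable_pt_lim_ln, Ht.
- rewrite Cpower_pred, RtoC_inv; [|try exact Ht; try lra..].
  unfold Cpower; field. intros E; apply RtoC_inj in E; lra.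
Qed.

Lemma Cder_cont_Re f t l : Cder f t l -> continuous (fun x => Re (f x)) t.
Proof. intros [a _]; apply @ex_derive_continuous; now exists (Re l). Qed.

Lemma Cder_cont_Im f t l : Cder f t l -> continuous (fun x => Im (f x)) t.
Proof. intros [_ a]; apply @ex_derive_continuous; now exists (Im l). Qed.

(** ** Limits *)

Section Limits.
Context {F : (R -> Prop) -> Prop} {FF : ProperFilter F}.

Lemma Clim_const c : Clim (fun _ => c) F c.
Proof. split; apply filterlim_const. Qed.

Lemma Clim_ext_loc f g l : F (fun x => f x = g x) -> Clim f F l -> Clim g F l.
Proof.
intros H [a b]; split.
- apply (filterlim_ext_loc (fun x => Re (f x))); [|exact a].
  revert H; apply filter_imp; intros x E; now rewrite E.
- apply (filterlim_ext_loc (fun x => Im (f x))); [|exact b].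
  revert H; apply filter_imp; intros x E; now rewrite E.
Qed.

Lemma Rlim_plus (f g : R -> R) a b : filterlim f F (locally a) -> filterlim g F (locally b) ->
  filterlim (fun x => f x + g x)%R F (locally (a + b)%R).
Proof.
intros Hf Hg; eapply filterlim_comp_2; [exact Hf|exact Hg|].
apply (@filterlim_plus R_AbsRing R_NormedModule a b).
Qed.

Lemma Rlim_opp (f : R -> R) a : filterlim f F (locally a) ->
  filterlim (fun x => - f x)%R F (locally (- a)%R).
Proof.
intros Hf; eapply filterlim_comp; [exact Hf|].
apply (@filterlim_opp R_AbsRing R_NormedModule a).
Qed.

Lemma Rlim_mult (f g : R -> R) a b : filterlim f F (locally a) -> filterlim g F (locally b) ->
  filterlim (fun x => f x * g x)%R F (locally (a * b)%R).
Proof.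
intros Hf Hg; eapply filterlim_comp_2; [exact Hf|exact Hg|].
apply (@filterlim_mult R_AbsRing a b).
Qed.

Lemma Rlim_le (f : R -> R) a M : F (fun x => f x <= M)%R -> filterlim f F (locally a) -> (a <= M)%R.
Proof.
intros H Hf; destruct (Rle_or_lt a M) as [|L]; [easy|exfalso].
assert (E : F (fun x => (M < f x)%R)).
{ apply Hf; now apply (open_gt M). }
destruct (filter_ex _ (filter_and _ _ H E)) as [x [? ?]]; lra.
Qed.

Lemma Rlim_squeeze0 (f g : R -> R) : F (fun x => Rabs (f x) <= g x)%R ->
  filterlim g F (locally 0%R) -> filterlim f F (locally 0%R).
Proof.
intros H Hg; apply (filterlim_le_le (F := F) (fun x => - g x)%R f g 0).
- revert H; apply filter_imp; intros x; unfold Rabs; destruct (Rcase_abs (f x)); intros; lra.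
- replace (Finite 0) with (Finite (- 0)%R) by (now rewrite Ropp_0). now apply Rlim_opp.
- exact Hg.
Qed.

Lemma Clim_eq f l l' : Clim f F l -> l = l' -> Clim f F l'.
Proof. now intros H <-. Qed.

Lemma Clim_plus f g a b : Clim f F a -> Clim g F b -> Clim (fun x => f x + g x) F (a + b).
Proof. intros [? ?] [? ?]; split; simpl; now apply Rlim_plus. Qed.

Lemma Clim_opp f a : Clim f F a -> Clim (fun x => - f x) F (- a).
Proof. intros [? ?]; split; simpl; now apply Rlim_opp. Qed.

Lemma Clim_minus f g a b : Clim f F a -> Clim g F b -> Clim (fun x => f x - g x) F (a - b).
Proof. intros Hf Hg; apply Clim_plus; [|apply Clim_opp]; assumption. Qed.

Lemma Clim_mult f g a b : Clim f F a -> Clim g F b -> Clim (fun x => f x * g x) F (a * b).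
Proof.
intros [? ?] [? ?]; split; simpl; [apply Rlim_plus; [|apply Rlim_opp]|apply Rlim_plus];
  now apply Rlim_mult.
Qed.

Lemma Clim_scal c f a : Clim f F a -> Clim (fun x => c * f x) F (c * a).
Proof. apply Clim_mult, Clim_const. Qed.

Lemma Clim_RtoC (f : R -> R) a : filterlim f F (locally a) -> Clim (fun x => RtoC (f x)) F (RtoC a).
Proof. intros H; split; simpl; [exact H|apply filterlim_const]. Qed.

Lemma Clim_0_bound f g : F (fun x => Cmod (f x) <= g x)%R ->
  filterlim g F (locally 0%R) -> Clim f F 0.
Proof.
intros H Hg; split; simpl; apply (Rlim_squeeze0 _ g); try exact Hg;
  revert H; apply filter_imp; intros x Hx; (eapply Rle_trans; [|exact Hx]).
- apply re_le_Cmod.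
- apply Rle_trans with (2 := Rmax_Cmod (f x)); apply Rmax_r.
Qed.

Lemma Cmod_Clim f l : Clim f F l -> filterlim (fun x => Cmod (f x)) F (locally (Cmod l)).
Proof.
intros [a b]; unfold Cmod.
apply (filterlim_comp _ _ _ (fun x => Re (f x) ^ 2 + Im (f x) ^ 2)%R sqrt F
        (locally (Re l ^ 2 + Im l ^ 2)%R)).
- apply Rlim_plus; simpl; repeat apply Rlim_mult; try assumption; apply filterlim_const.
- apply continuous_sqrt.
Qed.

Lemma Clim_Cmod_le f l M : F (fun x => Cmod (f x) <= M)%R -> Clim f F l -> (Cmod l <= M)%R.
Proof.
intros H Hl; eapply Rlim_le; [exact H|]; now apply Cmod_Clim.
Qed.

Lemma Rlim_unique (f : R -> R) a b : filterlim f F (locally a) -> filterlim f F (locally b) -> a = b.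
Proof. intros; eapply (filterlim_locally_unique (F:=F) f); eassumption. Qed.

Lemma Clim_unique f a b : Clim f F a -> Clim f F b -> a = b.
Proof. intros [? ?] [? ?]; apply C_eq; eapply Rlim_unique; eassumption. Qed.

Lemma Clim_Cexp f l : Clim f F l -> Clim (fun x => Cexp (f x)) F (Cexp l).
Proof.
intros [a b]; split; simpl; apply Rlim_mult;
  (eapply filterlim_comp; [eassumption|]).
1,3: apply continuous_exp.
- apply continuous_cos.
- apply continuous_sin.
Qed.
End Limits.

(** * Mean value inequality *)

Lemma nondecreasing_of_derive (u du : R -> R) a b : (a <= b)%R ->
  (forall t, a <= t <= b -> is_derive u t (du t))%R ->
  (forall t, a <= t <= b -> 0 <= du t)%R -> (u a <= u b)%R.
Proof.
intros Hab Hd Hp.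
destruct (MVT_gen u a b du) as [c [Hc E]].
- rewrite Rmin_left, Rmax_right by assumption; intros x Hx; apply Hd; lra.
- rewrite Rmin_left, Rmax_right by assumption; intros x Hx.
  apply derivable_continuous_pt; exists (du x); apply is_derive_Reals, Hd; lra.
- rewrite Rmin_left, Rmax_right in Hc by assumption.
  pose proof (Hp c Hc); nra.
Qed.

Lemma Re_mult_le (a b : C) : (Re a * Re b + Im a * Im b <= Cmod a * Cmod b)%R.
Proof.
rewrite <- (Cmod_conj a), <- Cmod_mult.
apply Rle_trans with (Re (Cconj a * b)).
- simpl; unfold Re, Im; lra.
- eapply Rle_trans; [apply Rle_abs|apply re_le_Cmod].
Qed.

Lemma Cmod_sqr (a : C) : (Re a * Re a + Im a * Im a = Cmod a * Cmod a)%R.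
Proof.
unfold Cmod; rewrite sqrt_sqrt; [unfold Re, Im; ring|]. 
apply Rplus_le_le_0_compat; apply pow2_ge_0.
Qed.

(** The mean value theorem fails for complex values; it is applied to the real part of [H] times
    the conjugate of [d = H b - H a], whose increment from [a] to [b] is [|d|^2]. *)
Lemma Cmod_diff_le (H f : R -> C) (Phi phi : R -> R) a b : (a <= b)%R ->
  (forall t, a <= t <= b -> Cder H t (f t))%R ->
  (forall t, a <= t <= b -> is_derive Phi t (phi t))%R ->
  (forall t, a <= t <= b -> Cmod (f t) <= phi t)%R ->
  (Cmod (H b - H a) <= Phi b - Phi a)%R.
Proof.
intros Hab HH HPhi Hle.
set (d := H b - H a).
assert (M : (0 <= Phi b - Phi a)%R).
{ enough (Phi a <= Phi b)%R by lra.
  apply (nondecreasing_of_derive Phi phi); try assumption.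
  intros t Ht; apply Rle_trans with (2 := Hle t Ht), Cmod_ge_0. }
pose (u := fun t => (Cmod d * Phi t - (Re d * Re (H t) + Im d * Im (H t)))%R).
assert (U : (u a <= u b)%R).
{ apply (nondecreasing_of_derive u
    (fun t => Cmod d * phi t - (Re d * Re (f t) + Im d * Im (f t)))%R); [assumption| |].
  - intros t Ht; destruct (HH t Ht) as [h1 h2].
    apply (is_derive_minus (fun t => Cmod d * Phi t)%R (fun t => (Re d * Re (H t) + Im d * Im (H t)))%R).
    + apply (is_derive_scal Phi); auto.
    + apply (is_derive_plus (fun t => Re d * Re (H t))%R (fun t => Im d * Im (H t))%R);
        apply is_derive_scal; assumption.
  - intros t Ht; pose proof (Re_mult_le d (f t)); pose proof (Hle t Ht).
    pose proof (Cmod_ge_0 d); nra. }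
unfold u in U.
assert (E : (Re d * Re d + Im d * Im d <= Cmod d * (Phi b - Phi a))%R).
{ replace (Re d * Re d + Im d * Im d)%R with
   (Re d * (Re (H b) - Re (H a)) + Im d * (Im (H b) - Im (H a)))%R; [lra|].
  unfold d; simpl; unfold Re, Im; ring. }
rewrite Cmod_sqr in E.
destruct (Req_dec (Cmod d) 0) as [Z|Z]; [rewrite Z; exact M|].
pose proof (Cmod_ge_0 d); apply Rmult_le_reg_l with (Cmod d); lra.
Qed.

Lemma Cder_0_const (H : R -> C) a b : (a <= b)%R ->
  (forall t, a <= t <= b -> Cder H t 0)%R -> H b = H a.
Proof.
intros Hab HH.
assert (E : (Cmod (H b - H a) <= 0 - 0)%R).
{ apply (Cmod_diff_le H (fun _ => 0) (fun _ => 0%R) (fun _ => 0%R)); try assumption.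
  - intros; apply @is_derive_const.
  - intros; rewrite Cmod_0; lra. }
assert (Z : H b - H a = 0) by (apply Cmod_eq_0; pose proof (Cmod_ge_0 (H b - H a)); lra).
replace (H b) with (H b - H a + H a) by ring; rewrite Z; ring.
Qed.

(** * Improper integrals and finite parts through primitives *)

Notation at_zero := (at_right 0%R).
Notation at_inf := (Rbar_locally p_infty).

(** [Q] is the divergent part at [0] of a primitive of [f]; when [Q] combines [ln] and powers with
    nonzero exponents, this is Hadamard's finite part.  Defined through primitives, linearity,
    scaling, integration by parts and domination all become facts on derivatives and limits. *)
Definition is_fp (f Q : R -> C) (v : C) : Prop :=
  exists (H : R -> C) (l0 l1 : C),
    (forall t, (0 < t)%R -> Cder H t (f t)) /\
    Clim (fun t => H t - Q t) at_zero l0 /\ Clim H at_inf l1 /\ v = l1 - l0.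

Definition is_cint (f : R -> C) (v : C) : Prop := is_fp f (fun _ => 0) v.

Lemma at_zero_lt (e : R) : (0 < e)%R -> at_zero (fun t => 0 < t < e)%R.
Proof.
intros He; exists (mkposreal e He); intros y Hy Hy0; split; [exact Hy0|].
unfold ball in Hy; simpl in Hy; unfold AbsRing_ball, abs, minus, plus, opp in Hy; simpl in Hy.
rewrite Ropp_0, Rplus_0_r, Rabs_pos_eq in Hy; lra.
Qed.

Lemma at_zero_pos : at_zero (fun t => 0 < t)%R.
Proof. generalize (at_zero_lt 1 Rlt_0_1); apply filter_imp; intros; lra. Qed.

Lemma at_inf_gt (M : R) : at_inf (fun t => M < t)%R.
Proof. now exists M. Qed.

Lemma is_fp_eq f Q v v' : is_fp f Q v -> v = v' -> is_fp f Q v'.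
Proof. now intros H <-. Qed.

Lemma is_fp_ext f g Q v : (forall t, (0 < t)%R -> f t = g t) -> is_fp f Q v -> is_fp g Q v.
Proof.
intros E [H [l0 [l1 [HH [H0 [H1 Hv]]]]]]; exists H, l0, l1; split; [|auto].
intros t Ht; rewrite <- E by assumption; now apply HH.
Qed.

(** A finite part depends on the constant term of [Q]: a change of scale moves [ln t] by a
    constant, and this is how logarithms of the parameters enter the values. *)
Lemma is_fp_shift f Q Q' v d : is_fp f Q v -> Clim (fun t => Q t - Q' t) at_zero d ->
  is_fp f Q' (v - d).
Proof.
intros [H [l0 [l1 [HH [H0 [H1 ->]]]]]] Hd; exists H, (l0 + d), l1; split; [exact HH|split; [|split; [exact H1|ring]]].
eapply (Clim_ext_loc (fun t => (H t - Q t) + (Q t - Q' t)));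
  [apply filter_forall; intros; ring|now apply Clim_plus].
Qed.

Lemma is_fp_Q f Q Q' v : is_fp f Q v -> Clim (fun t => Q t - Q' t) at_zero 0 -> is_fp f Q' v.
Proof. intros Hv Hd; eapply is_fp_eq; [eapply is_fp_shift; eassumption|ring]. Qed.

Lemma is_fp_plus f g Q R v w : is_fp f Q v -> is_fp g R w ->
  is_fp (fun t => f t + g t) (fun t => Q t + R t) (v + w).
Proof.
intros [H [l0 [l1 [HH [H0 [H1 ->]]]]]] [G [m0 [m1 [GG [G0 [G1 ->]]]]]].
exists (fun t => H t + G t), (l0 + m0), (l1 + m1); split; [|split; [|split; [|ring]]].
- intros; apply Cder_plus; auto.
- eapply (Clim_ext_loc (fun t => (H t - Q t) + (G t - R t)));
  [apply filter_forall; intros; ring|now apply Clim_plus].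
- now apply Clim_plus.
Qed.

Lemma is_fp_scal c f Q v : is_fp f Q v -> is_fp (fun t => c * f t) (fun t => c * Q t) (c * v).
Proof.
intros [H [l0 [l1 [HH [H0 [H1 ->]]]]]].
exists (fun t => c * H t), (c * l0), (c * l1); split; [|split; [|split; [|ring]]].
- intros; apply Cder_scal; auto.
- eapply (Clim_ext_loc (fun t => c * (H t - Q t)));
  [apply filter_forall; intros; ring|now apply Clim_scal].
- now apply Clim_scal.
Qed.

Lemma is_fp_primitive (G g R : R -> C) m0 m1 : (forall t, (0 < t)%R -> Cder G t (g t)) ->
  Clim (fun t => G t - R t) at_zero m0 -> Clim G at_inf m1 -> is_fp g R (m1 - m0).
Proof. intros; exists G, m0, m1; auto. Qed.

Lemma is_cint_ext f g v : (forall t, (0 < t)%R -> f t = g t) -> is_cint f v -> is_cint g v.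
Proof. apply is_fp_ext. Qed.

Lemma is_cint_eq f v v' : is_cint f v -> v = v' -> is_cint f v'.
Proof. apply is_fp_eq. Qed.

Lemma is_fp_0_shift f Q Q' v : is_fp f Q v -> (forall t, (0 < t)%R -> Q t = Q' t) -> is_fp f Q' v.
Proof.
intros H E; apply (is_fp_Q _ _ _ _ H).
eapply Clim_ext_loc; [|apply Clim_const].
generalize at_zero_pos; apply filter_imp; intros t Ht; rewrite E by assumption; ring.
Qed.

Lemma is_cint_plus f g v w : is_cint f v -> is_cint g w -> is_cint (fun t => f t + g t) (v + w).
Proof.
intros Hf Hg; eapply is_fp_0_shift; [apply (is_fp_plus _ _ _ _ _ _ Hf Hg)|intros; simpl; ring].
Qed.

Lemma is_cint_scal c f v : is_cint f v -> is_cint (fun t => c * f t) (c * v).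
Proof.
intros Hf; eapply is_fp_0_shift; [apply (is_fp_scal c _ _ _ Hf)|intros; simpl; ring].
Qed.

Lemma is_cint_opp f v : is_cint f v -> is_cint (fun t => - f t) (- v).
Proof.
intros Hf; apply (is_cint_scal (-(1))) in Hf.
eapply is_cint_eq; [eapply is_cint_ext; [|exact Hf]|]; intros; simpl; ring.
Qed.

Lemma is_cint_minus f g v w : is_cint f v -> is_cint g w -> is_cint (fun t => f t - g t) (v - w).
Proof. intros Hf Hg; apply is_cint_plus; [|apply is_cint_opp]; assumption. Qed.

Lemma is_cint_primitive (G g : R -> C) m0 m1 : (forall t, (0 < t)%R -> Cder G t (g t)) ->
  Clim G at_zero m0 -> Clim G at_inf m1 -> is_cint g (m1 - m0).
Proof.
intros Hd H0 H1; apply (is_fp_primitive G); auto.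
eapply Clim_ext_loc; [|exact H0]; apply filter_forall; intros; ring.
Qed.

Lemma is_fp_sum (f Q : nat -> R -> C) (v : nat -> C) N :
  (forall n, (n <= N)%nat -> is_fp (f n) (Q n) (v n)) ->
  is_fp (fun t => sum_n (fun n => f n t) N) (fun t => sum_n (fun n => Q n t) N) (sum_n v N).
Proof.
induction N as [|N IH]; intros H.
- rewrite sum_O. generalize (H 0%nat (Nat.le_refl _)); intros H0.
  eapply is_fp_0_shift; [eapply is_fp_ext; [|exact H0]|]; intros; now rewrite sum_O.
- rewrite sum_Sn.
  eapply is_fp_0_shift; [eapply is_fp_ext; [|apply is_fp_plus;
    [apply IH; intros; apply H; lia|apply (H (S N)); lia]]|];
  intros; now rewrite sum_Sn.
Qed.

Lemma is_cint_sum (f : nat -> R -> C) (v : nat -> C) N :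
  (forall n, (n <= N)%nat -> is_cint (f n) (v n)) ->
  is_cint (fun t => sum_n (fun n => f n t) N) (sum_n v N).
Proof.
intros H; eapply is_fp_0_shift; [apply (is_fp_sum f (fun _ _ => 0)); exact H|].
intros t _; induction N as [|N IH]; [now rewrite sum_O|].
rewrite sum_Sn, IH; [|intros; apply H; lia]. apply Cplus_0_l.
Qed.

Lemma primitive_diff_const (H G f : R -> C) : (forall t, (0 < t)%R -> Cder H t (f t)) ->
  (forall t, (0 < t)%R -> Cder G t (f t)) -> forall t, (0 < t)%R -> H t - G t = H 1%R - G 1%R.
Proof.
intros HH HG t Ht.
assert (D : forall s, (0 < s)%R -> Cder (fun x => H x - G x) s 0).
{ intros s Hs; eapply Cder_eq; [apply Cder_minus; auto|ring]. }
destruct (Rle_or_lt 1 t).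
- apply (Cder_0_const (fun x => H x - G x) 1 t); [lra|intros; apply D; lra].
- symmetry; apply (Cder_0_const (fun x => H x - G x) t 1); [lra|intros; apply D; lra].
Qed.

Lemma is_fp_unique f Q v w : is_fp f Q v -> is_fp f Q w -> v = w.
Proof.
intros [H [l0 [l1 [HH [H0 [H1 ->]]]]]] [G [m0 [m1 [HG [G0 [G1 ->]]]]]].
pose proof (primitive_diff_const H G f HH HG) as E.
assert (E1 : l1 - m1 = H 1%R - G 1%R).
{ eapply (Clim_unique (F := at_inf)); [apply Clim_minus; eassumption|].
  eapply Clim_ext_loc; [|apply Clim_const].
  generalize (at_inf_gt 0); apply filter_imp; intros t Ht; symmetry; now apply E. }
assert (E0 : l0 - m0 = H 1%R - G 1%R).
{ eapply (Clim_unique (F := at_zero)); [apply Clim_minus; eassumption|].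
  eapply Clim_ext_loc; [|apply Clim_const].
  generalize at_zero_pos; apply filter_imp; intros t Ht.
  rewrite <- (E t Ht); ring. }
replace l1 with (l1 - m1 + m1) by ring; rewrite E1, <- E0; ring.
Qed.

Lemma is_cint_unique f v w : is_cint f v -> is_cint f w -> v = w.
Proof. apply is_fp_unique. Qed.

Lemma at_zero_scale c : (0 < c)%R -> filterlim (fun t => c * t)%R at_zero at_zero.
Proof.
intros Hc P [e He].
assert (He' : (0 < e / c)%R) by (apply Rdiv_lt_0_compat; [apply cond_pos|exact Hc]).
generalize (at_zero_lt _ He'); unfold filtermap; apply filter_imp; intros t [Ht1 Ht2].
apply He; [|nra].
unfold ball; simpl; unfold AbsRing_ball, abs, minus, plus, opp; simpl.
rewrite Ropp_0, Rplus_0_r, Rabs_pos_eq by nra.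
apply (Rmult_lt_compat_l c) in Ht2; [|exact Hc].
replace (c * (e / c))%R with (pos e) in Ht2 by (field; lra); exact Ht2.
Qed.

Lemma at_inf_scale c : (0 < c)%R -> filterlim (fun t => c * t)%R at_inf at_inf.
Proof.
intros Hc P [M HM]; exists (M / c)%R; intros t Ht; apply HM.
apply (Rmult_lt_compat_l c) in Ht; [|exact Hc].
replace (c * (M / c))%R with M in Ht by (field; lra); exact Ht.
Qed.

Lemma Clim_comp (f : R -> C) (g : R -> R) F G l {FF : Filter F} : filterlim g F G -> Clim f G l ->
  Clim (fun x => f (g x)) F l.
Proof.
intros Hg [a b]; split.
- now apply (filterlim_comp _ _ _ g (fun x => Re (f x)) F G).
- now apply (filterlim_comp _ _ _ g (fun x => Im (f x)) F G).
Qed.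

Lemma is_fp_scaling c f Q v : (0 < c)%R -> is_fp f Q v ->
  is_fp (fun t => RtoC c * f (c * t)%R) (fun t => Q (c * t)%R) v.
Proof.
intros Hc [H [l0 [l1 [HH [H0 [H1 ->]]]]]].
apply (is_fp_primitive (fun t => H (c * t)%R)).
- intros t Ht; apply Cder_comp; [apply HH; nra|].
  auto_derive; [exact I|ring].
- apply (Clim_comp (fun t => H t - Q t) (fun t => (c * t)%R) at_zero at_zero); [typeclasses eauto|now apply at_zero_scale|exact H0].
- apply (Clim_comp H (fun t => (c * t)%R) at_inf at_inf); [typeclasses eauto|now apply at_inf_scale|exact H1].
Qed.

Lemma is_cint_scaling c f v : (0 < c)%R -> is_cint f v -> is_cint (fun t => RtoC c * f (c * t)%R) v.
Proof. intros Hc H; apply (is_fp_scaling c _ _ _ Hc H). Qed.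

(** ** Existence and bounds *)

Lemma primitive_exists (f : R -> C) : (forall t, (0 < t)%R -> exists l, Cder f t l) ->
  exists H, forall t, (0 < t)%R -> Cder H t (f t).
Proof.
intros Hf.
assert (P : forall g : R -> R, (forall t, (0 < t)%R -> continuous g t) ->
  forall t, (0 < t)%R -> is_derive (fun x => RInt g 1 x) t (g t)).
{ intros g Hg t Ht; apply (is_derive_RInt g _ 1); [|now apply Hg].
  generalize (locally_pos t Ht); apply filter_imp; intros x Hx.
  apply (@RInt_correct R_CompleteNormedModule); apply ex_RInt_continuous; intros z [Hz _].
  apply Hg; apply Rlt_le_trans with (2 := Hz); now apply Rmin_glb_lt; [lra|]. }
exists (fun t => (RInt (fun x => Re (f x)) 1 t, RInt (fun x => Im (f x)) 1 t)).
intros t Ht; split; simpl.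
- apply (P (fun x => Re (f x))); [|exact Ht]; intros s Hs; destruct (Hf s Hs) as [l Hl].
  eapply Cder_cont_Re, Hl.
- apply (P (fun x => Im (f x))); [|exact Ht]; intros s Hs; destruct (Hf s Hs) as [l Hl].
  eapply Cder_cont_Im, Hl.
Qed.

(** The increments of [H] are dominated by those of [Phi], which converges: Cauchy's criterion. *)
Lemma Clim_Cauchy (F : (R -> Prop) -> Prop) {FF : ProperFilter F} (H : R -> C) (Phi : R -> R) (p : R) :
  (exists P, F P /\ forall u v, P u -> P v -> (u <= v)%R -> (Cmod (H v - H u) <= Phi v - Phi u)%R) ->
  filterlim Phi F (locally p) -> exists l, Clim H F l.
Proof.
intros [P [FP HP]] HPhi.
assert (Cau : forall eps : posreal, exists P, F P /\ forall u v, P u -> P v -> (Cmod (H v - H u) < eps)%R).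
{ intros eps.
  destruct (proj2 (filterlim_locally_cauchy (U := R_CompleteSpace) (F := F) Phi) (ex_intro _ p HPhi) eps) as [Q [FQ HQ]].
  exists (fun x => P x /\ Q x); split; [now apply filter_and|].
  intros u v [Pu Qu] [Pv Qv].
  pose proof (HQ _ _ Qu Qv) as B1; unfold ball in B1; simpl in B1.
  unfold AbsRing_ball, abs, minus, plus, opp in B1; simpl in B1.
  apply Rabs_def2 in B1.
  destruct (Rle_or_lt u v) as [L|L].
  - eapply Rle_lt_trans; [now apply HP|lra].
  - rewrite <- Cmod_opp; replace (- (H v - H u)) with (H u - H v) by ring.
    eapply Rle_lt_trans; [apply HP; auto; lra|lra]. }
assert (Comp : forall c : C -> R, (forall z, Rabs (c z) <= Cmod z)%R ->
   (forall a b : C, c (a - b)%C = (c a - c b)%R) -> exists l, filterlim (fun x => c (H x)) F (locally l)).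
{ intros c Hc1 Hc2.
  apply (filterlim_locally_cauchy (U := R_CompleteSpace) (F := F)); intros eps.
  destruct (Cau eps) as [Q [FQ HQ]]; exists Q; split; [exact FQ|]; intros u v Qu Qv.
  unfold ball; simpl; unfold AbsRing_ball, abs, minus, plus, opp; simpl.
  change (c (H v) + - c (H u))%R with (c (H v) - c (H u))%R; rewrite <- Hc2.
  eapply Rle_lt_trans; [apply Hc1|]; now apply HQ. }
destruct (Comp Re re_le_Cmod) as [l1 Hl1].
{ intros [? ?] [? ?]; simpl; lra. }
destruct (Comp Im) as [l2 Hl2].
{ intros z; eapply Rle_trans; [|apply Rmax_Cmod]; apply Rmax_r. }
{ intros [? ?] [? ?]; simpl; lra. }
now exists (l1, l2).
Qed.

Lemma is_derive_Rpower_pos p t : (0 < t)%R -> is_derive (fun x => Rpower x p) t (p * Rpower t (p - 1))%R.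
Proof. intros Ht; apply is_derive_Reals, derivable_pt_lim_power, Ht. Qed.

Lemma is_derive_power_prim C p t : (0 < t)%R -> p <> (-1)%R ->
  is_derive (fun x => C * (Rpower x (p + 1) / (p + 1)))%R t (C * Rpower t p)%R.
Proof.
intros Ht Hp; apply (is_derive_scal (fun x => Rpower x (p + 1) / (p + 1))%R).
apply (is_derive_ext (fun x => / (p + 1) * Rpower x (p + 1))%R); [intros; unfold Rdiv; simpl; ring|].
evar_last; [apply (is_derive_scal (fun x => Rpower x (p+1))), is_derive_Rpower_pos, Ht|].
replace (p + 1 - 1)%R with p by ring. field; lra.
Qed.

Lemma Rpower_lim_zero p : (0 < p)%R -> filterlim (fun t => Rpower t p) at_zero (locally 0%R).
Proof.
intros Hp; apply (filterlim_locally (F := at_zero)); intros eps.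
assert (He : (0 < Rpower eps (/ p))%R) by apply exp_pos.
generalize (at_zero_lt _ He); apply filter_imp; intros t [Ht1 Ht2].
unfold ball; simpl; unfold AbsRing_ball, abs, minus, plus, opp; simpl.
rewrite Ropp_0, Rplus_0_r, Rabs_pos_eq by (left; apply exp_pos).
apply Rlt_le_trans with (Rpower (Rpower eps (/ p)) p).
- apply Rlt_Rpower_l; [exact Hp|]; split; assumption.
- rewrite Rpower_mult, Rinv_l, Rpower_1; [apply Rle_refl|apply cond_pos|lra].
Qed.

Lemma Rpower_lim_inf p : (p < 0)%R -> filterlim (fun t => Rpower t p) at_inf (locally 0%R).
Proof.
intros Hp; apply (filterlim_locally (F := at_inf)); intros eps.
exists (Rmax 1 (Rpower eps (/ p))); intros t Ht.
assert (H1 : (1 < t)%R) by (eapply Rle_lt_trans; [apply Rmax_l|exact Ht]).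
assert (H2 : (Rpower eps (/ p) < t)%R) by (eapply Rle_lt_trans; [apply Rmax_r|exact Ht]).
unfold ball; simpl; unfold AbsRing_ball, abs, minus, plus, opp; simpl.
rewrite Ropp_0, Rplus_0_r, Rabs_pos_eq by (left; apply exp_pos).
replace p with (- (- p))%R by ring; rewrite Rpower_Ropp.
assert (L : (Rpower (Rpower eps (/ p)) (- p) < Rpower t (- p))%R).
{ apply Rlt_Rpower_l; [lra|]; split; [apply exp_pos|exact H2]. }
rewrite Rpower_mult in L; replace (/ p * - p)%R with (- (1))%R in L by (field; lra).
rewrite Rpower_Ropp, Rpower_1 in L by apply cond_pos.
rewrite <- (Rinv_inv eps); apply Rinv_lt_contravar; [|exact L].
apply Rmult_lt_0_compat; [apply Rinv_0_lt_compat, cond_pos|apply exp_pos].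
Qed.

Lemma Rlim_const_mult (F : (R -> Prop) -> Prop) {FF : ProperFilter F} c f l : filterlim f F (locally l) ->
  filterlim (fun x => c * f x)%R F (locally (c * l)%R).
Proof. intros H; apply Rlim_mult; [apply filterlim_const|exact H]. Qed.

Lemma Rlim_eq (F : (R -> Prop) -> Prop) (f : R -> R) (l l' : R) :
  filterlim f F (locally l) -> l = l' -> filterlim f F (locally l').
Proof. now intros H <-. Qed.

Lemma power_prim_lim_zero C p : (-1 < p)%R ->
  filterlim (fun x => C * (Rpower x (p + 1) / (p + 1)))%R at_zero (locally 0%R).
Proof.
intros Hp; apply (filterlim_ext (fun x => C / (p + 1) * Rpower x (p + 1))%R).
- intros; field; lra.
- apply (Rlim_eq _ _ (C / (p + 1) * 0)%R); [|ring]; apply Rlim_const_mult; [typeclasses eauto|].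
  apply Rpower_lim_zero; lra.
Qed.

Lemma power_prim_lim_inf C p : (p < -1)%R ->
  filterlim (fun x => C * (Rpower x (p + 1) / (p + 1)))%R at_inf (locally 0%R).
Proof.
intros Hp; apply (filterlim_ext (fun x => C / (p + 1) * Rpower x (p + 1))%R).
- intros; field; lra.
- apply (Rlim_eq _ _ (C / (p + 1) * 0)%R); [|ring]; apply Rlim_const_mult; [typeclasses eauto|].
  apply Rpower_lim_inf; lra.
Qed.

Lemma is_cint_inv f v : is_cint f v -> exists H l0 l1, (forall t, (0 < t)%R -> Cder H t (f t)) /\
  Clim H at_zero l0 /\ Clim H at_inf l1 /\ v = l1 - l0.
Proof.
intros [H [l0 [l1 [HH [H0 H1]]]]]; exists H, l0, l1; split; [exact HH|split; [|exact H1]].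
eapply Clim_ext_loc; [|exact H0]; apply filter_forall; intros; ring.
Qed.

(** ** Majorants [C t^p] at the two ends of [(0, oo)] *)

Lemma primitive_lim_zero (H f : R -> C) C b p : (0 < b)%R -> (-1 < p)%R ->
  (forall t, (0 < t < b)%R -> Cder H t (f t)) ->
  (forall t, 0 < t < b -> Cmod (f t) <= C * Rpower t p)%R -> exists l0, Clim H at_zero l0.
Proof.
intros Hb Hp HH Hf.
apply (Clim_Cauchy at_zero H (fun x => C * (Rpower x (p + 1) / (p + 1)))%R 0); [|now apply power_prim_lim_zero].
exists (fun t => 0 < t < b)%R; split; [now apply at_zero_lt|].
intros u v Hu Hv Huv.
apply (Cmod_diff_le H f (fun x => C * (Rpower x (p + 1) / (p + 1)))%R (fun x => C * Rpower x p)%R); auto; intros.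
- apply HH; lra.
- apply is_derive_power_prim; lra.
- apply Hf; lra.
Qed.

Lemma primitive_lim_inf (H f : R -> C) C a p : (0 < a)%R -> (p < -1)%R ->
  (forall t, (a < t)%R -> Cder H t (f t)) ->
  (forall t, a < t -> Cmod (f t) <= C * Rpower t p)%R -> exists l1, Clim H at_inf l1.
Proof.
intros Ha Hp HH Hf.
apply (Clim_Cauchy at_inf H (fun x => C * (Rpower x (p + 1) / (p + 1)))%R 0); [|now apply power_prim_lim_inf].
exists (fun t => a < t)%R; split; [apply at_inf_gt|].
intros u v Hu Hv Huv.
apply (Cmod_diff_le H f (fun x => C * (Rpower x (p + 1) / (p + 1)))%R (fun x => C * Rpower x p)%R); auto; intros.
- apply HH; lra.
- apply is_derive_power_prim; lra.
- apply Hf; lra.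
Qed.

Lemma primitive_bound_zero (H f : R -> C) l0 C b p : (0 < b)%R -> (-1 < p)%R ->
  (forall t, (0 < t)%R -> Cder H t (f t)) ->
  (forall t, 0 < t <= b -> Cmod (f t) <= C * Rpower t p)%R -> Clim H at_zero l0 ->
  (Cmod (H b - l0) <= C * (Rpower b (p + 1) / (p + 1)))%R.
Proof.
intros Hb Hp HH Hle H0.
assert (L : filterlim (fun a => Cmod (H b - H a) + C * (Rpower a (p + 1) / (p + 1)))%R at_zero (locally (Cmod (H b - l0) + 0)%R)).
{ apply Rlim_plus; [|now apply power_prim_lim_zero].
  apply Cmod_Clim, Clim_minus; [apply Clim_const|exact H0]. }
rewrite <- (Rplus_0_r (Cmod _)); apply (Rlim_le (F := at_zero) _ _ _) with (2 := L).
generalize (at_zero_lt b Hb); apply filter_imp; intros a Ha.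
assert (X : (Cmod (H b - H a) <= C * (Rpower b (p + 1) / (p + 1)) - C * (Rpower a (p + 1) / (p + 1)))%R); [|lra].
apply (Cmod_diff_le H f (fun x => C * (Rpower x (p + 1) / (p + 1)))%R (fun x => C * Rpower x p)%R); try lra; intros.
- apply HH; lra.
- apply is_derive_power_prim; lra.
- apply Hle; lra.
Qed.

Lemma primitive_bound_inf (H f : R -> C) l1 C a p : (0 < a)%R -> (p < -1)%R ->
  (forall t, (0 < t)%R -> Cder H t (f t)) ->
  (forall t, a <= t -> Cmod (f t) <= C * Rpower t p)%R -> Clim H at_inf l1 ->
  (Cmod (l1 - H a) <= C * (Rpower a (p + 1) / - (p + 1)))%R.
Proof.
intros Ha Hp HH Hle H1.
assert (L : filterlim (fun b => Cmod (H b - H a) - C * (Rpower b (p + 1) / (p + 1)))%R at_inf (locally (Cmod (l1 - H a) - 0)%R)).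
{ apply Rlim_plus; [|now apply Rlim_opp, power_prim_lim_inf].
  apply Cmod_Clim, Clim_minus; [exact H1|apply Clim_const]. }
rewrite <- (Rminus_0_r (Cmod _)); apply (Rlim_le (F := at_inf) _ _ _) with (2 := L).
generalize (at_inf_gt a); apply filter_imp; intros b Hb.
assert (X : (Cmod (H b - H a) <= C * (Rpower b (p + 1) / (p + 1)) - C * (Rpower a (p + 1) / (p + 1)))%R).
{ apply (Cmod_diff_le H f (fun x => C * (Rpower x (p + 1) / (p + 1)))%R (fun x => C * Rpower x p)%R); try lra; intros.
  - apply HH; lra.
  - apply is_derive_power_prim; lra.
  - apply Hle; lra. }
replace (Rpower a (p + 1) / - (p + 1))%R with (- (Rpower a (p + 1) / (p + 1)))%R by (field; lra).
lra.
Qed.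

Lemma is_fp_exists (f Q q : R -> C) C p p' : (-1 < p)%R -> (p' < -1)%R ->
  (forall t, (0 < t)%R -> exists l, Cder f t l) ->
  (forall t, (0 < t)%R -> Cder Q t (q t)) ->
  (forall t, 0 < t <= 1 -> Cmod (f t - q t)%C <= C * Rpower t p)%R ->
  (forall t, 1 <= t -> Cmod (f t) <= C * Rpower t p')%R ->
  exists v, is_fp f Q v.
Proof.
intros Hp Hq Hd HQ H0 H1; destruct (primitive_exists f Hd) as [H HH].
destruct (primitive_lim_zero (fun t => H t - Q t) (fun t => f t - q t) C 1 p) as [l0 L0]; try lra; intros.
{ apply Cder_minus; [apply HH|apply HQ]; lra. }
{ apply H0; lra. }
destruct (primitive_lim_inf H f C 1 p') as [l1 L1]; try lra; intros.
{ apply HH; lra. }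
{ apply H1; lra. }
exists (l1 - l0); now apply (is_fp_primitive H).
Qed.

Lemma is_cint_exists (f : R -> C) C p q : (-1 < p)%R -> (q < -1)%R ->
  (forall t, (0 < t)%R -> exists l, Cder f t l) ->
  (forall t, 0 < t <= 1 -> Cmod (f t) <= C * Rpower t p)%R ->
  (forall t, 1 <= t -> Cmod (f t) <= C * Rpower t q)%R ->
  exists v, is_cint f v.
Proof.
intros Hp Hq Hd H0 H1; apply (is_fp_exists f (fun _ => 0) (fun _ => 0) C p q); auto.
- intros; apply Cder_const.
- intros t Ht; replace (f t - 0) with (f t) by ring; now apply H0.
Qed.

Lemma primitive_const_after (H f : R -> C) l1 b : (0 < b)%R -> (forall t, (0 < t)%R -> Cder H t (f t)) ->
  (forall t, (b <= t)%R -> f t = 0) -> Clim H at_inf l1 -> l1 = H b.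
Proof.
intros Hb HH Hz H1; eapply (Clim_unique (F := at_inf)); [exact H1|].
eapply Clim_ext_loc; [|apply Clim_const].
generalize (at_inf_gt b); apply filter_imp; intros t Ht; symmetry.
apply Cder_0_const; [lra|]; intros s Hs; rewrite <- (Hz s) by lra; apply HH; lra.
Qed.

Lemma primitive_const_before (H f : R -> C) l0 a : (0 < a)%R -> (forall t, (0 < t)%R -> Cder H t (f t)) ->
  (forall t, (0 < t <= a)%R -> f t = 0) -> Clim H at_zero l0 -> l0 = H a.
Proof.
intros Ha HH Hz H0; eapply (Clim_unique (F := at_zero)); [exact H0|].
eapply Clim_ext_loc; [|apply Clim_const].
generalize (at_zero_lt a Ha); apply filter_imp; intros t Ht.
apply Cder_0_const; [lra|]; intros s Hs; rewrite <- (Hz s) by lra; apply HH; lra.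
Qed.

Lemma is_cint_bound_zero (f : R -> C) v C b p : is_cint f v -> (0 < b)%R -> (-1 < p)%R ->
  (forall t, (b <= t)%R -> f t = 0) ->
  (forall t, 0 < t <= b -> Cmod (f t) <= C * Rpower t p)%R ->
  (Cmod v <= C * (Rpower b (p + 1) / (p + 1)))%R.
Proof.
intros Hv Hb Hp Hz Hle; destruct (is_cint_inv f v Hv) as [H [l0 [l1 [HH [H0 [H1 ->]]]]]].
rewrite (primitive_const_after H f l1 b) by assumption.
now apply (primitive_bound_zero H f).
Qed.

Lemma is_cint_bound_inf (f : R -> C) v C a p : is_cint f v -> (0 < a)%R -> (p < -1)%R ->
  (forall t, (0 < t <= a)%R -> f t = 0) ->
  (forall t, a <= t -> Cmod (f t) <= C * Rpower t p)%R ->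
  (Cmod v <= C * (Rpower a (p + 1) / - (p + 1)))%R.
Proof.
intros Hv Ha Hp Hz Hle; destruct (is_cint_inv f v Hv) as [H [l0 [l1 [HH [H0 [H1 ->]]]]]].
rewrite (primitive_const_before H f l0 a) by assumption.
now apply (primitive_bound_inf H f).
Qed.

Lemma is_cint_bound_both (f : R -> C) v C p q : is_cint f v -> (-1 < p)%R -> (q < -1)%R ->
  (forall t, 0 < t <= 1 -> Cmod (f t) <= C * Rpower t p)%R ->
  (forall t, 1 <= t -> Cmod (f t) <= C * Rpower t q)%R ->
  (Cmod v <= C * (/ (p + 1) + / - (q + 1)))%R.
Proof.
intros Hv Hp Hq B0 B1; destruct (is_cint_inv f v Hv) as [H [l0 [l1 [HH [H0 [H1 ->]]]]]].
assert (P1 : forall r, Rpower 1 r = 1%R) by (intros; unfold Rpower; rewrite ln_1, Rmult_0_r; apply exp_0).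
pose proof (primitive_bound_zero H f l0 C 1 p Rlt_0_1 Hp HH B0 H0) as X0.
pose proof (primitive_bound_inf H f l1 C 1 q Rlt_0_1 Hq HH B1 H1) as X1.
rewrite P1 in X0, X1; unfold Rdiv in X0, X1; rewrite Rmult_1_l in X0, X1.
replace (l1 - l0) with ((H 1%R - l0) + (l1 - H 1%R)) by ring.
eapply Rle_trans; [apply Cmod_triangle|]; lra.
Qed.

Lemma is_cint_exists_zero (f : R -> C) C a b p : (0 < a < b)%R -> (-1 < p)%R ->
  (forall t, (0 < t < b)%R -> exists l, Cder f t l) -> (forall t, (a < t)%R -> f t = 0) ->
  (forall t, 0 < t < b -> Cmod (f t) <= C * Rpower t p)%R ->
  exists v, is_cint f v.
Proof.
intros Hab Hp Hd Hz H0.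
destruct (primitive_exists f) as [H HH].
{ intros t Ht; destruct (Rlt_or_le t b) as [L|L]; [apply Hd; lra|].
  exists 0; apply (Cder_ext_loc (fun _ => 0)); [|apply Cder_const].
  generalize (open_gt a t ltac:(lra)); apply filter_imp; intros; symmetry; now apply Hz. }
destruct (primitive_lim_zero H f C b p) as [l0 L0]; try lra; auto.
{ intros; apply HH; lra. }
exists (H b - l0); apply (is_cint_primitive H); auto.
eapply Clim_ext_loc; [|apply Clim_const].
generalize (at_inf_gt b); apply filter_imp; intros t Ht; symmetry.
apply Cder_0_const; [lra|]; intros s Hs; rewrite <- (Hz s) by lra; apply HH; lra.
Qed.

(** ** Comparison with Riemann integrals *)

(** The fundamental theorem of calculus links primitives with improper Riemann integrals; the
    differentiability of [f] provides its integrability on compact intervals. *)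
Lemma CInt_primitive (H f : R -> C) (Fa Fb : (R -> Prop) -> Prop)
  {FFa : ProperFilter Fa} {FFb : ProperFilter Fb} la lb :
  Fa (fun t => 0 < t)%R -> Fb (fun t => 0 < t)%R ->
  (forall t, (0 < t)%R -> Cder H t (f t)) -> (forall t, (0 < t)%R -> exists l, Cder f t l) ->
  Clim H Fa la -> Clim H Fb lb -> CInt f Fa Fb = lb - la.
Proof.
intros Pa Pb HH Hf La Lb; unfold CInt; apply (is_RInt_gen_unique (V := C_R_CompleteNormedModule) f (lb - la)).
assert (I : forall a b, (0 < a)%R -> (0 < b)%R -> is_RInt (V := C_R_NormedModule) f a b (H b - H a)).
{ intros a b Ha Hb.
  assert (pos : forall x, (Rmin a b <= x)%R -> (0 < x)%R).
  { intros x Hx; eapply Rlt_le_trans; [|exact Hx]; now apply Rmin_glb_lt. }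
  apply (is_RInt_fct_extend_pair (U := R_NormedModule) (V := R_NormedModule) f a b (Re (H b) - Re (H a))%R (Im (H b) - Im (H a))%R).
  - apply (is_RInt_derive (fun x => Re (H x))); intros x [Hx _]; apply pos in Hx.
    + apply HH, Hx.
    + destruct (Hf x Hx) as [l Hl]; eapply Cder_cont_Re, Hl.
  - apply (is_RInt_derive (fun x => Im (H x))); intros x [Hx _]; apply pos in Hx.
    + apply HH, Hx.
    + destruct (Hf x Hx) as [l Hl]; eapply Cder_cont_Im, Hl. }
intros P HP; unfold filtermapi.
assert (Lim : forall (c : C -> R), filterlim (fun x => c (H x)) Fa (locally (c la)) ->
  filterlim (fun x => c (H x)) Fb (locally (c lb)) ->
  filterlim (fun ab : R * R => (c (H (snd ab)) + - c (H (fst ab)))%R) (filter_prod Fa Fb)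
   (locally (c lb + - c la)%R)).
{ intros c Ca Cb; eapply filterlim_comp_2.
  - apply (filterlim_comp _ _ _ snd (fun x => c (H x)) _ Fb); [apply filterlim_snd|exact Cb].
  - apply (filterlim_comp _ _ _ (fun ab : R * R => c (H (fst ab))) Ropp _ (locally (c la))).
    + apply (filterlim_comp _ _ _ fst (fun x => c (H x)) _ Fa); [apply filterlim_fst|exact Ca].
    + apply (@filterlim_opp R_AbsRing R_NormedModule).
  - apply (@filterlim_plus R_AbsRing R_NormedModule). }
assert (L : filterlim (fun ab : R * R => (H (snd ab) - H (fst ab) : C_R_NormedModule)) (filter_prod Fa Fb)
   (locally (lb - la : C_R_NormedModule))).
{ apply filterlim_locally; intros eps.
  generalize (filter_and _ _
    (proj1 (filterlim_locally _ _) (Lim Re (proj1 La) (proj1 Lb)) eps)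
    (proj1 (filterlim_locally _ _) (Lim Im (proj2 La) (proj2 Lb)) eps)).
  apply filter_imp; intros x [? ?]; split; assumption. }
assert (L' : filter_prod Fa Fb (fun ab => P (H (snd ab) - H (fst ab)))) by exact (L P HP).
assert (Q : filter_prod Fa Fb (fun ab => 0 < fst ab /\ 0 < snd ab)%R).
{ eapply Filter_prod; [exact Pa|exact Pb|]; simpl; auto. }
generalize (filter_and _ _ L' Q); apply filter_imp; intros [a b] [E [Ha Hb]]; simpl in *.
exists (H b - H a); split; [now apply I|exact E].
Qed.

Lemma is_cint_CInt f v : is_cint f v -> (forall t, (0 < t)%R -> exists l, Cder f t l) ->
  CInt f at_zero at_inf = v.
Proof.
intros Hv Hf; destruct (is_cint_inv f v Hv) as [H [l0 [l1 [HH [H0 [H1 ->]]]]]].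
apply (CInt_primitive H f at_zero at_inf); auto; [apply at_zero_pos|apply at_inf_gt].
Qed.

Lemma CInt_is_cint f : (forall t, (0 < t)%R -> exists l, Cder f t l) -> (exists v, is_cint f v) ->
  is_cint f (CInt f at_zero at_inf).
Proof. intros Hf [v Hv]; now rewrite (is_cint_CInt f v Hv Hf). Qed.

(** * Symbols *)

(** The symbol estimates [|f^(j)(s)| <= K s^(r-j)], [j <= J], on a domain [D]: the class of
    amplitudes that repeated integration by parts preserves.  The derivatives are carried as
    witnesses, which makes every closure property a plain induction on [J]. *)
Fixpoint sym (J : nat) (D : R -> Prop) (K r : R) (f : R -> C) : Prop :=
  (forall s, D s -> (Cmod (f s) <= K * Rpower s r)%R) /\
  match J with
  | O => True
  | S J' => exists f', (forall s, D s -> Cder f s (f' s)) /\ sym J' D K (r - 1) f'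
  end.

Definition open_pos (D : R -> Prop) := forall s, D s -> (0 < s)%R /\ locally s D.

Lemma sym_bound J D K r f : sym J D K r f -> forall s, D s -> (Cmod (f s) <= K * Rpower s r)%R.
Proof. destruct J; intros [H _]; exact H. Qed.

Lemma Rpower_gt0 s r : (0 < Rpower s r)%R.
Proof. apply exp_pos. Qed.

Lemma sym_eq J D K r r' f : sym J D K r f -> r = r' -> sym J D K r' f.
Proof. now intros H <-. Qed.

Lemma sym_le J D K K' r f : (K <= K')%R -> sym J D K r f -> sym J D K' r f.
Proof.
intros HK; revert r f; induction J as [|J IH]; intros r f [H1 H2]; split; auto.
1,2: intros s Hs; eapply Rle_trans; [now apply H1|]; apply Rmult_le_compat_r;
  [left; apply Rpower_gt0|exact HK].
destruct H2 as [f' [Hd H2]]; exists f'; auto.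
Qed.

Lemma sym_down J D K r f : sym (S J) D K r f -> sym J D K r f.
Proof.
revert r f; induction J as [|J IH]; intros r f [H1 [f' [Hd H2]]]; split; auto.
exists f'; auto.
Qed.

Lemma sym_le_order J' J D K r f : (J' <= J)%nat -> sym J D K r f -> sym J' D K r f.
Proof. induction 1; auto. intros H'; apply IHle; now apply sym_down. Qed.

Lemma sym_sub J (D D' : R -> Prop) K r f : (forall s, D' s -> D s) -> sym J D K r f -> sym J D' K r f.
Proof.
intros HD; revert r f; induction J as [|J IH]; intros r f [H1 H2]; split; auto.
destruct H2 as [f' [Hd H2]]; exists f'; auto.
Qed.

Lemma sym_ext J D K r f g : open_pos D -> (forall s, D s -> f s = g s) -> sym J D K r f -> sym J D K r g.
Proof.
intros HD E; destruct J; intros [H1 H2]; split; auto.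
1,2: intros s Hs; rewrite <- E; auto.
destruct H2 as [f' [Hd H2]]; exists f'; split; auto.
intros s Hs; apply (Cder_ext_loc f); auto.
destruct (HD s Hs) as [_ L]; revert L; apply filter_imp; exact E.
Qed.

(** Where [s^r] is bounded by [s^r'], an order [r] becomes an order [r']; this passes to the
    derivatives because both orders fall together. *)
Lemma sym_weaken J D K r r' L f : (0 <= L)%R -> open_pos D ->
  (forall s, D s -> Rpower s r <= L * Rpower s r')%R -> sym J D K r f -> (0 <= K)%R -> sym J D (L * K) r' f.
Proof.
intros HL HD HLs Hf HK; revert r r' f HLs Hf; induction J as [|J IH]; intros r r' f HLs [H1 H2]; split; auto.
1,2: intros s Hs; eapply Rle_trans; [now apply H1|]; pose proof (HLs s Hs); nra.
destruct H2 as [f' [Hd H2]]; exists f'; split; auto; apply (IH (r - 1)%R); auto.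
intros s Hs; specialize (HLs s Hs); destruct (HD s Hs) as [Hp _].
unfold Rminus; rewrite !Rpower_plus, Rpower_Ropp, Rpower_1 by exact Hp.
rewrite <- Rmult_assoc; apply Rmult_le_compat_r; [left; now apply Rinv_0_lt_compat|exact HLs].
Qed.

Lemma sym_zero J D K r : (0 <= K)%R -> sym J D K r (fun _ => 0).
Proof.
intros HK; revert r; induction J as [|J IH]; intros r; split; auto.
1,2: intros s Hs; rewrite Cmod_0; apply Rmult_le_pos; [exact HK|left; apply Rpower_gt0].
exists (fun _ => 0); split; auto; intros; apply Cder_const.
Qed.

Lemma sym_const J D c : sym J D (Cmod c) 0 (fun _ => c).
Proof.
destruct J as [|J]; split; auto.
1,2: intros s _; unfold Rpower; rewrite Rmult_0_l, exp_0; lra.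
exists (fun _ => 0); split; [intros; apply Cder_const|apply sym_zero, Cmod_ge_0].
Qed.

Lemma sym_plus J D K1 K2 r f g : sym J D K1 r f -> sym J D K2 r g -> sym J D (K1 + K2) r (fun s => f s + g s).
Proof.
revert r f g; induction J as [|J IH]; intros r f g [F1 F2] [G1 G2]; split; auto.
1,2: intros s Hs; eapply Rle_trans; [apply Cmod_triangle|]; rewrite Rmult_plus_distr_r;
  apply Rplus_le_compat; auto.
destruct F2 as [f' [Fd F2]], G2 as [g' [Gd G2]].
exists (fun s => f' s + g' s); split; auto.
intros; apply Cder_plus; auto.
Qed.

Lemma sym_scal J D K r c f : sym J D K r f -> sym J D (Cmod c * K) r (fun s => c * f s).
Proof.
revert r f; induction J as [|J IH]; intros r f [F1 F2]; split; auto.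
1,2: intros s Hs; rewrite Cmod_mult, Rmult_assoc; apply Rmult_le_compat_l; [apply Cmod_ge_0|auto].
destruct F2 as [f' [Fd F2]].
exists (fun s => c * f' s); split; auto.
intros; apply Cder_scal; auto.
Qed.

Lemma sym_mult J D K1 K2 r1 r2 f g : sym J D K1 r1 f -> sym J D K2 r2 g ->
  sym J D (2 ^ J * (K1 * K2)) (r1 + r2) (fun s => f s * g s).
Proof.
assert (B : forall r1 r2 f g, (forall s, D s -> (Cmod (f s) <= K1 * Rpower s r1)%R) ->
  (forall s, D s -> (Cmod (g s) <= K2 * Rpower s r2)%R) ->
  forall s, D s -> (0 <= K1 * K2)%R /\ (Cmod (f s * g s) <= (K1 * K2) * Rpower s (r1 + r2))%R).
{ clear; intros r1 r2 f g F1 G1 s Hs; specialize (F1 s Hs); specialize (G1 s Hs); split.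
  - pose proof (Cmod_ge_0 (f s)); pose proof (Cmod_ge_0 (g s)).
    pose proof (Rpower_gt0 s r1); pose proof (Rpower_gt0 s r2).
    apply Rmult_le_pos; nra.
  - rewrite Cmod_mult, Rpower_plus.
    replace (K1 * K2 * (Rpower s r1 * Rpower s r2))%R with ((K1 * Rpower s r1) * (K2 * Rpower s r2))%R by ring.
    apply Rmult_le_compat; auto; apply Cmod_ge_0. }
revert r1 r2 f g; induction J as [|J IH]; intros r1 r2 f g Hf Hg.
{ destruct Hf as [F1 _], Hg as [G1 _]; split; auto.
  intros s Hs; simpl; rewrite Rmult_1_l; now apply B. }
pose proof (sym_down _ _ _ _ _ Hf) as Hf0; pose proof (sym_down _ _ _ _ _ Hg) as Hg0.
destruct Hf as [F1 [f' [Fd F2]]], Hg as [G1 [g' [Gd G2]]]; split.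
- intros s Hs; destruct (B _ _ _ _ F1 G1 s Hs) as [P Q].
  eapply Rle_trans; [exact Q|]; apply Rmult_le_compat_r; [left; apply Rpower_gt0|].
  assert (1 <= 2 ^ S J)%R by (apply pow_R1_Rle; lra). nra.
- exists (fun s => f' s * g s + f s * g' s); split; [intros; apply Cder_mult; auto|].
  replace (2 ^ S J * (K1 * K2))%R with (2 ^ J * (K1 * K2) + 2 ^ J * (K1 * K2))%R by (simpl; ring).
  apply sym_plus.
  + eapply sym_eq; [apply IH; [exact F2|exact Hg0]|ring].
  + eapply sym_eq; [apply IH; [exact Hf0|exact G2]|ring].
Qed.

Lemma Cder_inv (f : R -> C) t l : f t <> 0 -> Cder f t l -> Cder (fun x => / f x) t (- (l * (/ f t * / f t))).
Proof.
intros Hn Hf.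
assert (N : (Re (f t) * Re (f t) + Im (f t) * Im (f t) <> 0)%R).
{ rewrite Cmod_sqr; intros E; apply Hn, Cmod_eq_0; nra. }
destruct Hf as [a b].
assert (Q : is_derive (fun x => (Re (f x) * Re (f x) + Im (f x) * Im (f x))%R) t
  (2 * (Re (f t) * Re l + Im (f t) * Im l))%R).
{ evar_last.
  - apply (is_derive_plus (fun x => (Re (f x) * Re (f x))%R) (fun x => (Im (f x) * Im (f x))%R)).
    + apply (is_derive_mult (fun x => Re (f x)) (fun x => Re (f x))); eauto; intros; apply Rmult_comm.
    + apply (is_derive_mult (fun x => Im (f x)) (fun x => Im (f x))); eauto; intros; apply Rmult_comm.
  - unfold plus, mult; simpl; unfold mult; simpl; ring. }
apply is_derive_inv in Q; [|exact N].
split.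
- apply (is_derive_ext (fun x => (Re (f x) * / (Re (f x) * Re (f x) + Im (f x) * Im (f x)))%R)).
  { intros x; unfold Cinv; simpl; unfold Rdiv, Re, Im; simpl; now rewrite !Rmult_1_r. }
  evar_last.
  + apply (is_derive_mult (fun x => Re (f x))); [exact a|exact Q|intros; apply Rmult_comm].
  + unfold plus, mult; simpl; unfold mult, Cinv; simpl; unfold Re, Im in *; field; exact N.
- apply (is_derive_ext (fun x => ((- Im (f x)) * / (Re (f x) * Re (f x) + Im (f x) * Im (f x)))%R)).
  { intros x; unfold Cinv; simpl; unfold Rdiv, Re, Im; simpl; now rewrite !Rmult_1_r. }
  evar_last.
  + apply (is_derive_mult (fun x => (- Im (f x))%R)); [apply (is_derive_opp (fun x => Im (f x))); exact b|exact Q|intros; apply Rmult_comm].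
  + unfold plus, mult, opp; simpl; unfold mult, opp, Cinv; simpl; unfold Re, Im in *; field; exact N.
Qed.

(** By induction through [(1/f)' = - f' / f^2].  The constant depends on [f] only through [K] and
    the lower bound [c], so that it is uniform in any parameter hidden in [f]. *)
Lemma sym_inv J K c : (0 < c)%R -> exists K', forall D r f, sym J D K r f ->
  (forall s, D s -> (c * Rpower s r <= Cmod (f s))%R) -> sym J D K' (- r) (fun s => / f s).
Proof.
intros Hc.
assert (B : forall (D : R -> Prop) r f, (forall s, D s -> (c * Rpower s r <= Cmod (f s))%R) -> forall s, D s ->
  f s <> 0 /\ (Cmod (/ f s) <= / c * Rpower s (- r))%R).
{ intros D r f H s Hs; specialize (H s Hs).
  assert (P : (0 < c * Rpower s r)%R) by (apply Rmult_lt_0_compat; [exact Hc|apply Rpower_gt0]).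
  assert (N : f s <> 0) by (intros E; rewrite E, Cmod_0 in H; lra).
  split; [exact N|].
  rewrite Cmod_inv by exact N; rewrite Rpower_Ropp, <- Rinv_mult.
  apply Rinv_le_contravar; assumption. }
induction J as [|J [K' IH]].
- exists (/ c)%R; intros D r f _ H; split; auto; intros s Hs; now apply (B D r f).
- exists (Rmax (/ c) (Cmod (- (1)) * (2 ^ J * (K * (2 ^ J * (K' * K')))))); intros D r f Hf H.
  split.
  + intros s Hs; eapply Rle_trans; [now apply (B D r f)|].
    apply Rmult_le_compat_r; [left; apply Rpower_gt0|apply Rmax_l].
  + pose proof (IH D r f (sym_down _ _ _ _ _ Hf) H) as Hi.
    destruct Hf as [_ [f' [Hd Hf']]].
    exists (fun s => - (1) * (f' s * (/ f s * / f s))); split.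
    * intros s Hs; eapply Cder_eq; [apply Cder_inv; [now apply (B D r f)|auto]|ring].
    * eapply sym_le; [apply Rmax_r|]. eapply sym_eq; [apply sym_scal, sym_mult; [exact Hf'|]|].
      -- apply sym_mult; exact Hi.
      -- ring.
Qed.

Lemma sym_Cpower J b : exists K, forall D, open_pos D -> sym J D K (Re b) (fun s => Cpower s b).
Proof.
revert b; induction J as [|J IH]; intros b.
- exists 1%R; intros D HD; split; auto; intros s Hs; rewrite Cmod_Cpower; lra.
- destruct (IH (b - 1)) as [K HK]; exists (Rmax 1 (Cmod b * K)); intros D HD; split.
  + intros s Hs; rewrite Cmod_Cpower; rewrite <- (Rmult_1_l (Rpower s (Re b))) at 1.
    apply Rmult_le_compat_r; [left; apply Rpower_gt0|apply Rmax_l].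
  + exists (fun s => b * Cpower s (b - 1)); split.
    * intros s Hs; apply Cder_Cpower; now apply HD.
    * eapply sym_le; [apply Rmax_r|]; apply sym_scal; apply HK; exact HD.
Qed.

Lemma sym_nonneg J D K r f s : sym J D K r f -> D s -> (0 <= K)%R.
Proof.
intros H Hs; apply sym_bound with (s := s) in H; [|exact Hs].
pose proof (Cmod_ge_0 (f s)); pose proof (Rpower_gt0 s r); nra.
Qed.

Lemma open_pos_interval a b : (0 <= a)%R -> open_pos (fun s => a < s < b)%R.
Proof.
intros Ha s [H1 H2]; split; [lra|].
apply filter_and; [now apply (open_gt a)|now apply (open_lt b)].
Qed.

Lemma open_pos_ray a : (0 <= a)%R -> open_pos (fun s => a < s)%R.
Proof. intros Ha s H; split; [lra|now apply (open_gt a)]. Qed.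

(** * Repeated integration by parts *)

Lemma Cder_zero_after (f : R -> C) a s l : (forall t, (a < t)%R -> f t = 0) -> (a < s)%R -> Cder f s l -> l = 0.
Proof.
intros Hz Hs Hd; apply (Cder_unique f s); [exact Hd|].
apply (Cder_ext_loc (fun _ => 0)); [|apply Cder_const].
generalize (open_gt a s Hs); apply filter_imp; intros; symmetry; now apply Hz.
Qed.

Lemma Cder_zero_before (f : R -> C) a s l : (forall t, (t < a)%R -> f t = 0) -> (s < a)%R -> Cder f s l -> l = 0.
Proof.
intros Hz Hs Hd; apply (Cder_unique f s); [exact Hd|].
apply (Cder_ext_loc (fun _ => 0)); [|apply Cder_const].
generalize (open_lt a s Hs); apply filter_imp; intros; symmetry; now apply Hz.
Qed.

Lemma Clim_0_eventually F {FF : ProperFilter F} (f : R -> C) : F (fun t => f t = 0) -> Clim f F 0.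
Proof.
intros H; eapply Clim_ext_loc; [|apply Clim_const].
revert H; apply filter_imp; intros; now symmetry.
Qed.

(** One integration by parts against a phase factor [E' = lam p E + e], where [1/p = v].
    The open set [D] carries the amplitude: outside of [D] it vanishes identically. *)
Lemma by_parts (D : R -> Prop) (lam : R) (E p v e f g : R -> C) val :
  (forall s, (0 < s)%R -> D s \/ (locally s (fun t => f t = 0) /\ g s = 0)) ->
  (forall s, D s -> Cder E s (RtoC lam * p s * E s + e s)) ->
  (forall s, D s -> p s * v s = 1) ->
  (forall s, D s -> Cder (fun x => f x * v x) s (g s)) ->
  Clim (fun s => f s * v s * E s) at_zero 0 -> Clim (fun s => f s * v s * E s) at_inf 0 ->
  is_cint (fun s => f s * E s) val ->
  is_cint (fun s => g s * E s + f s * v s * e s) (- RtoC lam * val).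
Proof.
intros HD HE Hpv Hg H0 H1 Hval.
assert (P : is_cint (fun s => RtoC lam * (f s * E s) + (g s * E s + f s * v s * e s)) (0 - 0)).
{ apply (is_cint_primitive (fun s => f s * v s * E s)); [|exact H0|exact H1].
  intros s Hs; destruct (HD s Hs) as [Ds|[L Z]].
  - eapply Cder_eq; [apply Cder_mult; [now apply Hg|now apply HE]|].
    transitivity (RtoC lam * (f s * E s * (p s * v s)) + (g s * E s + f s * v s * e s)); [ring|].
    rewrite (Hpv s Ds); ring.
  - assert (Fs : f s = 0) by exact (locally_singleton s _ L).
    rewrite Fs, Z; apply (Cder_ext_loc (fun _ => 0)).
    + revert L; apply filter_imp; intros x ->; ring.
    + eapply Cder_eq; [apply Cder_const|ring]. }
pose proof (is_cint_minus _ _ _ _ P (is_cint_scal (RtoC lam) _ _ Hval)) as Q.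
eapply is_cint_eq; [eapply is_cint_ext; [|exact Q]|]; intros; simpl; ring.
Qed.

(** The amplitude is controlled on an interval only, but it vanishes near the end of it: the
    derivative of [f v], extended by [0], is again an amplitude of the same kind. *)
Lemma derivative_cutoff_right (b a : R) (f v g0 : R -> C) : (forall s, (0 < s < b)%R -> Cder (fun x => f x * v x) s (g0 s)) ->
  (0 < a < b)%R -> (forall s, (a < s)%R -> f s = 0) ->
  exists g, (forall s, (0 < s < b)%R -> g0 s = g s) /\ (forall s, (a < s)%R -> g s = 0).
Proof.
intros Hd Hab Hf; exists (fun s => if Rlt_dec s b then g0 s else 0); split; intros s Hs; destruct (Rlt_dec s b); try lra; auto.
apply (Cder_zero_after (fun s => f s * v s) a s); [|exact Hs|apply Hd; lra].
intros t Ht; rewrite Hf by exact Ht; ring.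
Qed.

Lemma derivative_cutoff_left (a b : R) (f v g0 : R -> C) : (forall s, (a < s)%R -> Cder (fun x => f x * v x) s (g0 s)) ->
  (0 < a < b)%R -> (forall s, (s < b)%R -> f s = 0) ->
  exists g, (forall s, (a < s)%R -> g0 s = g s) /\ (forall s, (s < b)%R -> g s = 0).
Proof.
intros Hd Hab Hf; exists (fun s => if Rlt_dec a s then g0 s else 0); split; intros s Hs; destruct (Rlt_dec a s); try lra; auto.
apply (Cder_zero_before (fun s => f s * v s) b s); [|exact Hs|now apply Hd].
intros t Ht; rewrite Hf by exact Ht; ring.
Qed.

Lemma zero_or_left (f g : R -> C) a b : (0 < a < b)%R -> (forall s, (a < s)%R -> f s = 0) -> (forall s, (a < s)%R -> g s = 0) ->
  forall s, (0 < s)%R -> (0 < s < b)%R \/ (locally s (fun t => f t = 0) /\ g s = 0).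
Proof.
intros Hab Hf Hg s Hs; destruct (Rlt_or_le s b) as [L|L]; [left; lra|right].
split; [|apply Hg; lra]; generalize (open_gt a s ltac:(lra)); apply filter_imp; exact Hf.
Qed.

Lemma zero_or_right (f g : R -> C) a b : (a < b)%R -> (forall s, (s < b)%R -> f s = 0) -> (forall s, (s < b)%R -> g s = 0) ->
  forall s, (0 < s)%R -> (a < s)%R \/ (locally s (fun t => f t = 0) /\ g s = 0).
Proof.
intros Hab Hf Hg s Hs; destruct (Rlt_or_le a s) as [L|L]; [left; exact L|right].
split; [|apply Hg; lra]; generalize (open_lt b s ltac:(lra)); apply filter_imp; exact Hf.
Qed.

(** Dividing by a slope of order [tau] and differentiating lowers the order of the amplitude by
    [1 + tau] and gains a factor [1 / lam]; the condition on [r] keeps the amplitude integrable at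
    [0] after [J] such steps.  The constant depends neither on [lam] nor on the phase. *)
Lemma parts_zero J a b Kv tau : (0 < a < b)%R -> (-1 <= tau)%R ->
  forall K r, (r - INR J * (1 + tau) > -1)%R ->
  exists Ct, forall lam E p v f val,
    (0 < lam)%R ->
    (forall s, (0 < s < b)%R -> Cder E s (RtoC lam * p s * E s)) ->
    (forall s, (0 < s < b)%R -> p s * v s = 1) ->
    (forall s, 0 < s < b -> Cmod (E s) <= 1)%R ->
    sym J (fun s => 0 < s < b)%R Kv (- tau) v ->
    sym J (fun s => 0 < s < b)%R K r f ->
    (forall s, (a < s)%R -> f s = 0) ->
    is_cint (fun s => f s * E s) val ->
    (Cmod val <= Ct * / lam ^ J)%R.
Proof.
intros Hab Htau.
assert (Hopen : open_pos (fun s => 0 < s < b)%R) by (apply open_pos_interval; lra).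
induction J as [|J IH]; intros K r Hr.
- set (m := ((a + b) / 2)%R).
  exists (K * (Rpower m (r + 1) / (r + 1)))%R; intros lam E p v f val Hlam HE Hpv HE1 Hv Hf Hf0 Hval.
  simpl; rewrite Rinv_1, Rmult_1_r.
  simpl in Hr. apply (is_cint_bound_zero (fun s => f s * E s)); auto.
  + unfold m; lra.
  + lra.
  + intros t Ht; rewrite Hf0 by (unfold m in Ht; lra); ring.
  + intros t Ht; rewrite Cmod_mult, <- (Rmult_1_r (K * _)).
    apply Rmult_le_compat; try apply Cmod_ge_0.
    * apply (sym_bound _ _ _ _ _ Hf); unfold m in Ht; lra.
    * apply HE1; unfold m in Ht; lra.
- rewrite S_INR in Hr.
  destruct (IH (2 ^ S J * (K * Kv))%R (r - tau - 1)%R) as [Ct HC]; [lra|].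
  exists Ct; intros lam E p v f val Hlam HE Hpv HE1 Hv Hf Hf0 Hval.
  destruct (sym_mult _ _ _ _ _ _ _ _ Hf Hv) as [Gb [g0 [Gd Gs]]].
  destruct (derivative_cutoff_right b a f v g0 Gd Hab Hf0) as [g [Eg Hg0]].
  assert (I1 : is_cint (fun s => g s * E s) (- RtoC lam * val)).
  { eapply is_cint_ext; [|apply (by_parts (fun s => 0 < s < b)%R lam E p v (fun _ => 0) f g val); auto].
    - intros; simpl; ring.
    - apply (zero_or_left f g a b); auto.
    - intros s Hs; eapply Cder_eq; [now apply HE|ring].
    - intros s Hs; rewrite <- Eg by exact Hs; now apply Gd.
    - apply (Clim_0_bound (F := at_zero) _ (fun s => 2 ^ S J * (K * Kv) * Rpower s (r + - tau))%R).
      + generalize (at_zero_lt b ltac:(lra)); apply filter_imp; intros s Hs.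
        rewrite Cmod_mult, <- (Rmult_1_r (2 ^ S J * (K * Kv) * _)).
        apply Rmult_le_compat; try apply Cmod_ge_0; [now apply Gb|now apply HE1].
      + apply (Rlim_eq _ _ (2 ^ S J * (K * Kv) * 0)%R); [|ring].
        apply Rlim_const_mult; [typeclasses eauto|]; apply Rpower_lim_zero.
        pose proof (pos_INR J); nra.
    - apply (Clim_0_eventually at_inf); generalize (at_inf_gt a); apply filter_imp; intros; rewrite Hf0 by assumption; ring. }
  assert (B : (Cmod (- RtoC lam * val) <= Ct * / lam ^ J)%R).
  { apply (HC lam E p v g); auto.
    - now apply sym_down.
    - apply (sym_ext _ _ _ _ g0); [exact Hopen|exact Eg|]. eapply sym_eq; [exact Gs|ring]. }
  rewrite Cmod_mult, Cmod_opp, Cmod_R, Rabs_pos_eq in B by lra.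
  apply Rmult_le_reg_l with lam; [exact Hlam|].
  replace (lam * (Ct * / lam ^ S J))%R with (Ct * / lam ^ J)%R; [exact B|].
  simpl; field; split; [apply pow_nonzero|]; lra.
Qed.

(** At infinity each step improves the integrability.  The rapid decay of [E] kills the
    boundary terms, but its constants do not enter the bound. *)
Lemma parts_inf J a b Kv tau : (0 < a < b)%R ->
  forall K r, (r - INR J * (1 + tau) < -1)%R ->
  exists Ct, forall lam E p v f val,
    (0 < lam)%R ->
    (forall s, (a < s)%R -> Cder E s (RtoC lam * p s * E s)) ->
    (forall s, (a < s)%R -> p s * v s = 1) ->
    (forall s, a < s -> Cmod (E s) <= 1)%R ->
    (forall L, exists M, forall s, b < s -> Cmod (E s) <= M * Rpower s L)%R ->
    sym J (fun s => a < s)%R Kv (- tau) v ->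
    sym J (fun s => a < s)%R K r f ->
    (forall s, (s < b)%R -> f s = 0) ->
    is_cint (fun s => f s * E s) val ->
    (Cmod val <= Ct * / lam ^ J)%R.
Proof.
intros Hab.
assert (Hopen : open_pos (fun s => a < s)%R) by (apply open_pos_ray; lra).
induction J as [|J IH]; intros K r Hr.
- set (m := ((a + b) / 2)%R).
  exists (K * (Rpower m (r + 1) / - (r + 1)))%R; intros lam E p v f val Hlam HE Hpv HE1 Hdec Hv Hf Hf0 Hval.
  simpl; rewrite Rinv_1, Rmult_1_r.
  simpl in Hr. apply (is_cint_bound_inf (fun s => f s * E s)); auto.
  + unfold m; lra.
  + lra.
  + intros t Ht; rewrite Hf0 by (unfold m in Ht; lra); ring.
  + intros t Ht; rewrite Cmod_mult, <- (Rmult_1_r (K * _)).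
    apply Rmult_le_compat; try apply Cmod_ge_0.
    * apply (sym_bound _ _ _ _ _ Hf); unfold m in Ht; lra.
    * apply HE1; unfold m in Ht; lra.
- rewrite S_INR in Hr.
  destruct (IH (2 ^ S J * (K * Kv))%R (r - tau - 1)%R) as [Ct HC]; [lra|].
  exists Ct; intros lam E p v f val Hlam HE Hpv HE1 Hdec Hv Hf Hf0 Hval.
  destruct (sym_mult _ _ _ _ _ _ _ _ Hf Hv) as [Gb [g0 [Gd Gs]]].
  destruct (derivative_cutoff_left a b f v g0 Gd Hab Hf0) as [g [Eg Hg0]].
  assert (I1 : is_cint (fun s => g s * E s) (- RtoC lam * val)).
  { eapply is_cint_ext; [|apply (by_parts (fun s => a < s)%R lam E p v (fun _ => 0) f g val); auto].
    - intros; simpl; ring.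
    - apply (zero_or_right f g a b); auto; lra.
    - intros s Hs; eapply Cder_eq; [now apply HE|ring].
    - intros s Hs; rewrite <- Eg by exact Hs; now apply Gd.
    - apply (Clim_0_eventually at_zero); generalize (at_zero_lt b ltac:(lra)); apply filter_imp; intros; rewrite Hf0 by lra; ring.
    - destruct (Hdec (- (r + - tau) - 1)%R) as [M HM].
      apply (Clim_0_bound (F := at_inf) _ (fun s => 2 ^ S J * (K * Kv) * M * Rpower s (-1))%R).
      + generalize (at_inf_gt b); apply filter_imp; intros s Hs.
        rewrite Cmod_mult.
        replace (Rpower s (-1))%R with (Rpower s (r + - tau) * Rpower s (- (r + - tau) - 1))%R
          by (rewrite <- Rpower_plus; f_equal; ring).
        replace (2 ^ S J * (K * Kv) * M * (Rpower s (r + - tau) * Rpower s (- (r + - tau) - 1)))%R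
          with ((2 ^ S J * (K * Kv) * Rpower s (r + - tau)) * (M * Rpower s (- (r + - tau) - 1)))%R by ring.
        apply Rmult_le_compat; try apply Cmod_ge_0; [apply Gb; lra|now apply HM].
      + apply (Rlim_eq _ _ (2 ^ S J * (K * Kv) * M * 0)%R); [|ring].
        apply Rlim_const_mult; [typeclasses eauto|]; apply Rpower_lim_inf; lra. }
  assert (B : (Cmod (- RtoC lam * val) <= Ct * / lam ^ J)%R).
  { apply (HC lam E p v g); auto.
    - now apply sym_down.
    - apply (sym_ext _ _ _ _ g0); [exact Hopen|exact Eg|]. eapply sym_eq; [exact Gs|ring]. }
  rewrite Cmod_mult, Cmod_opp, Cmod_R, Rabs_pos_eq in B by lra.
  apply Rmult_le_reg_l with lam; [exact Hlam|].
  replace (lam * (Ct * / lam ^ S J))%R with (Ct * / lam ^ J)%R; [exact B|].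
  simpl; field; split; [apply pow_nonzero|]; lra.
Qed.

Ltac Cring :=
  change plus with Cplus; cbv beta;
  match goal with |- ?a = ?b => change (@eq C a b) end; ring.
Ltac Cfield :=
  change plus with Cplus; cbv beta;
  match goal with |- ?a = ?b => change (@eq C a b) end; field.

(** * Taylor remainders of the exponential *)

Fixpoint exp_rem (u : C) (N : nat) (y : R) : C :=
  match N with
  | O => Cexp (u * RtoC y)
  | S n => exp_rem u n y - (u * RtoC y) ^ n / RtoC (INR (fact n))
  end.

Lemma INR_fact_C n : RtoC (INR (fact n)) <> 0.
Proof. intros E; apply RtoC_inj in E; now apply (INR_fact_neq_0 n). Qed.

Lemma INR_S_C n : RtoC (INR (S n)) <> 0.
Proof. intros E; apply RtoC_inj in E; revert E; apply not_0_INR; lia. Qed.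

Lemma fact_S_C n : RtoC (INR (fact (S n))) = RtoC (INR (S n)) * RtoC (INR (fact n)).
Proof. change (fact (S n)) with ((S n) * fact n)%nat; now rewrite mult_INR, RtoC_mult. Qed.

Lemma Cder_pow f t l n : Cder f t l -> Cder (fun x => f x ^ S n) t (RtoC (INR (S n)) * l * f t ^ n).
Proof.
intros H; induction n as [|n IH].
- apply (Cder_ext f); [intros; simpl; ring|]. eapply Cder_eq; [exact H|simpl; ring].
- apply (Cder_ext (fun x => f x * f x ^ S n)); [intros; simpl; ring|].
  eapply Cder_eq; [apply Cder_mult; [exact H|exact IH]|].
  rewrite (S_INR (S n)), RtoC_plus. simpl Cpow; ring.
Qed.

Lemma Cder_id t : Cder (fun x => RtoC x) t 1.
Proof. apply (Cder_RtoC (fun x => x)), @is_derive_id. Qed.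

Lemma Cder_exp_rem u n y : Cder (exp_rem u (S n)) y (u * exp_rem u n y).
Proof.
assert (H1 : Cder (fun x => u * RtoC x) y (u * 1)) by apply Cder_scal, Cder_id.
induction n as [|n IH].
- simpl. eapply Cder_eq.
  + apply Cder_minus; [apply Cder_Cexp, H1|apply Cder_const].
  + cbv beta; simpl exp_rem; ring.
- eapply Cder_eq.
  + apply (Cder_minus (exp_rem u (S n)) (fun y => (u * RtoC y) ^ S n / RtoC (INR (fact (S n))))); [exact IH|].
    apply (Cder_ext (fun x => / RtoC (INR (fact (S n))) * (u * RtoC x) ^ S n)); [intros; unfold Cdiv; ring|].
    apply Cder_scal, Cder_pow, H1.
  + change (exp_rem u (S n) y) with (exp_rem u n y - (u * RtoC y) ^ n / RtoC (INR (fact n))).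
    rewrite fact_S_C; field; split; [apply INR_fact_C|apply INR_S_C].
Qed.

Lemma exp_rem_at_0 u n : exp_rem u (S n) 0 = 0.
Proof.
induction n as [|n IH].
- simpl; rewrite !Cmult_0_r, Cexp_0; field.
- change (exp_rem u (S n) 0 - (u * RtoC 0) ^ S n / RtoC (INR (fact (S n))) = 0).
  rewrite IH; simpl Cpow; unfold Cdiv; ring.
Qed.

(** By induction on [n]: the derivative of each remainder is [u] times the preceding one.  The
    factor [1 / n!] is given up. *)
Lemma exp_rem_le u n y : (Re u <= 0)%R -> (0 <= y)%R -> (Cmod (exp_rem u n y) <= (Cmod u * y) ^ n)%R.
Proof.
intros Hu; revert y; induction n as [|n IH]; intros y Hy.
- simpl; rewrite Cmod_Cexp, <- exp_0.
  assert (E : (Re (u * RtoC y) <= 0)%R) by (simpl; unfold Re in *; nra).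
  destruct E as [E|E]; [left; now apply exp_increasing|right; now rewrite E].
- assert (B : (Cmod (exp_rem u (S n) y - exp_rem u (S n) 0) <= (Cmod u * y) ^ S n - (Cmod u * 0) ^ S n)%R).
  { apply (Cmod_diff_le (exp_rem u (S n)) (fun t => u * exp_rem u n t) (fun t => ((Cmod u * t) ^ S n)%R)
      (fun t => Cmod u * (INR (S n) * (Cmod u * t) ^ n))%R); auto.
    - intros; apply Cder_exp_rem.
    - intros; auto_derive; auto; simpl; ring.
    - intros t Ht; rewrite Cmod_mult; apply Rmult_le_compat_l; [apply Cmod_ge_0|].
      eapply Rle_trans; [apply IH; lra|].
      rewrite <- (Rmult_1_l ((Cmod u * t) ^ n)) at 1; apply Rmult_le_compat_r.
      + apply pow_le, Rmult_le_pos; [apply Cmod_ge_0|lra].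
      + rewrite S_INR; pose proof (pos_INR n); lra. }
  rewrite exp_rem_at_0 in B.
  replace (exp_rem u (S n) y - 0) with (exp_rem u (S n) y) in B by ring.
  rewrite Rmult_0_r, pow_i in B by lia; lra.
Qed.

Lemma exp_rem_sum u N y : exp_rem u (S N) y =
  Cexp (u * RtoC y) - sum_n (fun n => (u * RtoC y) ^ n / RtoC (INR (fact n))) N.
Proof.
induction N as [|N IH]; [rewrite sum_O; reflexivity|].
rewrite sum_Sn; change (exp_rem u (S (S N)) y) with
  (exp_rem u (S N) y - (u * RtoC y) ^ S N / RtoC (INR (fact (S N)))).
rewrite IH; change plus with Cplus; ring.
Qed.

Notation expi_rem := (exp_rem Ci).

Lemma Cder_expi_rem n y : Cder (expi_rem (S n)) y (Ci * expi_rem n y).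
Proof. apply Cder_exp_rem. Qed.

Lemma Re_Ci_mult y : Re (Ci * RtoC y) = 0%R.
Proof. simpl; ring. Qed.

Lemma expi_rem_le n y : (0 <= y)%R -> (Cmod (expi_rem n y) <= y ^ n)%R.
Proof.
intros Hy; eapply Rle_trans; [apply exp_rem_le; [simpl; lra|exact Hy]|].
rewrite Cmod_Ci, Rmult_1_l; apply Rle_refl.
Qed.

(** * Oscillatory integrals with explicit phases *)

(** If [z = x - i eps] then [z = x zeta (eps / x)]: the parameter [delta = eps / x] measures the
    damping, and every bound on integrals below is uniform in it. *)
Definition zeta (delta : R) : C := (1%R, (- delta)%R).

Definition lin_phase (lam delta s : R) : C := Cexp (- Ci * RtoC lam * zeta delta * RtoC s).

(** The logarithmic derivative of [e^(i lam s^alpha - i lam zeta s)], divided by [lam]. *)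
Definition full_slope (alpha delta s : R) : C := Ci * (RtoC (alpha * Rpower s (alpha - 1)) - zeta delta).

Lemma Cmod_lin_phase lam delta s : Cmod (lin_phase lam delta s) = exp (- (lam * delta * s)).
Proof. unfold lin_phase, zeta; rewrite Cmod_Cexp; f_equal; simpl; ring. Qed.

Lemma Cder_lin_phase lam delta s :
  Cder (lin_phase lam delta) s (RtoC lam * (- Ci * zeta delta) * lin_phase lam delta s).
Proof.
eapply Cder_eq; [apply Cder_Cexp, Cder_scal, Cder_id|].
unfold lin_phase; ring.
Qed.

Lemma lin_phase_le_1 lam delta s : (0 <= lam)%R -> (0 <= delta)%R -> (0 <= s)%R -> (Cmod (lin_phase lam delta s) <= 1)%R.
Proof.
intros Hl Hd Hs; rewrite Cmod_lin_phase, <- exp_0.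
assert (0 <= lam * delta * s)%R by (repeat apply Rmult_le_pos; assumption).
destruct H as [H|H]; [left; apply exp_increasing; lra|right; f_equal; lra].
Qed.

(** For [r > 0], from [ln y <= y - 1] at [y = c t / r]. *)
Lemma exp_power_bound r c : (0 < c)%R -> exists M, forall t, (1 <= t)%R -> (Rpower t r * exp (- (c * t)) <= M)%R.
Proof.
intros Hc; destruct (Rle_or_lt r 0) as [Hr|Hr].
- exists 1%R; intros t Ht; apply Rle_trans with (1 * 1)%R; [|lra].
  apply Rmult_le_compat; try (left; apply exp_pos).
  + rewrite <- (Rpower_O t) by lra; apply Rle_Rpower; lra.
  + rewrite <- exp_0; left; apply exp_increasing; nra.
- exists (exp (- r * (1 + ln (c / r)))); intros t Ht.
  unfold Rpower; rewrite <- exp_plus.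
  assert (L : (ln t <= c / r * t - 1 - ln (c / r))%R).
  { assert (Hcr : (0 < c / r)%R) by now apply Rdiv_lt_0_compat.
    assert (E : (ln (c / r * t) <= c / r * t - 1)%R).
    { rewrite <- (ln_exp (c / r * t - 1)); apply ln_le; [nra|].
      pose proof (exp_ineq1_le (c / r * t - 1)); lra. }
    rewrite ln_mult in E; lra. }
  assert (L2 : (r * ln t <= c * t - r * (1 + ln (c / r)))%R).
  { apply Rle_trans with (r * (c / r * t - 1 - ln (c / r)))%R; [now apply Rmult_le_compat_l; lra|].
    right; field; lra. }
  assert (L3 : (r * ln t + - (c * t) <= - r * (1 + ln (c / r)))%R) by lra.
  destruct L3 as [L3|L3]; [left; now apply exp_increasing|right; now rewrite L3].
Qed.

Lemma exp_decay b c L : (0 < b)%R -> (0 < c)%R -> exists M, forall s, (b < s)%R -> (exp (- (c * s)) <= M * Rpower s L)%R.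
Proof.
intros Hb Hc; destruct (exp_power_bound (- L) (c * b)) as [M HM]; [nra|].
exists (M * Rpower b (- L))%R; intros s Hs.
assert (Hsb : (1 <= s / b)%R).
{ apply Rmult_le_reg_r with b; [lra|]; unfold Rdiv; rewrite Rmult_assoc, Rinv_l; lra. }
specialize (HM (s / b)%R Hsb).
replace (c * b * (s / b))%R with (c * s)%R in HM by (field; lra).
replace s with (b * (s / b))%R at 2 by (field; lra).
rewrite <- Rpower_mult_distr by lra.
rewrite Rpower_Ropp.
replace (M * / Rpower b L * (Rpower b L * Rpower (s / b) L))%R with (M * Rpower (s / b) L)%R
  by (field; apply Rgt_not_eq, exp_pos).
rewrite Rpower_Ropp in HM.
apply Rmult_le_reg_l with (/ Rpower (s / b) L)%R; [apply Rinv_0_lt_compat, exp_pos|].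
eapply Rle_trans; [exact HM|]; right; field; apply Rgt_not_eq, exp_pos.
Qed.

Lemma lin_phase_decay lam delta b L : (0 < lam)%R -> (0 < delta)%R -> (0 < b)%R ->
  exists M, forall s, (b < s)%R -> (Cmod (lin_phase lam delta s) <= M * Rpower s L)%R.
Proof.
intros Hl Hd Hb; destruct (exp_decay b (lam * delta) L) as [M HM]; [assumption|nra|].
exists M; intros s Hs; rewrite Cmod_lin_phase; now apply HM.
Qed.

Lemma Cmod_zeta_le delta : (0 <= delta <= 1)%R -> (1 <= Cmod (zeta delta) <= 2)%R.
Proof.
intros H; split.
- eapply Rle_trans; [|apply re_le_Cmod]; simpl; rewrite Rabs_pos_eq; lra.
- replace (zeta delta) with (1 + RtoC (- delta) * Ci) by (apply C_eq; simpl; ring).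
  eapply Rle_trans; [apply Cmod_triangle|].
  rewrite Cmod_mult, Cmod_Ci, Cmod_1, Cmod_R, Rabs_Ropp, Rabs_pos_eq; lra.
Qed.

Lemma zeta_neq0 delta : zeta delta <> 0.
Proof. intros E; apply (f_equal Re) in E; simpl in E; lra. Qed.

Lemma Ci_neq0 : Ci <> 0.
Proof. intros E; apply (f_equal Im) in E; simpl in E; lra. Qed.

(** The slope of the linear phase is constant and at least [1] in modulus: away from [0] such an
    integral is smaller than any power of [lam], even for a growing amplitude. *)
Lemma lin_phase_inf J a b K r : (0 < a < b)%R -> (r - INR J < -1)%R ->
  exists Ct, forall lam delta f val, (0 < lam)%R -> (0 < delta <= 1)%R ->
    sym J (fun s => a < s)%R K r f -> (forall s, (s < b)%R -> f s = 0) ->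
    is_cint (fun s => f s * lin_phase lam delta s) val ->
    (Cmod val <= Ct * / lam ^ J)%R.
Proof.
intros Hab Hr; destruct (parts_inf J a b 1 0 Hab K r) as [Ct HC]; [lra|].
exists Ct; intros lam delta f val Hl Hd Hf Hf0 Hval.
apply (HC lam (lin_phase lam delta) (fun _ => - Ci * zeta delta) (fun _ => / (- Ci * zeta delta)) f val); auto.
- intros; apply Cder_lin_phase.
- intros; field; split; [apply zeta_neq0|apply Ci_neq0].
- intros; apply lin_phase_le_1; lra.
- intros L; destruct (lin_phase_decay lam delta b L) as [M HM]; try lra; now exists M.
- eapply sym_eq; [|symmetry; apply Ropp_0].
  eapply sym_le; [|apply sym_const].
  rewrite Cmod_inv, Cmod_mult, Cmod_opp, Cmod_Ci, Rmult_1_l.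
  + pose proof (Cmod_zeta_le delta); rewrite <- Rinv_1; apply Rinv_le_contravar; lra.
  + intros E; apply (f_equal Im) in E; simpl in E; lra.
Qed.

Lemma lin_phase_zero J a b K r : (0 < a < b)%R -> (r - INR J > -1)%R ->
  exists Ct, forall lam delta f val, (0 < lam)%R -> (0 <= delta <= 1)%R ->
    sym J (fun s => 0 < s < b)%R K r f -> (forall s, (a < s)%R -> f s = 0) ->
    is_cint (fun s => f s * lin_phase lam delta s) val ->
    (Cmod val <= Ct * / lam ^ J)%R.
Proof.
intros Hab Hr; destruct (parts_zero J a b 1 0 Hab ltac:(lra) K r) as [Ct HC]; [lra|].
exists Ct; intros lam delta f val Hl Hd Hf Hf0 Hval.
apply (HC lam (lin_phase lam delta) (fun _ => - Ci * zeta delta) (fun _ => / (- Ci * zeta delta)) f val); auto.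
- intros; apply Cder_lin_phase.
- intros; field; split; [apply zeta_neq0|apply Ci_neq0].
- intros; apply lin_phase_le_1; lra.
- eapply sym_eq; [|symmetry; apply Ropp_0].
  eapply sym_le; [|apply sym_const].
  rewrite Cmod_inv, Cmod_mult, Cmod_opp, Cmod_Ci, Rmult_1_l.
  + pose proof (Cmod_zeta_le delta); rewrite <- Rinv_1; apply Rinv_le_contravar; lra.
  + intros E; apply (f_equal Im) in E; simpl in E; lra.
Qed.

Lemma Cder_Rpower alpha s : (0 < s)%R -> Cder (fun x => RtoC (Rpower x alpha)) s (RtoC (alpha * Rpower s (alpha - 1))).
Proof. intros Hs; apply Cder_RtoC, is_derive_Rpower_pos, Hs. Qed.

Lemma Im_full_slope alpha delta s : Im (full_slope alpha delta s) = (alpha * Rpower s (alpha - 1) - 1)%R.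
Proof. simpl; ring. Qed.

Lemma Im_le_Cmod z : (Im z <= Cmod z)%R.
Proof. eapply Rle_trans; [apply Rle_abs|]; eapply Rle_trans; [|apply Rmax_Cmod]; apply Rmax_r. Qed.

Lemma Rpower_le_pos p a s : (0 <= p)%R -> (0 < a <= s)%R -> (Rpower a p <= Rpower s p)%R.
Proof. intros; now apply Rle_Rpower_l. Qed.

Lemma sym_full_slope_inf J alpha a : (1 < alpha)%R -> (0 < a)%R ->
  exists K, forall delta, (0 <= delta <= 1)%R -> sym J (fun s => a < s)%R K (alpha - 1) (full_slope alpha delta).
Proof.
intros Ha Hpos.
pose proof (open_pos_ray a ltac:(lra)) as Ho.
destruct (sym_Cpower J (RtoC (alpha - 1))) as [K1 HK1].
exists (Cmod (Ci * RtoC alpha) * K1 + / Rpower a (alpha - 1) * (Cmod (- Ci) * 2))%R; intros delta Hd.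
apply (sym_ext J _ _ _ (fun s => (Ci * RtoC alpha) * Cpower s (RtoC (alpha - 1)) + (- Ci) * zeta delta)); auto.
{ intros s Hs; unfold full_slope; rewrite Cpower_RtoC, RtoC_mult; ring. }
apply sym_plus.
- apply sym_scal; apply (HK1 _ Ho).
- apply (sym_weaken J _ _ 0); auto.
  + left; apply Rinv_0_lt_compat, exp_pos.
  + intros s Hs; rewrite Rpower_O by lra.
    apply Rmult_le_reg_l with (Rpower a (alpha - 1)); [apply exp_pos|].
    rewrite <- Rmult_assoc, Rinv_r by (apply Rgt_not_eq, exp_pos).
    rewrite Rmult_1_r, Rmult_1_l; apply Rpower_le_pos; lra.
  + apply sym_scal; eapply sym_le; [|apply sym_const]; now apply Cmod_zeta_le.
  + apply Rmult_le_pos; [apply Cmod_ge_0|lra].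
Qed.

Lemma sym_full_slope_zero J alpha b : (1 < alpha)%R -> (0 < b)%R ->
  exists K, forall delta, (0 <= delta <= 1)%R -> sym J (fun s => 0 < s < b)%R K 0 (full_slope alpha delta).
Proof.
intros Ha Hpos.
pose proof (open_pos_interval 0 b ltac:(lra)) as Ho.
destruct (sym_Cpower J (RtoC (alpha - 1))) as [K1 HK1].
exists (Cmod (Ci * RtoC alpha) * (Rpower b (alpha - 1) * Rmax K1 0) + (Cmod (- Ci) * 2))%R; intros delta Hd.
apply (sym_ext J _ _ _ (fun s => (Ci * RtoC alpha) * Cpower s (RtoC (alpha - 1)) + (- Ci) * zeta delta)); auto.
{ intros s Hs; unfold full_slope; rewrite Cpower_RtoC, RtoC_mult; ring. }
apply sym_plus.
- apply sym_scal; apply (sym_weaken J _ _ (alpha - 1)); auto.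
  + left; apply exp_pos.
  + intros s Hs; rewrite Rpower_O by lra; rewrite Rmult_1_r; apply Rpower_le_pos; lra.
  + eapply sym_le; [apply Rmax_l|]; apply (HK1 _ Ho).
  + apply Rmax_r.
- apply sym_scal; eapply sym_le; [|apply sym_const]; now apply Cmod_zeta_le.
Qed.

(** Beyond the stationary point the imaginary part of the slope is bounded below by a multiple of
    [s^(alpha - 1)], so that each integration by parts lowers the order by [alpha]. *)
Lemma full_phase_inf J alpha a b K r : (1 < alpha)%R -> (0 < a < b)%R -> (1 < alpha * Rpower a (alpha - 1))%R ->
  (r - INR J * alpha < -1)%R ->
  exists Ct, forall lam delta f val, (0 < lam)%R -> (0 < delta <= 1)%R ->
    sym J (fun s => a < s)%R K r f -> (forall s, (s < b)%R -> f s = 0) ->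
    is_cint (fun s => f s * (Cexp (Ci * RtoC (lam * Rpower s alpha)) * lin_phase lam delta s)) val ->
    (Cmod val <= Ct * / lam ^ J)%R.
Proof.
intros Hal Hab Hst Hr.
destruct (sym_full_slope_inf J alpha a Hal ltac:(lra)) as [K1 HK1].
set (c := (alpha - / Rpower a (alpha - 1))%R).
assert (Hpa : (0 < Rpower a (alpha - 1))%R) by apply exp_pos.
assert (Hc : (0 < c)%R).
{ unfold c; apply Rmult_lt_reg_r with (Rpower a (alpha - 1)); [exact Hpa|].
  rewrite Rmult_0_l, Rmult_minus_distr_r, Rinv_l; lra. }
assert (Hlow : forall delta s, (a < s)%R -> (c * Rpower s (alpha - 1) <= Cmod (full_slope alpha delta s))%R).
{ intros delta s Hs; eapply Rle_trans; [|apply Im_le_Cmod]; rewrite Im_full_slope.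
  assert (Rpower a (alpha - 1) <= Rpower s (alpha - 1))%R by (apply Rpower_le_pos; lra).
  enough (1 <= / Rpower a (alpha - 1) * Rpower s (alpha - 1))%R by (unfold c; nra).
  apply Rmult_le_reg_l with (Rpower a (alpha - 1)); [exact Hpa|].
  rewrite <- Rmult_assoc, Rinv_r; lra. }
destruct (sym_inv J K1 c Hc) as [Kv HKv].
destruct (parts_inf J a b Kv (alpha - 1) Hab K r) as [Ct HC]; [lra|].
exists Ct; intros lam delta f val Hl Hd Hf Hf0 Hval.
apply (HC lam (fun s => Cexp (Ci * RtoC (lam * Rpower s alpha)) * lin_phase lam delta s)
  (full_slope alpha delta) (fun s => / full_slope alpha delta s) f val); auto.
- intros s Hs; eapply Cder_eq.
  + apply Cder_mult; [|apply Cder_lin_phase].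
    apply Cder_Cexp, Cder_scal, Cder_RtoC.
    apply (is_derive_scal (fun x => Rpower x alpha)), is_derive_Rpower_pos; lra.
  + unfold full_slope; rewrite !RtoC_mult; ring.
- intros s Hs; apply Cinv_r.
  intros E; specialize (Hlow delta s Hs); rewrite E, Cmod_0 in Hlow.
  pose proof (Rpower_gt0 s (alpha - 1)); nra.
- intros s Hs; rewrite Cmod_mult, Cmod_Cexp, Re_Ci_mult, exp_0, Rmult_1_l; apply lin_phase_le_1; lra.
- intros L; destruct (lin_phase_decay lam delta b L) as [M HM]; try lra; exists M.
  intros; rewrite Cmod_mult, Cmod_Cexp, Re_Ci_mult, exp_0, Rmult_1_l; auto.
- apply HKv; [apply HK1; lra|intros; now apply Hlow].
Qed.

Lemma Rpower_pow_mult s al n : (Rpower s al ^ n = Rpower s (al * INR n))%R.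
Proof. rewrite <- Rpower_pow by apply exp_pos; apply Rpower_mult. Qed.

(** Near [0] the full phase is treated through the Taylor remainder of [e^(i lam s^alpha)],
    whose vanishing at [0] compensates the singular amplitude; each integration by parts
    leaves a source term with linear phase, which in turn is integrated by parts.  The remainder
    costs the factor [lam ^ S n]; since [alpha > 1], its order [alpha (S n)] at [0] allows more
    than [S n] integrations when [n] is large, which recovers this factor. *)
Lemma rem_phase_zero n alpha a b : (1 < alpha)%R -> (0 < a < b)%R -> (alpha * Rpower b (alpha - 1) < 1)%R ->
  forall J K r, (r + alpha * INR (S n) - INR J > -1)%R ->
  exists Ct, forall lam delta f val, (1 <= lam)%R -> (0 <= delta <= 1)%R ->
    sym J (fun s => 0 < s < b)%R K r f -> (forall s, (a < s)%R -> f s = 0) ->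
    is_cint (fun s => f s * (expi_rem (S n) (lam * Rpower s alpha) * lin_phase lam delta s)) val ->
    (Cmod val <= Ct * (lam ^ S n * / lam ^ J))%R.
Proof.
intros Hal Hab Hst.
pose proof (open_pos_interval 0 b ltac:(lra)) as Ho.
set (N := S n).
assert (HEb : forall lam delta s, (0 <= lam)%R -> (0 <= delta)%R -> (0 < s)%R ->
  (Cmod (expi_rem N (lam * Rpower s alpha) * lin_phase lam delta s) <= lam ^ N * Rpower s (alpha * INR N))%R).
{ intros lam delta s Hl Hd Hs; rewrite Cmod_mult, <- (Rmult_1_r (lam ^ N * _)).
  apply Rmult_le_compat; try apply Cmod_ge_0; [|apply lin_phase_le_1; lra].
  rewrite <- Rpower_pow_mult, <- Rpow_mult_distr; apply expi_rem_le.
  apply Rmult_le_pos; [exact Hl|left; apply exp_pos]. }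
induction J as [|J IH]; intros K r Hr.
- set (m := ((a + b) / 2)%R).
  exists (K * (Rpower m (r + alpha * INR N + 1) / (r + alpha * INR N + 1)))%R; intros lam delta f val Hl Hd Hf Hf0 Hval.
  fold N in Hval.
  assert (B : (Cmod val <= K * lam ^ N * (Rpower m (r + alpha * INR N + 1) / (r + alpha * INR N + 1)))%R).
  { change (INR 0) with 0%R in Hr; fold N in Hr; apply (is_cint_bound_zero _ val (K * lam ^ N) m (r + alpha * INR N) Hval).
    - unfold m; lra.
    - lra.
    - intros t Ht; rewrite Hf0 by (unfold m in Ht; lra); ring.
    - intros t Ht; rewrite Cmod_mult, Rpower_plus.
      replace (K * lam ^ N * (Rpower t r * Rpower t (alpha * INR N)))%R with
        ((K * Rpower t r) * (lam ^ N * Rpower t (alpha * INR N)))%R by ring.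
      apply Rmult_le_compat; try apply Cmod_ge_0.
      + apply (sym_bound _ _ _ _ _ Hf); unfold m in Ht; lra.
      + apply HEb; lra. }
  simpl (lam ^ 0)%R; rewrite Rinv_1, Rmult_1_r.
  eapply Rle_trans; [exact B|]; right; ring.
- rewrite S_INR in Hr; fold N in Hr.
  destruct (sym_full_slope_zero (S J) alpha b Hal ltac:(lra)) as [K1 HK1].
  set (c := (1 - alpha * Rpower b (alpha - 1))%R).
  assert (Hc : (0 < c)%R) by (unfold c; lra).
  assert (Hlow : forall delta s, (0 < s < b)%R -> (c * Rpower s 0 <= Cmod (full_slope alpha delta s))%R).
  { intros delta s Hs; rewrite Rpower_O, Rmult_1_r by lra.
    eapply Rle_trans; [|rewrite <- Cmod_opp; apply Im_le_Cmod].
    replace (Im (- full_slope alpha delta s)) with (- Im (full_slope alpha delta s))%R by reflexivity.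
    rewrite Im_full_slope; unfold c.
    assert (Rpower s (alpha - 1) <= Rpower b (alpha - 1))%R by (apply Rpower_le_pos; lra).
    nra. }
  destruct (sym_inv (S J) K1 c Hc) as [Kv HKv].
  destruct (sym_Cpower J (RtoC (alpha * INR N - 1))) as [K2 HK2].
  destruct (IH (2 ^ S J * (K * Kv))%R (r - 1)%R) as [C1 HC1]; [fold N; lra|].
  destruct (lin_phase_zero J a b (2 ^ J * (2 ^ S J * (K * Kv) * K2)) (r + alpha * INR N - 1) Hab) as [C2 HC2]; [lra|].
  (* The derivative of the remainder of order [S n] involves that of order [n], which exceeds the
     former by a monomial: [cn] is the coefficient of the resulting source term [e]. *)
  set (cn := Ci * RtoC alpha * (Ci ^ n / RtoC (INR (fact n)))).
  exists (C1 + Cmod cn * C2)%R; intros lam delta f val Hl Hd Hf Hf0 Hval.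
  fold N in Hval.
  set (v := fun s => / full_slope alpha delta s).
  assert (Hv : sym (S J) (fun s => 0 < s < b)%R Kv 0 v).
  { eapply sym_eq; [apply HKv; [apply HK1; lra|intros; now apply Hlow]|ring]. }
  pose proof (sym_mult _ _ _ _ _ _ _ _ Hf Hv) as HG.
  pose proof HG as [Gb [g0 [Gd Gs]]].
  destruct (derivative_cutoff_right b a f v g0 Gd Hab Hf0) as [g [Eg Hg0]].
  set (E := fun s => expi_rem N (lam * Rpower s alpha) * lin_phase lam delta s).
  set (F := fun s => f s * v s * Cpower s (RtoC (alpha * INR N - 1))).
  set (e := fun s => (RtoC (lam ^ N) * cn) * (Cpower s (RtoC (alpha * INR N - 1)) * lin_phase lam delta s)).
  assert (I1 : is_cint (fun s => g s * E s + f s * v s * e s) (- RtoC lam * val)).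
  { apply (by_parts (fun s => 0 < s < b)%R lam E (full_slope alpha delta) v e f g val); auto.
    - apply (zero_or_left f g a b); auto.
    - intros s Hs; eapply Cder_eq.
      + apply Cder_mult; [|apply Cder_lin_phase].
        apply (Cder_comp (expi_rem N) (fun s => (lam * Rpower s alpha)%R)); [apply Cder_expi_rem|].
        apply (is_derive_scal (fun x => Rpower x alpha)), is_derive_Rpower_pos; lra.
      + unfold E, e, full_slope, N.
        change (expi_rem (S n) (lam * Rpower s alpha)) with
         (expi_rem n (lam * Rpower s alpha) - (Ci * RtoC (lam * Rpower s alpha)) ^ n / RtoC (INR (fact n))).
        assert (EP : RtoC (lam ^ S n) * Cpower s (RtoC (alpha * INR (S n) - 1)) =
           RtoC lam * RtoC (Rpower s (alpha - 1)) * RtoC (lam * Rpower s alpha) ^ n).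
        { rewrite Cpower_RtoC, <- RtoC_pow, <- !RtoC_mult; f_equal.
          rewrite Rpow_mult_distr, Rpower_pow_mult, S_INR.
          replace (alpha * (INR n + 1) - 1)%R with (alpha - 1 + alpha * INR n)%R by ring.
          rewrite Rpower_plus; simpl; ring. }
        unfold cn.
        transitivity (RtoC lam * (Ci * (RtoC (alpha * Rpower s (alpha - 1)) - zeta delta)) *
          ((expi_rem n (lam * Rpower s alpha) - (Ci * RtoC (lam * Rpower s alpha)) ^ n / RtoC (INR (fact n))) * lin_phase lam delta s)
          + (RtoC (lam ^ S n) * Cpower s (RtoC (alpha * INR (S n) - 1))) * (Ci * RtoC alpha * (Ci ^ n / RtoC (INR (fact n)))) * lin_phase lam delta s); [|ring].
        rewrite EP, !RtoC_mult, !Cpow_mult_l; unfold Cdiv; ring.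
    - intros s Hs; apply Cinv_r.
      intros E0; specialize (Hlow delta s Hs); rewrite E0, Cmod_0 in Hlow.
      pose proof (Rpower_gt0 s 0); nra.
    - intros s Hs; rewrite <- Eg by exact Hs; now apply Gd.
    - apply (Clim_0_bound (F := at_zero) _ (fun s => 2 ^ S J * (K * Kv) * lam ^ N * Rpower s (r + alpha * INR N))%R).
      + generalize (at_zero_lt b ltac:(lra)); apply filter_imp; intros s Hs.
        rewrite Cmod_mult, Rpower_plus.
        replace (2 ^ S J * (K * Kv) * lam ^ N * (Rpower s r * Rpower s (alpha * INR N)))%R with
          ((2 ^ S J * (K * Kv) * Rpower s (r + 0)) * (lam ^ N * Rpower s (alpha * INR N)))%R
          by (rewrite Rplus_0_r; ring).
        apply Rmult_le_compat; try apply Cmod_ge_0; [now apply Gb|apply HEb; lra].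
      + apply (Rlim_eq _ _ (2 ^ S J * (K * Kv) * lam ^ N * 0)%R); [|ring].
        apply Rlim_const_mult; [typeclasses eauto|]; apply Rpower_lim_zero.
        pose proof (pos_INR J); lra.
    - apply (Clim_0_eventually at_inf); generalize (at_inf_gt a); apply filter_imp; intros; rewrite Hf0 by assumption; ring. }
  assert (HF : sym J (fun s => 0 < s < b)%R (2 ^ J * (2 ^ S J * (K * Kv) * K2)) (r + alpha * INR N - 1) F).
  { eapply sym_eq; [apply sym_mult; [apply sym_down; exact HG|apply HK2; exact Ho]|simpl; ring]. }
  assert (HF0 : forall s, (a < s)%R -> F s = 0).
  { intros s Hs; unfold F; rewrite Hf0 by exact Hs; ring. }
  assert (X : exists w, is_cint (fun s => F s * lin_phase lam delta s) w).
  { apply (is_cint_exists_zero _ (2 ^ J * (2 ^ S J * (K * Kv) * K2)) a b (r + alpha * INR N - 1)); auto.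
    - pose proof (pos_INR J); lra.
    - intros t Ht; eexists; apply Cder_mult; [|apply Cder_lin_phase].
      apply Cder_mult; [now apply Gd|apply Cder_Cpower; lra].
    - intros t Ht; rewrite HF0 by exact Ht; ring.
    - intros t Ht; rewrite Cmod_mult, <- (Rmult_1_r (_ * Rpower t _)).
      apply Rmult_le_compat; try apply Cmod_ge_0; [now apply (sym_bound _ _ _ _ _ HF)|apply lin_phase_le_1; lra]. }
  destruct X as [w Hw].
  assert (Bw : (Cmod w <= C2 * / lam ^ J)%R) by (apply (HC2 lam delta F w); auto; lra).
  assert (I2 : is_cint (fun s => g s * E s) (- RtoC lam * val - RtoC (lam ^ N) * cn * w)).
  { eapply is_cint_ext; [|apply is_cint_minus; [exact I1|apply is_cint_scal; exact Hw]].
    intros s Hs; unfold e, F; ring. }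
  assert (B : (Cmod (- RtoC lam * val - RtoC (lam ^ N) * cn * w) <= C1 * (lam ^ N * / lam ^ J))%R).
  { apply (HC1 lam delta g); auto.
    apply (sym_ext _ _ _ _ g0); [exact Ho|exact Eg|]. eapply sym_eq; [exact Gs|ring]. }
  assert (T : (lam * Cmod val <= C1 * (lam ^ N * / lam ^ J) + Cmod cn * C2 * (lam ^ N * / lam ^ J))%R).
  { replace (lam * Cmod val)%R with (Cmod (- RtoC lam * val))%R
      by (rewrite Cmod_mult, Cmod_opp, Cmod_R, Rabs_pos_eq; lra).
    replace (- RtoC lam * val) with ((- RtoC lam * val - RtoC (lam ^ N) * cn * w) + RtoC (lam ^ N) * cn * w) by ring.
    eapply Rle_trans; [apply Cmod_triangle|]; apply Rplus_le_compat; [exact B|].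
    rewrite !Cmod_mult, Cmod_R, Rabs_pos_eq by (apply pow_le; lra).
    apply Rle_trans with (lam ^ N * Cmod cn * (C2 * / lam ^ J))%R; [|right; ring].
    apply Rmult_le_compat_l; [|exact Bw].
    apply Rmult_le_pos; [apply pow_le; lra|apply Cmod_ge_0]. }
  apply Rmult_le_reg_l with lam; [lra|].
  eapply Rle_trans; [exact T|]; right.
  simpl (lam ^ S J)%R; field; split; [apply pow_nonzero|]; lra.
Qed.

(** * Finite parts of the Laplace transforms of powers *)

(** The primitive of [t^(p-1)] without constant term: this normalization fixes the finite parts. *)
Definition power_primitive (p : C) (t : R) : C :=
  if Ceq_dec p 0 then RtoC (ln t) else Cpower t p / p.

Definition laplace_kernel (s w : C) (t : R) : C := Cpower t (s - 1) * Cexp (- w * RtoC t).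

(** The divergent part at [0] of a primitive of [laplace_kernel s w]. *)
Definition laplace_poles (s w : C) (B : nat) (t : R) : C :=
  sum_n (fun m => (- w) ^ m / RtoC (INR (fact m)) * power_primitive (s + RtoC (INR m)) t) B.

(** The terms of [laplace_poles] with exponent of positive real part vanish at [0], so the value is
    the same for all large [B]; keeping [B] free allows it to change in the recursion on [s]. *)
Definition laplace_fp (s w v : C) : Prop :=
  exists B, (INR B + 1 + Re s > 0)%R /\ is_fp (laplace_kernel s w) (laplace_poles s w B) v.

Lemma Cder_power_primitive p t : (0 < t)%R -> Cder (power_primitive p) t (Cpower t (p - 1)).
Proof.
intros Ht; unfold power_primitive; destruct (Ceq_dec p 0) as [->|N].
- eapply Cder_eq.
  + apply Cder_RtoC, is_derive_Reals, derivable_pt_lim_ln, Ht.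
  + rewrite Cpower_pred, Cpower_0, RtoC_inv by (assumption || lra); unfold Cdiv; ring.
- apply (Cder_ext (fun x => / p * Cpower x p)); [intros; unfold Cdiv; ring|].
  eapply Cder_eq; [apply Cder_scal, Cder_Cpower, Ht|field; exact N].
Qed.

Lemma Cpower_lim_zero p : (0 < Re p)%R -> Clim (fun t => Cpower t p) at_zero 0.
Proof.
intros Hp; apply (Clim_0_bound (F := at_zero) _ (fun t => Rpower t (Re p))).
- apply filter_forall; intros; rewrite Cmod_Cpower; apply Rle_refl.
- now apply Rpower_lim_zero.
Qed.

Lemma power_primitive_lim_zero p : (0 < Re p)%R -> Clim (power_primitive p) at_zero 0.
Proof.
intros Hp; unfold power_primitive; destruct (Ceq_dec p 0) as [->|N]; [simpl in Hp; lra|].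
eapply Clim_eq; [apply Clim_mult; [apply Cpower_lim_zero, Hp|apply Clim_const]|ring].
Qed.

Lemma laplace_poles_S s w B t : laplace_poles s w (S B) t =
  laplace_poles s w B t + (- w) ^ (S B) / RtoC (INR (fact (S B))) * power_primitive (s + RtoC (INR (S B))) t.
Proof. unfold laplace_poles; now rewrite sum_Sn. Qed.

Lemma laplace_poles_shift s w B B' : (INR B + 1 + Re s > 0)%R -> (B <= B')%nat ->
  Clim (fun t => laplace_poles s w B' t - laplace_poles s w B t) at_zero 0.
Proof.
intros HB; induction 1 as [|B' L IH].
- eapply Clim_ext_loc; [|apply Clim_const]; apply filter_forall; intros; ring.
- apply le_INR in L.
  assert (T : Clim (fun t => (- w) ^ (S B') / RtoC (INR (fact (S B'))) * power_primitive (s + RtoC (INR (S B'))) t) at_zero 0).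
  { eapply Clim_eq; [apply Clim_scal, power_primitive_lim_zero|ring].
    rewrite S_INR; simpl; unfold Re in *; simpl in *; lra. }
  eapply Clim_eq; [eapply Clim_ext_loc; [|apply Clim_plus; [exact IH|exact T]]|ring].
  apply filter_forall; intros t; rewrite laplace_poles_S; simpl; ring.
Qed.

Lemma laplace_fp_is_fp s w v B : laplace_fp s w v -> (INR B + 1 + Re s > 0)%R ->
  is_fp (laplace_kernel s w) (laplace_poles s w B) v.
Proof.
intros [B' [HB' Hv]] HB; destruct (Nat.le_ge_cases B B') as [L|L].
- apply (is_fp_Q _ _ _ _ Hv). now apply laplace_poles_shift.
- apply (is_fp_Q _ _ _ _ Hv).
  eapply Clim_eq; [eapply Clim_ext_loc; [|apply Clim_opp, (laplace_poles_shift s w B' B HB' L)]|ring].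
  apply filter_forall; intros; ring.
Qed.

Lemma laplace_fp_unique s w v v' : laplace_fp s w v -> laplace_fp s w v' -> v = v'.
Proof.
intros H [B [HB Hv']]; apply (laplace_fp_is_fp _ _ _ B) in H; [|exact HB].
eapply is_fp_unique; eassumption.
Qed.

Lemma sum_n_C_scal (c : C) (u : nat -> C) N : sum_n (fun n => c * u n) N = c * sum_n u N.
Proof.
induction N as [|N IH]; [now rewrite !sum_O|].
rewrite !sum_Sn, IH; Cring.
Qed.

Lemma sum_n_C_plus (u v : nat -> C) N : sum_n (fun n => u n + v n) N = sum_n u N + sum_n v N.
Proof.
induction N as [|N IH]; [now rewrite !sum_O|].
rewrite !sum_Sn, IH; Cring.
Qed.

Lemma sum_n_C_shift (u : nat -> C) N : sum_n u (S N) = u O + sum_n (fun n => u (S n)) N.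
Proof.
induction N as [|N IH]; [now rewrite sum_Sn, !sum_O|].
rewrite sum_Sn, IH, sum_Sn; Cring.
Qed.

Lemma sum_n_C_zero (u : nat -> C) N : (forall n, (n <= N)%nat -> u n = 0) -> sum_n u N = RtoC 0.
Proof.
induction N as [|N IH]; intros H; [rewrite sum_O; now apply H|].
rewrite sum_Sn, IH, H by (intros; try apply H; lia); Cring.
Qed.

Lemma sum_n_C_single (u : nat -> C) N k : (k <= N)%nat -> (forall n, (n <= N)%nat -> n <> k -> u n = 0) ->
  sum_n u N = u k.
Proof.
induction N as [|N IH]; intros Hk H; [rewrite sum_O; f_equal; lia|].
rewrite sum_Sn.
destruct (Nat.eq_dec k (S N)) as [->|L].
- rewrite sum_n_C_zero; [Cring|]; intros; apply H; lia.
- rewrite IH, (H (S N)); [Cring|lia|lia|lia|intros; apply H; lia].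
Qed.

Lemma RtoC_INR_S n : RtoC (INR (S n)) = RtoC (INR n) + 1.
Proof. now rewrite S_INR, RtoC_plus. Qed.

(** Integration by parts lowers [s]; the only finite part produced by the boundary term
    [t^s e^(-w t)] at [0] is the constant term of its expansion, present when [s] is a
    nonpositive integer. *)
Lemma laplace_fp_step (s w v c : C) : s <> 0 -> (0 < Re w)%R -> laplace_fp (s + 1) w v ->
  ((forall k : nat, s <> RtoC (- INR k)) /\ c = 0 \/
   exists k : nat, s = RtoC (- INR k) /\ c = (- w) ^ k / RtoC (INR (fact k))) ->
  laplace_fp s w ((w * v - c) / s).
Proof.
intros Hs Hw [B [HB Hv]] Hc.
assert (HB' : (INR (S B) + 1 + Re s > 0)%R) by (rewrite S_INR; simpl in HB; unfold Re in *; simpl in *; lra).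
exists (S B); split; [exact HB'|].
(* [r] collects the monomials of the expansion of [G] at [0], except the constant one. *)
set (a := fun m => (- w) ^ m / RtoC (INR (fact m))).
set (r := fun m (t : R) => if Ceq_dec (s + RtoC (INR m)) 0 then RtoC 0 else a m * Cpower t (s + RtoC (INR m))).
set (Rr := fun t => sum_n (fun m => r m t) (S B)).
set (G := fun t => Cpower t s * Cexp (- w * RtoC t)).
assert (HG : forall t, (0 < t)%R -> Cder G t (s * laplace_kernel s w t + - w * laplace_kernel (s + 1) w t)).
{ intros t Ht; eapply Cder_eq.
  - apply Cder_mult; [apply Cder_Cpower, Ht|apply Cder_Cexp, Cder_scal, Cder_id].
  - cbv beta; unfold laplace_kernel. replace (s + 1 - 1) with s by ring. ring. }
assert (Hmode : forall t, (0 < t)%R -> G t = Cpower t s * exp_rem (- w) (S (S B)) t +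
   sum_n (fun m => a m * Cpower t (s + RtoC (INR m))) (S B)).
{ intros t Ht; rewrite exp_rem_sum; unfold G.
  assert (E : sum_n (fun m => a m * Cpower t (s + RtoC (INR m))) (S B) =
    Cpower t s * sum_n (fun n => (- w * RtoC t) ^ n / RtoC (INR (fact n))) (S B)).
  { rewrite <- sum_n_C_scal; apply sum_n_ext; intros m; unfold a.
    rewrite Cpower_plus, Cpower_RtoC, Rpower_pow, RtoC_pow, Cpow_mult_l by exact Ht.
    unfold Cdiv; Cring. }
  rewrite E; Cring. }
assert (Hconst : exists c', Clim (fun t => G t - Rr t) at_zero c' /\ c' = c).
{ assert (Hrem : Clim (fun t => Cpower t s * exp_rem (- w) (S (S B)) t) at_zero 0).
  { apply (Clim_0_bound (F := at_zero) _ (fun t => Cmod (- w) ^ S (S B) * Rpower t (Re s + INR (S (S B))))%R).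
    - generalize at_zero_pos; apply filter_imp; intros t Ht.
      rewrite Cmod_mult, Cmod_Cpower, Rpower_plus, Rpower_pow by exact Ht.
      assert (X : (Cmod (exp_rem (- w) (S (S B)) t) <= (Cmod (- w) * t) ^ S (S B))%R).
      { apply exp_rem_le; [simpl; unfold Re in *; simpl in *; lra|lra]. }
      rewrite Rpow_mult_distr in X.
      replace (Cmod (- w) ^ S (S B) * (Rpower t (Re s) * t ^ S (S B)))%R with
        (Rpower t (Re s) * (Cmod (- w) ^ S (S B) * t ^ S (S B)))%R by ring.
      apply Rmult_le_compat_l; [left; apply exp_pos|exact X].
    - eapply Rlim_eq; [apply Rlim_const_mult; [typeclasses eauto|]; apply Rpower_lim_zero|ring].
      rewrite S_INR; lra. }
  assert (Hdiff : forall t, (0 < t)%R ->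
    sum_n (fun m => a m * Cpower t (s + RtoC (INR m))) (S B) - Rr t = c).
  { intros t Ht; unfold Rr.
    replace (sum_n (fun m => a m * Cpower t (s + RtoC (INR m))) (S B) - sum_n (fun m => r m t) (S B)) with
     (sum_n (fun m => a m * Cpower t (s + RtoC (INR m)) + -(1) * r m t) (S B))
      by (rewrite sum_n_C_plus, sum_n_C_scal; Cring).
    destruct Hc as [[Hn ->]|[k [Hk ->]]].
    - apply sum_n_C_zero; intros m _; unfold r; destruct (Ceq_dec _ 0) as [E|_]; [|ring].
      destruct (Hn m); rewrite RtoC_opp; replace s with (s + RtoC (INR m) - RtoC (INR m)) by ring; rewrite E; ring.
    - rewrite (sum_n_C_single _ _ k).
      + unfold r; destruct (Ceq_dec _ 0) as [E|N].
        * rewrite E, Cpower_0; unfold a; ring.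
        * destruct N; rewrite Hk, RtoC_opp; ring.
      + apply INR_le; rewrite Hk in HB'; simpl Re in HB'.
        destruct (le_lt_dec k (S B)) as [L|L]; [now apply le_INR|].
        apply (le_INR (S (S B))) in L; rewrite (S_INR (S B)) in L; lra.
      + intros n _ Hnk; unfold r; destruct (Ceq_dec _ 0) as [E|N]; [|ring].
        destruct Hnk; rewrite Hk, <- RtoC_plus in E; apply RtoC_inj in E; apply INR_eq; lra. }
  exists c; split; [|reflexivity].
  eapply Clim_eq; [eapply Clim_ext_loc; [|apply Clim_plus; [exact Hrem|apply (Clim_const c)]]|ring].
  generalize at_zero_pos; apply filter_imp; intros t Ht.
  rewrite <- (Hdiff t Ht), (Hmode t Ht); Cring. }
destruct Hconst as [c' [Hlim ->]].
assert (Hinf : Clim G at_inf 0).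
{ destruct (exp_power_bound (Re s + 1) (Re w) Hw) as [M HM].
  apply (Clim_0_bound (F := at_inf) _ (fun t => M * Rpower t (-1))%R).
  - generalize (at_inf_gt 1); apply filter_imp; intros t Ht.
    unfold G; rewrite Cmod_mult, Cmod_Cpower, Cmod_Cexp.
    replace (Re (- w * RtoC t)) with (- (Re w * t))%R by (simpl; unfold Re; simpl; ring).
    replace (Re s) with ((Re s + 1) + (-1))%R at 1 by ring.
    rewrite Rpower_plus.
    replace (Rpower t (Re s + 1) * Rpower t (-1) * exp (- (Re w * t)))%R with
      (Rpower t (Re s + 1) * exp (- (Re w * t)) * Rpower t (-1))%R by ring.
    apply Rmult_le_compat_r; [left; apply exp_pos|apply HM; lra].
  - eapply Rlim_eq; [apply Rlim_const_mult; [typeclasses eauto|]; apply Rpower_lim_inf; lra|ring]. }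
pose proof (is_fp_primitive G _ Rr c 0 HG Hlim Hinf) as P1.
pose proof (is_fp_scal w _ _ _ Hv) as P2.
pose proof (is_fp_scal (/ s) _ _ _ (is_fp_plus _ _ _ _ _ _ P1 P2)) as P3.
eapply is_fp_eq; [eapply is_fp_0_shift; [eapply is_fp_ext; [|exact P3]|]|].
- intros t Ht; cbv beta; field; exact Hs.
- intros t Ht; unfold Rr, laplace_poles; rewrite !sum_n_C_shift.
  assert (E0 : r 0%nat t = s * (a 0%nat * power_primitive (s + RtoC (INR 0)) t)).
  { unfold r, power_primitive; simpl INR; rewrite Cplus_0_r; destruct (Ceq_dec s 0) as [E|_]; [easy|].
    field; exact Hs. }
  rewrite E0, Cmult_plus_distr_l, <- !sum_n_C_scal, Cmult_plus_distr_l, <- Cplus_assoc.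
  f_equal.
  { unfold a; field; split; [apply INR_fact_C|exact Hs]. }
  rewrite <- !sum_n_C_scal, <- sum_n_C_plus; apply sum_n_ext; intros m.
  assert (Ea : w * ((- w) ^ m / RtoC (INR (fact m))) = - RtoC (INR (S m)) * a (S m)).
  { unfold a; rewrite fact_S_C; simpl Cpow; field; split; [apply INR_fact_C|apply INR_S_C]. }
  replace (s + 1 + RtoC (INR m)) with (s + RtoC (INR (S m))) by (rewrite RtoC_INR_S; ring).
  fold (a (S m)).
  transitivity (/ s * (r (S m) t + (w * ((- w) ^ m / RtoC (INR (fact m)))) * power_primitive (s + RtoC (INR (S m))) t)); [Cring|].
  rewrite Ea.
  unfold r, power_primitive; destruct (Ceq_dec _ 0) as [E|N].
  + replace (RtoC (INR (S m))) with (s + RtoC (INR (S m)) - s) by ring; rewrite E; Cfield; exact Hs.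
  + Cfield; split; assumption.
- field; exact Hs.
Qed.

(** ** Dependence on the imaginary part of [w] *)

Lemma Cder_of_quadratic (f : R -> C) t l K : (forall e, (Cmod (f (t + e)%R - f t - RtoC e * l) <= K * e ^ 2)%R) ->
  Cder f t l.
Proof.
intros H.
assert (P : forall c : C -> R, (forall z, Rabs (c z) <= Cmod z)%R ->
   (forall a b : C, c (a - b)%C = (c a - c b)%R) -> (forall (e : R) z, c (RtoC e * z) = (e * c z)%R) ->
   is_derive (fun x => c (f x)) t (c l)).
{ intros c c1 c2 c3; apply is_derive_Reals; intros eps Heps.
  assert (Hd : (0 < eps / (Rabs K + 1))%R).
  { apply Rdiv_lt_0_compat; [exact Heps|]; pose proof (Rabs_pos K); lra. }
  exists (mkposreal _ Hd); simpl; intros e He0 He.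
  assert (B : (Rabs (c (f (t + e)%R) - c (f t) - e * c l) <= K * e ^ 2)%R).
  { rewrite <- c3, <- !c2; eapply Rle_trans; [apply c1|apply H]. }
  replace ((c (f (t + e)%R) - c (f t)) / e - c l)%R with ((c (f (t + e)%R) - c (f t) - e * c l) / e)%R by (field; exact He0).
  unfold Rdiv; rewrite Rabs_mult, Rabs_inv.
  assert (He' : (0 < Rabs e)%R) by now apply Rabs_pos_lt.
  apply Rmult_lt_reg_r with (Rabs e); [exact He'|].
  rewrite Rmult_assoc, Rinv_l, Rmult_1_r by lra.
  eapply Rle_lt_trans; [exact B|].
  rewrite <- (pow2_abs e); simpl; rewrite Rmult_1_r, <- Rmult_assoc.
  apply Rmult_lt_compat_r; [exact He'|].
  apply (Rmult_lt_compat_l (Rabs K + 1)) in He; [|pose proof (Rabs_pos K); lra].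
  replace ((Rabs K + 1) * (eps / (Rabs K + 1)))%R with eps in He by (field; pose proof (Rabs_pos K); lra).
  pose proof (Rle_abs K); nra. }
split.
- apply (P Re); [apply re_le_Cmod|intros [? ?] [? ?]; simpl; lra|intros ? [? ?]; simpl; unfold Re; simpl; ring].
- apply (P Im); [|intros [? ?] [? ?]; simpl; lra|intros ? [? ?]; simpl; unfold Im, Re; simpl; ring].
  intros z; eapply Rle_trans; [|apply Rmax_Cmod]; apply Rmax_r.
Qed.

(** Differentiation under the integral sign: [|e^(iy) - 1 - iy| <= y^2] bounds the error by [e^2]
    times a convergent integral.  Moving [w] on a vertical line replaces holomorphy in [w] by
    differentiability in one real variable. *)
Lemma Cder_laplace (s : C) (eps : R) (Q : R -> C) (v : R -> C) (v1 : C) x : (0 < eps)%R -> (-1 < Re s)%R ->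
  (forall x, is_fp (laplace_kernel s (eps, x)) Q (v x)) ->
  is_cint (laplace_kernel (s + 1) (eps, x)) v1 -> Cder v x (- Ci * v1).
Proof.
intros He Hs Hv Hv1.
destruct (exp_power_bound (Re s + 3) eps He) as [M HM].
set (K := (Rmax 1 M * (/ (Re s + 1 + 1) + / - (-2 + 1)))%R).
apply (Cder_of_quadratic _ _ _ K); intros e.
set (D := fun t => laplace_kernel s (eps, (x + e)%R) t - laplace_kernel s (eps, x) t + (RtoC e * Ci) * laplace_kernel (s + 1) (eps, x) t).
assert (ID : is_cint D (v (x + e)%R - v x - RtoC e * (- Ci * v1))).
{ eapply is_fp_eq; [eapply is_fp_0_shift; [eapply is_fp_ext; [|apply is_fp_plus; [apply is_fp_plus;
    [apply (Hv (x + e)%R)|apply (is_fp_scal (-(1))), (Hv x)]|apply (is_fp_scal (RtoC e * Ci)), Hv1]]|]|].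
  - intros t Ht; unfold D; ring.
  - intros t Ht; simpl; ring.
  - ring. }
(* [exp_rem] is estimated at nonnegative arguments, so [u] carries the sign of [e]. *)
set (u := Ci * RtoC (- (if Rle_dec 0 e then 1 else -1))).
assert (HD : forall t, (0 < t)%R -> D t = Cpower t (s - 1) * Cexp (- (eps, x) * RtoC t) * exp_rem u 2 (Rabs e * t)).
{ intros t Ht; unfold D, laplace_kernel.
  replace (Cpower t (s + 1 - 1)) with (Cpower t (s - 1) * RtoC t)
    by (rewrite <- (Cpower_succ t (s - 1)) by exact Ht; f_equal; ring).
  replace (Cexp (- (eps, (x + e)%R) * RtoC t)) with (Cexp (- (eps, x) * RtoC t) * Cexp (- Ci * RtoC (e * t))).
  2:{ rewrite <- Cexp_plus; f_equal; apply C_eq; simpl; ring. }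
  change (exp_rem u 2 (Rabs e * t)) with (Cexp (u * RtoC (Rabs e * t)) - 1 / RtoC 1 - (u * RtoC (Rabs e * t)) * 1 / RtoC 1).
  replace (u * RtoC (Rabs e * t)) with (- Ci * RtoC (e * t)).
  2:{ unfold u, Rabs; destruct (Rle_dec 0 e), (Rcase_abs e); try lra; apply C_eq; simpl; ring. }
  rewrite RtoC_mult. field. }
assert (Hu : Cmod u = 1%R).
{ unfold u; rewrite Cmod_mult, Cmod_Ci, Cmod_R; destruct (Rle_dec 0 e); rewrite Rabs_Ropp; [rewrite Rabs_pos_eq|rewrite Rabs_left]; lra. }
assert (Hb : forall t, (0 < t)%R -> (Cmod (D t) <= e ^ 2 * (Rpower t (Re s + 1) * exp (- (eps * t))))%R).
{ intros t Ht; rewrite HD, !Cmod_mult, Cmod_Cpower, Cmod_Cexp by exact Ht.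
  replace (Re (- (eps, x) * RtoC t)) with (- (eps * t))%R by (simpl; ring).
  assert (B : (Cmod (exp_rem u 2 (Rabs e * t)) <= (Cmod u * (Rabs e * t)) ^ 2)%R).
  { apply exp_rem_le; [unfold u; simpl; lra|apply Rmult_le_pos; [apply Rabs_pos|lra]]. }
  rewrite Hu, Rmult_1_l, Rpow_mult_distr, pow2_abs in B.
  replace (Rpower t (Re s + 1)) with (Rpower t (Re (s - 1)) * t ^ 2)%R.
  2:{ rewrite <- Rpower_pow, <- Rpower_plus by exact Ht; f_equal; simpl; unfold Re; simpl; ring. }
  replace (e ^ 2 * (Rpower t (Re (s - 1)) * t ^ 2 * exp (- (eps * t))))%R with
   (Rpower t (Re (s - 1)) * exp (- (eps * t)) * (e ^ 2 * t ^ 2))%R by ring.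
  apply Rmult_le_compat_l; [|exact B].
  apply Rmult_le_pos; left; apply exp_pos. }
unfold K; rewrite Rmult_comm, <- Rmult_assoc.
apply (is_cint_bound_both D); auto; try lra.
- intros t Ht; eapply Rle_trans; [apply Hb; lra|].
  rewrite Rmult_assoc; apply Rmult_le_compat_l; [apply pow2_ge_0|].
  rewrite Rmult_comm; apply Rmult_le_compat_r; [left; apply exp_pos|].
  eapply Rle_trans; [|apply Rmax_l].
  rewrite <- exp_0; left; apply exp_increasing; nra.
- intros t Ht; eapply Rle_trans; [apply Hb; lra|].
  rewrite Rmult_assoc; apply Rmult_le_compat_l; [apply pow2_ge_0|].
  replace (Re s + 1)%R with (Re s + 3 + -2)%R by ring.
  rewrite Rpower_plus.
  replace (Rpower t (Re s + 3) * Rpower t (-2) * exp (- (eps * t)))%R with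
   ((Rpower t (Re s + 3) * exp (- (eps * t))) * Rpower t (-2))%R by ring.
  apply Rmult_le_compat_r; [left; apply exp_pos|].
  eapply Rle_trans; [now apply HM|apply Rmax_r].
Qed.

Ltac Rring :=
  change plus with Rplus; change opp with Ropp; cbv beta;
  match goal with |- ?a = ?b => change (@eq R a b) end; ring.

(** ** The logarithm on a vertical line of the right half-plane *)

(** The principal logarithm of [w = eps + i x], for [eps > 0]. *)
Definition Clog (eps x : R) : C := ((/ 2 * ln (eps ^ 2 + x ^ 2))%R, atan (x / eps)).

Lemma w_neq0 eps x : (0 < eps)%R -> ((eps, x) : C) <> 0.
Proof. intros H E; apply (f_equal Re) in E; simpl in E; lra. Qed.

Lemma Cder_Clog eps x : (0 < eps)%R -> Cder (Clog eps) x (Ci / (eps, x)).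
Proof.
intros He.
assert (P : (0 < eps ^ 2 + x ^ 2)%R) by (pose proof (pow2_ge_0 x); nra).
split; simpl.
- evar_last; [auto_derive; [|reflexivity]|].
  + simpl in P; lra.
  + field; simpl in P; lra.
- apply (is_derive_ext (fun x => atan (/ eps * x))).
  { intros; f_equal; unfold Rdiv; ring. }
  evar_last.
  + apply (is_derive_comp atan (fun x => (/ eps * x)%R)).
    * apply is_derive_Reals, derivable_pt_lim_atan.
    * apply (is_derive_scal (fun x => x)), @is_derive_id.
  + unfold scal, one; simpl; unfold mult; simpl. unfold Rsqr; simpl in P. field; split; lra.
Qed.

Lemma Clog_0 eps : (0 < eps)%R -> Clog eps 0 = RtoC (ln eps).
Proof.
intros He; unfold Clog; apply C_eq; simpl.
- replace (eps * (eps * 1) + 0 * (0 * 1))%R with (eps * eps)%R by ring.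
  rewrite ln_mult by assumption; lra.
- unfold Rdiv; rewrite Rmult_0_l; apply atan_0.
Qed.

Lemma Cder_w eps x : Cder (fun x => (eps, x)) x Ci.
Proof. split; simpl; [apply @is_derive_const|apply @is_derive_id]. Qed.

Lemma Cder_0_everywhere (H : R -> C) : (forall t, Cder H t 0) -> forall t, H t = H 0%R.
Proof.
intros HH t; destruct (Rle_or_lt 0 t) as [L|L].
- apply (Cder_0_const H 0 t L); auto.
- symmetry; apply (Cder_0_const H t 0); [lra|auto].
Qed.

(** [w e^(- Log w)] has derivative [0] along the line and equals [1] at [x = 0]. *)
Lemma Cexp_Clog eps x : (0 < eps)%R -> Cexp (Clog eps x) = (eps, x).
Proof.
intros He.
assert (D : forall t, Cder (fun t => Cexp (- Clog eps t) * (eps, t)) t 0).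
{ intros t; eapply Cder_eq.
  - apply Cder_mult; [apply Cder_Cexp, Cder_opp, Cder_Clog, He|apply Cder_w].
  - cbv beta; field; now apply w_neq0. }
pose proof (Cder_0_everywhere _ D x) as E; cbv beta in E.
rewrite Clog_0 in E by exact He.
replace (Cexp (- RtoC (ln eps)) * (eps, 0%R)) with (RtoC 1) in E.
2:{ rewrite <- RtoC_opp, Cexp_RtoC, exp_Ropp, exp_ln by exact He.
    apply C_eq; simpl; field; lra. }
change (@eq C (Cexp (Clog eps x)) (eps, x)).
transitivity (Cexp (Clog eps x) * (Cexp (- Clog eps x) * (eps, x))).
- rewrite E; ring.
- rewrite Cmult_assoc, (Cmult_comm (Cexp (Clog eps x))), Cexp_opp; ring.
Qed.

Lemma Cder_laplace_kernel s w t : (0 < t)%R -> exists l, Cder (laplace_kernel s w) t l.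
Proof.
intros Ht; eexists; apply Cder_mult; [apply Cder_Cpower, Ht|apply Cder_Cexp, Cder_scal, Cder_id].
Qed.

Lemma Cmod_laplace_kernel s w t : Cmod (laplace_kernel s w t) = (Rpower t (Re s - 1) * exp (- (Re w * t)))%R.
Proof.
unfold laplace_kernel; rewrite Cmod_mult, Cmod_Cpower, Cmod_Cexp. replace (Re (- w * RtoC t)) with (- (Re w * t))%R by (simpl; unfold Re; simpl; ring). reflexivity.
Qed.

Lemma laplace_kernel_inf s w : (0 < Re w)%R -> exists M, forall t, (1 <= t)%R ->
  (Cmod (laplace_kernel s w t) <= M * Rpower t (-2))%R.
Proof.
intros Hw; destruct (exp_power_bound (Re s + 1) (Re w) Hw) as [M HM]; exists M; intros t Ht.
rewrite Cmod_laplace_kernel.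
replace (Re s - 1)%R with (Re s + 1 + -2)%R by ring; rewrite Rpower_plus.
replace (Rpower t (Re s + 1) * Rpower t (-2) * exp (- (Re w * t)))%R with
   ((Rpower t (Re s + 1) * exp (- (Re w * t))) * Rpower t (-2))%R by ring.
apply Rmult_le_compat_r; [left; apply exp_pos|now apply HM].
Qed.

Lemma laplace_exists s w : (0 < Re s)%R -> (0 < Re w)%R -> exists v, is_cint (laplace_kernel s w) v.
Proof.
intros Hs Hw; destruct (laplace_kernel_inf s w Hw) as [M HM].
apply (is_cint_exists _ (Rmax 1 M) (Re s - 1) (-2)); try lra.
- intros; now apply Cder_laplace_kernel.
- intros t Ht; rewrite Cmod_laplace_kernel, Rmult_comm.
  apply Rmult_le_compat_r; [left; apply exp_pos|].
  eapply Rle_trans; [|apply Rmax_l].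
  assert (0 <= Re w * t)%R by nra.
  rewrite <- exp_0; destruct H as [H|H]; [left; apply exp_increasing; lra|right; f_equal; lra].
- intros t Ht; eapply Rle_trans; [now apply HM|].
  apply Rmult_le_compat_r; [left; apply exp_pos|apply Rmax_r].
Qed.

Lemma Gamma_integral_is_cint s : (0 < Re s)%R -> is_cint (laplace_kernel s 1) (Gamma_integral s).
Proof.
intros Hs; destruct (laplace_exists s 1 Hs) as [v Hv]; [simpl; lra|].
assert (E : forall t, (0 < t)%R -> laplace_kernel s 1 t = RtoC (exp (- t)) * Cpower t (s - 1)).
{ intros t Ht; unfold laplace_kernel; rewrite <- Cexp_RtoC, RtoC_opp, Cmult_comm; do 2 f_equal; ring. }
assert (Ev : Gamma_integral s = v); [|now rewrite Ev].
unfold Gamma_integral; apply (is_cint_CInt (fun t => RtoC (exp (- t)) * Cpower t (s - 1)) v).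
- now apply (is_cint_ext (laplace_kernel s 1)).
- intros t Ht; destruct (Cder_laplace_kernel s 1 t Ht) as [l Hl]; exists l.
  now apply (Cder_ext_pos (laplace_kernel s 1)).
Qed.

Lemma is_cint_laplace_fp s w v : (0 < Re s)%R -> is_cint (laplace_kernel s w) v -> laplace_fp s w v.
Proof.
intros Hs Hv; exists 0%nat; split; [simpl; lra|].
apply (is_fp_Q _ _ _ _ Hv).
eapply Clim_eq; [eapply Clim_ext_loc; [|apply Clim_opp, (power_primitive_lim_zero s Hs)]|ring].
apply filter_forall; intros t; unfold laplace_poles; rewrite sum_O; simpl.
rewrite Cplus_0_r; field.
Qed.

Lemma not_pole_pos s : (0 < Re s)%R -> forall k : nat, s <> RtoC (- INR k).
Proof. intros H k ->; simpl in H; pose proof (pos_INR k); lra. Qed.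

Lemma laplace_fp_step_regular s w v : (forall k : nat, s <> RtoC (- INR k)) -> (0 < Re w)%R ->
  laplace_fp (s + 1) w v -> laplace_fp s w (w * v / s).
Proof.
intros Hs Hw Hv.
replace (w * v / s) with ((w * v - 0) / s) by (unfold Cdiv; ring).
apply laplace_fp_step; auto.
intros ->; apply (Hs 0%nat); simpl; now rewrite Ropp_0.
Qed.

(** Write [P(s, w)] for the integral.  Its derivative in [x] is [- i P(s + 1, w)], and
    [w P(s + 1, w) = s P(s, w)]; hence [w^s P(s, w)] is constant on the line, and at [x = 0] a change
    of scale turns it into Euler's integral. *)
Lemma laplace_value s eps x : (0 < eps)%R -> (0 < Re s)%R ->
  is_cint (laplace_kernel s (eps, x)) (Cexp (- s * Clog eps x) * Gamma_integral s).
Proof.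
intros He Hs.
set (V := fun s x => CInt (laplace_kernel s (eps, x)) at_zero at_inf).
assert (HV : forall s x, (0 < Re s)%R -> is_cint (laplace_kernel s (eps, x)) (V s x)).
{ intros z y Hz; apply CInt_is_cint; [intros; now apply Cder_laplace_kernel|now apply laplace_exists]. }
assert (Hs1 : (0 < Re (s + 1))%R) by (simpl; unfold Re in *; simpl in *; lra).
assert (Rec : forall y, (eps, y) * V (s + 1) y = s * V s y).
{ intros y.
  assert (L : laplace_fp s (eps, y) ((eps, y) * V (s + 1) y / s)).
  { apply laplace_fp_step_regular; auto; [now apply not_pole_pos|].
    apply is_cint_laplace_fp; auto. }
  rewrite (laplace_fp_unique _ _ _ _ (is_cint_laplace_fp _ _ _ Hs (HV s y Hs)) L).
  field; intros E; rewrite E in Hs; simpl in Hs; lra. }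
assert (D : forall y, Cder (fun y => V s y * Cexp (s * Clog eps y)) y 0).
{ intros y; eapply Cder_eq.
  - apply Cder_mult; [|apply Cder_Cexp, Cder_scal, Cder_Clog, He].
    apply (Cder_laplace s eps (fun _ => 0) (V s) (V (s + 1) y) y He); [lra| |now apply HV].
    intros; now apply HV.
  - cbv beta. assert (Hw := w_neq0 eps y He).
    replace (V (s + 1) y) with (s * V s y / (eps, y)) by (rewrite <- Rec; field; exact Hw).
    field; exact Hw. }
pose proof (Cder_0_everywhere _ D x) as E; cbv beta in E.
rewrite Clog_0 in E by exact He.
assert (E0 : V s 0%R * Cexp (s * RtoC (ln eps)) = Gamma_integral s).
{ apply (is_cint_unique (laplace_kernel s 1)); [|now apply Gamma_integral_is_cint].
  assert (Hie : (0 < / eps)%R) by now apply Rinv_0_lt_compat.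
  eapply is_cint_eq; [eapply is_cint_ext; [|apply (is_cint_scal (Cpower eps s)), (is_cint_scaling (/ eps) _ _ Hie (HV s 0%R Hs))]|].
  - intros t Ht; unfold laplace_kernel; cbv beta.
    rewrite Cpower_mult_base by assumption.
    replace (Cpower (/ eps) (s - 1)) with (RtoC eps * / Cpower eps s).
    + replace (- (eps, 0%R) * RtoC (/ eps * t)) with (- (1) * RtoC t) by (apply C_eq; simpl; field; lra).
      rewrite RtoC_inv by lra; Cfield.
      split; [apply Cpower_neq0|intros Z; apply RtoC_inj in Z; lra].
    + rewrite <- Cpower_opp. unfold Cpower; rewrite ln_Rinv by exact He.
      rewrite <- (exp_ln eps) at 1 by exact He. rewrite <- Cexp_RtoC, <- Cexp_plus, RtoC_opp; f_equal; ring.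
  - unfold Cpower; ring. }
eapply is_cint_eq; [apply HV, Hs|].
rewrite <- E0, <- E.
replace (- s * Clog eps x) with (- (s * Clog eps x)) by ring.
rewrite (Cmult_comm (V s x)), Cmult_assoc, Cexp_opp; ring.
Qed.

Lemma rising_factorial_S s N : rising_factorial s (S N) = s * rising_factorial (s + 1) N.
Proof.
induction N as [|N IH]; [simpl; ring|].
change (rising_factorial s (S N) * (s + RtoC (INR (S N))) = s * (rising_factorial (s + 1) N * (s + 1 + RtoC (INR N)))).
rewrite IH, RtoC_INR_S; ring.
Qed.

Lemma rising_factorial_neq0 s N : (forall k : nat, s <> RtoC (- INR k)) -> rising_factorial s N <> 0.
Proof.
intros Hs; induction N as [|N IH]; [apply C1_nz|].
apply Cmult_neq_0; [exact IH|].
intros E; apply (Hs N); rewrite RtoC_opp; replace s with (s + RtoC (INR N) - RtoC (INR N)) by ring; rewrite E; ring.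
Qed.

(** [N] integrations by parts lead to a convergent integral and build up the denominator in the
    continuation of [Gamma]. *)
Lemma laplace_fp_rising N : forall s eps x, (0 < eps)%R -> (forall k : nat, s <> RtoC (- INR k)) ->
  (0 < Re s + INR N)%R ->
  laplace_fp s (eps, x) (Cexp (- s * Clog eps x) * (Gamma_integral (s + RtoC (INR N)) / rising_factorial s N)).
Proof.
induction N as [|N IH]; intros s eps x He Hs HN.
- simpl INR in *; rewrite Rplus_0_r in HN; rewrite Cplus_0_r; simpl.
  replace (Gamma_integral s / 1) with (Gamma_integral s) by field.
  apply is_cint_laplace_fp; [exact HN|now apply laplace_value].
- assert (Hs1 : forall k : nat, s + 1 <> RtoC (- INR k)).
  { intros k E; apply (Hs (S k)); rewrite S_INR; replace s with (s + 1 - 1) by ring; rewrite E.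
    rewrite <- RtoC_minus; f_equal; ring. }
  assert (P : laplace_fp (s + 1) (eps, x) (Cexp (- (s + 1) * Clog eps x) *
     (Gamma_integral (s + 1 + RtoC (INR N)) / rising_factorial (s + 1) N))).
  { apply IH; auto; rewrite S_INR in HN; simpl; unfold Re in *; simpl in *; lra. }
  apply laplace_fp_step_regular in P; [|exact Hs|exact He].
  assert (Hs0 : s <> 0) by (intros ->; apply (Hs 0%nat); simpl; now rewrite Ropp_0).
  replace (s + RtoC (INR (S N))) with (s + 1 + RtoC (INR N)) by (rewrite RtoC_INR_S; ring).
  rewrite rising_factorial_S.
  match goal with |- laplace_fp _ _ ?a => match type of P with laplace_fp _ _ ?b => replace a with b end end; [exact P|].
  replace (- s * Clog eps x) with (- (s + 1) * Clog eps x + Clog eps x) by ring.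
  rewrite Cexp_plus, Cexp_Clog by exact He.
  field; split; [now apply rising_factorial_neq0|exact Hs0].
Qed.

Lemma laplace_fp_regular s eps x : (0 < eps)%R -> (forall k : nat, s <> RtoC (- INR k)) ->
  laplace_fp s (eps, x) (Cexp (- s * Clog eps x) * Gamma_star s).
Proof.
intros He Hs; rewrite Gamma_star_regular by exact Hs; unfold CGamma.
apply laplace_fp_rising; auto.
set (u := up (- Re s)).
destruct (archimed (- Re s)) as [Hu _]; fold u in Hu.
destruct (Z_le_dec 0 u) as [L|L].
- rewrite INR_IZR_INZ, Z2Nat.id by exact L; lra.
- assert (u <= -1)%Z by lia; apply IZR_le in H. pose proof (pos_INR (Z.to_nat u)); lra.
Qed.

(** ** The Euler--Mascheroni constant *)

(** With [y = t / n], the [n]-th power of [1 - y^2 <= (1 - y) e^y <= 1], and Bernoulli's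
    inequality. *)
Lemma exp_pow_bounds t n : (1 <= n)%nat -> (0 <= t <= INR n)%R ->
  (0 <= exp (- t) - (1 - t / INR n) ^ n <= t ^ 2 * exp (- t) / INR n)%R.
Proof.
intros Hn Ht.
assert (Hn' : (1 <= INR n)%R) by (apply (le_INR 1); exact Hn).
set (y := (t / INR n)%R).
assert (Hy : (0 <= y <= 1)%R).
{ unfold y; split; [apply Rdiv_le_0_compat; lra|].
  apply Rmult_le_reg_r with (INR n); [lra|]; unfold Rdiv; rewrite Rmult_assoc, Rinv_l; lra. }
assert (Et : t = (INR n * y)%R) by (unfold y; field; lra).
assert (Ee : exp (- t) = (exp (- y) ^ n)%R).
{ rewrite <- Rpower_pow by apply exp_pos; unfold Rpower; rewrite ln_exp; f_equal; rewrite Et; ring. }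
assert (Hup : (1 - y <= exp (- y))%R) by (pose proof (exp_ineq1_le (- y)); lra).
assert (Hlow : (1 - y ^ 2 <= (1 - y) * exp y)%R).
{ pose proof (exp_ineq1_le y). replace (1 - y ^ 2)%R with ((1 - y) * (1 + y))%R by ring.
  apply Rmult_le_compat_l; lra. }
assert (Hlow2 : (exp (- t) * (1 - y ^ 2) ^ n <= (1 - y) ^ n)%R).
{ rewrite Ee, <- Rpow_mult_distr; apply pow_incr; split.
  - apply Rmult_le_pos; [left; apply exp_pos|nra].
  - replace (1 - y)%R with (exp (- y) * ((1 - y) * exp y))%R.
    + apply Rmult_le_compat_l; [left; apply exp_pos|exact Hlow].
    + rewrite exp_Ropp; field; apply Rgt_not_eq, exp_pos. }
assert (Bern : forall k z, (0 <= z <= 1)%R -> (1 - INR k * z ^ 2 <= (1 - z ^ 2) ^ k)%R).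
{ intros k z Hz; induction k as [|k IH]; [simpl; lra|].
  rewrite S_INR; change ((1 - z ^ 2) ^ S k)%R with ((1 - z ^ 2) * (1 - z ^ 2) ^ k)%R.
  assert (0 <= 1 - z ^ 2)%R by nra.
  apply Rle_trans with ((1 - z ^ 2) * (1 - INR k * z ^ 2))%R; [|now apply Rmult_le_compat_l].
  assert (0 <= INR k * (z ^ 2 * z ^ 2))%R; [|nra].
  apply Rmult_le_pos; [apply pos_INR|]; pose proof (pow2_ge_0 z); nra. }
specialize (Bern n y Hy).
split.
- rewrite Ee; enough ((1 - y) ^ n <= exp (- y) ^ n)%R by (fold y; lra).
  apply pow_incr; lra.
- fold y. pose proof (exp_pos (- t)).
  replace (t ^ 2 * exp (- t) / INR n)%R with (exp (- t) * (INR n * y ^ 2))%R.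
  2:{ unfold y; field; lra. }
  assert (exp (- t) * (1 - INR n * y ^ 2) <= exp (- t) * (1 - y ^ 2) ^ n)%R by (apply Rmult_le_compat_l; lra).
  lra.
Qed.

Lemma filterlim_INR_inf : filterlim INR eventually at_inf.
Proof.
intros P [M HM]; destruct (archimed M) as [Hu _].
exists (Z.to_nat (up M)); intros n Hn; apply HM.
apply le_INR in Hn; eapply Rlt_le_trans; [exact Hu|]; eapply Rle_trans; [|exact Hn].
destruct (Z_le_dec 0 (up M)) as [L|L].
- rewrite INR_IZR_INZ, Z2Nat.id by exact L; lra.
- assert (up M <= -1)%Z by lia; apply IZR_le in H; pose proof (pos_INR (Z.to_nat (up M))); lra.
Qed.

(** [H_n = int_0^n (1 - (1 - t/n)^n) dt/t]; letting [n] tend to infinity turns [(1 - t/n)^n]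
    into [e^(-t)] and identifies the finite part of [int e^(-t) dt/t]. *)
Lemma exponential_integral_gamma v : is_fp (laplace_kernel 0 1) (fun t => RtoC (ln t)) v ->
  v = RtoC (- euler_gamma).
Proof.
intros [H [l0 [l1 [HH [H0 [H1 ->]]]]]].
assert (HH' : forall t, (0 < t)%R -> Cder H t (RtoC (exp (- t) / t))).
{ intros t Ht; eapply Cder_eq; [now apply HH|].
  unfold laplace_kernel; rewrite Cpower_pred, Cpower_0 by exact Ht.
  replace (- (1) * RtoC t) with (RtoC (- t)) by (rewrite RtoC_opp; ring).
  rewrite Cexp_RtoC; unfold Rdiv; rewrite RtoC_mult, RtoC_inv; unfold Cdiv; try ring. lra. }
(* A primitive of [(1 - (1 - t/n)^n) / t], from the geometric sum in [1 - t/n]; it vanishes at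
   [t = n] and equals [- H_n] at [t = 0]. *)
pose (prim := fun (n : nat) (t : R) => (- sum_n (fun j => (1 - t / INR n) ^ (S j) / INR (S j)) (pred n))%R).
assert (Hprim : forall n t, (1 <= n)%nat -> (0 < t)%R -> is_derive (prim n) t ((1 - (1 - t / INR n) ^ n) / t)%R).
{ intros n t Hn Ht.
  assert (Hn' : (1 <= INR n)%R) by (apply (le_INR 1); exact Hn).
  assert (G : forall N, is_derive (fun t => (- sum_n (fun j => (1 - t / INR n) ^ (S j) / INR (S j)) N)%R) t
     ((1 - (1 - t / INR n) ^ S N) / t)%R).
  { induction N as [|N IH].
    - apply (is_derive_ext (fun t => (- (1 - t / INR n))%R)).
      + intros u; rewrite sum_O; simpl; field; lra.
      + auto_derive; auto; simpl; field; lra.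
    - apply (is_derive_ext (fun t => (- sum_n (fun j => (1 - t / INR n) ^ (S j) / INR (S j)) N + - ((1 - t / INR n) ^ (S (S N)) / INR (S (S N))))%R)).
      + intros u; rewrite sum_Sn; Rring.
      + evar_last; [apply @is_derive_plus; [exact IH|]|].
        * apply (is_derive_ext (fun t => (- (/ INR (S (S N)) * (1 - t / INR n) ^ S (S N)))%R)).
          { intros u; unfold Rdiv; Rring. }
          apply (is_derive_opp (fun t => (/ INR (S (S N)) * (1 - t / INR n) ^ S (S N))%R)).
          apply (is_derive_scal (fun t => ((1 - t / INR n) ^ S (S N))%R)).
          apply (is_derive_pow (fun t => (1 - t / INR n)%R) (S (S N)) t (- / INR n)%R).
          auto_derive; auto; field; lra.
        * unfold plus, opp; cbn -[INR pow].
          set (q := ((1 - t / INR n) ^ S N)%R).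
          replace ((1 - t / INR n) ^ S (S N))%R with ((1 - t / INR n) * q)%R by reflexivity.
          simpl pred; fold q. field; split; [|split]; try lra. apply not_0_INR; lia. }
  destruct n as [|n]; [lia|]; apply (G n). }
assert (Hprim0 : forall n, (1 <= n)%nat -> filterlim (prim n) at_zero (locally (- harmonic n)%R)).
{ intros n Hn.
  assert (E : (- harmonic n)%R = prim n 0%R).
  { unfold prim, harmonic. f_equal. destruct n as [|n]; [lia|]; simpl pred.
    rewrite <- (sum_n_m_S (fun j => (/ INR j)%R) 0 n); unfold sum_n; apply sum_n_m_ext; intros j.
    unfold Rdiv; rewrite Rmult_0_l, Rminus_0_r, pow1; Rring. }
  rewrite E.
  assert (C0 : continuous (prim n) 0%R).
  { unfold prim; apply (continuous_opp (V := R_NormedModule)).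
    generalize (pred n); induction n0 as [|N IH].
    - apply (continuous_ext (fun t => ((1 - t / INR n) ^ 1 / INR 1)%R)); [intros; now rewrite sum_O|].
      apply @ex_derive_continuous; auto_derive; auto.
    - apply (continuous_ext (fun t => plus (sum_n (fun j => ((1 - t / INR n) ^ (S j) / INR (S j))%R) N)
         ((1 - t / INR n) ^ (S (S N)) / INR (S (S N)))%R)); [intros; now rewrite sum_Sn|].
      apply @continuous_plus; [exact IH|].
      apply @ex_derive_continuous; auto_derive; auto. }
  intros P HP; destruct (C0 P HP) as [d Hd]; exists d; intros u Hu _; now apply Hd. }
assert (Main : forall n, (1 <= n)%nat ->
  (Cmod (RtoC (ln (INR n)) - H (INR n) + l0 - RtoC (harmonic n)) <= / INR n)%R).
{ intros n Hn.
  assert (Hn' : (1 <= INR n)%R) by (apply (le_INR 1); exact Hn).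
  set (D := fun t => RtoC (ln t) - H t - RtoC (prim n t)).
  assert (Dd : forall t, (0 < t)%R -> Cder D t (RtoC (((1 - t / INR n) ^ n - exp (- t)) / t))).
  { intros t Ht; eapply Cder_eq.
    - apply Cder_minus; [apply Cder_minus; [apply Cder_RtoC, is_derive_Reals, derivable_pt_lim_ln, Ht|now apply HH']|].
      apply Cder_RtoC, Hprim; assumption.
    - rewrite <- !RtoC_minus; f_equal; field; lra. }
  assert (Dn : prim n (INR n) = 0%R).
  { unfold prim; replace (1 - INR n / INR n)%R with 0%R by (field; lra).
    rewrite (sum_n_ext _ (fun _ => zero)); [|intros j; unfold zero; simpl; unfold Rdiv; ring].
    unfold sum_n; rewrite sum_n_m_const_zero; unfold zero; simpl; ring. }
  assert (Lim : Clim (fun t => D (INR n) - D t) at_zero (D (INR n) - (- l0 - RtoC (- harmonic n)))).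
  { apply Clim_minus; [apply Clim_const|].
    eapply Clim_ext_loc; [|apply Clim_minus; [apply Clim_opp, H0|apply Clim_RtoC, Hprim0, Hn]].
    apply filter_forall; intros t; unfold D; ring. }
  replace (RtoC (ln (INR n)) - H (INR n) + l0 - RtoC (harmonic n)) with
    (D (INR n) - (- l0 - RtoC (- harmonic n))).
  2:{ unfold D; rewrite Dn, RtoC_opp; ring. }
  eapply (Clim_Cmod_le (F := at_zero)); [|exact Lim].
  generalize (at_zero_lt (INR n) ltac:(lra)); apply filter_imp; intros t Ht.
  (* [Phi' = t e^(-t) / n] dominates the derivative of [D] by [exp_pow_bounds]. *)
  set (Phi := fun t => (/ INR n * (- (1 + t) * exp (- t)))%R).
  assert (B : (Cmod (D (INR n) - D t) <= Phi (INR n) - Phi t)%R).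
  { apply (Cmod_diff_le D (fun t => RtoC (((1 - t / INR n) ^ n - exp (- t)) / t)) Phi (fun t => / INR n * (t * exp (- t)))%R); [lra| | |].
    - intros u Hu; apply Dd; lra.
    - intros u Hu; unfold Phi; auto_derive; auto; ring.
    - intros u Hu; rewrite Cmod_R.
      destruct (exp_pow_bounds u n Hn) as [b1 b2]; [lra|].
      unfold Rdiv; rewrite Rabs_mult, Rabs_inv, (Rabs_pos_eq u) by lra.
      rewrite Rabs_left1 by lra.
      apply Rmult_le_reg_r with u; [lra|]; rewrite Rmult_assoc, Rinv_l, Rmult_1_r by lra.
      eapply Rle_trans; [|eapply Rle_trans; [exact b2|]]; [lra|]; right; unfold Rdiv; ring. }
  eapply Rle_trans; [exact B|]; unfold Phi.
  assert (P1 : (0 <= (1 + INR n) * exp (- INR n))%R) by (apply Rmult_le_pos; [lra|left; apply exp_pos]).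
  assert (P2 : ((1 + t) * exp (- t) <= 1)%R).
  { pose proof (exp_ineq1_le t); rewrite exp_Ropp.
    apply Rmult_le_reg_r with (exp t); [apply exp_pos|]; rewrite Rmult_assoc, Rinv_l; [lra|apply Rgt_not_eq, exp_pos]. }
  assert (P3 : (0 < / INR n)%R) by (apply Rinv_0_lt_compat; lra).
  nra. }
assert (Lim : is_lim_seq (fun n => (harmonic n - ln (INR n))%R) (Re (l0 - l1)) /\ Im (l0 - l1) = 0%R).
{ assert (HInf : forall c : C -> R, (forall z, Rabs (c z) <= Cmod z)%R ->
    (forall a b : C, c (a - b)%C = (c a - c b)%R) -> (forall a b : C, c (a + b)%C = (c a + c b)%R) ->
    filterlim (fun x => c (H x)) at_inf (locally (c l1)) ->
    is_lim_seq (fun n => (c (RtoC (harmonic n)) - c (RtoC (ln (INR n))))%R) (c (l0 - l1))).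
  { intros c c1 c2 c3 cH.
    apply (is_lim_seq_ext (fun n => ((c l0 - c (H (INR n))) - c (RtoC (ln (INR n)) - H (INR n) + l0 - RtoC (harmonic n))%C)%R)).
    { intros n; rewrite c2, c3, c2; ring. }
    replace (Finite (c (l0 - l1))) with (Finite ((c l0 - c l1) - 0)) by (rewrite c2; f_equal; ring).
    apply (is_lim_seq_minus' _ _ (c l0 - c l1)%R 0%R).
    - apply (is_lim_seq_minus' (fun _ => c l0) (fun n => c (H (INR n))) (c l0) (c l1)); [apply is_lim_seq_const|].
      apply (filterlim_comp _ _ _ INR (fun x => c (H x)) eventually at_inf); [apply filterlim_INR_inf|exact cH].
    - apply is_lim_seq_abs_0.
      apply (is_lim_seq_le_le_loc (fun _ => 0%R) _ (fun n => (/ INR n)%R)).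
      + exists 1%nat; intros n Hn; split; [apply Rabs_pos|].
        eapply Rle_trans; [apply c1|now apply Main].
      + apply is_lim_seq_const.
      + apply (is_lim_seq_inv INR p_infty); [apply is_lim_seq_INR|discriminate]. }
  split.
  - apply (HInf Re); [apply re_le_Cmod|intros [? ?] [? ?]; simpl; lra|intros [? ?] [? ?]; simpl; lra|apply H1].
  - assert (L2 : is_lim_seq (fun n => (Im (RtoC (harmonic n)) - Im (RtoC (ln (INR n))))%R) (Im (l0 - l1))).
    { apply (HInf Im); [|intros [? ?] [? ?]; simpl; lra|intros [? ?] [? ?]; simpl; lra|apply H1].
      intros z; eapply Rle_trans; [|apply Rmax_Cmod]; apply Rmax_r. }
    apply is_lim_seq_unique in L2.
    rewrite (Lim_seq_ext _ (fun _ => 0%R)), Lim_seq_const in L2 by (intros; simpl; ring).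
    injection L2; intros; symmetry; assumption. }
destruct Lim as [L1 L2].
apply is_lim_seq_unique in L1.
unfold euler_gamma; rewrite L1.
apply C_eq; simpl in *; lra.
Qed.

Lemma is_cint_exponential eps x : (0 < eps)%R -> is_cint (laplace_kernel 1 (eps, x)) (1 / (eps, x)).
Proof.
intros He; set (w := (eps, x) : C).
assert (Hw : w <> 0) by now apply w_neq0.
eapply is_cint_eq.
- apply (is_cint_primitive (fun t => - / w * Cexp (- w * RtoC t)) _ (- / w * Cexp (- w * RtoC 0)) 0).
  + intros t Ht; eapply Cder_eq; [apply Cder_scal, Cder_Cexp, Cder_scal, Cder_id|].
    cbv beta; unfold laplace_kernel; replace (1 - 1) with (RtoC 0) by ring; rewrite Cpower_0; field; exact Hw.
  + apply (Clim_scal (F := at_zero)), (Clim_Cexp (F := at_zero)), (Clim_scal (F := at_zero)), (Clim_RtoC (F := at_zero)).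
    intros P [d Hd]; exists d; intros y Hy _; now apply Hd.
  + destruct (exp_power_bound 1 eps He) as [M HM].
    apply (Clim_0_bound (F := at_inf) _ (fun t => Cmod (- / w) * M * Rpower t (-1))%R).
    * generalize (at_inf_gt 1); apply filter_imp; intros t Ht.
      rewrite Cmod_mult, Cmod_Cexp, Rmult_assoc.
      replace (Re (- w * RtoC t)) with (- (eps * t))%R by (simpl; ring).
      apply Rmult_le_compat_l; [apply Cmod_ge_0|].
      apply Rle_trans with ((Rpower t 1 * exp (- (eps * t))) * Rpower t (-1))%R.
      -- rewrite Rpower_1 by lra. replace (-1)%R with (- (1))%R by ring. rewrite Rpower_Ropp, Rpower_1 by lra.
         right; field; lra.
      -- apply Rmult_le_compat_r; [left; apply exp_pos|apply HM; lra].
    * eapply Rlim_eq; [apply Rlim_const_mult; [typeclasses eauto|]; apply Rpower_lim_inf; lra|ring].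
- rewrite Cmult_0_r, Cexp_0; field; exact Hw.
Qed.

Lemma laplace_fp_0_exists eps x : (0 < eps)%R ->
  exists v, is_fp (laplace_kernel 0 (eps, x)) (fun t => RtoC (ln t)) v.
Proof.
intros He; set (w := (eps, x) : C).
destruct (laplace_kernel_inf 0 w He) as [M HM].
apply (is_fp_exists _ _ (fun t => RtoC (/ t)) (Rmax (Cmod (- w)) M) 0 (-2)); try lra.
- intros; now apply Cder_laplace_kernel.
- intros t Ht; apply Cder_RtoC, is_derive_Reals, derivable_pt_lim_ln, Ht.
- intros t Ht; rewrite Rpower_O, Rmult_1_r by lra.
  eapply Rle_trans; [|apply Rmax_l].
  replace (laplace_kernel 0 w t - RtoC (/ t)) with (RtoC (/ t) * exp_rem (- w) 1 t).
  2:{ unfold laplace_kernel; rewrite Cpower_pred, Cpower_0 by lra; simpl.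
      rewrite RtoC_inv by lra; field. intros E; apply RtoC_inj in E; lra. }
  rewrite Cmod_mult, Cmod_R, Rabs_pos_eq by (left; apply Rinv_0_lt_compat; lra).
  apply Rmult_le_reg_l with t; [lra|]; rewrite <- Rmult_assoc, Rinv_r, Rmult_1_l by lra.
  eapply Rle_trans; [apply exp_rem_le; [simpl; lra|lra]|]. simpl; lra.
- intros t Ht; eapply Rle_trans; [now apply HM|].
  apply Rmult_le_compat_r; [left; apply exp_pos|apply Rmax_r].
Qed.

(** As in [laplace_value]: the derivative of the value in [x] is [- i / w], that of [- Log w], and at
    [x = 0] the change of scale moves [ln t] by [ln eps]. *)
Lemma laplace_fp_0 eps x : (0 < eps)%R ->
  is_fp (laplace_kernel 0 (eps, x)) (fun t => RtoC (ln t)) (- RtoC euler_gamma - Clog eps x).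
Proof.
intros He.
set (V := fun y => iota (T := C_R_CompleteNormedModule)
  (fun v => is_fp (laplace_kernel 0 (eps, y)) (fun t => RtoC (ln t)) v) : C).
assert (HV : forall y, is_fp (laplace_kernel 0 (eps, y)) (fun t => RtoC (ln t)) (V y)).
{ intros y; unfold V; apply (iota_correct (V := C_R_CompleteNormedModule)
   (fun v => is_fp (laplace_kernel 0 (eps, y)) (fun t => RtoC (ln t)) v)).
  destruct (laplace_fp_0_exists eps y He) as [v Hv]; exists v; split; [exact Hv|].
  intros v' Hv'; eapply is_fp_unique; eassumption. }
assert (D : forall y, Cder (fun y => V y + Clog eps y) y 0).
{ intros y; eapply Cder_eq.
  - apply Cder_plus; [|apply Cder_Clog, He].
    apply (Cder_laplace 0 eps (fun t => RtoC (ln t)) V (1 / (eps, y)) y He); [simpl; lra|exact HV|].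
    replace (0 + 1) with (RtoC 1) by ring. now apply is_cint_exponential.
  - field; now apply w_neq0. }
pose proof (Cder_0_everywhere _ D x) as E; cbv beta in E.
rewrite Clog_0 in E by exact He.
assert (E0 : V 0%R + RtoC (ln eps) = RtoC (- euler_gamma)).
{ apply exponential_integral_gamma.
  assert (Hie : (0 < / eps)%R) by now apply Rinv_0_lt_compat.
  pose proof (is_fp_scaling (/ eps) _ _ _ Hie (HV 0%R)) as S1.
  apply (is_fp_ext _ (laplace_kernel 0 1)) in S1.
  - apply (is_fp_eq _ _ (V 0%R - - RtoC (ln eps))); [|ring].
    apply (is_fp_shift _ _ _ _ _ S1).
    eapply Clim_ext_loc; [|apply Clim_const].
    generalize at_zero_pos; apply filter_imp; intros t Ht; cbv beta.
    rewrite ln_mult, ln_Rinv, RtoC_plus, RtoC_opp by assumption; ring.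
  - intros t Ht; unfold laplace_kernel.
    assert (Hit : (0 < / eps * t)%R) by now apply Rmult_lt_0_compat.
    rewrite !Cpower_pred, !Cpower_0 by assumption.
    replace (- (eps, 0%R) * RtoC (/ eps * t)) with (- (1) * RtoC t) by (apply C_eq; simpl; field; lra).
    rewrite RtoC_mult, RtoC_inv by lra; Cfield.
    split; intros Z; apply RtoC_inj in Z; lra. }
eapply is_fp_eq; [apply HV|].
rewrite RtoC_opp in E0; rewrite <- E0, <- E; ring.
Qed.

Lemma harmonic_S k : harmonic (S k) = (harmonic k + / INR (S k))%R.
Proof. unfold harmonic; rewrite sum_n_Sm by lia; reflexivity. Qed.

Lemma harmonic_0 : harmonic 0 = 0%R.
Proof. unfold harmonic; now rewrite sum_n_m_zero by lia. Qed.

(** By induction on [k] through [laplace_fp_step]: the boundary term of each integration by parts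
    contributes one term of the harmonic sum. *)
Lemma laplace_fp_pole k eps x : (0 < eps)%R ->
  laplace_fp (RtoC (- INR k)) (eps, x)
    ((- (eps, x)) ^ k / RtoC (INR (fact k)) * (- RtoC euler_gamma + RtoC (harmonic k) - Clog eps x)).
Proof.
intros He; induction k as [|k IH].
- exists 0%nat; split; [simpl; lra|].
  replace (RtoC (- INR 0)) with (RtoC 0) by (simpl; f_equal; ring).
  eapply is_fp_eq; [eapply is_fp_0_shift; [apply laplace_fp_0, He|]|].
  + intros t Ht; unfold laplace_poles; rewrite sum_O; simpl.
    rewrite Cplus_0_r; unfold power_primitive; destruct (Ceq_dec 0 0) as [_|N]; [field|easy].
  + rewrite harmonic_0; simpl; field.
- set (w := (eps, x) : C) in *.
  assert (Hs : RtoC (- INR (S k)) + 1 = RtoC (- INR k)) by (rewrite S_INR, <- RtoC_plus; f_equal; ring).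
  rewrite <- Hs in IH.
  apply (laplace_fp_step _ _ _ ((- w) ^ S k / RtoC (INR (fact (S k))))) in IH.
  + match goal with |- laplace_fp _ _ ?a => match type of IH with laplace_fp _ _ ?b => replace a with b end end; [exact IH|].
    rewrite harmonic_S, RtoC_plus, RtoC_inv, RtoC_opp, fact_S_C by (apply not_0_INR; lia).
    simpl Cpow. field. split; [apply INR_S_C|apply INR_fact_C].
  + intros E; apply RtoC_inj in E; apply (not_0_INR (S k)); [lia|lra].
  + exact He.
  + right; exists (S k); split; reflexivity.
Qed.

(** It vanishes unless [s] is a pole [- k] of [Gamma], and then equals [(-w)^k / k!], the factor in
    front of [- Log w] in [laplace_fp_pole]. *)
Definition log_coef (s w : C) (B : nat) : C :=
  sum_n (fun m => if Ceq_dec (s + RtoC (INR m)) 0 then (- w) ^ m / RtoC (INR (fact m)) else RtoC 0) B.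

Lemma pole_dec s : (exists k : nat, s = RtoC (- INR k)) \/ (forall k : nat, s <> RtoC (- INR k)).
Proof.
destruct (Ceq_dec s (RtoC (- INR (Z.to_nat (Int_part (- Re s)))))) as [E|N].
- left; eexists; exact E.
- right; intros k ->; apply N; simpl Re.
  now rewrite Ropp_involutive, Int_part_INR, Nat2Z.id.
Qed.

(** At a pole [s = - k] one has [w^(-s) = w^k], and [Gamma_star (- k)] is the finite part at
    [w = 1]: the regular case and the poles follow one formula. *)
Lemma laplace_fp_value s eps x B : (0 < eps)%R -> (0 <= INR B + Re s)%R ->
  laplace_fp s (eps, x) (Cexp (- s * Clog eps x) * Gamma_star s - log_coef s (eps, x) B * Clog eps x).
Proof.
intros He HB; destruct (pole_dec s) as [[k ->]|N].
- rewrite Gamma_star_opp_nat; unfold log_coef.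
  rewrite (sum_n_C_single _ _ k).
  + destruct (Ceq_dec _ 0) as [_|N]; [|destruct N; rewrite RtoC_opp; ring].
    match goal with |- laplace_fp _ _ ?a => replace a with
     ((- (eps, x)) ^ k / RtoC (INR (fact k)) * (- RtoC euler_gamma + RtoC (harmonic k) - Clog eps x)) end;
     [now apply laplace_fp_pole|].
    unfold Gamma_star_pole; replace (- RtoC (- INR k)) with (RtoC (INR k)) by (rewrite RtoC_opp; ring).
    rewrite <- Cexp_pow, Cexp_Clog by exact He.
    unfold Rdiv; rewrite !RtoC_mult, RtoC_plus, RtoC_opp, RtoC_inv, RtoC_pow by apply INR_fact_neq_0.
    replace (- (eps, x)) with ((- (1)) * (eps, x)) by ring.
    rewrite Cpow_mult_l. replace (RtoC (-1)) with (- (1)) by (apply C_eq; simpl; lra). Cfield. apply INR_fact_C.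
  + apply INR_le; simpl in HB; lra.
  + intros m _ Hm; destruct (Ceq_dec _ 0) as [E|_]; [|reflexivity].
    destruct Hm; rewrite <- RtoC_plus in E; apply RtoC_inj in E; apply INR_eq; lra.
- unfold log_coef; rewrite sum_n_C_zero.
  + replace (Cexp (- s * Clog eps x) * Gamma_star s - 0 * Clog eps x) with (Cexp (- s * Clog eps x) * Gamma_star s) by ring.
    now apply laplace_fp_regular.
  + intros m _; destruct (Ceq_dec _ 0) as [E|_]; [|reflexivity].
    destruct (N m); rewrite RtoC_opp; replace s with (s + RtoC (INR m) - RtoC (INR m)) by ring; rewrite E; ring.
Qed.

(** * Decomposition of the Hadamard finite part *)

Lemma Cder_sum_n (u v : nat -> R -> C) N t : (forall n, (n <= N)%nat -> Cder (u n) t (v n t)) ->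
  Cder (fun t => sum_n (fun n => u n t) N) t (sum_n (fun n => v n t) N).
Proof.
induction N as [|N IH]; intros H.
- rewrite sum_O; apply (Cder_ext (u 0%nat)); [intros; now rewrite sum_O|apply H; lia].
- rewrite sum_Sn; apply (Cder_ext (fun t => sum_n (fun n => u n t) N + u (S N) t)); [intros; now rewrite sum_Sn|].
  apply Cder_plus; [apply IH; intros; apply H; lia|apply H; lia].
Qed.

Lemma Clim_sum_n F {FF : ProperFilter F} (u : nat -> R -> C) (l : nat -> C) N :
  (forall n, (n <= N)%nat -> Clim (u n) F (l n)) ->
  Clim (fun t => sum_n (fun n => u n t) N) F (sum_n l N).
Proof.
induction N as [|N IH]; intros H.
- rewrite sum_O; eapply Clim_ext_loc; [|apply (H 0%nat); lia].
  apply filter_forall; intros; now rewrite sum_O.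
- rewrite sum_Sn; eapply Clim_ext_loc; [|apply Clim_plus; [apply IH; intros; apply H; lia|apply (H (S N)); lia]].
  apply filter_forall; intros; now rewrite sum_Sn.
Qed.

Lemma sum_n_extend (u : nat -> C) B N : (B <= N)%nat -> (forall n, (B < n <= N)%nat -> u n = RtoC 0) ->
  sum_n u N = sum_n u B.
Proof.
induction 1 as [|N L IH]; intros H; [reflexivity|].
rewrite sum_Sn, IH, (H (S N)) by (intros; try apply H; lia). Cring.
Qed.

Lemma pair_sum_extend B N P (P_dec : forall n m, {P n m} + {~ P n m}) f : (B <= N)%nat ->
  (forall n m, P n m -> (n <= B)%nat /\ (m <= B)%nat) ->
  pair_sum B P_dec f = pair_sum N P_dec f.
Proof.
intros HBN HP; unfold pair_sum; symmetry; rewrite (sum_n_extend _ B N HBN).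
- apply sum_n_ext; intros n; apply sum_n_extend; [exact HBN|].
  intros m Hm; destruct (P_dec n m) as [p|]; [apply HP in p; lia|reflexivity].
- intros n Hn; apply sum_n_C_zero; intros m Hm.
  destruct (P_dec n m) as [p|]; [apply HP in p; lia|reflexivity].
Qed.

Lemma pair_sum_ext B P (P_dec : forall n m, {P n m} + {~ P n m}) f g :
  (forall n m, P n m -> f n m = g n m) -> pair_sum B P_dec f = pair_sum B P_dec g.
Proof.
intros E; unfold pair_sum; apply sum_n_ext; intros n; apply sum_n_ext; intros m.
destruct (P_dec n m); auto.
Qed.

Lemma pair_sum_scal c B P (P_dec : forall n m, {P n m} + {~ P n m}) f :
  c * pair_sum B P_dec f = pair_sum B P_dec (fun n m => c * f n m).
Proof.
unfold pair_sum; rewrite <- sum_n_C_scal; apply sum_n_ext; intros n.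
rewrite <- sum_n_C_scal; apply sum_n_ext; intros m.
destruct (P_dec n m); [reflexivity|Cring].
Qed.

(** A primitive of the terms subtracted on [(0, 1)] in the definition of the finite part. *)
Definition fp_poles alpha beta z (t : R) : C :=
  pair_sum (pair_bound beta) (pair_le_dec alpha beta)
    (fun n m => phase_coef z n m * power_primitive (pair_exponent alpha beta n m) t).

Lemma Cder_fp_poles alpha beta z t : (0 < t)%R -> Cder (fp_poles alpha beta z) t
  (Cpower t beta * pair_sum (pair_bound beta) (pair_le_dec alpha beta)
     (fun n m => phase_coef z n m * RtoC (Rpower t (INR n * alpha + INR m)))).
Proof.
intros Ht; rewrite pair_sum_scal; unfold fp_poles, pair_sum.
set (B := pair_bound beta).
apply (Cder_sum_n (fun n t => sum_n (fun m => if pair_le_dec alpha beta n m then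
   phase_coef z n m * power_primitive (pair_exponent alpha beta n m) t else RtoC 0) B)
   (fun n t => sum_n (fun m => if pair_le_dec alpha beta n m then
   Cpower t beta * (phase_coef z n m * RtoC (Rpower t (INR n * alpha + INR m))) else RtoC 0) B)).
intros n _; apply (Cder_sum_n (fun m t => if pair_le_dec alpha beta n m then
   phase_coef z n m * power_primitive (pair_exponent alpha beta n m) t else RtoC 0)
   (fun m t => if pair_le_dec alpha beta n m then
   Cpower t beta * (phase_coef z n m * RtoC (Rpower t (INR n * alpha + INR m))) else RtoC 0)).
intros m _; destruct (pair_le_dec alpha beta n m); [|apply Cder_const].
eapply Cder_eq; [apply Cder_scal, Cder_power_primitive, Ht|].
unfold pair_exponent; replace (beta + RtoC (INR n * alpha) + RtoC (INR m) + 1 - 1) with (beta + RtoC (INR n * alpha + INR m))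
  by (rewrite RtoC_plus; ring).
rewrite Cpower_plus, Cpower_RtoC; ring.
Qed.

Lemma Cder_phase alpha beta z t : (0 < t)%R -> exists l, Cder (fun t => Cpower t beta * phase_exp alpha z t) t l.
Proof.
intros Ht; eexists; apply Cder_mult; [apply Cder_Cpower, Ht|].
unfold phase_exp; apply Cder_Cexp, Cder_minus; [apply Cder_scal, Cder_Rpower, Ht|apply Cder_scal, Cder_id].
Qed.

Lemma at_point_lim (f : R -> C) a : Clim f (at_point a) (f a).
Proof. split; intros P HP; exact (locally_singleton _ P HP). Qed.

(** If [H] is a primitive of the integrand, the integrals over [(1, oo)] and [(0, 1)] are increments
    of [H] and of [H - fp_poles]; the last sum of the definition is the value of [fp_poles] at [1],
    where the logarithms of the omitted terms vanish. *)
Lemma F_finite_part_is_fp alpha beta z v :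
  is_fp (fun t => Cpower t beta * phase_exp alpha z t) (fp_poles alpha beta z) v ->
  F_finite_part alpha beta z = v.
Proof.
intros [H [l0 [l1 [HH [H0 [H1 ->]]]]]]; unfold F_finite_part.
rewrite (CInt_primitive H _ (at_point 1%R) at_inf (H 1%R) l1); auto.
2: unfold at_point; lra.
2: apply (at_inf_gt 0).
2: intros; now apply Cder_phase.
2: apply at_point_lim.
rewrite (CInt_primitive (fun t => H t - fp_poles alpha beta z t) _ at_zero (at_point 1%R) l0 (H 1%R - fp_poles alpha beta z 1%R)); auto.
2: apply at_zero_pos.
2: unfold at_point; lra.
2:{ intros t Ht; eapply Cder_eq; [apply Cder_minus; [now apply HH|now apply Cder_fp_poles]|ring]. }
2:{ intros t Ht; eexists; apply Cder_mult; [apply Cder_Cpower, Ht|].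
    apply Cder_minus.
    - unfold phase_exp; apply Cder_Cexp, Cder_minus; [apply Cder_scal, Cder_Rpower, Ht|apply Cder_scal, Cder_id].
    - unfold pair_sum.
      apply (Cder_sum_n (fun n t => sum_n (fun m => if pair_le_dec alpha beta n m then
        phase_coef z n m * RtoC (Rpower t (INR n * alpha + INR m)) else RtoC 0) (pair_bound beta))
       (fun n t => sum_n (fun m => if pair_le_dec alpha beta n m then
        phase_coef z n m * RtoC ((INR n * alpha + INR m) * Rpower t (INR n * alpha + INR m - 1)) else RtoC 0) (pair_bound beta))).
      intros n _; apply (Cder_sum_n (fun m t => if pair_le_dec alpha beta n m then
        phase_coef z n m * RtoC (Rpower t (INR n * alpha + INR m)) else RtoC 0)
       (fun m t => if pair_le_dec alpha beta n m then
        phase_coef z n m * RtoC ((INR n * alpha + INR m) * Rpower t (INR n * alpha + INR m - 1)) else RtoC 0)).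
      intros m _; destruct (pair_le_dec alpha beta n m); [|apply Cder_const].
      apply Cder_scal, Cder_Rpower, Ht. }
2:{ apply (at_point_lim (fun t => H t - fp_poles alpha beta z t)). }
replace (pair_sum (pair_bound beta) (pair_le_dec alpha beta)
      (fun n m => if pair_eq_dec alpha beta n m then RtoC 0
                  else phase_coef z n m * (1 / pair_exponent alpha beta n m))) with (fp_poles alpha beta z 1%R).
- ring.
- apply pair_sum_ext; intros n m _; unfold power_primitive.
  unfold pair_eq_dec; destruct (Ceq_dec _ 0) as [E|N].
  + rewrite ln_1; ring.
  + do 2 f_equal; unfold Cpower; rewrite ln_1, Cmult_0_r; apply Cexp_0.
Qed.

Definition rem_integrand alpha beta (w : C) N (t : R) : C :=
  Cpower t beta * expi_rem N (Rpower t alpha) * Cexp (- w * RtoC t).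

Definition pole_exponent (alpha : R) (beta : C) (n : nat) : C := beta + RtoC (INR n * alpha) + 1.

Lemma Rpower_le_1 t p : (0 < t <= 1)%R -> (0 <= p)%R -> (Rpower t p <= 1)%R.
Proof.
intros Ht Hp; replace 1%R with (Rpower 1 p); [now apply Rle_Rpower_l|].
unfold Rpower; rewrite ln_1, Rmult_0_r; apply exp_0.
Qed.

Lemma rem_integrand_exists alpha beta w N : (1 < alpha)%R -> (0 < Re w)%R ->
  (Re beta + alpha * INR (S N) > -1)%R ->
  (forall t, (0 < t)%R -> exists l, Cder (rem_integrand alpha beta w (S N)) t l) /\
  exists v, is_cint (rem_integrand alpha beta w (S N)) v.
Proof.
intros Hal Hw HN.
assert (Hd : forall t, (0 < t)%R -> exists l, Cder (rem_integrand alpha beta w (S N)) t l).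
{ intros t Ht; eexists; apply Cder_mult; [|apply Cder_Cexp, Cder_scal, Cder_id].
  apply Cder_mult; [apply Cder_Cpower, Ht|].
  apply (Cder_comp (expi_rem (S N)) (fun t => Rpower t alpha)); [apply Cder_expi_rem|now apply is_derive_Rpower_pos]. }
split; [exact Hd|].
set (p := (Re beta + alpha * INR (S N))%R) in *.
assert (Hb : forall t, (0 < t)%R -> (Cmod (rem_integrand alpha beta w (S N) t) <= Rpower t p * exp (- (Re w * t)))%R).
{ intros t Ht; unfold rem_integrand; rewrite !Cmod_mult, Cmod_Cpower, Cmod_Cexp.
  replace (Re (- w * RtoC t)) with (- (Re w * t))%R by (simpl; unfold Re; simpl; ring).
  apply Rmult_le_compat_r; [left; apply exp_pos|].
  unfold p; rewrite Rpower_plus, <- Rpower_pow_mult; apply Rmult_le_compat_l; [left; apply exp_pos|].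
  apply expi_rem_le; left; apply exp_pos. }
destruct (exp_power_bound (p + 2) (Re w) Hw) as [M HM].
apply (is_cint_exists _ (Rmax 1 M) p (-2)); auto; try lra.
- intros t Ht; eapply Rle_trans; [apply Hb; lra|]; rewrite Rmult_comm.
  apply Rmult_le_compat_r; [left; apply exp_pos|].
  eapply Rle_trans; [|apply Rmax_l].
  rewrite <- exp_0; left; apply exp_increasing; nra.
- intros t Ht; eapply Rle_trans; [apply Hb; lra|].
  replace p with (p + 2 + -2)%R by ring; rewrite Rpower_plus.
  replace (Rpower t (p + 2) * Rpower t (-2) * exp (- (Re w * t)))%R with
    ((Rpower t (p + 2) * exp (- (Re w * t))) * Rpower t (-2))%R by ring.
  apply Rmult_le_compat_r; [left; apply exp_pos|].
  eapply Rle_trans; [now apply HM|apply Rmax_r].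
Qed.

(** The Taylor polynomial of [e^(i t^alpha)] is integrated term by term.  Its poles and those of the
    definition differ by powers with exponents of positive real part, which vanish at [0]. *)
Lemma F_finite_part_decomposition alpha beta eps x N (P : nat -> C) J : (1 < alpha)%R -> (0 < eps)%R ->
  (pair_bound beta <= N)%nat -> (0 < INR N + 2 + Re beta)%R ->
  (forall n, (n <= N)%nat -> laplace_fp (pole_exponent alpha beta n) (eps, x) (P n)) ->
  is_cint (rem_integrand alpha beta (eps, x) (S N)) J ->
  F_finite_part alpha beta (x, (- eps)%R) =
    sum_n (fun n => Ci ^ n / RtoC (INR (fact n)) * P n) N + J.
Proof.
intros Hal He HB HN HP HJ; apply F_finite_part_is_fp.
set (z := (x, (- eps)%R) : C); set (w := (eps, x) : C).
assert (Ew : - Ci * z = - w) by (apply C_eq; simpl; ring).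
assert (Hfp : is_fp (fun t => sum_n (fun n => Ci ^ n / RtoC (INR (fact n)) * laplace_kernel (pole_exponent alpha beta n) w t) N
    + rem_integrand alpha beta w (S N) t)
  (fun t => sum_n (fun n => Ci ^ n / RtoC (INR (fact n)) * laplace_poles (pole_exponent alpha beta n) w N t) N + 0)
  (sum_n (fun n => Ci ^ n / RtoC (INR (fact n)) * P n) N + J)).
{ apply is_fp_plus; [|exact HJ].
  apply (is_fp_sum (fun n t => Ci ^ n / RtoC (INR (fact n)) * laplace_kernel (pole_exponent alpha beta n) w t)
    (fun n t => Ci ^ n / RtoC (INR (fact n)) * laplace_poles (pole_exponent alpha beta n) w N t)).
  intros n Hn; apply is_fp_scal, laplace_fp_is_fp; [now apply HP|].
  unfold pole_exponent; simpl. pose proof (pos_INR n); unfold Re in *; simpl in *; nra. }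
apply (is_fp_Q _ (fun t => sum_n (fun n => Ci ^ n / RtoC (INR (fact n)) * laplace_poles (pole_exponent alpha beta n) w N t) N + 0)).
- apply (is_fp_ext _ (fun t => Cpower t beta * phase_exp alpha z t)) in Hfp; [exact Hfp|].
  intros t Ht; unfold rem_integrand.
  rewrite exp_rem_sum.
  assert (E : sum_n (fun n => Ci ^ n / RtoC (INR (fact n)) * laplace_kernel (pole_exponent alpha beta n) w t) N =
    Cpower t beta * Cexp (- w * RtoC t) * sum_n (fun n => (Ci * RtoC (Rpower t alpha)) ^ n / RtoC (INR (fact n))) N).
  { rewrite <- sum_n_C_scal; apply sum_n_ext; intros n.
    unfold laplace_kernel, pole_exponent.
    replace (beta + RtoC (INR n * alpha) + 1 - 1) with (beta + RtoC (INR n * alpha)) by ring.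
    rewrite Cpower_plus, Cpower_RtoC, Cpow_mult_l, <- RtoC_pow, Rpower_pow_mult, (Rmult_comm alpha).
    unfold Cdiv; Cring. }
  rewrite E; unfold phase_exp.
  replace (Ci * RtoC (Rpower t alpha) - Ci * z * RtoC t) with (Ci * RtoC (Rpower t alpha) + - w * RtoC t)
    by (rewrite <- Ew; ring).
  rewrite Cexp_plus; Cring.
- assert (Hsum : forall t, sum_n (fun n => Ci ^ n / RtoC (INR (fact n)) * laplace_poles (pole_exponent alpha beta n) w N t) N + 0 -
    fp_poles alpha beta z t = sum_n (fun n => sum_n (fun m => if pair_le_dec alpha beta n m then RtoC 0 else
       phase_coef z n m * power_primitive (pair_exponent alpha beta n m) t) N) N).
  { intros t; unfold fp_poles.
    rewrite (pair_sum_extend _ N _ (pair_le_dec alpha beta) _ HB) by (intros n m; now apply pair_bound_le).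
    unfold pair_sum.
    assert (Aux : forall a b c : C, a = b + c -> a + 0 - b = c) by (intros a b c ->; ring).
    apply Aux.
    rewrite <- sum_n_C_plus; apply sum_n_ext; intros n.
    unfold laplace_poles; rewrite <- sum_n_C_plus, <- sum_n_C_scal; apply sum_n_ext; intros m.
    assert (T : Ci ^ n / RtoC (INR (fact n)) * ((- w) ^ m / RtoC (INR (fact m)) *
       power_primitive (pole_exponent alpha beta n + RtoC (INR m)) t) =
       phase_coef z n m * power_primitive (pair_exponent alpha beta n m) t).
    { unfold phase_coef; rewrite Ew.
      replace (pair_exponent alpha beta n m) with (pole_exponent alpha beta n + RtoC (INR m))
        by (unfold pair_exponent, pole_exponent; ring).
      field; split; apply INR_fact_C. }
    rewrite T; destruct (pair_le_dec alpha beta n m); Cring. }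
  eapply Clim_ext_loc; [apply filter_forall; intros t; symmetry; apply Hsum|].
  eapply Clim_eq.
  + apply (Clim_sum_n at_zero (fun n t => sum_n (fun m => if pair_le_dec alpha beta n m then RtoC 0 else
       phase_coef z n m * power_primitive (pair_exponent alpha beta n m) t) N) (fun _ => RtoC 0)).
    intros n _; eapply Clim_eq.
    * apply (Clim_sum_n at_zero (fun m t => if pair_le_dec alpha beta n m then RtoC 0 else
       phase_coef z n m * power_primitive (pair_exponent alpha beta n m) t) (fun _ => RtoC 0)).
      intros m _; destruct (pair_le_dec alpha beta n m) as [_|L]; [apply Clim_const|].
      eapply Clim_eq; [apply Clim_scal, power_primitive_lim_zero|ring].
      unfold pair_le in L; unfold pair_exponent; simpl; unfold Re in *; simpl in *; lra.
    * now apply sum_n_C_zero.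
  + now apply sum_n_C_zero.
Qed.

(** ** The limit on the real axis *)

Lemma Clim_Clog x : (0 < x)%R -> Clim (fun eps => Clog eps x) at_zero (ln x, (PI / 2)%R).
Proof.
intros Hx.
assert (T : forall g : R -> R, continuous g 0%R -> filterlim g at_zero (locally (g 0%R))).
{ intros g Hg P HP; destruct (Hg P HP) as [d Hd]; exists d; intros u Hu _; now apply Hd. }
split; simpl.
- eapply Rlim_eq; [apply (T (fun eps => / 2 * ln (eps * (eps * 1) + x * (x * 1)))%R)|].
  + apply @ex_derive_continuous; auto_derive; nra.
  + replace (0 * (0 * 1) + x * (x * 1))%R with (x * x)%R by ring; rewrite ln_mult by exact Hx; lra.
- apply (filterlim_ext_loc (fun eps => PI / 2 - atan (eps / x))%R).
  + generalize at_zero_pos; apply filter_imp; intros eps He.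
    assert (Hd : (0 < eps / x)%R) by now apply Rdiv_lt_0_compat.
    replace (x / eps)%R with (/ (eps / x))%R by (field; lra).
    rewrite atan_inv by exact Hd; reflexivity.
  + eapply Rlim_eq; [apply (T (fun eps => PI / 2 - atan (eps / x))%R)|].
    * apply (continuous_minus (V := R_NormedModule) (fun _ => PI / 2)%R (fun eps => atan (eps / x))); [apply continuous_const|].
      apply (continuous_comp (fun eps => eps / x)%R atan).
      -- apply @ex_derive_continuous; auto_derive; lra.
      -- apply continuity_pt_filterlim, derivable_continuous_pt, derivable_pt_atan.
    * unfold Rdiv; rewrite Rmult_0_l, atan_0; ring.
Qed.

(** * Functions of class [C^J] *)

(** As for [sym], the derivatives are carried as witnesses; finite orders are enough, because only
    finitely many integrations by parts are performed for a given precision. *)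
Fixpoint Ck (J : nat) (D : R -> Prop) (f : R -> C) : Prop :=
  match J with
  | O => forall s, D s -> continuous (fun x => Re (f x)) s /\ continuous (fun x => Im (f x)) s
  | S J' => exists f', (forall s, D s -> Cder f s (f' s)) /\ Ck J' D f'
  end.

Definition open_dom (D : R -> Prop) := forall s, D s -> locally s D.

Lemma Cder_Ck0 (D : R -> Prop) f f' : (forall s, D s -> Cder f s (f' s)) -> Ck 0 D f.
Proof.
intros H s Hs; split; [eapply Cder_cont_Re|eapply Cder_cont_Im]; now apply H.
Qed.

Lemma Ck_down J D f : Ck (S J) D f -> Ck J D f.
Proof.
revert f; induction J as [|J IH]; intros f [f' [Hd Hf']].
- eapply Cder_Ck0, Hd.
- exists f'; split; auto.
Qed.

Lemma Ck_le_order J' J D f : (J' <= J)%nat -> Ck J D f -> Ck J' D f.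
Proof. induction 1; auto; intros; apply IHle; now apply Ck_down. Qed.

Lemma Ck_sub J (D D' : R -> Prop) f : (forall s, D' s -> D s) -> Ck J D f -> Ck J D' f.
Proof.
intros HD; revert f; induction J as [|J IH]; intros f H; simpl in *; [auto|].
destruct H as [f' [Hd H]]; exists f'; auto.
Qed.

Lemma Ck_ext J D f g : open_dom D -> (forall s, D s -> f s = g s) -> Ck J D f -> Ck J D g.
Proof.
intros HD E; destruct J as [|J].
- intros H s Hs; destruct (H s Hs) as [H1 H2]; specialize (HD s Hs); split.
  + apply (continuous_ext_loc _ (fun x => Re (f x))); [|exact H1].
    revert HD; apply filter_imp; intros x Hx; now rewrite E.
  + apply (continuous_ext_loc _ (fun x => Im (f x))); [|exact H2].
    revert HD; apply filter_imp; intros x Hx; now rewrite E.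
- intros [f' [Hd H]]; exists f'; split; auto; intros s Hs.
  apply (Cder_ext_loc f); auto. specialize (HD s Hs); revert HD; apply filter_imp; exact E.
Qed.

Lemma Ck_const J D c : Ck J D (fun _ => c).
Proof.
revert c; induction J as [|J IH]; intros c.
- intros s _; split; apply continuous_const.
- exists (fun _ => 0); split; [intros; apply Cder_const|apply IH].
Qed.

Lemma Ck_id J D : Ck J D (fun x => RtoC x).
Proof.
destruct J as [|J].
- apply (Cder_Ck0 _ _ (fun _ => 1)); intros; apply Cder_id.
- exists (fun _ => 1); split; [intros; apply Cder_id|apply Ck_const].
Qed.

Lemma Ck_plus J D f g : Ck J D f -> Ck J D g -> Ck J D (fun s => f s + g s).
Proof.
revert f g; induction J as [|J IH]; intros f g F G.
- intros s Hs; destruct (F s Hs), (G s Hs); split; simpl.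
  + now apply (continuous_plus (V := R_NormedModule) (fun x => Re (f x)) (fun x => Re (g x))).
  + now apply (continuous_plus (V := R_NormedModule) (fun x => Im (f x)) (fun x => Im (g x))).
- destruct F as [f' [Fd F]], G as [g' [Gd G]]; exists (fun s => f' s + g' s); split; auto.
  intros; apply Cder_plus; auto.
Qed.

Lemma Ck_mult J D f g : Ck J D f -> Ck J D g -> Ck J D (fun s => f s * g s).
Proof.
revert f g; induction J as [|J IH]; intros f g F G.
- intros s Hs; destruct (F s Hs), (G s Hs); split; simpl.
  + apply (continuous_minus (V := R_NormedModule) (fun x => Re (f x) * Re (g x))%R (fun x => Im (f x) * Im (g x))%R);
    apply (continuous_mult (K := R_AbsRing)); assumption.
  + apply (continuous_plus (V := R_NormedModule) (fun x => Re (f x) * Im (g x))%R (fun x => Im (f x) * Re (g x))%R);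
    apply (continuous_mult (K := R_AbsRing)); assumption.
- pose proof (Ck_down _ _ _ F); pose proof (Ck_down _ _ _ G).
  destruct F as [f' [Fd F]], G as [g' [Gd G]]; exists (fun s => f' s * g s + f s * g' s); split.
  + intros; apply Cder_mult; auto.
  + apply Ck_plus; auto.
Qed.

Lemma Ck_scal J D c f : Ck J D f -> Ck J D (fun s => c * f s).
Proof. apply Ck_mult, Ck_const. Qed.

(** The loss of one derivative spares the case of merely continuous functions. *)
Lemma Ck_inv J D (f : R -> C) : (forall s, D s -> f s <> 0) -> Ck (S J) D f -> Ck J D (fun s => / f s).
Proof.
intros Hn; revert J; fix IH 1; intros J; destruct J as [|J]; intros F.
- destruct F as [f' [Fd _]]; apply (Cder_Ck0 _ _ (fun s => - (f' s * (/ f s * / f s)))).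
  intros; apply Cder_inv; auto.
- pose proof (IH J (Ck_down _ _ _ F)) as I.
  destruct F as [f' [Fd F]].
  exists (fun s => - (1) * (f' s * (/ f s * / f s))); split.
  + intros; eapply Cder_eq; [apply Cder_inv; auto|ring].
  + apply Ck_scal, Ck_mult; [now apply Ck_down|now apply Ck_mult].
Qed.

Lemma Ck_Cpower J b : Ck J (fun s => 0 < s)%R (fun s => Cpower s b).
Proof.
revert b; induction J as [|J IH]; intros b.
- apply (Cder_Ck0 _ _ (fun s => b * Cpower s (b - 1))); intros; now apply Cder_Cpower.
- exists (fun s => b * Cpower s (b - 1)); split; [intros; now apply Cder_Cpower|now apply Ck_scal].
Qed.

Lemma Ck_comp J (D D' : R -> Prop) (f : R -> C) (g : R -> R) : open_dom D -> (forall s, D s -> D' (g s)) ->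
  Ck J D' f -> Ck J D (fun s => RtoC (g s)) -> Ck J D (fun s => f (g s)).
Proof.
intros Ho HD; revert f; induction J as [|J IH]; intros f F G.
- intros s Hs; destruct (F _ (HD s Hs)) as [F1 F2]; destruct (G s Hs) as [G1 _]; split;
    [apply (continuous_comp g (fun x => Re (f x)))|apply (continuous_comp g (fun x => Im (f x)))]; assumption.
- pose proof (Ck_down _ _ _ G) as G0.
  destruct F as [f' [Fd F]], G as [g' [Gd G]].
  exists (fun s => g' s * f' (g s)); split; [|apply Ck_mult; auto].
  intros s Hs; destruct (Gd s Hs) as [G1 G2]; simpl in G1, G2.
  assert (E : g' s = RtoC (Re (g' s))).
  { apply C_eq; [reflexivity|]; rewrite <- (is_derive_unique _ _ _ G2); apply Derive_const. }
  rewrite E; now apply Cder_comp; [apply Fd, HD|].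
Qed.

Lemma open_dom_interval a b : open_dom (fun s => a < s < b)%R.
Proof. intros s [H1 H2]; apply filter_and; [now apply (open_gt a)|now apply (open_lt b)]. Qed.

Lemma open_dom_ray a : open_dom (fun s => a < s)%R.
Proof. intros s H; now apply (open_gt a). Qed.

Lemma Ck_bounded D (f : R -> C) a b : (a <= b)%R -> (forall s, a <= s <= b -> D s)%R -> Ck 0 D f ->
  exists M, (0 <= M)%R /\ forall s, (a <= s <= b)%R -> (Cmod (f s) <= M)%R.
Proof.
intros Hab HD F.
destruct (continuity_ab_maj (fun s => Cmod (f s)) a b Hab) as [c [Hc _]].
- intros s Hs; destruct (F s (HD s Hs)) as [F1 F2].
  apply continuity_pt_filterlim.
  apply (Cmod_Clim (F := locally s) f (f s)); split; assumption.
- exists (Cmod (f c)); split; [apply Cmod_ge_0|exact Hc].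
Qed.

(** On a compact subset of [(0, oo)] all powers of [s] are comparable, so the order is arbitrary. *)
Lemma Ck_sym_compact J (f : R -> C) a b : (0 < a <= b)%R -> Ck J (fun s => 0 < s)%R f ->
  (forall s, (0 < s < a)%R -> f s = 0) -> (forall s, (b < s)%R -> f s = 0) ->
  forall r, exists K, (0 <= K)%R /\ sym J (fun s => 0 < s)%R K r f.
Proof.
intros Hab; revert f; induction J as [|J IH]; intros f F Fa Fb r.
1: pose proof F as F0.
2: pose proof (Ck_le_order 0 (S J) _ _ ltac:(lia) F) as F0.
all: destruct (Ck_bounded (fun s => 0 < s)%R f a b ltac:(lra) ltac:(intros; lra) F0) as [M [HM HMf]].
all: assert (Hc : exists K, (0 <= K)%R /\ forall s, (0 < s)%R -> (Cmod (f s) <= K * Rpower s r)%R).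
1,3: exists (M * (/ Rpower a r + / Rpower b r))%R; assert (P1 := Rpower_gt0 a r); assert (P2 := Rpower_gt0 b r);
  assert (Q1 := Rinv_0_lt_compat _ P1); assert (Q2 := Rinv_0_lt_compat _ P2); split; [nra|];
  intros s Hs; assert (P3 := Rpower_gt0 s r);
  destruct (Rlt_or_le s a) as [L|L]; [rewrite Fa, Cmod_0 by lra; apply Rmult_le_pos; nra|];
  destruct (Rlt_or_le b s) as [L'|L']; [rewrite Fb, Cmod_0 by lra; apply Rmult_le_pos; nra|];
  eapply Rle_trans; [apply HMf; lra|];
  rewrite <- (Rmult_1_r M) at 1; rewrite Rmult_assoc; apply Rmult_le_compat_l; [exact HM|];
  destruct (Rle_or_lt 0 r) as [Hr|Hr];
  [assert (T : (Rpower a r <= Rpower s r)%R) by (apply Rle_Rpower_l; lra);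
   apply Rle_trans with (/ Rpower a r * Rpower s r)%R; [apply Rmult_le_reg_l with (Rpower a r); [exact P1|]; rewrite <- Rmult_assoc, Rinv_r; lra|nra]
  |assert (T : (Rpower b r <= Rpower s r)%R);
   [replace r with (- (- r))%R by ring; rewrite !(Rpower_Ropp _ (- r)); apply Rinv_le_contravar; [apply exp_pos|apply Rle_Rpower_l; lra]|];
   apply Rle_trans with (/ Rpower b r * Rpower s r)%R; [apply Rmult_le_reg_l with (Rpower b r); [exact P2|]; rewrite <- Rmult_assoc, Rinv_r; lra|nra]].
- destruct Hc as [K [K0 HK]]; exists K; split; [exact K0|]; split; auto.
- destruct Hc as [K [K0 HK]].
  destruct F as [f' [Fd F]].
  destruct (IH f' F) with (r := (r - 1)%R) as [K' [K0' HK']].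
  + intros s Hs; apply (Cder_zero_before (fun x => if Rlt_dec 0 x then f x else 0) a s); [|lra|].
    * intros t Ht; destruct (Rlt_dec 0 t); [apply Fa; lra|reflexivity].
    * apply (Cder_ext_loc f); [|apply Fd; lra].
      generalize (locally_pos s ltac:(lra)); apply filter_imp; intros x Hx; destruct (Rlt_dec 0 x); [easy|lra].
  + intros s Hs; apply (Cder_zero_after f b s); auto; apply Fd; lra.
  + exists (K + K')%R; split; [lra|]; split.
    * intros s Hs; eapply Rle_trans; [now apply HK|].
      apply Rmult_le_compat_r; [left; apply Rpower_gt0|lra].
    * exists f'; split; [exact Fd|]; eapply sym_le; [|exact HK']; lra.
Qed.

(** The derivative of a cutoff function has compact support, where it is a symbol of any order. *)
Lemma Ck_sym_cutoff J (f : R -> C) a b ca cb : (0 < a <= b)%R -> Ck J (fun s => 0 < s)%R f ->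
  (forall s, (0 < s < a)%R -> f s = ca) -> (forall s, (b < s)%R -> f s = cb) ->
  exists K, sym J (fun s => 0 < s)%R K 0 f.
Proof.
intros Hab F Fa Fb.
assert (F0 := Ck_le_order 0 J _ _ ltac:(lia) F).
destruct (Ck_bounded (fun s => 0 < s)%R f a b ltac:(lra) ltac:(intros; lra) F0) as [M [HM HMf]].
set (K := (M + Cmod ca + Cmod cb)%R).
assert (P1 := Cmod_ge_0 ca); assert (P2 := Cmod_ge_0 cb).
assert (HK : forall s, (0 < s)%R -> (Cmod (f s) <= K * Rpower s 0)%R).
{ intros s Hs; rewrite Rpower_O, Rmult_1_r by exact Hs; unfold K.
  destruct (Rlt_or_le s a) as [L|L]; [rewrite Fa by lra; lra|].
  destruct (Rlt_or_le b s) as [L'|L']; [rewrite Fb by lra; lra|].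
  pose proof (HMf s); lra. }
destruct J as [|J]; [exists K; split; auto|].
destruct F as [f' [Fd F]].
destruct (Ck_sym_compact J f' a b Hab F) with (r := (0 - 1)%R) as [K' [K0' HK']].
- intros s Hs; apply (Cder_unique f s); [apply Fd; lra|].
  apply (Cder_ext_loc (fun _ => ca)); [|apply Cder_const].
  apply filter_imp with (P := fun x => (0 < x < a)%R); [intros; symmetry; now apply Fa|].
  now apply (open_dom_interval 0 a).
- intros s Hs; apply (Cder_unique f s); [apply Fd; lra|].
  apply (Cder_ext_loc (fun _ => cb)); [|apply Cder_const].
  generalize (open_dom_ray b s Hs); apply filter_imp; intros; symmetry; now apply Fb.
- exists (K + K')%R; split.
  + intros s Hs; eapply Rle_trans; [now apply HK|].
    apply Rmult_le_compat_r; [left; apply Rpower_gt0|lra].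
  + exists f'; split; [exact Fd|]; eapply sym_le; [|exact HK']; unfold K; lra.
Qed.

(** * Hadamard's lemma *)

(** For [m = 0] and [g = f'] with [f 0 = 0] this is the quotient of [f y] by [y], extended smoothly
    to [y = 0]; the weight [th^m] accounts for differentiation in [y]. *)
Definition hadamard (m : nat) (g : R -> R) (y : R) : R := RInt (fun th => (th ^ m * g (th * y))%R) 0 1.

Section Hadamard.
Variables (a : R) (a_pos : (0 < a)%R).

Lemma segment_dom y th : (- a < y)%R -> (0 <= th <= 1)%R -> (- a < th * y)%R.
Proof. intros; destruct (Rle_or_lt 0 y); nra. Qed.

Lemma hadamard_continuous_integrand m (g : R -> R) y : (forall y, (- a < y)%R -> continuous g y) -> (- a < y)%R ->
  forall th, (0 <= th <= 1)%R -> continuous (fun th => (th ^ m * g (th * y))%R) th.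
Proof.
intros Hg Hy th Hth.
apply (continuous_mult (K := R_AbsRing) (fun th => (th ^ m)%R) (fun th => g (th * y)%R)).
- apply @ex_derive_continuous; auto_derive; auto.
- apply (continuous_comp (fun th => (th * y)%R) g).
  + apply @ex_derive_continuous; auto_derive; auto.
  + apply Hg; now apply segment_dom.
Qed.

Lemma hadamard_ex_RInt m (g : R -> R) y : (forall y, (- a < y)%R -> continuous g y) -> (- a < y)%R ->
  ex_RInt (fun th => (th ^ m * g (th * y))%R) 0 1.
Proof.
intros Hg Hy; apply (ex_RInt_continuous (V := R_CompleteNormedModule)); intros th Hth.
rewrite Rmin_left, Rmax_right in Hth by lra.
now apply (hadamard_continuous_integrand m g y).
Qed.

Lemma is_derive_hadamard m (g g' : R -> R) y : (forall y, (- a < y)%R -> is_derive g y (g' y)) ->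
  (forall y, (- a < y)%R -> continuous g' y) -> (- a < y)%R ->
  is_derive (hadamard m g) y (hadamard (S m) g' y).
Proof.
intros Hg Hg' Hy.
assert (Hgc : forall y, (- a < y)%R -> continuous g y).
{ intros z Hz; apply @ex_derive_continuous; exists (g' z); now apply Hg. }
assert (Hd : forall u v, (- a < v * u)%R -> is_derive (fun z => (v ^ m * g (v * z))%R) u (v ^ S m * g' (v * u))%R).
{ intros u v Huv.
  apply (is_derive_ext (fun z => (v ^ m * g (v * z))%R)); [reflexivity|].
  evar_last.
  - apply (is_derive_scal (fun z => g (v * z)%R)).
    apply (is_derive_comp g (fun z => (v * z)%R)); [now apply Hg|].
    apply (is_derive_scal (fun z => z)), @is_derive_id.
  - unfold scal, one; simpl; unfold mult; simpl; ring. }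
assert (L : locally y (fun z => (- a < z)%R)) by now apply (open_gt (- a)).
evar_last.
- apply (is_derive_RInt_param (fun y th => (th ^ m * g (th * y))%R) 0 1 y).
  + revert L; apply filter_imp; intros z Hz th Hth.
    rewrite Rmin_left, Rmax_right in Hth by lra.
    eexists; apply Hd; now apply segment_dom.
  + intros th Hth; rewrite Rmin_left, Rmax_right in Hth by lra.
    assert (Hty := segment_dom y th Hy Hth).
    assert (C0 : continuity_2d_pt (fun u v => (v * u)%R) y th)
      by (apply continuity_2d_pt_mult; [apply continuity_2d_pt_id2|apply continuity_2d_pt_id1]).
    apply (continuity_2d_pt_ext_loc (fun u v => (v ^ S m * g' (v * u))%R)).
    * destruct (C0 (mkposreal (th * y + a) ltac:(lra))) as [d Hd']; exists d; intros u v Hu Hv.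
      symmetry; apply is_derive_unique, Hd.
      specialize (Hd' u v Hu Hv); simpl in Hd'; apply Rabs_def2 in Hd'; lra.
    * apply continuity_2d_pt_mult.
      -- apply (continuity_1d_2d_pt_comp (fun v => (v ^ S m)%R)); [|apply continuity_2d_pt_id2].
         apply derivable_continuous_pt, derivable_pt_pow.
      -- apply (continuity_1d_2d_pt_comp g'); [|exact C0].
         apply continuity_pt_filterlim, Hg', Hty.
  + revert L; apply filter_imp; intros z Hz; now apply hadamard_ex_RInt.
- unfold hadamard; apply RInt_ext; intros th Hth; rewrite Rmin_left, Rmax_right in Hth by lra.
  apply is_derive_unique, Hd, segment_dom; lra.
Qed.

Lemma hadamard_gt0 m g y : (forall y, (- a < y)%R -> continuous g y) -> (forall y, (- a < y)%R -> (0 < g y)%R) ->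
  (- a < y)%R -> (0 < hadamard m g y)%R.
Proof.
intros Hg Hp Hy; apply RInt_gt_0; [lra| |].
- intros th Hth; apply Rmult_lt_0_compat; [apply pow_lt; lra|apply Hp, segment_dom; lra].
- intros th Hth; now apply (hadamard_continuous_integrand m g y).
Qed.

Lemma Ck_real_derivative J (g : R -> R) : Ck (S J) (fun y => - a < y)%R (fun y => RtoC (g y)) ->
  exists g' : R -> R, (forall y, (- a < y)%R -> is_derive g y (g' y)) /\ Ck J (fun y => - a < y)%R (fun y => RtoC (g' y)).
Proof.
intros [f' [Hd H]]; exists (fun y => Re (f' y)); split.
- intros y Hy; destruct (Hd y Hy) as [H1 _]; exact H1.
- apply (Ck_ext J _ f'); auto; [apply open_dom_ray|].
  intros y Hy; destruct (Hd y Hy) as [_ H2]; simpl in H2.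
  apply C_eq; [reflexivity|]; rewrite <- (is_derive_unique _ _ _ H2); apply Derive_const.
Qed.

Lemma Ck_hadamard J : forall m g, Ck (S J) (fun y => - a < y)%R (fun y => RtoC (g y)) ->
  Ck J (fun y => - a < y)%R (fun y => RtoC (hadamard m g y)).
Proof.
assert (D : forall J m g, Ck (S J) (fun y => - a < y)%R (fun y => RtoC (g y)) ->
  exists g', Ck J (fun y => - a < y)%R (fun y => RtoC (g' y)) /\
   forall y, (- a < y)%R -> Cder (fun y => RtoC (hadamard m g y)) y (RtoC (hadamard (S m) g' y))).
{ intros K m g H; destruct (Ck_real_derivative K g H) as [g' [Hd Hg']]; exists g'; split; [exact Hg'|].
  intros y Hy; apply Cder_RtoC, is_derive_hadamard; auto.
  intros z Hz; apply (Ck_le_order 0 K _ _ ltac:(lia) Hg' z Hz). }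
induction J as [|J IH]; intros m g H.
- destruct (D 0%nat m g H) as [g' [_ Hd]]; now apply (Cder_Ck0 _ _ (fun y => RtoC (hadamard (S m) g' y))).
- destruct (D (S J) m g H) as [g' [Hg' Hd]]; exists (fun y => RtoC (hadamard (S m) g' y)); split; [exact Hd|].
  now apply IH.
Qed.

(** The integral of the derivative of [f (th y)] with respect to [th]. *)
Lemma hadamard_factor (f f' : R -> R) y : (forall y, (- a < y)%R -> is_derive f y (f' y)) ->
  (forall y, (- a < y)%R -> continuous f' y) -> f 0%R = 0%R -> (- a < y)%R -> f y = (y * hadamard 0 f' y)%R.
Proof.
intros Hf Hf' H0 Hy.
assert (I : is_RInt (fun th => (y * f' (th * y))%R) 0 1 (minus (f (1 * y)%R) (f (0 * y)%R))).
{ apply (is_RInt_derive (fun th => f (th * y)%R)); intros th Hth; rewrite Rmin_left, Rmax_right in Hth by lra.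
  - evar_last.
    + apply (is_derive_comp f (fun th => (th * y)%R)); [apply Hf, segment_dom; lra|].
      auto_derive; auto.
    + unfold scal; simpl; unfold mult; simpl; ring.
  - apply (continuous_mult (K := R_AbsRing) (fun _ => y) (fun th => f' (th * y)%R)); [apply continuous_const|].
    apply (continuous_comp (fun th => (th * y)%R) f').
    + apply @ex_derive_continuous; auto_derive; auto.
    + apply Hf', segment_dom; lra. }
apply (is_RInt_unique (V := R_CompleteNormedModule)) in I.
rewrite Rmult_1_l, Rmult_0_l, H0 in I; unfold minus, plus, opp in I; simpl in I.
unfold hadamard; rewrite Ropp_0, Rplus_0_r in I; rewrite <- I.
rewrite <- (RInt_scal (V := R_CompleteNormedModule)).
- apply RInt_ext; intros; unfold scal; simpl; unfold mult; simpl; ring.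
- now apply hadamard_ex_RInt.
Qed.

End Hadamard.

(** * The phase near its stationary point *)

Lemma s0_pos alpha : (0 < s0 alpha)%R.
Proof. apply exp_pos. Qed.

Lemma s0_slope alpha : (1 < alpha)%R -> (alpha * Rpower (s0 alpha) (alpha - 1) = 1)%R.
Proof.
intros Ha; unfold s0; rewrite Rpower_mult.
replace (- (1 / (alpha - 1)) * (alpha - 1))%R with (- (1))%R by (field; lra).
rewrite Rpower_Ropp, Rpower_1 by lra; field; lra.
Qed.

Lemma slope_lt_1 alpha s : (1 < alpha)%R -> (0 < s < s0 alpha)%R -> (alpha * Rpower s (alpha - 1) < 1)%R.
Proof.
intros Ha Hs; pose proof (s0_slope alpha Ha).
assert (Rpower s (alpha - 1) < Rpower (s0 alpha) (alpha - 1))%R by (apply Rlt_Rpower_l; lra).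
nra.
Qed.

Lemma slope_gt_1 alpha s : (1 < alpha)%R -> (s0 alpha < s)%R -> (1 < alpha * Rpower s (alpha - 1))%R.
Proof.
intros Ha Hs; pose proof (s0_pos alpha); pose proof (s0_slope alpha Ha).
assert (Rpower (s0 alpha) (alpha - 1) < Rpower s (alpha - 1))%R by (apply Rlt_Rpower_l; lra).
nra.
Qed.

(** The origin is moved to the stationary point, where [defect] and [defect1] vanish. *)
Definition defect alpha y : R := (h alpha (s0 alpha) - h alpha (s0 alpha + y))%R.
Definition defect1 alpha y : R := (alpha * Rpower (s0 alpha + y) (alpha - 1) - 1)%R.
Definition defect2 alpha y : R := (alpha * ((alpha - 1) * Rpower (s0 alpha + y) (alpha - 2)))%R.

Lemma is_derive_shifted_power c p y : (- c < y)%R ->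
  is_derive (fun y => Rpower (c + y) p) y (p * Rpower (c + y) (p - 1))%R.
Proof.
intros Hy; evar_last.
- apply (is_derive_comp (fun x => Rpower x p) (fun y => (c + y)%R)).
  + apply is_derive_Rpower_pos; lra.
  + auto_derive; auto.
- unfold scal; simpl; unfold mult; simpl; ring.
Qed.

Lemma is_derive_defect alpha y : (- s0 alpha < y)%R -> is_derive (defect alpha) y (defect1 alpha y).
Proof.
intros Hy; unfold defect, defect1, h.
apply (is_derive_ext (fun y => (s0 alpha - Rpower (s0 alpha) alpha - s0 alpha) + (- y + Rpower (s0 alpha + y) alpha))%R);
  [intros; Rring|].
evar_last.
- apply @is_derive_plus; [apply @is_derive_const|].
  apply @is_derive_plus; [apply @is_derive_opp, @is_derive_id|now apply is_derive_shifted_power].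
- unfold zero, opp, one; simpl; Rring.
Qed.

Lemma is_derive_defect1 alpha y : (- s0 alpha < y)%R -> is_derive (defect1 alpha) y (defect2 alpha y).
Proof.
intros Hy; unfold defect1, defect2.
evar_last.
- apply @is_derive_minus; [|apply @is_derive_const].
  apply is_derive_scal; now apply is_derive_shifted_power.
- unfold minus, zero; simpl; replace (alpha - 1 - 1)%R with (alpha - 2)%R by ring.
  unfold plus, opp; simpl; ring.
Qed.

Lemma Ck_defect2 J alpha : Ck J (fun y => - s0 alpha < y)%R (fun y => RtoC (defect2 alpha y)).
Proof.
apply (Ck_ext J _ (fun y => RtoC (alpha * (alpha - 1)) * Cpower (s0 alpha + y) (RtoC (alpha - 2)))).
- apply open_dom_ray.
- intros y Hy; unfold defect2; rewrite Cpower_RtoC, <- RtoC_mult; f_equal; ring.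
- apply Ck_scal.
  apply (Ck_comp J _ (fun s => 0 < s)%R (fun s => Cpower s (RtoC (alpha - 2))) (fun y => (s0 alpha + y)%R)).
  + apply open_dom_ray.
  + intros; lra.
  + apply Ck_Cpower.
  + apply (Ck_ext J _ (fun y => RtoC (s0 alpha) + RtoC y)); [apply open_dom_ray|intros; now rewrite RtoC_plus|].
    apply Ck_plus; [apply Ck_const|apply Ck_id].
Qed.

(** Successive quotients: [defect1 y = y q1(y)] and [defect y = y^2 q(y)].  Both are weighted averages
    of the positive function [defect2], hence smooth and positive. *)
Definition defect_q1 alpha := hadamard 0 (defect2 alpha).
Definition defect_q alpha := hadamard 1 (defect_q1 alpha).

Lemma Ck_continuous D (g : R -> R) J : Ck J D (fun y => RtoC (g y)) -> forall y, D y -> continuous g y.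
Proof. intros H y Hy; apply (Ck_le_order 0 J _ _ ltac:(lia) H y Hy). Qed.

Lemma Ck_defect_q1 J alpha : Ck J (fun y => - s0 alpha < y)%R (fun y => RtoC (defect_q1 alpha y)).
Proof. apply (Ck_hadamard (s0 alpha) (s0_pos alpha) J 0 (defect2 alpha)), Ck_defect2. Qed.

Lemma Ck_defect_q J alpha : Ck J (fun y => - s0 alpha < y)%R (fun y => RtoC (defect_q alpha y)).
Proof. apply (Ck_hadamard (s0 alpha) (s0_pos alpha) J 1 (defect_q1 alpha)), Ck_defect_q1. Qed.

Lemma defect_q1_pos alpha y : (1 < alpha)%R -> (- s0 alpha < y)%R -> (0 < defect_q1 alpha y)%R.
Proof.
intros Ha; apply (hadamard_gt0 (s0 alpha) (s0_pos alpha) 0 (defect2 alpha)).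
- apply (Ck_continuous _ _ 0), Ck_defect2.
- intros z Hz; unfold defect2; repeat apply Rmult_lt_0_compat; try lra; apply exp_pos.
Qed.

Lemma defect_q_pos alpha y : (1 < alpha)%R -> (- s0 alpha < y)%R -> (0 < defect_q alpha y)%R.
Proof.
intros Ha; apply (hadamard_gt0 (s0 alpha) (s0_pos alpha) 1 (defect_q1 alpha)).
- apply (Ck_continuous _ _ 0), Ck_defect_q1.
- intros; now apply defect_q1_pos.
Qed.

Lemma defect1_factor alpha y : (1 < alpha)%R -> (- s0 alpha < y)%R -> defect1 alpha y = (y * defect_q1 alpha y)%R.
Proof.
intros Ha Hy; apply (hadamard_factor (s0 alpha) (s0_pos alpha) (defect1 alpha) (defect2 alpha)); auto.
- intros; now apply is_derive_defect1.
- apply (Ck_continuous _ _ 0), Ck_defect2.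
- unfold defect1; rewrite Rplus_0_r, s0_slope by exact Ha; ring.
Qed.

Lemma defect_factor alpha y : (1 < alpha)%R -> (- s0 alpha < y)%R -> defect alpha y = (y * y * defect_q alpha y)%R.
Proof.
intros Ha Hy.
rewrite (hadamard_factor (s0 alpha) (s0_pos alpha) (defect alpha) (defect1 alpha)); auto.
- rewrite Rmult_assoc; f_equal; unfold hadamard, defect_q, hadamard.
  rewrite <- (RInt_scal (V := R_CompleteNormedModule)).
  + apply RInt_ext; intros th Hth; rewrite Rmin_left, Rmax_right in Hth by lra.
    rewrite defect1_factor by (auto; apply (segment_dom (s0 alpha) (s0_pos alpha)); lra).
    unfold scal; simpl; unfold mult; simpl; ring.
  + apply (hadamard_ex_RInt (s0 alpha) (s0_pos alpha)); auto; apply (Ck_continuous _ _ 0), Ck_defect_q1.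
- intros; now apply is_derive_defect.
- intros z Hz; apply @ex_derive_continuous; eexists; now apply is_derive_defect1.
- unfold defect; rewrite Rplus_0_r; ring.
Qed.

(** The sign and the square root of [y^2] combine to [y = s - s0], and the square root of the positive
    function [q] is smooth: [psi] is smooth across its zero. *)
Lemma psi_eq alpha s : (1 < alpha)%R -> (0 < s)%R ->
  psi alpha s = ((s - s0 alpha) * Rpower (defect_q alpha (s - s0 alpha)) (/ 2))%R.
Proof.
intros Ha Hs; unfold psi.
assert (Hy : (- s0 alpha < s - s0 alpha)%R) by lra.
pose proof (defect_q_pos alpha _ Ha Hy) as Hq.
replace (h alpha (s0 alpha) - h alpha s)%R with (defect alpha (s - s0 alpha))
  by (unfold defect; do 2 f_equal; ring).
rewrite defect_factor by assumption.
set (y := (s - s0 alpha)%R) in *.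
rewrite Rpower_sqrt, sqrt_mult by (nra || lra).
destruct (Rtotal_order y 0) as [L|[L|L]].
- rewrite sign_eq_m1 by exact L. replace (y * y)%R with ((- y) * (- y))%R by ring. rewrite sqrt_square by lra; ring.
- rewrite L, sign_0; ring.
- rewrite sign_eq_1 by exact L. rewrite sqrt_square by lra; ring.
Qed.

Lemma psi_sqr alpha s : (1 < alpha)%R -> (0 < s)%R -> (psi alpha s ^ 2 = h alpha (s0 alpha) - h alpha s)%R.
Proof.
intros Ha Hs; rewrite psi_eq by assumption.
assert (Hy : (- s0 alpha < s - s0 alpha)%R) by lra.
pose proof (defect_q_pos alpha _ Ha Hy) as Hq.
replace (h alpha (s0 alpha) - h alpha s)%R with (defect alpha (s - s0 alpha))
  by (unfold defect; do 2 f_equal; ring).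
rewrite defect_factor, Rpower_sqrt by assumption.
rewrite Rpow_mult_distr, pow2_sqrt by lra; ring.
Qed.

Lemma Ck_shift J c : Ck J (fun s => 0 < s)%R (fun s => RtoC (s - c)).
Proof.
apply (Ck_ext J _ (fun s => RtoC s + RtoC (- c))); [apply open_dom_ray|intros; rewrite <- RtoC_plus; f_equal|].
apply Ck_plus; [apply Ck_id|apply Ck_const].
Qed.

Lemma Ck_psi J alpha : (1 < alpha)%R -> Ck J (fun s => 0 < s)%R (fun s => RtoC (psi alpha s)).
Proof.
intros Ha.
apply (Ck_ext J _ (fun s => RtoC (s - s0 alpha) * Cpower (defect_q alpha (s - s0 alpha)) (RtoC (/ 2)))).
- apply open_dom_ray.
- intros s Hs; rewrite psi_eq by assumption; now rewrite Cpower_RtoC, <- RtoC_mult.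
- apply Ck_mult; [apply Ck_shift|].
  apply (Ck_comp J _ (fun x => 0 < x)%R (fun x => Cpower x (RtoC (/ 2))) (fun s => defect_q alpha (s - s0 alpha))).
  + apply open_dom_ray.
  + intros s Hs; apply defect_q_pos; lra.
  + apply Ck_Cpower.
  + apply (Ck_comp J _ (fun y => - s0 alpha < y)%R (fun y => RtoC (defect_q alpha y)) (fun s => (s - s0 alpha)%R)).
    * apply open_dom_ray.
    * intros; lra.
    * apply Ck_defect_q.
    * apply Ck_shift.
Qed.

Lemma Ck_Derive J D (g : R -> R) : open_dom D -> Ck (S J) D (fun y => RtoC (g y)) ->
  (forall y, D y -> is_derive g y (Derive g y)) /\ Ck J D (fun y => RtoC (Derive g y)).
Proof.
intros HD [f' [Hd H]].
assert (E : forall y, D y -> is_derive g y (Derive g y)).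
{ intros y Hy; apply Derive_correct; exists (Re (f' y)); now destruct (Hd y Hy). }
split; [exact E|].
apply (Ck_ext J _ f'); auto; intros y Hy; destruct (Hd y Hy) as [H1 H2]; simpl in H1, H2.
apply C_eq; simpl; [symmetry; now apply is_derive_unique|].
rewrite <- (is_derive_unique _ _ _ H2); apply Derive_const.
Qed.

Lemma is_derive_psi alpha s : (1 < alpha)%R -> (0 < s)%R -> is_derive (psi alpha) s (Derive (psi alpha) s).
Proof. intros Ha; apply (Ck_Derive 0 (fun s => 0 < s)%R); [apply open_dom_ray|now apply Ck_psi]. Qed.

Lemma Ck_dpsi J alpha : (1 < alpha)%R -> Ck J (fun s => 0 < s)%R (fun s => RtoC (Derive (psi alpha) s)).
Proof. intros Ha; apply Ck_Derive; [apply open_dom_ray|now apply Ck_psi]. Qed.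

Lemma dpsi_pos alpha s : (1 < alpha)%R -> (0 < s)%R -> (0 < Derive (psi alpha) s)%R.
Proof.
intros Ha Hs.
set (y := (s - s0 alpha)%R); assert (Hy : (- s0 alpha < y)%R) by (unfold y; lra).
pose proof (defect_q_pos alpha y Ha Hy) as Hq.
pose proof (defect_q1_pos alpha y Ha Hy) as Hq1.
assert (Hr : (0 < Rpower (defect_q alpha y) (/ 2))%R) by apply exp_pos.
assert (E : psi alpha s = (y * Rpower (defect_q alpha y) (/ 2))%R) by now apply psi_eq.
destruct (Req_dec y 0) as [Z|Z].
- (* at [s0] the derivative is the square root of [q(0)] *)
  destruct (Ck_Derive 0 (fun y => - s0 alpha < y)%R (defect_q alpha) (open_dom_ray _) (Ck_defect_q 1 alpha)) as [Dq _].
  assert (D : is_derive (psi alpha) s (Rpower (defect_q alpha y) (/ 2))).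
  { apply (is_derive_ext_loc (fun s => ((s - s0 alpha) * Rpower (defect_q alpha (s - s0 alpha)) (/ 2))%R)).
    - generalize (locally_pos s Hs); apply filter_imp; intros x Hx; symmetry; now apply psi_eq.
    - evar_last.
      + apply (is_derive_mult (fun s => (s - s0 alpha)%R) (fun s => Rpower (defect_q alpha (s - s0 alpha)) (/ 2))).
        * auto_derive; auto.
        * apply (is_derive_comp (fun x => Rpower x (/ 2)) (fun s => defect_q alpha (s - s0 alpha))).
          -- now apply is_derive_Rpower_pos.
          -- apply (is_derive_comp (defect_q alpha) (fun s => (s - s0 alpha)%R)); [now apply Dq|].
             auto_derive; auto.
        * intros; apply Rmult_comm.
      + fold y; rewrite Z; unfold plus, scal, mult; simpl; unfold mult; simpl; ring. }
  rewrite (is_derive_unique _ _ _ D); exact Hr.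
- (* elsewhere [2 psi psi' = y q1(y)] *)
  assert (D : is_derive (fun s => (psi alpha s * psi alpha s)%R) s (y * defect_q1 alpha y)%R).
  { apply (is_derive_ext_loc (fun s => defect alpha (s - s0 alpha))).
    - generalize (locally_pos s Hs); apply filter_imp; intros x Hx.
      replace (psi alpha x * psi alpha x)%R with (psi alpha x ^ 2)%R by ring.
      rewrite psi_sqr by assumption; unfold defect; do 2 f_equal; ring.
    - evar_last.
      + apply (is_derive_comp (defect alpha) (fun s => (s - s0 alpha)%R)); [now apply is_derive_defect|].
        auto_derive; auto.
      + fold y; rewrite defect1_factor by assumption; unfold scal; simpl; unfold mult; simpl; ring. }
  assert (D2 : is_derive (fun s => (psi alpha s * psi alpha s)%R) s (2 * psi alpha s * Derive (psi alpha) s)%R).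
  { evar_last.
    - apply (is_derive_mult (psi alpha) (psi alpha)); try apply is_derive_psi; auto; intros; apply Rmult_comm.
    - unfold plus, mult; simpl; ring. }
  pose proof (is_derive_unique _ _ _ D) as U; rewrite (is_derive_unique _ _ _ D2), E in U.
  assert (U' : (2 * Rpower (defect_q alpha y) (/ 2) * Derive (psi alpha) s = defect_q1 alpha y)%R).
  { apply Rmult_eq_reg_l with y; [|exact Z]; rewrite <- U; ring. }
  nra.
Qed.

Lemma psi_increasing alpha s t : (1 < alpha)%R -> (0 < s < t)%R -> (psi alpha s < psi alpha t)%R.
Proof.
intros Ha Hst.
destruct (MVT_gen (psi alpha) s t (Derive (psi alpha))) as [c [Hc E]].
- rewrite Rmin_left, Rmax_right by lra; intros x Hx; apply is_derive_psi; lra.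
- rewrite Rmin_left, Rmax_right by lra; intros x Hx.
  apply derivable_continuous_pt; eexists; apply is_derive_Reals, is_derive_psi; lra.
- rewrite Rmin_left, Rmax_right in Hc by lra.
  assert (P := dpsi_pos alpha c Ha ltac:(lra)); nra.
Qed.

Lemma psi_injective alpha s t : (1 < alpha)%R -> (0 < s)%R -> (0 < t)%R -> psi alpha s = psi alpha t -> s = t.
Proof.
intros Ha Hs Ht E; destruct (Rtotal_order s t) as [L|[L|L]]; [|exact L|].
- pose proof (psi_increasing alpha s t Ha ltac:(lra)); lra.
- pose proof (psi_increasing alpha t s Ha ltac:(lra)); lra.
Qed.

Lemma psi_s0 alpha : psi alpha (s0 alpha) = 0%R.
Proof. unfold psi; rewrite Rminus_diag, sign_0; ring. Qed.

Lemma psi_inv_psi alpha s : (1 < alpha)%R -> (0 < s)%R -> psi_inv alpha (psi alpha s) = s.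
Proof.
intros Ha Hs; unfold psi_inv.
apply (iota_unique (V := R_CompleteNormedModule)); [|split; [exact Hs|reflexivity]].
intros t [Ht E]; now apply (psi_injective alpha).
Qed.

Lemma psi_surjective alpha a b om : (1 < alpha)%R -> (0 < a < b)%R -> (psi alpha a < om < psi alpha b)%R ->
  exists s, (a < s < b)%R /\ psi alpha s = om.
Proof.
intros Ha Hab Hom.
destruct (Ranalysis5.IVT_interv (fun s => (psi alpha s - om)%R) a b) as [s [Hs E]]; try lra.
- intros x Hx; apply derivable_continuous_pt; eexists; apply is_derive_Reals.
  apply @is_derive_minus; [apply is_derive_psi; lra|apply @is_derive_const].
- exists s; split; [|lra].
  destruct (Req_dec s a) as [->|]; [lra|]; destruct (Req_dec s b) as [->|]; lra.
Qed.

Lemma psi_inv_range alpha a b om : (1 < alpha)%R -> (0 < a < b)%R -> (psi alpha a < om < psi alpha b)%R ->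
  (a < psi_inv alpha om < b)%R /\ psi alpha (psi_inv alpha om) = om.
Proof.
intros Ha Hab Hom; destruct (psi_surjective alpha a b om Ha Hab Hom) as [s [Hs <-]].
rewrite psi_inv_psi by lra; auto.
Qed.

Section Inverse.
Variables (alpha : R) (Ha : (1 < alpha)%R) (a b : R) (Hab : (0 < a < b)%R).

Let W (om : R) := (psi alpha a < om < psi alpha b)%R.

(** By the mean value theorem for [psi] the difference quotient is [1 / psi'(c)], and monotonicity
    forces [c] towards [psi_inv om]. *)
Lemma is_derive_psi_inv om : W om -> is_derive (psi_inv alpha) om (/ Derive (psi alpha) (psi_inv alpha om))%R.
Proof.
intros Hom; destruct (psi_inv_range alpha a b om Ha Hab Hom) as [Hs Es].
set (s := psi_inv alpha om) in *.
assert (Cd : continuous (fun x => / Derive (psi alpha) x)%R s).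
{ apply (continuous_comp (Derive (psi alpha)) Rinv).
  - apply (Ck_continuous (fun s => 0 < s)%R (Derive (psi alpha)) 0); [now apply Ck_dpsi|lra].
  - apply continuous_Rinv; apply Rgt_not_eq, dpsi_pos; lra. }
apply is_derive_Reals; intros eps Heps.
destruct (proj1 (filterlim_locally _ _) Cd (mkposreal eps Heps)) as [d Hd].
set (e := (Rmin d (Rmin (s - a) (b - s)) / 2)%R).
assert (He : (0 < e /\ e < d /\ a < s - e /\ s + e < b)%R).
{ unfold e; pose proof (cond_pos d).
  pose proof (Rmin_l d (Rmin (s - a) (b - s))); pose proof (Rmin_r d (Rmin (s - a) (b - s))).
  pose proof (Rmin_l (s - a) (b - s)); pose proof (Rmin_r (s - a) (b - s)).
  assert (0 < Rmin d (Rmin (s - a) (b - s)))%R by (repeat apply Rmin_glb_lt; lra).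
  lra. }
assert (L1 : (psi alpha (s - e) < om)%R) by (rewrite <- Es; apply psi_increasing; lra).
assert (L2 : (om < psi alpha (s + e))%R) by (rewrite <- Es; apply psi_increasing; lra).
assert (Hdel : (0 < Rmin (om - psi alpha (s - e)) (psi alpha (s + e) - om))%R) by (apply Rmin_glb_lt; lra).
exists (mkposreal _ Hdel); simpl; intros u Hu0 Hu.
pose proof (Rmin_l (om - psi alpha (s - e)) (psi alpha (s + e) - om)).
pose proof (Rmin_r (om - psi alpha (s - e)) (psi alpha (s + e) - om)).
apply Rabs_def2 in Hu.
destruct (psi_inv_range alpha (s - e) (s + e) (om + u) Ha ltac:(lra) ltac:(lra)) as [Ht Et].
fold s; set (t := psi_inv alpha (om + u)) in *.
destruct (MVT_gen (psi alpha) s t (Derive (psi alpha))) as [c [Hc E]].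
{ intros x Hx; apply is_derive_psi; auto.
  assert (Rmin s t > s - e)%R by (apply Rmin_glb_lt; lra). lra. }
{ intros x Hx; apply derivable_continuous_pt; eexists; apply is_derive_Reals, is_derive_psi; auto.
  assert (Rmin s t > s - e)%R by (apply Rmin_glb_lt; lra). lra. }
assert (Hc1 : (s - e < c < s + e)%R).
{ assert (Rmin s t > s - e)%R by (apply Rmin_glb_lt; lra).
  assert (Rmax s t < s + e)%R by (apply Rmax_lub_lt; lra). lra. }
rewrite Et, Es in E; replace (om + u - om)%R with u in E by ring.
assert (Pc := dpsi_pos alpha c Ha ltac:(lra)).
assert (Hts : (t - s <> 0)%R) by (intros Z; rewrite Z in E; lra).
replace ((t - s) / u)%R with (/ Derive (psi alpha) c)%R.
2:{ rewrite E; field; split; lra. }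
apply (Hd c); unfold ball; simpl; unfold AbsRing_ball, abs, minus, plus, opp; simpl.
apply Rabs_def1; lra.
Qed.

Lemma open_W : open_dom W.
Proof. apply open_dom_interval. Qed.

Lemma psi_inv_dom om : W om -> (0 < psi_inv alpha om)%R.
Proof. intros H; destruct (psi_inv_range alpha a b om Ha Hab H); lra. Qed.

Lemma Ck_dpsi_inv J : Ck J (fun s => 0 < s)%R (fun s => / RtoC (Derive (psi alpha) s)).
Proof.
apply Ck_inv; [|now apply Ck_dpsi].
intros s Hs E; apply RtoC_inj in E; pose proof (dpsi_pos alpha s Ha Hs); lra.
Qed.

Lemma Ck_psi_inv J : Ck J W (fun om => RtoC (psi_inv alpha om)).
Proof.
assert (D : forall om, W om -> Cder (fun om => RtoC (psi_inv alpha om)) om (/ RtoC (Derive (psi alpha) (psi_inv alpha om)))).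
{ intros om Hom; rewrite <- RtoC_inv.
  - apply Cder_RtoC; now apply is_derive_psi_inv.
  - apply Rgt_not_eq, dpsi_pos; auto; now apply psi_inv_dom. }
induction J as [|J IH].
- eapply Cder_Ck0, D.
- eexists; split; [exact D|].
  apply (Ck_comp J W (fun s => 0 < s)%R (fun s => / RtoC (Derive (psi alpha) s))); auto.
  + apply open_W.
  + apply psi_inv_dom.
  + apply Ck_dpsi_inv.
Qed.

(** The function whose derivatives at [0] are the pairings of [delta^(k)(psi)] with [s^beta]. *)
Lemma Ck_density J beta : Ck J W (fun om => Cpower (psi_inv alpha om) beta / RtoC (Derive (psi alpha) (psi_inv alpha om))).
Proof.
apply Ck_mult.
- apply (Ck_comp J W (fun s => 0 < s)%R (fun s => Cpower s beta)); [apply open_W|apply psi_inv_dom|apply Ck_Cpower|apply Ck_psi_inv].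
- apply (Ck_comp J W (fun s => 0 < s)%R (fun s => / RtoC (Derive (psi alpha) s))); [apply open_W|apply psi_inv_dom|apply Ck_dpsi_inv|apply Ck_psi_inv].
Qed.

End Inverse.

(** * Taylor expansion *)

Fixpoint tpoly (c : nat -> C) (m : nat) (t : R) : C :=
  match m with
  | O => 0
  | S n => tpoly c n t + c n * RtoC t ^ n
  end.

Lemma Cder_tpoly c m t : Cder (tpoly c (S m)) t (tpoly (fun j => RtoC (INR (S j)) * c (S j)) m t).
Proof.
induction m as [|m IH].
- apply (Cder_ext (fun _ => c 0%nat)); [intros; simpl; ring|apply Cder_const].
- change (tpoly (fun j => RtoC (INR (S j)) * c (S j)) (S m) t) with
   (tpoly (fun j => RtoC (INR (S j)) * c (S j)) m t + RtoC (INR (S m)) * c (S m) * RtoC t ^ m).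
  apply (Cder_plus (tpoly c (S m)) (fun t => c (S m) * RtoC t ^ S m)); [exact IH|].
  eapply Cder_eq; [apply Cder_scal, Cder_pow, Cder_id|ring].
Qed.

Lemma tpoly_ext c c' m t : (forall j, (j < m)%nat -> c j = c' j) -> tpoly c m t = tpoly c' m t.
Proof.
induction m as [|m IH]; intros E; simpl; [reflexivity|].
rewrite IH, E by (intros; try apply E; lia); reflexivity.
Qed.

Lemma tpoly_at_0 c m : tpoly c (S m) 0 = c 0%nat.
Proof.
induction m as [|m IH]; [simpl; ring|].
change (tpoly c (S m) 0 + c (S m) * RtoC 0 ^ S m = c 0%nat); rewrite IH; simpl; ring.
Qed.

Lemma tpoly_even (c : nat -> C) P t : (forall j, Nat.Odd j -> c j = 0) ->
  tpoly c (2 * P) t = tpoly (fun n => c (2 * n)%nat) P (t ^ 2).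
Proof.
intros Hc; induction P as [|P IH]; [reflexivity|].
replace (2 * S P)%nat with (S (S (2 * P))) by lia.
change (tpoly c (S (S (2 * P))) t) with (tpoly c (2 * P) t + c (2 * P)%nat * RtoC t ^ (2 * P) + c (S (2 * P)) * RtoC t ^ S (2 * P)).
rewrite (Hc (S (2 * P))) by (exists P; lia).
rewrite IH; cbn [tpoly]; rewrite Cpow_mult_r, RtoC_pow; ring.
Qed.

Lemma CDerive_n_S f f' n : locally 0%R (fun s => Cder f s (f' s)) -> CDerive_n f (S n) 0 = CDerive_n f' n 0.
Proof.
intros H; unfold CDerive_n; replace (S n) with (n + 1)%nat by lia.
rewrite <- !Derive_n_comp; f_equal; apply Derive_n_ext_loc; revert H; apply filter_imp; intros s [H1 H2];
  now apply is_derive_unique.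
Qed.

Definition taylor_coef (f : R -> C) (j : nat) : C := CDerive_n f j 0 / RtoC (INR (fact j)).

(** The derivative of the remainder of [f] is the remainder of [f'], one order lower: induction
    with the mean value inequality shows it to be a symbol of order [m] near [0]. *)
Lemma Ck_taylor m : forall f w w', (0 < w' < w)%R -> Ck m (fun s => - w < s < w)%R f ->
  exists K, (0 <= K)%R /\
    (forall t, (0 <= t < w')%R -> (Cmod (f t - tpoly (taylor_coef f) m t) <= K * t ^ m)%R) /\
    sym m (fun s => 0 < s < w')%R K (INR m) (fun t => f t - tpoly (taylor_coef f) m t).
Proof.
induction m as [|m IH]; intros f w w' Hw Hf.
- destruct (Ck_bounded _ f 0 w' ltac:(lra) (fun s Hs => conj (Rlt_le_trans (- w) 0 s ltac:(lra) (proj1 Hs)) (Rle_lt_trans s w' w (proj2 Hs) (proj2 Hw))) Hf) as [K [HK HKf]].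
  exists K; split; [exact HK|]; split.
  + intros t Ht; simpl. replace (f t - 0) with (f t) by ring. rewrite Rmult_1_r; apply HKf; lra.
  + split; auto; intros s Hs; simpl. replace (f s - 0) with (f s) by ring.
    rewrite Rpower_O, Rmult_1_r by lra; apply HKf; lra.
- destruct Hf as [f' [Hd Hf']].
  destruct (IH f' w w' Hw Hf') as [K [HK [HKb HKs]]].
  assert (L : locally 0%R (fun s => Cder f s (f' s))).
  { apply filter_imp with (P := fun s => (- w < s < w)%R); [exact Hd|].
    apply (open_dom_interval (- w) w); lra. }
  assert (Hc : forall j, RtoC (INR (S j)) * taylor_coef f (S j) = taylor_coef f' j).
  { intros j; unfold taylor_coef; rewrite (CDerive_n_S f f' j L), fact_S_C; field.
    split; [apply INR_fact_C|apply INR_S_C]. }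
  assert (HD : forall t, (- w < t < w)%R -> Cder (fun t => f t - tpoly (taylor_coef f) (S m) t) t (f' t - tpoly (taylor_coef f') m t)).
  { intros t Ht; apply Cder_minus; [now apply Hd|].
    eapply Cder_eq; [apply Cder_tpoly|]; apply tpoly_ext; intros; apply Hc. }
  assert (Hb : forall t, (0 <= t < w')%R -> (Cmod (f t - tpoly (taylor_coef f) (S m) t) <= K * t ^ S m)%R).
  { intros t Ht.
    assert (B : (Cmod ((f t - tpoly (taylor_coef f) (S m) t) - (f 0%R - tpoly (taylor_coef f) (S m) 0)) <= K * t ^ S m - K * 0 ^ S m)%R).
    { apply (Cmod_diff_le (fun t => f t - tpoly (taylor_coef f) (S m) t) (fun t => f' t - tpoly (taylor_coef f') m t)
       (fun t => K * t ^ S m)%R (fun t => K * (INR (S m) * t ^ m))%R); [lra| | |].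
      - intros u Hu; apply HD; lra.
      - intros u Hu; apply (is_derive_scal (fun t => (t ^ S m)%R)); auto_derive; auto; simpl; ring.
      - intros u Hu; eapply Rle_trans; [apply HKb; lra|].
        apply Rmult_le_compat_l; [exact HK|].
        rewrite <- (Rmult_1_l (u ^ m)) at 1; apply Rmult_le_compat_r; [apply pow_le; lra|].
        rewrite S_INR; pose proof (pos_INR m); lra. }
    rewrite tpoly_at_0 in B.
    assert (E0 : taylor_coef f 0 = f 0%R).
    { unfold taylor_coef, CDerive_n; simpl; unfold Cdiv.
      apply C_eq; simpl; unfold Re, Im; field. }
    rewrite E0 in B; simpl (0 ^ S m)%R in B.
    replace (f t - tpoly (taylor_coef f) (S m) t - (f 0%R - f 0%R)) with (f t - tpoly (taylor_coef f) (S m) t) in B by ring.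
    lra. }
  exists K; split; [exact HK|]; split; [exact Hb|]; split.
  + intros s Hs; rewrite Rpower_pow by lra; apply Hb; lra.
  + exists (fun t => f' t - tpoly (taylor_coef f') m t); split.
    * intros s Hs; apply HD; lra.
    * eapply sym_eq; [exact HKs|]; rewrite S_INR; ring.
Qed.

(** Folding [f] at [0] doubles its even derivatives and cancels the odd ones ([e = 1]); the induction
    alternates the sign [e]. *)
Lemma CDerive_n_reflect j : forall f w e, (0 < w)%R -> Ck j (fun s => - w < s < w)%R f ->
  CDerive_n (fun s => f s + RtoC e * f (- s)%R) j 0 = (1 + RtoC (e * (-1) ^ j)) * CDerive_n f j 0.
Proof.
induction j as [|j IH]; intros f w e Hw Hf.
- unfold CDerive_n; simpl; rewrite Ropp_0; apply C_eq; simpl; unfold Re, Im; ring.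
- destruct Hf as [f' [Hd Hf']].
  assert (L : locally 0%R (fun s => (- w < s < w)%R)) by (apply (open_dom_interval (- w) w); lra).
  rewrite (CDerive_n_S _ (fun s => f' s + RtoC (- e) * f' (- s)%R)), (CDerive_n_S f f'), (IH f' w); auto.
  + f_equal; f_equal; f_equal; simpl; ring.
  + revert L; apply filter_imp; exact Hd.
  + revert L; apply filter_imp; intros s Hs; apply Cder_plus; [now apply Hd|].
    eapply Cder_eq.
    * apply Cder_scal, (Cder_comp f (fun s => (- s)%R)); [apply Hd; lra|].
      auto_derive; auto.
    * replace (RtoC (- e)) with (- RtoC e) by (now rewrite RtoC_opp); rewrite RtoC_opp; ring.
Qed.

(** * Cutoff functions *)

(** The positive part of [x], raised to the power [n + 1]: a function of class [C^n], which replaces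
    the usual flat exponential in the construction of cutoffs. *)
Definition ramp (n : nat) (x : R) : R := if Rlt_dec 0 x then (x ^ S n)%R else 0%R.

Lemma ramp_neg n x : (x <= 0)%R -> ramp n x = 0%R.
Proof. intros H; unfold ramp; destruct (Rlt_dec 0 x); [lra|reflexivity]. Qed.

Lemma ramp_pos n x : (0 < x)%R -> (0 < ramp n x)%R.
Proof. intros H; unfold ramp; destruct (Rlt_dec 0 x); [now apply pow_lt|lra]. Qed.

Lemma ramp_nonneg n x : (0 <= ramp n x)%R.
Proof. destruct (Rlt_or_le 0 x); [left; now apply ramp_pos|rewrite ramp_neg by assumption; lra]. Qed.

Lemma is_derive_ramp n x : is_derive (ramp (S n)) x (INR (S (S n)) * ramp n x)%R.
Proof.
destruct (Rtotal_order x 0) as [L|[->|L]].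
- apply (is_derive_ext_loc (fun _ => 0%R)).
  + generalize (open_lt 0 x L); apply filter_imp; intros y Hy; rewrite ramp_neg; lra.
  + rewrite ramp_neg, Rmult_0_r by lra; apply @is_derive_const.
- rewrite ramp_neg, Rmult_0_r by lra.
  apply is_derive_Reals; intros eps Heps.
  exists (mkposreal (Rmin 1 eps) ltac:(apply Rmin_glb_lt; lra)); simpl; intros y Hy0 Hy.
  assert (Hy1 : (Rabs y < 1)%R) by (eapply Rlt_le_trans; [exact Hy|apply Rmin_l]).
  assert (Hy2 : (Rabs y < eps)%R) by (eapply Rlt_le_trans; [exact Hy|apply Rmin_r]).
  rewrite Rplus_0_l, (ramp_neg _ 0), !Rminus_0_r by lra.
  unfold ramp; destruct (Rlt_dec 0 y) as [P|P].
  + rewrite Rabs_pos_eq in Hy1, Hy2 by lra.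
    replace (y ^ S (S n) / y)%R with (y * y ^ n)%R by (simpl; field; lra).
    rewrite Rabs_pos_eq by (apply Rmult_le_pos; [lra|apply pow_le; lra]).
    apply Rle_lt_trans with (y * 1)%R; [|lra].
    apply Rmult_le_compat_l; [lra|].
    rewrite <- (pow1 n); apply pow_incr; lra.
  + unfold Rdiv; rewrite Rmult_0_l, Rabs_R0; exact Heps.
- apply (is_derive_ext_loc (fun y => (y ^ S (S n))%R)).
  + generalize (open_gt 0 x L); apply filter_imp; intros y Hy; unfold ramp; destruct (Rlt_dec 0 y); [reflexivity|lra].
  + unfold ramp; destruct (Rlt_dec 0 x); [|lra]. auto_derive; auto; simpl; ring.
Qed.

Definition whole_line (_ : R) : Prop := True.

Lemma open_whole_line : open_dom whole_line.
Proof. intros s _; now apply filter_forall. Qed.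

Lemma Ck_ramp J : forall n, (J < n)%nat -> Ck J whole_line (fun x => RtoC (ramp n x)).
Proof.
induction J as [|J IH]; intros [|n] Hn; try lia.
- apply (Cder_Ck0 _ _ (fun x => RtoC (INR (S (S n)) * ramp n x))); intros; apply Cder_RtoC, is_derive_ramp.
- exists (fun x => RtoC (INR (S (S n))) * RtoC (ramp n x)); split.
  + intros; rewrite <- RtoC_mult; apply Cder_RtoC, is_derive_ramp.
  + apply Ck_scal, IH; lia.
Qed.

(** The exponent of the ramps leaves room for the derivative lost in [Ck_inv]. *)
Definition smooth_step (J : nat) (w1 w2 x : R) : R :=
  (ramp (S (S J)) (x - w1) / (ramp (S (S J)) (x - w1) + ramp (S (S J)) (w2 - x)))%R.

Lemma smooth_step_den J w1 w2 x : (w1 < w2)%R ->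
  (0 < ramp (S (S J)) (x - w1) + ramp (S (S J)) (w2 - x))%R.
Proof.
intros H; pose proof (ramp_nonneg (S (S J)) (x - w1)); pose proof (ramp_nonneg (S (S J)) (w2 - x)).
destruct (Rlt_or_le w1 x).
- pose proof (ramp_pos (S (S J)) (x - w1) ltac:(lra)); lra.
- pose proof (ramp_pos (S (S J)) (w2 - x) ltac:(lra)); lra.
Qed.

Lemma smooth_step_0 J w1 w2 x : (x <= w1)%R -> smooth_step J w1 w2 x = 0%R.
Proof. intros H; unfold smooth_step; rewrite (ramp_neg _ (x - w1)) by lra; unfold Rdiv; ring. Qed.

Lemma smooth_step_1 J w1 w2 x : (w1 < w2)%R -> (w2 <= x)%R -> smooth_step J w1 w2 x = 1%R.
Proof.
intros H Hx; pose proof (smooth_step_den J w1 w2 x H); unfold smooth_step.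
rewrite (ramp_neg _ (w2 - x)) in * by lra; field; lra.
Qed.

Lemma Ck_smooth_step J w1 w2 : (w1 < w2)%R -> Ck J whole_line (fun x => RtoC (smooth_step J w1 w2 x)).
Proof.
intros H.
assert (A : Ck (S J) whole_line (fun x => RtoC (ramp (S (S J)) (x - w1)))).
{ apply (Ck_comp (S J) whole_line whole_line (fun x => RtoC (ramp (S (S J)) x)) (fun x => (x - w1)%R)).
  - apply open_whole_line.
  - auto.
  - apply Ck_ramp; lia.
  - apply (Ck_ext _ _ (fun x => RtoC x + RtoC (- w1))); [apply open_whole_line|intros; now rewrite <- RtoC_plus|].
    apply Ck_plus; [apply Ck_id|apply Ck_const]. }
assert (B : Ck (S J) whole_line (fun x => RtoC (ramp (S (S J)) (w2 - x)))).
{ apply (Ck_comp (S J) whole_line whole_line (fun x => RtoC (ramp (S (S J)) x)) (fun x => (w2 - x)%R)).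
  - apply open_whole_line.
  - auto.
  - apply Ck_ramp; lia.
  - apply (Ck_ext _ _ (fun x => RtoC w2 + RtoC (-1) * RtoC x)); [apply open_whole_line|intros; rewrite <- RtoC_mult, <- RtoC_plus; f_equal; ring|].
    apply Ck_plus; [apply Ck_const|apply Ck_scal, Ck_id]. }
apply (Ck_ext J _ (fun x => RtoC (ramp (S (S J)) (x - w1)) * / RtoC (ramp (S (S J)) (x - w1) + ramp (S (S J)) (w2 - x)))).
- apply open_whole_line.
- intros x _; unfold smooth_step, Rdiv; rewrite RtoC_mult, RtoC_inv; [reflexivity|].
  apply Rgt_not_eq; now apply smooth_step_den.
- apply Ck_mult; [now apply Ck_down|].
  apply Ck_inv.
  + intros x _ E; apply RtoC_inj in E; pose proof (smooth_step_den J w1 w2 x H); lra.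
  + apply (Ck_ext _ _ (fun x => RtoC (ramp (S (S J)) (x - w1)) + RtoC (ramp (S (S J)) (w2 - x)))); [apply open_whole_line|intros; now rewrite RtoC_plus|].
    now apply Ck_plus.
Qed.

Lemma Ck_reflect J (f : R -> C) : Ck J whole_line f -> Ck J whole_line (fun x => f (- x)%R).
Proof.
intros H; apply (Ck_comp J whole_line whole_line f (fun x => (- x)%R)); auto.
- apply open_whole_line.
- apply (Ck_ext _ _ (fun x => RtoC (-1) * RtoC x)); [apply open_whole_line|intros; rewrite <- RtoC_mult; f_equal; ring|].
  apply Ck_scal, Ck_id.
Qed.

(** With the steps on both sides it forms a partition of unity of the line; being even, it is
    compatible with folding. *)
Definition bump (J : nat) (w1 w2 x : R) : R := (1 - smooth_step J w1 w2 x - smooth_step J w1 w2 (- x))%R.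

Lemma bump_even J w1 w2 x : bump J w1 w2 (- x) = bump J w1 w2 x.
Proof. unfold bump; rewrite Ropp_involutive; ring. Qed.

Lemma bump_pos J w1 w2 x : (0 < w1)%R -> (0 <= x)%R -> bump J w1 w2 x = (1 - smooth_step J w1 w2 x)%R.
Proof. intros; unfold bump; rewrite (smooth_step_0 _ _ _ (- x)) by lra; ring. Qed.

Lemma bump_0 J w1 w2 x : (0 < w1 < w2)%R -> (w2 <= Rabs x)%R -> bump J w1 w2 x = 0%R.
Proof.
intros Hw Hx; unfold Rabs in Hx; destruct (Rcase_abs x).
- rewrite <- bump_even, bump_pos, smooth_step_1 by lra; ring.
- rewrite bump_pos, smooth_step_1 by lra; ring.
Qed.

Lemma Ck_bump J w1 w2 : (w1 < w2)%R -> Ck J whole_line (fun x => RtoC (bump J w1 w2 x)).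
Proof.
intros H; apply (Ck_ext J _ (fun x => 1 + RtoC (-1) * RtoC (smooth_step J w1 w2 x) + RtoC (-1) * RtoC (smooth_step J w1 w2 (- x)))).
- apply open_whole_line.
- intros x _; unfold bump; rewrite <- !RtoC_mult, <- !RtoC_plus; f_equal; ring.
- apply Ck_plus; [apply Ck_plus; [apply Ck_const|]|]; apply Ck_scal.
  + now apply Ck_smooth_step.
  + apply (Ck_reflect J (fun x => RtoC (smooth_step J w1 w2 x))); now apply Ck_smooth_step.
Qed.

Lemma sym_smooth_step J w1 w2 : (0 < w1 < w2)%R ->
  exists K, sym J (fun s => 0 < s)%R K 0 (fun x => RtoC (smooth_step J w1 w2 x)).
Proof.
intros H; apply (Ck_sym_cutoff J _ w1 w2 0 1); [lra| | |].
- apply (Ck_sub J whole_line); [now intros|apply Ck_smooth_step; lra].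
- intros; rewrite smooth_step_0 by lra; reflexivity.
- intros; rewrite smooth_step_1 by lra; reflexivity.
Qed.

Lemma sym_bump J w1 w2 : (0 < w1 < w2)%R ->
  exists K, sym J (fun s => 0 < s)%R K 0 (fun x => RtoC (bump J w1 w2 x)).
Proof.
intros H; apply (Ck_sym_cutoff J _ w1 w2 1 0); [lra| | |].
- apply (Ck_sub J whole_line); [now intros|apply Ck_bump; lra].
- intros; rewrite bump_pos, smooth_step_0 by lra; f_equal; ring.
- intros; rewrite bump_0; auto; rewrite Rabs_pos_eq; lra.
Qed.

(** * Fresnel integrals *)

(** [e^(lam (i - eta) t^2)]: the damping [eta > 0] makes the model integrals converge absolutely and
    is removed at the end. *)
Definition fresnel_kernel (lam eta t : R) : C := Cexp (RtoC lam * (- eta, 1)%R * RtoC (t ^ 2)).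

Lemma Cmod_fresnel_kernel lam eta t : Cmod (fresnel_kernel lam eta t) = exp (- (lam * eta * t ^ 2)).
Proof. unfold fresnel_kernel; rewrite Cmod_Cexp; f_equal; simpl; ring. Qed.

Lemma Cder_fresnel_kernel lam eta t :
  Cder (fresnel_kernel lam eta) t (RtoC lam * ((- eta, 1)%R * RtoC (2 * t)) * fresnel_kernel lam eta t).
Proof.
unfold fresnel_kernel; eapply Cder_eq.
- apply Cder_Cexp, Cder_scal, (Cder_RtoC (fun t => t ^ 2)%R t (2 * t)%R). auto_derive; [exact I|ring].
- cbv beta; ring.
Qed.

Lemma fresnel_kernel_le_1 lam eta t : (0 <= lam)%R -> (0 <= eta)%R -> (Cmod (fresnel_kernel lam eta t) <= 1)%R.
Proof.
intros Hl He; rewrite Cmod_fresnel_kernel, <- exp_0.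
assert (0 <= lam * eta * t ^ 2)%R by (apply Rmult_le_pos; [now apply Rmult_le_pos|apply pow2_ge_0]).
destruct H as [H|H]; [left; apply exp_increasing; lra|right; f_equal; lra].
Qed.

Lemma slope_neq0 eta : ((- eta, 1)%R : C) <> 0.
Proof. intros E; apply (f_equal Im) in E; simpl in E; lra. Qed.

Lemma sym_fresnel_slope_inv J : exists K, forall eta D, open_pos D ->
  sym J D K (- (1)) (fun t => / ((- eta, 1)%R * RtoC (2 * t))).
Proof.
destruct (sym_Cpower J (RtoC (-1))) as [K HK]; exists (1 * Rmax K 0)%R; intros eta D HD.
apply (sym_ext J D _ _ (fun t => / ((- eta, 1)%R * 2) * Cpower t (RtoC (-1)))); auto.
- intros t Ht; destruct (HD t Ht) as [Hp _].
  replace (RtoC (-1)) with (- (1)) by (apply C_eq; simpl; lra).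
  rewrite Cpower_opp, Cpower_1 by exact Hp. rewrite RtoC_mult.
  assert (RtoC t <> 0) by (intros E; apply RtoC_inj in E; lra).
  assert (N2 := slope_neq0 eta). field. split; [assumption|exact N2].
- assert (B : (Cmod (/ ((- eta, 1)%R * 2)) <= 1)%R).
  { rewrite Cmod_inv by (apply Cmult_neq_0; [apply slope_neq0|intros E; apply RtoC_inj in E; lra]).
    rewrite <- Rinv_1; apply Rinv_le_contravar; [lra|].
    rewrite Cmod_mult, Cmod_R, Rabs_pos_eq by lra.
    match goal with |- (1 <= ?m * 2)%R => assert (1 <= m)%R; [|lra] end.
    eapply Rle_trans; [|apply Im_le_Cmod]; simpl; lra. }
  apply (sym_le J D (Cmod (/ ((- eta, 1)%R * 2)) * Rmax K 0)).
  + apply Rmult_le_compat_r; [apply Rmax_r|exact B].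
  + apply sym_scal; eapply sym_le; [apply Rmax_l|].
    eapply sym_eq; [apply HK; exact HD|simpl; ring].
Qed.

Lemma is_cint_square_subst f v : is_cint f v -> is_cint (fun t => RtoC (2 * t) * f (t ^ 2)%R) v.
Proof.
intros [H [l0 [l1 [HH [H0 [H1 ->]]]]]].
apply (is_cint_primitive (fun t => H (t ^ 2)%R)).
- intros t Ht; apply Cder_comp; [apply HH; nra|auto_derive; auto; ring].
- apply (Clim_comp H (fun t => (t ^ 2)%R) at_zero at_zero); [typeclasses eauto| |].
  + intros P [e He].
    assert (Hm : (0 < Rmin 1 e)%R) by (apply Rmin_glb_lt; [lra|apply cond_pos]).
    generalize (at_zero_lt _ Hm); unfold filtermap; apply filter_imp; intros t [Ht1 Ht2].
    assert (Hm1 := Rmin_l 1 e); assert (Hm2 := Rmin_r 1 e).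
    apply He; [|nra].
    unfold ball; simpl; unfold AbsRing_ball, abs, minus, plus, opp; simpl.
    rewrite Ropp_0, Rplus_0_r, Rabs_pos_eq by nra. nra.
  + eapply Clim_ext_loc; [|exact H0]; apply filter_forall; intros; ring.
- apply (Clim_comp H (fun t => (t ^ 2)%R) at_inf at_inf); [typeclasses eauto| |exact H1].
  intros P [M HM]; exists (Rmax 1 M); intros t Ht; apply HM.
  assert (Hm1 := Rmax_l 1 M); assert (Hm2 := Rmax_r 1 M); nra.
Qed.

Definition half_int (n : nat) : C := RtoC (INR n + 1 / 2).

Lemma Re_half_int n : (0 < Re (half_int n))%R.
Proof. simpl; pose proof (pos_INR n); lra. Qed.

(** The substitution [t^2] yields a Laplace transform at [w = lam (eta - i)]. *)
Lemma is_cint_damped_fresnel lam eta n : (0 < lam)%R -> (0 < eta)%R ->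
  is_cint (fun t => RtoC t ^ (2 * n) * fresnel_kernel lam eta t)
    (/ 2 * (Cexp (- half_int n * Clog (lam * eta) (- lam)) * Gamma_integral (half_int n))).
Proof.
intros Hl He.
assert (Hle : (0 < lam * eta)%R) by now apply Rmult_lt_0_compat.
pose proof (is_cint_scal (/ 2) _ _ (is_cint_square_subst _ _ (laplace_value (half_int n) (lam * eta) (- lam) Hle (Re_half_int n)))) as I.
eapply is_cint_ext; [|exact I].
intros t Ht; cbv beta; unfold laplace_kernel, fresnel_kernel.
replace (- (lam * eta, - lam)%R * RtoC (t ^ 2)) with (RtoC lam * (- eta, 1)%R * RtoC (t ^ 2)) by (apply C_eq; simpl; ring).
replace (half_int n - 1) with (RtoC (INR n - 1 / 2)) by (unfold half_int; rewrite <- RtoC_minus; f_equal; field).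
rewrite Cpower_RtoC.
assert (E : (t * Rpower (t ^ 2) (INR n - 1 / 2) = t ^ (2 * n))%R).
{ rewrite <- (Rpower_pow 2 t), Rpower_mult by exact Ht.
  rewrite <- (Rpower_1 t) at 1 by exact Ht. rewrite <- Rpower_plus.
  rewrite <- Rpower_pow by exact Ht. f_equal. rewrite mult_INR; simpl INR; field. }
rewrite <- RtoC_pow, <- E, !RtoC_mult. field. 
Qed.

Lemma is_cint_bump_fresnel_exists J w1 w2 lam eta n : (0 < w1 < w2)%R -> (0 <= lam)%R -> (0 <= eta)%R ->
  (forall t, (0 < t)%R -> exists l, Cder (fun t => RtoC (bump (S J) w1 w2 t) * RtoC t ^ (2 * n) * fresnel_kernel lam eta t) t l) /\
  exists v, is_cint (fun t => RtoC (bump (S J) w1 w2 t) * RtoC t ^ (2 * n) * fresnel_kernel lam eta t) v.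
Proof.
intros Hw Hl He.
assert (Hd : forall t, (0 < t)%R -> exists l, Cder (fun t => RtoC (bump (S J) w1 w2 t) * RtoC t ^ (2 * n) * fresnel_kernel lam eta t) t l).
{ intros t Ht.
  destruct (Ck_bump (S J) w1 w2 ltac:(lra)) as [f' [Hf' _]].
  eexists; apply Cder_mult; [|apply Cder_fresnel_kernel].
  apply Cder_mult; [now apply Hf'|].
  apply (Cder_ext_pos (fun t => Cpower t (RtoC (INR (2 * n))))); [exact Ht| |apply Cder_Cpower, Ht].
  intros x Hx; now rewrite Cpower_RtoC, Rpower_pow, RtoC_pow. }
split; [exact Hd|].
destruct (sym_bump (S J) w1 w2 Hw) as [K HK].
apply (is_cint_exists_zero _ (K * (w2 + 1) ^ (2 * n)) w2 (w2 + 1) 0); try lra.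
- intros t Ht; apply Hd; lra.
- intros t Ht; rewrite bump_0; [ring|exact Hw|rewrite Rabs_pos_eq; lra].
- intros t Ht; rewrite Rpower_O, Rmult_1_r by lra.
  rewrite !Cmod_mult, <- (Rmult_1_r (K * _)).
  apply Rmult_le_compat; [apply Rmult_le_pos; apply Cmod_ge_0|apply Cmod_ge_0| |now apply fresnel_kernel_le_1].
  apply Rmult_le_compat; try apply Cmod_ge_0.
  + pose proof (sym_bound _ _ _ _ _ HK t ltac:(lra)) as B; rewrite Rpower_O, Rmult_1_r in B by lra; exact B.
  + rewrite Cmod_pow, Cmod_R, Rabs_pos_eq by lra; apply pow_incr; lra.
Qed.

Lemma Clim_Clog_neg x : (0 < x)%R -> Clim (fun eps => Clog eps (- x)) at_zero (ln x, (- (PI / 2))%R).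
Proof.
intros Hx; destruct (Clim_Clog x Hx) as [A B]; split; simpl in *.
- apply (filterlim_ext (fun eps => / 2 * ln (eps * (eps * 1) + x * (x * 1)))%R); [|exact A].
  intros; do 2 f_equal; ring.
- apply (filterlim_ext (fun eps => - atan (x / eps))%R).
  + intros; rewrite <- atan_opp; f_equal; unfold Rdiv; ring.
  + now apply Rlim_opp.
Qed.

(** The limit as [eta] tends to [0], where [Log w] tends to [ln lam - i pi / 2]. *)
Definition fresnel_value (lam : R) (n : nat) : C :=
  / 2 * (Cpower lam (- half_int n) * Cexp (Ci * RtoC (PI * (2 * INR n + 1) / 4)) * Gamma_integral (half_int n)).

(** The step is supported away from the stationary point [t = 0], so that [parts_inf] applies. *)
Lemma fresnel_tail J w1 w2 n : (0 < w1 < w2)%R -> (n < J)%nat ->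
  exists Ct, forall lam eta v, (0 < lam)%R -> (0 < eta)%R ->
   is_cint (fun t => RtoC (smooth_step J w1 w2 t) * RtoC t ^ (2 * n) * fresnel_kernel lam eta t) v ->
   (Cmod v <= Ct * / lam ^ J)%R.
Proof.
intros Hw Hn.
destruct (sym_smooth_step J w1 w2 Hw) as [K1 HK1].
destruct (sym_Cpower J (RtoC (INR (2 * n)))) as [K2 HK2].
destruct (sym_fresnel_slope_inv J) as [Kv HKv].
set (a := (w1 / 2)%R).
assert (Hab : (0 < a < w1)%R) by (unfold a; lra).
pose proof (open_pos_ray a ltac:(lra)) as Ho.
pose proof (le_INR (S n) J Hn) as HnJ; rewrite S_INR in HnJ.
destruct (parts_inf J a w1 Kv 1 Hab (2 ^ J * (K1 * K2)) (0 + INR (2 * n))) as [Ct HC].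
{ rewrite mult_INR; simpl INR; lra. }
exists Ct; intros lam eta v Hl He Hv.
apply (HC lam (fresnel_kernel lam eta) (fun t => (- eta, 1)%R * RtoC (2 * t)) (fun t => / ((- eta, 1)%R * RtoC (2 * t)))
  (fun t => RtoC (smooth_step J w1 w2 t) * Cpower t (RtoC (INR (2 * n)))) v); auto.
- intros; apply Cder_fresnel_kernel.
- intros t Ht; apply Cinv_r, Cmult_neq_0; [apply slope_neq0|intros E; apply RtoC_inj in E; lra].
- intros; apply fresnel_kernel_le_1; lra.
- intros L; destruct (exp_decay w1 (lam * eta * w1) L) as [M HM]; [lra|repeat apply Rmult_lt_0_compat; lra|].
  exists M; intros t Ht; rewrite Cmod_fresnel_kernel; eapply Rle_trans; [|now apply HM].
  left; apply exp_increasing.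
  assert (0 < lam * eta)%R by now apply Rmult_lt_0_compat.
  replace (lam * eta * w1 * t)%R with (lam * eta * (w1 * t))%R by ring.
  apply Ropp_lt_contravar, Rmult_lt_compat_l; [assumption|nra].
- apply sym_mult.
  + apply (sym_sub J (fun s => 0 < s)%R); [intros; lra|exact HK1].
  + apply (HK2 _ Ho).
- intros t Ht; rewrite smooth_step_0 by lra; ring.
- eapply is_cint_ext; [|exact Hv]; intros t Ht; cbv beta.
  rewrite Cpower_RtoC, Rpower_pow, RtoC_pow by exact Ht; reflexivity.
Qed.

(** The full damped integral is explicit and differs from the one with the bump by [fresnel_tail],
    uniformly in [eta]; with the bump the integral is continuous at [eta = 0]. *)
Lemma fresnel_expansion J w1 w2 n : (0 < w1 < w2)%R -> (n < S J)%nat ->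
  exists Ct, forall lam v, (0 < lam)%R ->
   is_cint (fun t => RtoC (bump (S J) w1 w2 t) * RtoC t ^ (2 * n) * fresnel_kernel lam 0 t) v ->
   (Cmod (v - fresnel_value lam n) <= Ct * / lam ^ S J)%R.
Proof.
intros Hw Hn; destruct (fresnel_tail (S J) w1 w2 n Hw Hn) as [Ct HC]; exists Ct; intros lam v Hl Hv.
set (f := fun eta t => RtoC (bump (S J) w1 w2 t) * RtoC t ^ (2 * n) * fresnel_kernel lam eta t).
set (X := fun eta => CInt (f eta) at_zero at_inf).
assert (HX : forall eta, (0 <= eta)%R -> is_cint (f eta) (X eta)).
{ intros eta He; now apply CInt_is_cint; apply is_cint_bump_fresnel_exists; try lra. }
set (V := fun eta => / 2 * (Cexp (- half_int n * Clog (lam * eta) (- lam)) * Gamma_integral (half_int n))).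
assert (HB : forall eta, (0 < eta)%R -> (Cmod (X eta - V eta) <= Ct * / lam ^ S J)%R).
{ intros eta He.
  pose proof (is_cint_minus _ _ _ _ (is_cint_damped_fresnel lam eta n Hl He) (HX eta ltac:(lra))) as I.
  rewrite <- Cmod_opp; replace (- (X eta - V eta)) with (V eta - X eta) by ring.
  apply (HC lam eta); auto.
  eapply is_cint_ext; [|exact I]; intros t Ht; unfold f; cbv beta.
  rewrite bump_pos, RtoC_minus by lra; ring. }
assert (LX : Clim X at_zero v).
{ destruct (sym_bump (S J) w1 w2 Hw) as [K HK].
  set (b := (w2 + 1)%R).
  assert (HK0 : (0 <= K)%R) by (apply (sym_nonneg _ _ _ _ _ 1 HK); lra).
  set (C0 := (K * b ^ (2 * n) * (lam * b ^ 2) * (Rpower b (0 + 1) / (0 + 1)))%R).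
  apply (Clim_ext_loc (fun eta => v + (X eta - v))); [apply filter_forall; intros; ring|].
  apply (Clim_eq (F := at_zero) _ (v + 0)); [apply Clim_plus; [apply Clim_const|]|ring].
  apply (Clim_0_bound (F := at_zero) _ (fun eta => C0 * eta)%R).
  - generalize at_zero_pos; apply filter_imp; intros eta He.
    pose proof (is_cint_minus _ _ _ _ (HX eta ltac:(lra)) Hv) as I.
    replace (C0 * eta)%R with (K * b ^ (2 * n) * (lam * b ^ 2) * eta * (Rpower b (0 + 1) / (0 + 1)))%R by (unfold C0; ring).
    apply (is_cint_bound_zero _ _ _ b 0 I); [unfold b; lra|lra| |].
    + intros t Ht; unfold f; rewrite bump_0; [ring|exact Hw|unfold b in Ht; rewrite Rabs_pos_eq; lra].
    + intros t Ht; rewrite Rpower_O, Rmult_1_r by lra; unfold f.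
      replace (RtoC (bump (S J) w1 w2 t) * RtoC t ^ (2 * n) * fresnel_kernel lam eta t -
        RtoC (bump (S J) w1 w2 t) * RtoC t ^ (2 * n) * fresnel_kernel lam 0 t) with
       (RtoC (bump (S J) w1 w2 t) * RtoC t ^ (2 * n) * (fresnel_kernel lam eta t - fresnel_kernel lam 0 t)) by ring.
      rewrite !Cmod_mult.
      replace (K * b ^ (2 * n) * (lam * b ^ 2) * eta)%R with (K * b ^ (2 * n) * (lam * b ^ 2 * eta))%R by ring.
      apply Rmult_le_compat; [apply Rmult_le_pos; apply Cmod_ge_0|apply Cmod_ge_0| |].
      * apply Rmult_le_compat; try apply Cmod_ge_0.
        -- pose proof (sym_bound _ _ _ _ _ HK t ltac:(lra)) as B; rewrite Rpower_O, Rmult_1_r in B by lra; exact B.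
        -- rewrite Cmod_pow, Cmod_R, Rabs_pos_eq by lra; apply pow_incr; lra.
      * replace (fresnel_kernel lam eta t) with (RtoC (exp (- (lam * eta * t ^ 2))) * fresnel_kernel lam 0 t).
        2:{ unfold fresnel_kernel; rewrite <- Cexp_RtoC, <- Cexp_plus; f_equal; apply C_eq; simpl; ring. }
        replace (RtoC (exp (- (lam * eta * t ^ 2))) * fresnel_kernel lam 0 t - fresnel_kernel lam 0 t) with
          (RtoC (exp (- (lam * eta * t ^ 2)) - 1) * fresnel_kernel lam 0 t) by (rewrite RtoC_minus; ring).
        rewrite Cmod_mult, Cmod_R.
        assert (P : (0 <= lam * eta * t ^ 2)%R) by (apply Rmult_le_pos; [apply Rmult_le_pos; lra|apply pow2_ge_0]).
        assert (Q : (exp (- (lam * eta * t ^ 2)) <= 1)%R).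
        { rewrite <- exp_0; destruct P as [P|P]; [left; apply exp_increasing; lra|right; f_equal; lra]. }
        rewrite Rabs_left1 by lra.
        pose proof (exp_ineq1_le (- (lam * eta * t ^ 2))) as P1.
        pose proof (fresnel_kernel_le_1 lam 0 t ltac:(lra) ltac:(lra)) as P2.
        pose proof (Cmod_ge_0 (fresnel_kernel lam 0 t)) as P3.
        apply Rle_trans with (lam * eta * t ^ 2)%R; [nra|].
        replace (lam * b ^ 2 * eta)%R with (lam * eta * b ^ 2)%R by ring.
        apply Rmult_le_compat_l; [nra|]. apply pow_incr; lra.
  - eapply Rlim_eq; [apply Rlim_const_mult; [typeclasses eauto|]|].
    + intros P [d Hd]; exists d; intros y Hy _; apply Hd, Hy.
    + ring. }
assert (LV : Clim V at_zero (fresnel_value lam n)).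
{ unfold V, fresnel_value; apply (Clim_scal (F := at_zero)).
  eapply Clim_eq.
  - apply (Clim_mult (F := at_zero)); [|apply Clim_const].
    apply (Clim_Cexp (F := at_zero)), (Clim_scal (F := at_zero)).
    apply (Clim_comp (fun eps => Clog eps (- lam)) (fun eta => (lam * eta)%R) at_zero at_zero); [typeclasses eauto|now apply at_zero_scale|now apply Clim_Clog_neg].
  - f_equal; unfold Cpower; rewrite <- Cexp_plus; f_equal; unfold half_int; apply C_eq; simpl; field. }
eapply (Clim_Cmod_le (F := at_zero)); [|apply Clim_minus; [exact LX|exact LV]].
generalize at_zero_pos; apply filter_imp; exact HB.
Qed.

(** Both are the finite part of the same Laplace transform at [w = 1]. *)
Lemma CGamma_integral s : (0 < Re s)%R -> CGamma s = Gamma_integral s.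
Proof.
intros Hs.
assert (L1 := laplace_fp_regular s 1 0 Rlt_0_1 (not_pole_pos s Hs)).
rewrite Gamma_star_regular in L1 by now apply not_pole_pos.
assert (L2 := is_cint_laplace_fp _ _ _ Hs (laplace_value s 1 0 Rlt_0_1 Hs)).
pose proof (laplace_fp_unique _ _ _ _ L1 L2) as E.
replace (CGamma s) with (/ Cexp (- s * Clog 1 0) * (Cexp (- s * Clog 1 0) * CGamma s)) by (field; apply Cexp_neq0).
rewrite E; field; apply Cexp_neq0.
Qed.

(** * The stationary contribution *)

Definition density alpha beta (om : R) : C :=
  Cpower (psi_inv alpha om) beta / RtoC (Derive (psi alpha) (psi_inv alpha om)).

(** [psi] does not take all negative values: the variable [om = psi s] is used in a window
    [(-w, w)] only, whose preimage lies in [(a, b)]. *)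
Definition psi_window alpha a b w : Prop :=
  (0 < a < s0 alpha)%R /\ (s0 alpha < b)%R /\ (0 < w)%R /\ (psi alpha a < - w)%R /\ (w < psi alpha b)%R.

Lemma psi_window_exists alpha : (1 < alpha)%R -> exists a b w, psi_window alpha a b w.
Proof.
intros Ha; pose proof (s0_pos alpha) as Hs.
exists (s0 alpha / 2)%R, (2 * s0 alpha)%R.
assert (A : (psi alpha (s0 alpha / 2) < 0)%R) by (rewrite <- (psi_s0 alpha); apply psi_increasing; lra).
assert (B : (0 < psi alpha (2 * s0 alpha))%R) by (rewrite <- (psi_s0 alpha); apply psi_increasing; lra).
exists (Rmin (- psi alpha (s0 alpha / 2)) (psi alpha (2 * s0 alpha)) / 2)%R.
pose proof (Rmin_l (- psi alpha (s0 alpha / 2)) (psi alpha (2 * s0 alpha))).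
pose proof (Rmin_r (- psi alpha (s0 alpha / 2)) (psi alpha (2 * s0 alpha))).
assert (0 < Rmin (- psi alpha (s0 alpha / 2)) (psi alpha (2 * s0 alpha)))%R by (apply Rmin_glb_lt; lra).
repeat split; lra.
Qed.

Lemma h_psi alpha s : (1 < alpha)%R -> (0 < s)%R -> h alpha s = (h alpha (s0 alpha) - psi alpha s ^ 2)%R.
Proof. intros Ha Hs; rewrite psi_sqr by assumption; ring. Qed.

(** The change of variables [om = psi s] turns the phase into [om^2]; its two half-lines are folded
    together, so that only integrals over [(0, oo)] with even phase occur. *)
Lemma fold_stationary alpha beta a b w w2 lam (B : R -> R) S : (1 < alpha)%R -> psi_window alpha a b w ->
  (0 < w2 < w)%R -> (forall x, (w2 <= Rabs x)%R -> B x = 0%R) ->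
  is_cint (fun s => RtoC (B (psi alpha s)) * Cpower s beta * Cexp (- Ci * RtoC (lam * h alpha s))) S ->
  is_cint (fun t => (RtoC (B t) * density alpha beta t + RtoC (B (- t)%R) * density alpha beta (- t)) * fresnel_kernel lam 0 t)
    (Cexp (Ci * RtoC (lam * h alpha (s0 alpha))) * S).
Proof.
intros Ha [[Ha0 Has] [Hbs [Hw [Hwa Hwb]]]] Hw2 HB HS.
destruct (is_cint_inv _ _ HS) as [H [l0 [l1 [HH [H0 [H1 ->]]]]]].
set (f := fun s => RtoC (B (psi alpha s)) * Cpower s beta * Cexp (- Ci * RtoC (lam * h alpha s))) in *.
set (c0 := Cexp (Ci * RtoC (lam * h alpha (s0 alpha)))).
set (L := fun om => c0 * H (psi_inv alpha om)).
assert (Hab : (0 < a < b)%R) by lra.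
assert (Hf0 : forall s, (0 < s)%R -> (w2 <= Rabs (psi alpha s))%R -> f s = 0).
{ intros s Hs Hp; unfold f; rewrite HB by exact Hp; ring. }
assert (Hrange : forall om, (- w < om < w)%R -> (a < psi_inv alpha om < b)%R /\ psi alpha (psi_inv alpha om) = om).
{ intros om Hom; apply psi_inv_range; auto; lra. }
assert (DL : forall om, (- w < om < w)%R -> Cder L om (RtoC (B om) * density alpha beta om * fresnel_kernel lam 0 om)).
{ intros om Hom; destruct (Hrange om Hom) as [R1 R2].
  eapply Cder_eq.
  - apply Cder_scal, (Cder_comp H (psi_inv alpha)); [apply HH; lra|].
    apply (is_derive_psi_inv alpha Ha a b Hab); lra.
  - unfold f; rewrite R2, (h_psi alpha (psi_inv alpha om)), R2 by (auto; lra).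
    rewrite RtoC_inv by (apply Rgt_not_eq, dpsi_pos; lra).
    unfold density, c0.
    replace (fresnel_kernel lam 0 om) with (Cexp (Ci * RtoC (lam * h alpha (s0 alpha))) * Cexp (- Ci * RtoC (lam * (h alpha (s0 alpha) - om ^ 2)))).
    2:{ rewrite <- Cexp_plus; unfold fresnel_kernel; f_equal; apply C_eq; simpl; ring. }
    unfold Cdiv; ring. }
set (w3 := ((w2 + w) / 2)%R).
assert (Hw3 : (w2 < w3 < w)%R) by (unfold w3; lra).
set (cst := L w3 - L (- w3)%R).
assert (Lp : forall t, (w2 < t < w)%R -> L t = L w3).
{ intros t Ht; destruct (Rle_or_lt t w3) as [Q|Q].
  - symmetry; apply Cder_0_const; [exact Q|]; intros x Hx; eapply Cder_eq; [apply DL; lra|].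
    rewrite HB by (rewrite Rabs_pos_eq; lra); ring.
  - apply Cder_0_const; [lra|]; intros x Hx; eapply Cder_eq; [apply DL; lra|].
    rewrite HB by (rewrite Rabs_pos_eq; lra); ring. }
assert (Lm : forall t, (w2 < t < w)%R -> L (- t)%R = L (- w3)%R).
{ intros t Ht; destruct (Rle_or_lt t w3) as [Q|Q].
  - apply Cder_0_const; [lra|]; intros x Hx; eapply Cder_eq; [apply DL; lra|].
    rewrite HB by (rewrite Rabs_left; lra); ring.
  - symmetry; apply Cder_0_const; [lra|]; intros x Hx; eapply Cder_eq; [apply DL; lra|].
    rewrite HB by (rewrite Rabs_left; lra); ring. }
(* The folded primitive.  Past the support of [B] it is constant, which extends it beyond the
   window. *)
set (M := fun t => if Rlt_dec t w3 then L t - L (- t)%R else cst).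
assert (Mc : forall t, (w2 < t)%R -> M t = cst).
{ intros t Ht; unfold M; destruct (Rlt_dec t w3); [|reflexivity].
  rewrite Lp, Lm by lra; reflexivity. }
assert (E1 : c0 * l1 = L w3).
{ unfold L; f_equal; destruct (Hrange w3 ltac:(lra)) as [R1 R2].
  apply (primitive_const_after H f); auto; [lra|]; intros x Hx; apply Hf0; [lra|].
  assert (w3 <= psi alpha x)%R.
  { rewrite <- R2; destruct (Req_dec (psi_inv alpha w3) x) as [->|N]; [lra|left; apply psi_increasing; lra]. }
  rewrite Rabs_pos_eq; lra. }
assert (E0 : c0 * l0 = L (- w3)%R).
{ unfold L; f_equal; destruct (Hrange (- w3)%R ltac:(lra)) as [R1 R2].
  apply (primitive_const_before H f); auto; [lra|]; intros x Hx; apply Hf0; [lra|].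
  assert (psi alpha x <= - w3)%R.
  { rewrite <- R2; destruct (Req_dec x (psi_inv alpha (- w3))) as [->|N]; [lra|left; apply psi_increasing; lra]. }
  rewrite Rabs_left; lra. }
apply (is_cint_eq _ (cst - 0)).
2:{ unfold cst; rewrite <- E1, <- E0; ring. }
apply (is_cint_primitive M).
- intros t Ht; destruct (Rlt_or_le t w3) as [Q|Q].
  + apply (Cder_ext_loc (fun t => L t - L (- t)%R)).
    * generalize (open_lt w3 t Q); apply filter_imp; intros x Hx; unfold M; destruct (Rlt_dec x w3); [reflexivity|lra].
    * eapply Cder_eq.
      -- apply Cder_minus; [apply DL; lra|].
         apply (Cder_comp L (fun x => (- x)%R) t (RtoC (B (- t)%R) * density alpha beta (- t) * fresnel_kernel lam 0 (- t)) (-1)); [apply DL; lra|auto_derive; auto].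
      -- replace (fresnel_kernel lam 0 (- t)) with (fresnel_kernel lam 0 t)
           by (unfold fresnel_kernel; do 2 f_equal; f_equal; simpl; ring).
         replace (RtoC (-1)) with (- (1)) by (apply C_eq; simpl; lra). ring.
  + apply (Cder_ext_loc (fun _ => cst)).
    * generalize (open_gt w2 t ltac:(lra)); apply filter_imp; intros x Hx; symmetry; now apply Mc.
    * rewrite !HB by (rewrite ?Rabs_Ropp, Rabs_pos_eq; lra).
      eapply Cder_eq; [apply Cder_const|ring].
- assert (T : forall g : R -> C, (exists l, Cder g 0 l) -> Clim g at_zero (g 0%R)).
  { intros g [l Hl]; split; intros P HP.
    - destruct (Cder_cont_Re _ _ _ Hl P HP) as [d Hd]; exists d; intros y Hy _; now apply Hd.
    - destruct (Cder_cont_Im _ _ _ Hl P HP) as [d Hd]; exists d; intros y Hy _; now apply Hd. }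
  apply (Clim_ext_loc (fun t => L t - L (- t)%R)).
  + generalize (at_zero_lt w3 ltac:(lra)); apply filter_imp; intros x Hx; unfold M; destruct (Rlt_dec x w3); [reflexivity|lra].
  + eapply Clim_eq; [apply (T (fun t => L t - L (- t)%R))|rewrite Ropp_0; ring].
    eexists; apply Cder_minus; [apply DL; lra|].
    apply (Cder_comp L (fun x => (- x)%R) 0 (RtoC (B (- 0)%R) * density alpha beta (- 0) * fresnel_kernel lam 0 (- 0)) (-1)); [apply DL; lra|auto_derive; auto].
- eapply Clim_ext_loc; [|apply Clim_const].
  generalize (at_inf_gt w2); apply filter_imp; intros t Ht; symmetry; now apply Mc.
Qed.

Lemma tpoly_sum c N t : tpoly c (S N) t = sum_n (fun n => c n * RtoC t ^ n) N.
Proof.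
induction N as [|N IH]; [rewrite sum_O; simpl; ring|].
rewrite sum_Sn, <- IH; reflexivity.
Qed.

Definition stationary_coef alpha beta (n : nat) : C :=
  1 / RtoC (INR (fact (2 * n))) * Cexp (Ci * RtoC (PI * (2 * INR n + 1) / 4))
  * CGamma (RtoC (INR n + 1 / 2)) * delta_pairing alpha beta (2 * n).

Lemma sum_n_C_minus (u v : nat -> C) N : sum_n u N - sum_n v N = sum_n (fun n => u n - v n) N.
Proof.
induction N as [|N IH]; [now rewrite !sum_O|].
rewrite !sum_Sn, <- IH; Cring.
Qed.

Lemma Cmod_sum_n_le (u : nat -> C) (b : nat -> R) N : (forall n, (n <= N)%nat -> (Cmod (u n) <= b n)%R) ->
  (Cmod (sum_n u N) <= sum_n b N)%R.
Proof.
induction N as [|N IH]; intros H; [rewrite !sum_O; apply H; lia|].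
rewrite !sum_Sn; change (plus (sum_n u N) (u (S N))) with (sum_n u N + u (S N)).
eapply Rle_trans; [apply Cmod_triangle|]; apply Rplus_le_compat; [apply IH; intros; apply H; lia|apply H; lia].
Qed.

Lemma sum_n_R_scal_r (u : nat -> R) (c : R) N : sum_n (fun n => (u n * c)%R) N = (sum_n u N * c)%R.
Proof.
induction N as [|N IH]; [now rewrite !sum_O|].
rewrite !sum_Sn, IH; Rring.
Qed.

Lemma finite_choice (P : nat -> R -> Prop) N : (forall n x y, (x <= y)%R -> P n x -> P n y) ->
  (forall n, (n <= N)%nat -> exists x, P n x) -> exists x, (0 <= x)%R /\ forall n, (n <= N)%nat -> P n x.
Proof.
intros Hm; induction N as [|N IH]; intros H.
- destruct (H 0%nat (Nat.le_refl _)) as [x Hx]; exists (Rmax x 0); split; [apply Rmax_r|].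
  intros n Hn; replace n with 0%nat by lia; apply (Hm 0%nat x); [apply Rmax_l|exact Hx].
- destruct IH as [x [Hx0 Hx]]; [intros; apply H; lia|].
  destruct (H (S N) (Nat.le_refl _)) as [y Hy]; exists (Rmax x y); split; [eapply Rle_trans; [exact Hx0|apply Rmax_l]|].
  intros n Hn; destruct (Nat.eq_dec n (S N)) as [->|].
  + apply (Hm _ y); [apply Rmax_r|exact Hy].
  + apply (Hm _ x); [apply Rmax_l|apply Hx; lia].
Qed.

(** The folded amplitude has an even Taylor polynomial at [0].  Its monomials give Fresnel integrals,
    hence the coefficients; its remainder of order [2 P] allows [P] integrations by parts against
    the slope [2 t], each of which costs two powers of [t]. *)
Lemma stationary_expansion alpha beta a b w w1 w2 J N : (1 < alpha)%R -> psi_window alpha a b w ->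
  (0 < w1 < w2)%R -> (w2 < w)%R -> (N <= J)%nat ->
  exists K, forall (lam : R) (S : C), (1 <= lam)%R ->
    is_cint (fun s => RtoC (bump (Datatypes.S J) w1 w2 (psi alpha s)) * Cpower s beta * Cexp (- Ci * RtoC (lam * h alpha s))) S ->
    (Cmod (S - Cexp (- Ci * RtoC (lam * h alpha (s0 alpha))) *
       sum_n (fun n => stationary_coef alpha beta n * Cpower lam (- half_int n))%C N)%C <= K * / lam ^ Datatypes.S N)%R.
Proof.
intros Ha Hwin Hw12 Hw2 HN.
set (P := Datatypes.S N).
pose proof Hwin as [[Ha0 Has] [Hbs [Hw [Hwa Hwb]]]].
set (g := density alpha beta).
set (fe := fun t => g t + RtoC 1 * g (- t)%R).
assert (Hg : forall m, Ck m (fun t => - w < t < w)%R g).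
{ intros m; apply (Ck_sub m (fun om => psi alpha a < om < psi alpha b)%R); [intros; lra|].
  apply (Ck_density alpha Ha a b); lra. }
assert (Hfe : forall m, Ck m (fun t => - w < t < w)%R fe).
{ intros m; apply Ck_plus; [apply Hg|]; apply Ck_scal.
  apply (Ck_comp m _ (fun t => - w < t < w)%R g (fun t => (- t)%R)); [apply open_dom_interval|intros; lra|apply Hg|].
  apply (Ck_ext _ _ (fun x => RtoC (-1) * RtoC x)); [apply open_dom_interval|intros; rewrite <- RtoC_mult; f_equal; ring|].
  apply Ck_scal, Ck_id. }
set (w' := ((w2 + w) / 2)%R).
assert (Hw' : (w2 < w' < w)%R) by (unfold w'; lra).
destruct (Ck_taylor (2 * P) fe w w' ltac:(lra) (Hfe _)) as [K1 [HK1 [_ HK1s]]].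
set (Rm := fun t => fe t - tpoly (taylor_coef fe) (2 * P) t) in *.
destruct (sym_bump (Datatypes.S J) w1 w2 Hw12) as [K2 HK2].
destruct (sym_fresnel_slope_inv P) as [Kv HKv].
pose proof (open_pos_interval 0 w' ltac:(lra)) as Ho.
destruct (parts_zero P w2 w' Kv 1 ltac:(lra) ltac:(lra) (2 ^ P * (K2 * K1)) (0 + INR (2 * P))) as [C1 HC1].
{ rewrite mult_INR; simpl (INR 2); lra. }
assert (Hcoef : forall n, taylor_coef fe (2 * n) = 2 * taylor_coef g (2 * n)).
{ intros n; unfold taylor_coef, fe; rewrite (CDerive_n_reflect (2 * n) g w 1 Hw (Hg _)).
  rewrite pow_1_even. replace (RtoC (1 * 1)) with (RtoC 1) by (f_equal; ring). field; apply INR_fact_C. }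
assert (Hodd : forall j, Nat.Odd j -> taylor_coef fe j = 0).
{ intros j [k ->]; unfold taylor_coef, fe; rewrite (CDerive_n_reflect (2 * k + 1) g w 1 Hw (Hg _)).
  replace (2 * k + 1)%nat with (Datatypes.S (2 * k)) by lia; rewrite pow_1_odd.
  replace (RtoC (1 * -1)) with (- (1)) by (apply C_eq; simpl; lra). field; apply INR_fact_C. }
destruct (finite_choice (fun n Ct => forall lam v, (0 < lam)%R ->
   is_cint (fun t => RtoC (bump (Datatypes.S J) w1 w2 t) * RtoC t ^ (2 * n) * fresnel_kernel lam 0 t) v ->
   (Cmod (v - fresnel_value lam n) <= Ct * / lam ^ Datatypes.S J)%R) N) as [C2 [HC20 HC2]].
{ intros n x y Hxy H lam v Hl Hv; eapply Rle_trans; [now apply H|].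
  apply Rmult_le_compat_r; [left; apply Rinv_0_lt_compat, pow_lt, Hl|exact Hxy]. }
{ intros n Hn; apply fresnel_expansion; [exact Hw12|lia]. }
set (Cs := sum_n (fun n => (Cmod (2 * taylor_coef g (2 * n)) * C2)%R) N).
exists (C1 + Cs)%R; intros lam S Hl HS.
set (Bf := bump (Datatypes.S J) w1 w2) in *.
assert (HBz : forall x, (w2 <= Rabs x)%R -> Bf x = 0%R) by (intros; now apply bump_0).
pose proof (fold_stationary alpha beta a b w w2 lam Bf S Ha Hwin ltac:(lra) HBz HS) as IT.
set (T := Cexp (Ci * RtoC (lam * h alpha (s0 alpha))) * S) in *.
set (X := fun n => CInt (fun t => RtoC (Bf t) * RtoC t ^ (2 * n) * fresnel_kernel lam 0 t) at_zero at_inf).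
assert (HX : forall n, is_cint (fun t => RtoC (Bf t) * RtoC t ^ (2 * n) * fresnel_kernel lam 0 t) (X n)).
{ intros n; apply CInt_is_cint; apply is_cint_bump_fresnel_exists; lra. }
assert (IX : is_cint (fun t => sum_n (fun n => 2 * taylor_coef g (2 * n) * (RtoC (Bf t) * RtoC t ^ (2 * n) * fresnel_kernel lam 0 t)) N)
   (sum_n (fun n => 2 * taylor_coef g (2 * n) * X n)%C N)).
{ apply (is_cint_sum (fun n t => 2 * taylor_coef g (2 * n) * (RtoC (Bf t) * RtoC t ^ (2 * n) * fresnel_kernel lam 0 t))).
  intros n _; apply is_cint_scal, HX. }
assert (IR : is_cint (fun t => RtoC (Bf t) * Rm t * fresnel_kernel lam 0 t) (T - sum_n (fun n => 2 * taylor_coef g (2 * n) * X n)%C N)).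
{ eapply is_cint_ext; [|apply (is_cint_minus _ _ _ _ IT IX)].
  intros t Ht; cbv beta; unfold Bf at 2; rewrite bump_even; fold Bf; fold g.
  assert (E : sum_n (fun n => 2 * taylor_coef g (2 * n) * (RtoC (Bf t) * RtoC t ^ (2 * n) * fresnel_kernel lam 0 t)) N =
    RtoC (Bf t) * fresnel_kernel lam 0 t * tpoly (taylor_coef fe) (2 * P) t).
  { rewrite (tpoly_even _ _ _ Hodd); unfold P; rewrite tpoly_sum, <- sum_n_C_scal; apply sum_n_ext; intros n.
    rewrite Hcoef, RtoC_pow, Cpow_mult_r; Cring. }
  rewrite E; unfold Rm, fe; ring. }
assert (BR : (Cmod (T - sum_n (fun n => 2 * taylor_coef g (2 * n) * X n)%C N) <= C1 * / lam ^ P)%R).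
{ apply (HC1 lam (fresnel_kernel lam 0) (fun t => (- 0, 1)%R * RtoC (2 * t)) (fun t => / ((- 0, 1)%R * RtoC (2 * t)))
   (fun t => RtoC (Bf t) * Rm t)); auto.
  - lra.
  - intros; apply Cder_fresnel_kernel.
  - intros t Ht; apply Cinv_r, Cmult_neq_0; [apply slope_neq0|intros E; apply RtoC_inj in E; lra].
  - intros; apply fresnel_kernel_le_1; lra.
  - apply sym_mult.
    + apply (sym_le_order P (Datatypes.S J)); [unfold P; lia|].
      apply (sym_sub _ (fun s => 0 < s)%R); [intros; lra|exact HK2].
    + apply (sym_le_order P (2 * P)); [lia|exact HK1s].
  - intros t Ht; rewrite HBz by (rewrite Rabs_pos_eq; lra); ring. }
assert (HlamJ : (/ lam ^ Datatypes.S J <= / lam ^ P)%R).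
{ apply Rinv_le_contravar; [apply pow_lt; lra|apply Rle_pow; [exact Hl|unfold P; lia]]. }
assert (Hpos : (0 < / lam ^ P)%R) by (apply Rinv_0_lt_compat, pow_lt; lra).
assert (BX : (Cmod (sum_n (fun n => 2 * taylor_coef g (2 * n) * X n)%C N - sum_n (fun n => 2 * taylor_coef g (2 * n) * fresnel_value lam n)%C N) <= Cs * / lam ^ P)%R).
{ rewrite sum_n_C_minus.
  apply Rle_trans with (sum_n (fun n => (Cmod (2 * taylor_coef g (2 * n)) * C2 * / lam ^ P)%R) N).
  - apply Cmod_sum_n_le; intros n Hn.
    replace (2 * taylor_coef g (2 * n) * X n - 2 * taylor_coef g (2 * n) * fresnel_value lam n) with
      (2 * taylor_coef g (2 * n) * (X n - fresnel_value lam n)) by ring.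
    rewrite Cmod_mult, Rmult_assoc; apply Rmult_le_compat_l; [apply Cmod_ge_0|].
    eapply Rle_trans; [apply (HC2 n Hn lam); [lra|apply HX]|].
    now apply Rmult_le_compat_l.
  - right; apply (sum_n_R_scal_r (fun n => (Cmod (2 * taylor_coef g (2 * n)) * C2)%R)). }
assert (ET : Cexp (- Ci * RtoC (lam * h alpha (s0 alpha))) * T = S).
{ unfold T; rewrite Cmult_assoc.
  replace (- Ci * RtoC (lam * h alpha (s0 alpha))) with (- (Ci * RtoC (lam * h alpha (s0 alpha)))) by ring.
  rewrite Cexp_opp; ring. }
assert (EV : sum_n (fun n => 2 * taylor_coef g (2 * n) * fresnel_value lam n) N =
   sum_n (fun n => stationary_coef alpha beta n * Cpower lam (- half_int n)) N).
{ apply sum_n_ext; intros n; unfold fresnel_value, stationary_coef, taylor_coef.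
  fold (half_int n); rewrite CGamma_integral by apply Re_half_int.
  change (delta_pairing alpha beta (2 * n)) with (CDerive_n g (2 * n) 0).
  Cfield. apply INR_fact_C. }
rewrite <- ET at 1; rewrite <- EV.
match goal with |- (Cmod ?u <= _)%R => replace u with (Cexp (- Ci * RtoC (lam * h alpha (s0 alpha))) *
  ((T - sum_n (fun n => 2 * taylor_coef g (2 * n) * X n)%C N) +
   (sum_n (fun n => 2 * taylor_coef g (2 * n) * X n)%C N - sum_n (fun n => 2 * taylor_coef g (2 * n) * fresnel_value lam n)%C N))) by Cring end.
rewrite Cmod_mult, Cmod_Cexp.
replace (Re (- Ci * RtoC (lam * h alpha (s0 alpha)))) with 0%R by (simpl; ring).
rewrite exp_0, Rmult_1_l, Rmult_plus_distr_r.
eapply Rle_trans; [apply Cmod_triangle|]; now apply Rplus_le_compat.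
Qed.

(** * Negligible contributions *)

(** [Rpower] and [psi] are meaningful on [(0, oo)] only, whereas the estimates at infinity ask for
    amplitudes that vanish on a whole left half-line. *)
Definition mask (f : R -> C) (s : R) : C := if Rlt_dec 0 s then f s else 0.

Lemma mask_pos f s : (0 < s)%R -> mask f s = f s.
Proof. intros H; unfold mask; destruct (Rlt_dec 0 s); [reflexivity|lra]. Qed.

Lemma mask_zero (f : R -> C) b s : (forall s, (0 < s < b)%R -> f s = 0) -> (s < b)%R -> mask f s = 0.
Proof. intros H Hs; unfold mask; destruct (Rlt_dec 0 s); [apply H; lra|reflexivity]. Qed.

Lemma sym_mask J a K r f : (0 <= a)%R -> sym J (fun s => a < s)%R K r f -> sym J (fun s => a < s)%R K r (mask f).
Proof.
intros Ha; apply sym_ext; [now apply open_pos_ray|].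
intros s Hs; rewrite mask_pos by lra; reflexivity.
Qed.

Lemma is_cint_mask f E v : is_cint (fun s => f s * E s) v -> is_cint (fun s => mask f s * E s) v.
Proof. apply is_cint_ext; intros t Ht; now rewrite mask_pos. Qed.

Lemma is_cint_exists_inf (f E : R -> C) J K r b : (0 < b)%R ->
  sym (S J) (fun s => 0 < s)%R K r f -> (forall s, (0 < s < b)%R -> f s = 0) ->
  (forall s, (0 < s)%R -> exists l, Cder E s l) -> (forall s, (0 < s)%R -> (Cmod (E s) <= 1)%R) ->
  (forall L, exists M, forall s, (/ 2 < s)%R -> (Cmod (E s) <= M * Rpower s L)%R) ->
  exists v, is_cint (fun s => f s * E s) v.
Proof.
intros Hb Hf Hf0 HE HE1 Hdec.
assert (HK : (0 <= K)%R) by (apply (sym_nonneg _ _ _ _ _ 1 Hf); lra).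
pose proof (sym_bound _ _ _ _ _ Hf) as Hfb.
destruct Hf as [_ [f' [Hd _]]].
destruct (Hdec (- r - 2)%R) as [M HM].
set (C := (K * (1 + Rpower b r) + K * M)%R).
assert (HM0 : (0 <= M)%R).
{ pose proof (HM 1%R ltac:(lra)) as B; pose proof (Cmod_ge_0 (E 1%R)); pose proof (Rpower_gt0 1 (- r - 2)); nra. }
pose proof (Rpower_gt0 b r) as Pb.
apply (is_cint_exists _ C 0 (-2)); try lra.
- intros t Ht; destruct (HE t Ht) as [l Hl]; eexists; apply Cder_mult; [now apply Hd|exact Hl].
- intros t Ht; rewrite Rpower_O, Rmult_1_r by lra.
  apply Rle_trans with (K * (1 + Rpower b r))%R; [|unfold C; nra].
  destruct (Rlt_or_le t b) as [L|L].
  + rewrite Hf0, Cmult_0_l, Cmod_0 by lra; nra.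
  + rewrite Cmod_mult, <- (Rmult_1_r (K * _)).
    apply Rmult_le_compat; try apply Cmod_ge_0; [|apply HE1; lra].
    eapply Rle_trans; [apply Hfb; lra|]; apply Rmult_le_compat_l; [exact HK|].
    destruct (Rle_or_lt 0 r) as [Q|Q].
    * pose proof (Rpower_le_1 t r Ht Q); lra.
    * assert (Rpower t r <= Rpower b r)%R; [|lra].
      replace r with (- (- r))%R by ring; rewrite !(Rpower_Ropp _ (- r)).
      apply Rinv_le_contravar; [apply exp_pos|apply Rle_Rpower_l; lra].
- intros t Ht; apply Rle_trans with (K * M * Rpower t (-2))%R.
  + rewrite Cmod_mult. replace (-2)%R with (r + (- r - 2))%R by ring; rewrite Rpower_plus.
    replace (K * M * (Rpower t r * Rpower t (- r - 2)))%R with ((K * Rpower t r) * (M * Rpower t (- r - 2)))%R by ring.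
    apply Rmult_le_compat; try apply Cmod_ge_0; [apply Hfb; lra|apply HM; lra].
  + apply Rmult_le_compat_r; [left; apply exp_pos|unfold C; nra].
Qed.

Definition full_kernel alpha lam delta (s : R) : C :=
  Cexp (Ci * RtoC (lam * Rpower s alpha)) * lin_phase lam delta s.

Lemma Cmod_full_kernel alpha lam delta s : Cmod (full_kernel alpha lam delta s) = Cmod (lin_phase lam delta s).
Proof. unfold full_kernel; rewrite Cmod_mult, Cmod_Cexp, Re_Ci_mult, exp_0; ring. Qed.

Lemma Cder_full_kernel alpha lam delta s : (0 < s)%R -> exists l, Cder (full_kernel alpha lam delta) s l.
Proof.
intros Hs; eexists; apply Cder_mult; [|apply Cder_lin_phase].
apply Cder_Cexp, Cder_scal, Cder_RtoC.
apply (is_derive_scal (fun x => Rpower x alpha)), is_derive_Rpower_pos, Hs.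
Qed.

(** Cutting in the variable [psi s] makes the middle piece even in [om]. *)
Definition chi_left J w1 w2 alpha s : C := RtoC (smooth_step J w1 w2 (- psi alpha s)).
Definition chi_mid J w1 w2 alpha s : C := RtoC (bump J w1 w2 (psi alpha s)).
Definition chi_right J w1 w2 alpha s : C := RtoC (smooth_step J w1 w2 (psi alpha s)).

Lemma chi_sum J w1 w2 alpha s : chi_left J w1 w2 alpha s + chi_mid J w1 w2 alpha s + chi_right J w1 w2 alpha s = 1.
Proof. unfold chi_left, chi_mid, chi_right, bump; rewrite <- !RtoC_plus; f_equal; ring. Qed.

Lemma psi_below alpha a b w s : (1 < alpha)%R -> psi_window alpha a b w -> (0 < s < a)%R -> (psi alpha s < - w)%R.
Proof. intros Ha [H1 [H2 [H3 [H4 H5]]]] Hs; pose proof (psi_increasing alpha s a Ha Hs); lra. Qed.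

Lemma psi_above alpha a b w s : (1 < alpha)%R -> psi_window alpha a b w -> (b < s)%R -> (w < psi alpha s)%R.
Proof. intros Ha [H1 [H2 [H3 [H4 H5]]]] Hs; pose proof (psi_increasing alpha b s Ha ltac:(lra)); lra. Qed.

Lemma Ck_comp_psi J alpha (f : R -> C) : (1 < alpha)%R -> Ck J whole_line f -> Ck J (fun s => 0 < s)%R (fun s => f (psi alpha s)).
Proof.
intros Ha Hf; apply (Ck_comp J _ whole_line f (psi alpha)); [apply open_dom_ray|now intros|exact Hf|now apply Ck_psi].
Qed.

Lemma sym_chi_left J w1 w2 alpha a b w : (1 < alpha)%R -> psi_window alpha a b w -> (0 < w1 < w2)%R -> (w2 < w)%R ->
  exists K, sym J (fun s => 0 < s)%R K 0 (chi_left J w1 w2 alpha).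
Proof.
intros Ha Hwin Hw Hw2; pose proof Hwin as [H1 [H2 _]]; apply (Ck_sym_cutoff J _ a b 1 0); [lra| | |].
- apply (Ck_comp_psi J alpha (fun x => RtoC (smooth_step J w1 w2 (- x)))); [exact Ha|].
  apply (Ck_reflect J (fun x => RtoC (smooth_step J w1 w2 x))), Ck_smooth_step; lra.
- intros s Hs; pose proof (psi_below _ _ _ _ s Ha Hwin Hs); unfold chi_left; now rewrite smooth_step_1 by lra.
- intros s Hs; pose proof (psi_above _ _ _ _ s Ha Hwin Hs); unfold chi_left; now rewrite smooth_step_0 by lra.
Qed.

Lemma sym_chi_right J w1 w2 alpha a b w : (1 < alpha)%R -> psi_window alpha a b w -> (0 < w1 < w2)%R -> (w2 < w)%R ->
  exists K, sym J (fun s => 0 < s)%R K 0 (chi_right J w1 w2 alpha).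
Proof.
intros Ha Hwin Hw Hw2; pose proof Hwin as [H1 [H2 _]]; apply (Ck_sym_cutoff J _ a b 0 1); [lra| | |].
- apply (Ck_comp_psi J alpha (fun x => RtoC (smooth_step J w1 w2 x))); [exact Ha|].
  apply Ck_smooth_step; lra.
- intros s Hs; pose proof (psi_below _ _ _ _ s Ha Hwin Hs); unfold chi_right; now rewrite smooth_step_0 by lra.
- intros s Hs; pose proof (psi_above _ _ _ _ s Ha Hwin Hs); unfold chi_right; now rewrite smooth_step_1 by lra.
Qed.

Lemma sym_chi_mid J w1 w2 alpha a b w r : (1 < alpha)%R -> psi_window alpha a b w -> (0 < w1 < w2)%R -> (w2 < w)%R ->
  exists K, sym J (fun s => 0 < s)%R K r (chi_mid J w1 w2 alpha).
Proof.
intros Ha Hwin Hw Hw2; pose proof Hwin as [H1 [H2 _]].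
destruct (Ck_sym_compact J (chi_mid J w1 w2 alpha) a b ltac:(lra)) with (r := r) as [K [_ HK]].
- apply (Ck_comp_psi J alpha (fun x => RtoC (bump J w1 w2 x))); [exact Ha|apply Ck_bump; lra].
- intros s Hs; pose proof (psi_below _ _ _ _ s Ha Hwin Hs); unfold chi_mid; rewrite bump_0; auto; rewrite Rabs_left; lra.
- intros s Hs; pose proof (psi_above _ _ _ _ s Ha Hwin Hs); unfold chi_mid; rewrite bump_0; auto; rewrite Rabs_pos_eq; lra.
- now exists K.
Qed.

Lemma pow_inv_split lam n m : (1 <= lam)%R -> (lam ^ n * / lam ^ (n + m) = / lam ^ m)%R.
Proof.
intros H; assert (0 < lam ^ n)%R by (apply pow_lt; lra); assert (0 < lam ^ m)%R by (apply pow_lt; lra).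
rewrite pow_add; field; split; lra.
Qed.

(** Outside the window around [s0] only the Taylor polynomial of [e^(i lam s^alpha)] at [0]
    contributes: the rest is smaller than any given power of [lam].  To the left of the window the
    Taylor remainder is kept whole; to its right, and inside it, the exponential and the polynomial
    are separated, and [1 - chi_left] is the amplitude of the polynomial.  On the left the remainder
    may reach [lam ^ S N], whence [S N + m0] integrations by parts for a bound [lam ^ - m0]. *)
Lemma off_stationary_bound alpha beta a b w w1 w2 N m0 J : (1 < alpha)%R -> psi_window alpha a b w ->
  (0 < w1 < w2)%R -> (w2 < w)%R ->
  (Re beta + alpha * INR (S N) - INR (S N + m0) > -1)%R ->
  (S N + m0 <= J)%nat -> (Re beta - INR J * alpha < -1)%R -> (Re beta + INR N * alpha + INR N + INR m0 + 1 < INR J)%R ->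
  exists K, forall lam delta Iv Sv, (1 <= lam)%R -> (0 < delta <= 1)%R ->
    is_cint (fun s => Cpower s beta * (expi_rem (S N) (lam * Rpower s alpha) * lin_phase lam delta s)) Iv ->
    is_cint (fun s => chi_mid J w1 w2 alpha s * Cpower s beta * full_kernel alpha lam delta s) Sv ->
    (Cmod (Iv - Sv) <= K * / lam ^ m0)%R.
Proof.
intros Ha Hwin Hw12 Hw2 HJ0 HJ HJC HJD.
pose proof Hwin as [[Ha0 Has] [Hbs [Hw [Hwa Hwb]]]].
assert (Hpos : open_pos (fun s => 0 < s)%R) by (apply open_pos_ray; lra).
destruct J as [|J']; [lia|]; set (J := S J') in *.
destruct (sym_chi_left J w1 w2 alpha a b w Ha Hwin Hw12 Hw2) as [KL HKL].
destruct (sym_chi_right J w1 w2 alpha a b w Ha Hwin Hw12 Hw2) as [KR HKR].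
destruct (sym_Cpower J beta) as [Kb HKb].
(* [chi_left] vanishes after [aL], [chi_right] before [bR] and [1 - chi_left] before [bD]; [mL] and
   [mR] leave a margin on the side of [s0], where the slope still does not vanish. *)
destruct (psi_inv_range alpha a b (- w1) Ha ltac:(lra) ltac:(lra)) as [RL1 RL2].
destruct (psi_inv_range alpha a b w1 Ha ltac:(lra) ltac:(lra)) as [RR1 RR2].
destruct (psi_inv_range alpha a b (- w2) Ha ltac:(lra) ltac:(lra)) as [RD1 RD2].
set (aL := psi_inv alpha (- w1)) in *; set (bR := psi_inv alpha w1) in *; set (bD := psi_inv alpha (- w2)) in *.
assert (HaL : (aL < s0 alpha)%R).
{ destruct (Rlt_or_le aL (s0 alpha)) as [|L]; [assumption|].
  destruct L as [L|L]; [pose proof (psi_increasing alpha _ _ Ha (conj (s0_pos alpha) L))|rewrite <- L in RL2]; rewrite psi_s0 in *; lra. }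
assert (HbR : (s0 alpha < bR)%R).
{ destruct (Rlt_or_le (s0 alpha) bR) as [|L]; [assumption|].
  destruct L as [L|L]; [pose proof (psi_increasing alpha _ _ Ha (conj (Rlt_trans _ _ _ Ha0 (proj1 RR1)) L))|rewrite L in RR2]; rewrite psi_s0 in *; lra. }
set (mL := ((aL + s0 alpha) / 2)%R); assert (HmL : (0 < aL < mL)%R /\ (mL < s0 alpha)%R) by (unfold mL; lra).
set (mR := ((s0 alpha + bR) / 2)%R); assert (HmR : (0 < mR < bR)%R /\ (s0 alpha < mR)%R) by (unfold mR; lra).
set (fL := fun s => chi_left J w1 w2 alpha s * Cpower s beta).
set (fR := fun s => chi_right J w1 w2 alpha s * Cpower s beta).
set (fD := fun n s => (1 + - (1) * chi_left J w1 w2 alpha s) * Cpower s (beta + RtoC (INR n * alpha))).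
assert (SL : sym J (fun s => 0 < s)%R (2 ^ J * (KL * Kb)) (0 + Re beta) fL).
{ apply sym_mult; [exact HKL|now apply HKb]. }
assert (SR : sym J (fun s => 0 < s)%R (2 ^ J * (KR * Kb)) (0 + Re beta) fR).
{ apply sym_mult; [exact HKR|now apply HKb]. }
assert (SD : forall n, exists KD, sym J (fun s => 0 < s)%R KD (0 + (Re beta + INR n * alpha)) (fD n)).
{ intros n; destruct (sym_Cpower J (beta + RtoC (INR n * alpha))) as [Kn HKn]; eexists.
  apply sym_mult; [|apply HKn; exact Hpos].
  apply sym_plus; [apply sym_const|apply sym_scal; exact HKL]. }
assert (ZL : forall s, (aL < s)%R -> fL s = 0).
{ intros s Hs; unfold fL, chi_left; rewrite smooth_step_0; [ring|].
  pose proof (psi_increasing alpha aL s Ha ltac:(lra)); lra. }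
assert (ZR : forall s, (0 < s < bR)%R -> fR s = 0).
{ intros s Hs; unfold fR, chi_right; rewrite smooth_step_0; [ring|].
  pose proof (psi_increasing alpha s bR Ha ltac:(lra)); lra. }
assert (ZD : forall n s, (0 < s < bD)%R -> fD n s = 0).
{ intros n s Hs; unfold fD, chi_left; rewrite smooth_step_1; [ring|lra|].
  pose proof (psi_increasing alpha s bD Ha ltac:(lra)); lra. }
destruct (rem_phase_zero N alpha aL mL Ha (proj1 HmL) (slope_lt_1 alpha mL Ha ltac:(lra)) (S N + m0)
  (2 ^ J * (KL * Kb)) (0 + Re beta)) as [CL HCL]; [lra|].
destruct (full_phase_inf J alpha mR bR (2 ^ J * (KR * Kb)) (0 + Re beta) Ha (proj1 HmR) (slope_gt_1 alpha mR Ha (proj2 HmR))) as [CR HCR]; [lra|].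
destruct (finite_choice (fun n C => forall lam delta v, (0 < lam)%R -> (0 < delta <= 1)%R ->
   is_cint (fun s => fD n s * lin_phase lam delta s) v -> (Cmod v <= C * / lam ^ J)%R) N) as [CD [HCD0 HCD]].
{ intros n x y Hxy H lam delta v Hl Hd Hv; eapply Rle_trans; [now apply (H lam delta)|].
  apply Rmult_le_compat_r; [left; apply Rinv_0_lt_compat, pow_lt, Hl|exact Hxy]. }
{ intros n Hn; destruct (SD n) as [KD HKD].
  destruct (lin_phase_inf J (bD / 2) bD KD (0 + (Re beta + INR n * alpha)) ltac:(lra)) as [C HC].
  { apply le_INR in Hn; pose proof (pos_INR m0); pose proof (pos_INR N); nra. }
  exists C; intros lam delta v Hl Hd Hv; apply (HC lam delta (mask (fD n)) v Hl Hd).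
  - apply sym_mask; [lra|]; apply (sym_sub J (fun s => 0 < s)%R); [intros; lra|exact HKD].
  - intros s Hs; apply (mask_zero _ bD); [apply ZD|exact Hs].
  - now apply is_cint_mask. }
exists (CL + Rmax CR 0 + INR (S N) * CD)%R; intros lam delta Iv Sv Hl Hd HI HS.
assert (Hlin1 : forall s, (0 < s)%R -> (Cmod (lin_phase lam delta s) <= 1)%R) by (intros; apply lin_phase_le_1; lra).
assert (Hlindec : forall L, exists M, forall s, (/ 2 < s)%R -> (Cmod (lin_phase lam delta s) <= M * Rpower s L)%R).
{ intros L; apply lin_phase_decay; lra. }
destruct (is_cint_exists_inf fR (full_kernel alpha lam delta) J' _ _ bR ltac:(lra) SR ZR) as [vR HvR].
{ intros; now apply Cder_full_kernel. }
{ intros; rewrite Cmod_full_kernel; auto. }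
{ intros L; destruct (Hlindec L) as [M HM]; exists M; intros; rewrite Cmod_full_kernel; auto. }
set (vD := fun n => CInt (fun s => fD n s * lin_phase lam delta s) at_zero at_inf).
assert (HvD : forall n, is_cint (fun s => fD n s * lin_phase lam delta s) (vD n)).
{ intros n; destruct (SD n) as [KD HKD].
  assert (Dl : forall s, (0 < s)%R -> exists l, Cder (lin_phase lam delta) s l) by (intros; eexists; apply Cder_lin_phase).
  destruct (is_cint_exists_inf (fD n) (lin_phase lam delta) J' _ _ bD ltac:(lra) HKD (ZD n) Dl Hlin1 Hlindec) as [v Hv].
  apply CInt_is_cint; [|now exists v].
  intros t Ht; destruct HKD as [_ [f' [Hd' _]]]; eexists; apply Cder_mult; [now apply Hd'|apply Cder_lin_phase]. }
assert (ID : is_cint (fun s => sum_n (fun n => (Ci * RtoC lam) ^ n / RtoC (INR (fact n)) * (fD n s * lin_phase lam delta s)) N)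
   (sum_n (fun n => (Ci * RtoC lam) ^ n / RtoC (INR (fact n)) * vD n) N)).
{ apply (is_cint_sum (fun n s => (Ci * RtoC lam) ^ n / RtoC (INR (fact n)) * (fD n s * lin_phase lam delta s))).
  intros n _; apply is_cint_scal, HvD. }
set (sD := sum_n (fun n => (Ci * RtoC lam) ^ n / RtoC (INR (fact n)) * vD n) N) in *.
assert (IL : is_cint (fun s => fL s * (expi_rem (S N) (lam * Rpower s alpha) * lin_phase lam delta s)) (Iv - Sv - vR + sD)).
{ eapply is_cint_ext; [|apply is_cint_plus; [apply is_cint_minus; [apply is_cint_minus; [exact HI|exact HS]|exact HvR]|exact ID]].
  intros s Hs; cbv beta.
  assert (E : sum_n (fun n => (Ci * RtoC lam) ^ n / RtoC (INR (fact n)) * (fD n s * lin_phase lam delta s)) N =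
    (1 + - (1) * chi_left J w1 w2 alpha s) * Cpower s beta * lin_phase lam delta s *
      sum_n (fun n => (Ci * RtoC (lam * Rpower s alpha)) ^ n / RtoC (INR (fact n))) N).
  { rewrite <- sum_n_C_scal; apply sum_n_ext; intros n; unfold fD.
    rewrite Cpower_plus, Cpower_RtoC, RtoC_mult, !Cpow_mult_l, <- (RtoC_pow (Rpower s alpha)), Rpower_pow_mult, (Rmult_comm alpha).
    unfold Cdiv; Cring. }
  rewrite E, exp_rem_sum; unfold fL, fR, full_kernel.
  replace (chi_right J w1 w2 alpha s) with (1 - chi_left J w1 w2 alpha s - chi_mid J w1 w2 alpha s)
    by (rewrite <- (chi_sum J w1 w2 alpha s); ring).
  Cring. }
assert (Hlm : (0 < / lam ^ m0)%R) by (apply Rinv_0_lt_compat, pow_lt; lra).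
assert (BL : (Cmod (Iv - Sv - vR + sD) <= CL * / lam ^ m0)%R).
{ rewrite <- (pow_inv_split lam (S N) m0 Hl); apply (HCL lam delta fL); auto; try lra.
  apply (sym_le_order _ J); [exact HJ|]; apply (sym_sub J (fun s => 0 < s)%R); [intros; lra|exact SL]. }
assert (HlJ : forall k, (k + m0 <= J)%nat -> (lam ^ k * / lam ^ J <= / lam ^ m0)%R).
{ intros k Hk; rewrite <- (pow_inv_split lam k m0 Hl); apply Rmult_le_compat_l; [apply pow_le; lra|].
  apply Rinv_le_contravar; [apply pow_lt; lra|now apply Rle_pow]. }
assert (BR : (Cmod vR <= Rmax CR 0 * / lam ^ m0)%R).
{ eapply Rle_trans; [apply (HCR lam delta (mask fR)); auto; try lra|].
  - apply sym_mask; [lra|]; apply (sym_sub J (fun s => 0 < s)%R); [intros; lra|exact SR].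
  - intros s Hs; now apply (mask_zero _ bR).
  - now apply is_cint_mask.
  - pose proof (HlJ 0%nat ltac:(lia)) as Q; simpl in Q; rewrite Rmult_1_l in Q.
    assert (0 < / lam ^ J)%R by (apply Rinv_0_lt_compat, pow_lt; lra).
    apply Rle_trans with (Rmax CR 0 * / lam ^ J)%R; [apply Rmult_le_compat_r; [lra|apply Rmax_l]|].
    apply Rmult_le_compat_l; [apply Rmax_r|exact Q]. }
assert (BD : (Cmod sD <= INR (S N) * CD * / lam ^ m0)%R).
{ unfold sD; apply Rle_trans with (sum_n (fun _ : nat => (CD * / lam ^ m0)%R) N).
  - apply Cmod_sum_n_le; intros n Hn.
    rewrite Cmod_mult; unfold Cdiv; rewrite Cmod_mult, Cmod_pow, Cmod_mult, Cmod_Ci, Rmult_1_l, Cmod_R, Rabs_pos_eq by lra.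
    rewrite Cmod_inv by apply INR_fact_C; rewrite Cmod_R, Rabs_pos_eq by apply pos_INR.
    assert (F1 : (/ INR (fact n) <= 1)%R).
    { rewrite <- Rinv_1; apply Rinv_le_contravar; [lra|]; apply (le_INR 1), lt_O_fact. }
    assert (F0 : (0 < / INR (fact n))%R) by (apply Rinv_0_lt_compat, INR_fact_lt_0).
    pose proof (HCD n Hn lam delta (vD n) ltac:(lra) Hd (HvD n)) as Bn.
    assert (Hn' : (n + m0 <= J)%nat) by lia.
    pose proof (HlJ n Hn') as Q.
    assert (P1 : (0 < lam ^ n)%R) by (apply pow_lt; lra).
    pose proof (Cmod_ge_0 (vD n)).
    apply Rle_trans with (lam ^ n * Cmod (vD n))%R.
    + apply Rmult_le_compat_r; [assumption|]. nra.
    + apply Rle_trans with (lam ^ n * (CD * / lam ^ J))%R; [now apply Rmult_le_compat_l; [lra|]|].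
      replace (lam ^ n * (CD * / lam ^ J))%R with (CD * (lam ^ n * / lam ^ J))%R by ring.
      now apply Rmult_le_compat_l.
  - right; rewrite sum_n_const; ring. }
replace (Iv - Sv) with ((Iv - Sv - vR + sD) + vR + - sD) by ring.
rewrite !Rmult_plus_distr_r.
eapply Rle_trans; [apply Cmod_triangle|]; apply Rplus_le_compat; [|now rewrite Cmod_opp].
eapply Rle_trans; [apply Cmod_triangle|]; now apply Rplus_le_compat.
Qed.

(** The support is bounded, so the damping can be removed from the stationary part: this provides
    the undamped integral that [stationary_expansion] describes. *)
Lemma stationary_undamped alpha beta a b w w1 w2 J lam : (1 < alpha)%R -> psi_window alpha a b w ->
  (0 < w1 < w2)%R -> (w2 < w)%R -> (0 < lam)%R ->
  exists Sf : R -> C, (forall delta, (0 <= delta)%R ->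
    is_cint (fun s => chi_mid (S J) w1 w2 alpha s * Cpower s beta * full_kernel alpha lam delta s) (Sf delta)) /\
    Clim Sf at_zero (Sf 0%R).
Proof.
intros Ha Hwin Hw12 Hw2 Hl.
pose proof Hwin as [[Ha0 Has] [Hbs [Hw [Hwa Hwb]]]].
assert (Hpos : open_pos (fun s => 0 < s)%R) by (apply open_pos_ray; lra).
destruct (sym_chi_mid (S J) w1 w2 alpha a b w (- Re beta) Ha Hwin Hw12 Hw2) as [K1 HK1].
destruct (sym_Cpower (S J) beta) as [K2 HK2].
pose proof (sym_mult _ _ _ _ _ _ _ _ HK1 (HK2 _ Hpos)) as HF.
set (F := fun s => chi_mid (S J) w1 w2 alpha s * Cpower s beta) in *.
set (K := (2 ^ S J * (K1 * K2))%R) in *.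
assert (HK0 : (0 <= K)%R) by (apply (sym_nonneg _ _ _ _ _ 1 HF); lra).
assert (HFb : forall s, (0 < s)%R -> (Cmod (F s) <= K)%R).
{ intros s Hs; pose proof (sym_bound _ _ _ _ _ HF s Hs) as B.
  replace (- Re beta + Re beta)%R with 0%R in B by ring; rewrite Rpower_O, Rmult_1_r in B by exact Hs; exact B. }
assert (HF0 : forall s, (b < s)%R -> F s = 0).
{ intros s Hs; pose proof (psi_above _ _ _ _ s Ha Hwin Hs); unfold F, chi_mid; rewrite bump_0; [ring|exact Hw12|rewrite Rabs_pos_eq; lra]. }
destruct HF as [_ [F' [HFd _]]].
assert (Hd : forall delta t, (0 < t)%R -> exists l, Cder (fun s => F s * full_kernel alpha lam delta s) t l).
{ intros delta t Ht; destruct (Cder_full_kernel alpha lam delta t Ht) as [l Hl']; eexists; apply Cder_mult; [now apply HFd|exact Hl']. }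
set (Sf := fun delta => CInt (fun s => F s * full_kernel alpha lam delta s) at_zero at_inf).
assert (HS : forall delta, (0 <= delta)%R -> is_cint (fun s => F s * full_kernel alpha lam delta s) (Sf delta)).
{ intros delta Hdel; apply CInt_is_cint; [auto|].
  apply (is_cint_exists_zero (fun s => F s * full_kernel alpha lam delta s) K b (b + 1) 0); try lra.
  - intros; apply Hd; lra.
  - intros t Ht; rewrite HF0 by exact Ht; ring.
  - intros t Ht; rewrite Rpower_O, Rmult_1_r by lra; rewrite Cmod_mult, <- (Rmult_1_r K).
    apply Rmult_le_compat; try apply Cmod_ge_0; [apply HFb; lra|rewrite Cmod_full_kernel; apply lin_phase_le_1; lra]. }
exists Sf; split; [exact HS|].
set (b1 := (b + 1)%R).
set (C0 := (K * (lam * b1) * (Rpower b1 (0 + 1) / (0 + 1)))%R).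
apply (Clim_ext_loc (fun delta => Sf 0%R + (Sf delta - Sf 0%R))); [apply filter_forall; intros; ring|].
apply (Clim_eq (F := at_zero) _ (Sf 0%R + 0)); [apply Clim_plus; [apply Clim_const|]|ring].
apply (Clim_0_bound (F := at_zero) _ (fun delta => C0 * delta)%R).
- generalize at_zero_pos; apply filter_imp; intros delta Hdel.
  pose proof (is_cint_minus _ _ _ _ (HS delta ltac:(lra)) (HS 0%R ltac:(lra))) as I.
  replace (C0 * delta)%R with (K * (lam * b1) * delta * (Rpower b1 (0 + 1) / (0 + 1)))%R by (unfold C0; ring).
  apply (is_cint_bound_zero _ _ _ b1 0 I); [unfold b1; lra|lra| |].
  + intros t Ht; rewrite HF0 by (unfold b1 in Ht; lra); ring.
  + intros t Ht; rewrite Rpower_O, Rmult_1_r by lra.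
    replace (F t * full_kernel alpha lam delta t - F t * full_kernel alpha lam 0 t) with
      (F t * (full_kernel alpha lam delta t - full_kernel alpha lam 0 t)) by ring.
    rewrite Cmod_mult, (Rmult_assoc K); apply Rmult_le_compat; try apply Cmod_ge_0; [apply HFb; lra|].
    assert (E : full_kernel alpha lam delta t - full_kernel alpha lam 0 t =
       RtoC (exp (- (lam * delta * t)) - 1) * full_kernel alpha lam 0 t).
    { assert (E1 : lin_phase lam delta t = RtoC (exp (- (lam * delta * t))) * lin_phase lam 0 t).
      { unfold lin_phase, zeta; rewrite <- Cexp_RtoC, <- Cexp_plus; f_equal; apply C_eq; simpl; ring. }
      unfold full_kernel; rewrite E1, RtoC_minus; ring. }
    rewrite E, Cmod_mult, Cmod_R, Cmod_full_kernel.
    assert (P : (0 <= lam * delta * t)%R) by (repeat apply Rmult_le_pos; lra).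
    assert (Q : (exp (- (lam * delta * t)) <= 1)%R).
    { rewrite <- exp_0; destruct P as [P|P]; [left; apply exp_increasing; lra|right; f_equal; lra]. }
    rewrite Rabs_left1 by lra.
    pose proof (exp_ineq1_le (- (lam * delta * t))) as P1.
    pose proof (lin_phase_le_1 lam 0 t ltac:(lra) ltac:(lra) ltac:(lra)) as P2.
    pose proof (Cmod_ge_0 (lin_phase lam 0 t)) as P3.
    apply Rle_trans with (lam * delta * t)%R; [nra|].
    replace (lam * b1 * delta)%R with (lam * delta * b1)%R by ring.
    apply Rmult_le_compat_l; [nra|lra].
- eapply Rlim_eq; [apply Rlim_const_mult; [typeclasses eauto|]|].
  + intros P [d Hd']; exists d; intros y Hy _; apply Hd', Hy.
  + ring.
Qed.

(** * Passage to the real axis *)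

Lemma entire_boundary_limit (F : C -> C) x : entire F -> Clim (fun eps => F (x, (- eps)%R)) at_zero (F (RtoC x)).
Proof.
intros HF.
pose proof (ex_derive_continuous (K := C_AbsRing) (V := C_NormedModule) F (RtoC x) (HF (RtoC x))) as Hc.
assert (L : filterlim (fun eps => F (x, (- eps)%R)) at_zero (locally (F (RtoC x) : C_NormedModule))).
{ apply (filterlim_comp _ _ _ (fun eps => (x, (- eps)%R) : C) F at_zero (@locally (AbsRing_UniformSpace C_AbsRing) (RtoC x))); [|exact Hc].
  intros P [d Hd]; generalize (at_zero_lt d (cond_pos d)); unfold filtermap; apply filter_imp; intros eps Heps.
  apply Hd; unfold ball; simpl; unfold AbsRing_ball.
  replace (minus ((x, (- eps)%R) : C_AbsRing) (RtoC x : C_AbsRing)) with (RtoC (- eps) * Ci).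
  - change (abs (RtoC (- eps) * Ci : C_AbsRing)) with (Cmod (RtoC (- eps) * Ci)).
    rewrite Cmod_mult, Cmod_Ci, Cmod_R, Rabs_Ropp, Rabs_pos_eq; lra.
  - unfold minus, plus, opp; simpl; apply C_eq; simpl; ring. }
split; intros P HP.
- apply (L (fun z => P (Re z))); destruct HP as [d Hd]; exists d; intros z [Hz _]; now apply Hd.
- apply (L (fun z => P (Im z))); destruct HP as [d Hd]; exists d; intros z [_ Hz]; now apply Hd.
Qed.

Lemma Clim_pow F {FF : ProperFilter F} f l n : Clim f F l -> Clim (fun t => f t ^ n) F (l ^ n).
Proof.
intros H; induction n as [|n IH]; simpl; [apply Clim_const|now apply Clim_mult].
Qed.

Lemma Clim_w x : Clim (fun eps => (eps, x)) at_zero (0%R, x).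
Proof.
split; simpl; [|apply filterlim_const].
intros P [d Hd]; exists d; intros y Hy _; now apply Hd.
Qed.

(** The value in [laplace_fp_value] at [w = i x], where [Log w = ln x + i pi / 2]. *)
Definition laplace_boundary (s : C) (x : R) (B : nat) : C :=
  Cexp (- s * (ln x, (PI / 2)%R)) * Gamma_star s - log_coef s (0%R, x) B * (ln x, (PI / 2)%R).

Lemma Clim_laplace s x B : (0 < x)%R ->
  Clim (fun eps => Cexp (- s * Clog eps x) * Gamma_star s - log_coef s (eps, x) B * Clog eps x) at_zero (laplace_boundary s x B).
Proof.
intros Hx; assert (L := Clim_Clog x Hx); unfold laplace_boundary.
apply (Clim_minus (F := at_zero)).
- apply (Clim_mult (F := at_zero)); [|apply Clim_const].
  apply (Clim_Cexp (F := at_zero)), (Clim_scal (F := at_zero)), L.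
- apply (Clim_mult (F := at_zero)); [|exact L].
  unfold log_coef.
  apply (Clim_sum_n at_zero (fun m eps => if Ceq_dec (s + RtoC (INR m)) 0 then (- (eps, x)) ^ m / RtoC (INR (fact m)) else RtoC 0)
    (fun m => if Ceq_dec (s + RtoC (INR m)) 0 then (- (0%R, x)) ^ m / RtoC (INR (fact m)) else RtoC 0)).
  intros m _; destruct (Ceq_dec (s + RtoC (INR m)) 0); [|apply Clim_const].
  apply (Clim_mult (F := at_zero)); [|apply Clim_const].
  apply (Clim_pow at_zero (fun eps => - (eps, x))), (Clim_opp (F := at_zero)), Clim_w.
Qed.

Definition algebraic_coef alpha beta (n : nat) : C :=
  1 / RtoC (INR (fact n)) * Cexp (- (Ci * RtoC PI / 2) * (beta + 1 + RtoC (INR n * (alpha - 1))))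
  * Gamma_star (beta + RtoC (INR n * alpha) + 1).

Lemma Ci_pow n : Ci ^ n = Cexp (Ci * RtoC PI / 2 * RtoC (INR n)).
Proof.
replace (Ci * RtoC PI / 2 * RtoC (INR n)) with (RtoC (INR n) * (Ci * RtoC (PI / 2))).
2:{ unfold Rdiv; rewrite RtoC_mult, RtoC_inv by lra; unfold Cdiv; ring. }
rewrite <- Cexp_pow; f_equal.
unfold Cexp; simpl; apply C_eq; simpl.
- replace (0 * 0 + 1 * (PI / 2))%R with (PI / 2)%R by ring; rewrite cos_PI2; ring.
- replace (0 * 0 + 1 * (PI / 2))%R with (PI / 2)%R by ring. rewrite sin_PI2.
  replace (0 * (PI / 2) - 1 * 0)%R with 0%R by ring; rewrite exp_0; ring.
Qed.

Lemma log_value x : ((ln x, (PI / 2)%R) : C) = RtoC (ln x) + RtoC PI * Ci / 2.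
Proof.
replace (RtoC PI * Ci / 2) with (RtoC (PI / 2) * Ci).
2:{ unfold Rdiv; rewrite RtoC_mult, RtoC_inv by lra; unfold Cdiv; ring. }
apply C_eq; simpl; field.
Qed.

(** With [s = beta + n alpha + 1], [i^n (i x)^(-s) = e^(- i pi (s - n) / 2) x^(-s)] produces the
    coefficients, and the [log_coef] run through the pairs of the logarithmic sum. *)
Lemma algebraic_part alpha beta x N : (1 < alpha)%R -> (0 < x)%R -> (pair_bound beta <= N)%nat ->
  sum_n (fun n => Ci ^ n / RtoC (INR (fact n)) * laplace_boundary (pole_exponent alpha beta n) x N) N =
  sum_n (fun n => algebraic_coef alpha beta n / Cpower x (beta + RtoC (INR n * alpha) + 1)) N -
  pair_sum (pair_bound beta) (pair_eq_dec alpha beta)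
             (fun n m => Ci ^ n / Ci ^ m * RtoC x ^ m
                         / (RtoC (INR (fact n)) * RtoC (INR (fact m))))
           * (RtoC (ln x) + RtoC PI * Ci / 2).
Proof.
intros Ha Hx HB.
rewrite <- log_value.
set (L := (ln x, (PI / 2)%R) : C).
rewrite (pair_sum_extend _ N _ (pair_eq_dec alpha beta) _ HB) by (intros n m; now apply pair_bound_eq).
assert (E : forall u v w : C, u + w = v -> u = v - w) by (intros u v w <-; ring).
apply E; clear E.
unfold pair_sum; rewrite Cmult_comm, <- sum_n_C_scal, <- sum_n_C_plus; apply sum_n_ext; intros n.
unfold laplace_boundary; fold L; set (s := pole_exponent alpha beta n).
assert (E1 : Ci ^ n * Cexp (- s * L) = Cexp (- (Ci * RtoC PI / 2) * (beta + 1 + RtoC (INR n * (alpha - 1)))) / Cpower x s).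
{ rewrite Ci_pow; unfold Cdiv at 2; rewrite <- Cpower_opp; unfold Cpower; rewrite <- !Cexp_plus; f_equal.
  unfold s, pole_exponent, L. change (@eq C (Ci * RtoC PI / 2 * RtoC (INR n) + - (beta + RtoC (INR n * alpha) + 1) * (ln x, (PI / 2)%R))
   (- (Ci * RtoC PI / 2) * (beta + 1 + RtoC (INR n * (alpha - 1))) + - (beta + RtoC (INR n * alpha) + 1) * RtoC (ln x))).
  rewrite log_value, !RtoC_mult, RtoC_minus; field. }
assert (E2 : sum_n (fun m => if pair_eq_dec alpha beta n m then Ci ^ n / Ci ^ m * RtoC x ^ m
                         / (RtoC (INR (fact n)) * RtoC (INR (fact m))) else RtoC 0) N =
  Ci ^ n / RtoC (INR (fact n)) * log_coef s (0%R, x) N).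
{ unfold log_coef; rewrite <- sum_n_C_scal; apply sum_n_ext; intros m.
  assert (Es : pair_exponent alpha beta n m = s + RtoC (INR m)) by (unfold s, pole_exponent, pair_exponent; ring).
  destruct (pair_eq_dec alpha beta n m) as [p|p], (Ceq_dec (s + RtoC (INR m)) 0) as [q|q];
    unfold pair_eq in p; rewrite Es in p; [|contradiction|contradiction|Cring].
  replace (- (0%R, x)) with (/ Ci * RtoC x) by (apply C_eq; simpl; field).
  rewrite Cpow_mult_l, Cpow_inv by apply Ci_neq0.
  Cfield; repeat split; try apply INR_fact_C. apply Cpow_nz, Ci_neq0. }
rewrite E2; unfold algebraic_coef; fold (pole_exponent alpha beta n); fold s.
replace (1 / RtoC (INR (fact n)) * Cexp (- (Ci * RtoC PI / 2) * (beta + 1 + RtoC (INR n * (alpha - 1)))) * Gamma_star s / Cpower x s)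
  with (1 / RtoC (INR (fact n)) * (Cexp (- (Ci * RtoC PI / 2) * (beta + 1 + RtoC (INR n * (alpha - 1)))) / Cpower x s) * Gamma_star s)
  by (unfold Cdiv; ring).
rewrite <- E1; Cfield; apply INR_fact_C.
Qed.

(** * Scaling *)

(** The scale [X = x^(1/(alpha-1))] balances the two phases: if [t = X s] then
    [t^alpha = lam s^alpha] and [x t = lam s]. *)
Lemma rem_integrand_scaled alpha beta eps x X lam N Jv : (0 < x)%R -> (0 < X)%R -> Rpower X alpha = lam ->
  (x * X = lam)%R -> is_cint (rem_integrand alpha beta (eps, x) N) Jv ->
  is_cint (fun s => Cpower s beta * (expi_rem N (lam * Rpower s alpha) * lin_phase lam (eps / x) s))
    (Jv / Cpower X (beta + 1)).
Proof.
intros Hx HX HXa HxX HJ.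
pose proof (is_cint_scal (/ Cpower X (beta + 1)) _ _ (is_cint_scaling X _ _ HX HJ)) as I.
eapply is_cint_eq; [eapply is_cint_ext; [|exact I]|unfold Cdiv; ring].
intros s Hs; unfold rem_integrand; cbv beta.
rewrite Cpower_mult_base, <- Rpower_mult_distr, HXa by assumption.
replace (Cexp (- (eps, x) * RtoC (X * s))) with (lin_phase lam (eps / x) s).
- rewrite Cpower_succ by exact HX; field.
  split; [intros E; apply RtoC_inj in E; lra|apply Cpower_neq0].
- unfold lin_phase, zeta; f_equal; apply C_eq; simpl; rewrite <- HxX; field; lra.
Qed.

Lemma nat_above (r : R) : exists n : nat, (r <= INR n)%R.
Proof.
destruct (archimed r) as [Hu _]; exists (Z.to_nat (up r)).
destruct (Z_le_dec 0 (up r)) as [L|L].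
- rewrite INR_IZR_INZ, Z2Nat.id by exact L; lra.
- assert (up r <= -1)%Z by lia; apply IZR_le in H; pose proof (pos_INR (Z.to_nat (up r))); lra.
Qed.

Lemma h_s0 alpha : (1 < alpha)%R -> h alpha (s0 alpha) = (s0 alpha * (1 - 1 / alpha))%R.
Proof.
intros Ha; unfold h; pose proof (s0_slope alpha Ha) as E.
replace (Rpower (s0 alpha) alpha) with (Rpower (s0 alpha) (alpha - 1) * s0 alpha)%R.
- replace (Rpower (s0 alpha) (alpha - 1)) with (1 / alpha)%R; [ring|].
  apply Rmult_eq_reg_l with alpha; [rewrite E; field; lra|lra].
- rewrite <- (Rpower_1 (s0 alpha)) at 2 by apply s0_pos.
  rewrite <- Rpower_plus; f_equal; ring.
Qed.

Lemma stationary_part alpha beta x N2 : (1 < alpha)%R -> (0 < x)%R ->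
  Cpower (Rpower x (1 / (alpha - 1))) (beta + 1) *
   (Cexp (- Ci * RtoC (Rpower x (alpha / (alpha - 1)) * h alpha (s0 alpha))) *
    sum_n (fun n => stationary_coef alpha beta n * Cpower (Rpower x (alpha / (alpha - 1))) (- half_int n)) N2) =
  Cexp (- Ci * RtoC (Rpower alpha (- (1 / (alpha - 1))) * (1 - 1 / alpha) * Rpower x (alpha / (alpha - 1))))
   * Cpower x ((beta + 1 - RtoC (alpha / 2)) / RtoC (alpha - 1))
   * sum_n (fun n => stationary_coef alpha beta n / RtoC (Rpower x (INR n * alpha / (alpha - 1)))) N2.
Proof.
intros Ha Hx.
rewrite h_s0 by exact Ha; fold (s0 alpha).
replace (Rpower x (alpha / (alpha - 1)) * (s0 alpha * (1 - 1 / alpha)))%R with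
  (s0 alpha * (1 - 1 / alpha) * Rpower x (alpha / (alpha - 1)))%R by ring.
set (e := Cexp _).
rewrite <- !sum_n_C_scal; apply sum_n_ext; intros n.
assert (E : Cpower (Rpower x (1 / (alpha - 1))) (beta + 1) * Cpower (Rpower x (alpha / (alpha - 1))) (- half_int n) =
  Cpower x ((beta + 1 - RtoC (alpha / 2)) / RtoC (alpha - 1)) / RtoC (Rpower x (INR n * alpha / (alpha - 1)))).
{ rewrite <- Cpower_RtoC; unfold Cdiv; rewrite <- Cpower_opp; unfold Cpower, Rpower; rewrite !ln_exp, <- !Cexp_plus; f_equal.
  unfold half_int, Rdiv; rewrite !RtoC_mult, RtoC_plus, !RtoC_mult, !RtoC_inv, !RtoC_minus by lra.
  field; cbv beta; rewrite <- RtoC_minus; intros E; apply RtoC_inj in E; lra. }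
transitivity (e * stationary_coef alpha beta n * (Cpower (Rpower x (1 / (alpha - 1))) (beta + 1) * Cpower (Rpower x (alpha / (alpha - 1))) (- half_int n))); [Cring|].
rewrite E; unfold Cdiv; Cring.
Qed.

(** Negative powers of [lam] absorb the factor [X^(beta+1)] left by the change of scale. *)
Lemma error_bound alpha beta M x k : (1 < alpha)%R -> (1 <= x)%R ->
  ((Re beta + 1 + M * (alpha - 1)) / alpha <= INR k)%R ->
  (Rpower (Rpower x (1 / (alpha - 1))) (Re beta + 1) * / Rpower x (alpha / (alpha - 1)) ^ k <= Rpower x (- M))%R.
Proof.
intros Ha Hx Hk.
rewrite Rpower_mult, Rpower_pow_mult, <- Rpower_Ropp, <- Rpower_plus.
apply Rle_Rpower; [exact Hx|].
apply Rmult_le_reg_r with (alpha - 1)%R; [lra|].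
replace ((1 / (alpha - 1) * (Re beta + 1) + - (alpha / (alpha - 1) * INR k)) * (alpha - 1))%R with
  (Re beta + 1 - alpha * INR k)%R by (field; lra).
apply (Rmult_le_compat_l alpha) in Hk; [|lra].
replace (alpha * ((Re beta + 1 + M * (alpha - 1)) / alpha))%R with (Re beta + 1 + M * (alpha - 1))%R in Hk by (field; lra).
lra.
Qed.

(** For [eps > 0] the bounds of [off_stationary_bound] are uniform in [eps]; they pass to the limit
    together with the explicit terms, and [stationary_expansion] is applied at [eps = 0]. *)
Lemma expansion_error alpha beta (F : C -> C) M N1 N2 m0 : (1 < alpha)%R -> entire F ->
  (forall z : C, (Im z < 0)%R -> F z = F_finite_part alpha beta z) ->
  ((Re beta + 1 + M * (alpha - 1)) / alpha <= INR m0)%R -> (m0 <= S N2)%nat ->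
  (pair_bound beta <= N1)%nat -> (0 <= INR N1 + Re beta)%R ->
  (Re beta + (alpha - 1) * INR (S N1) - INR m0 > -1)%R ->
  exists K, forall x, (1 <= x)%R ->
    (Cmod (F (RtoC x)
       - sum_n (fun n => (Ci ^ n / RtoC (INR (fact n)) * laplace_boundary (pole_exponent alpha beta n) x N1)%C) N1
       - Cpower (Rpower x (1 / (alpha - 1))) (beta + 1) *
         (Cexp (- Ci * RtoC (Rpower x (alpha / (alpha - 1)) * h alpha (s0 alpha))) *
          sum_n (fun n => (stationary_coef alpha beta n * Cpower (Rpower x (alpha / (alpha - 1))) (- half_int n))%C) N2))
     <= K * Rpower x (- M))%R.
Proof.
intros Ha HF HFl Hm0 HN2 HB HN1 HJ.
destruct (psi_window_exists alpha Ha) as [a [b [w Hwin]]].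
assert (Hw : (0 < w)%R) by apply Hwin.
assert (Hw12 : (0 < w / 3 < 2 * w / 3)%R) by lra.
assert (Hw2 : (2 * w / 3 < w)%R) by lra.
destruct (nat_above (Rabs (Re beta) + INR N1 * alpha + INR N1 + INR m0 + 2)) as [q Hq].
(* The order of smoothness of the cutoffs: [S N1 + m0] integrations by parts near [0], [q] for
   convergence at infinity and for the polynomial part, and [N2] for the expansion at the stationary
   point. *)
set (J' := (S N1 + m0 + q + N2)%nat).
assert (HJJ : (INR q <= INR (S J'))%R) by (apply le_INR; unfold J'; lia).
pose proof (Rle_abs (Re beta)) as Hab; pose proof (Rle_abs (- Re beta)) as Hab'; rewrite Rabs_Ropp in Hab'.
pose proof (pos_INR N1) as PN1; pose proof (pos_INR m0) as Pm0.
assert (HJ0 : (Re beta + alpha * INR (S N1) - INR (S N1 + m0) > -1)%R) by (rewrite plus_INR; lra).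
destruct (off_stationary_bound alpha beta a b w _ _ N1 m0 (S J') Ha Hwin Hw12 Hw2 HJ0) as [K1 HK1].
{ unfold J'; lia. }
{ nra. }
{ lra. }
destruct (stationary_expansion alpha beta a b w _ _ J' N2 Ha Hwin Hw12 Hw2) as [K2 HK2]; [unfold J'; lia|].
exists (Rmax K1 0 + Rmax K2 0)%R; intros x Hx.
set (X := Rpower x (1 / (alpha - 1))); set (lam := Rpower x (alpha / (alpha - 1))).
assert (HX : (0 < X)%R) by apply exp_pos.
assert (Hlam : (1 <= lam)%R).
{ unfold lam; rewrite <- (Rpower_O x) at 1 by lra; apply Rle_Rpower; [exact Hx|].
  left; apply Rdiv_lt_0_compat; lra. }
assert (HXa : Rpower X alpha = lam).
{ unfold X, lam; rewrite Rpower_mult; f_equal; field; lra. }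
assert (HxX : (x * X = lam)%R).
{ unfold X, lam; rewrite <- (Rpower_1 x) at 1 by lra; rewrite <- Rpower_plus; f_equal; field; lra. }
destruct (stationary_undamped alpha beta a b w _ _ J' lam Ha Hwin Hw12 Hw2 ltac:(lra)) as [Sf [HSf LSf]].
set (P := fun n eps => Cexp (- pole_exponent alpha beta n * Clog eps x) * Gamma_star (pole_exponent alpha beta n)
   - log_coef (pole_exponent alpha beta n) (eps, x) N1 * Clog eps x).
set (c := Cpower X (beta + 1)).
assert (B0 : (Cmod (Sf 0%R - Cexp (- Ci * RtoC (lam * h alpha (s0 alpha))) *
   sum_n (fun n => (stationary_coef alpha beta n * Cpower lam (- half_int n))%C) N2) <= K2 * / lam ^ S N2)%R).
{ apply HK2; [exact Hlam|].
  eapply is_cint_ext; [|apply (HSf 0%R); lra].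
  intros s Hs; unfold chi_mid, full_kernel, lin_phase, zeta, h; cbv beta.
  rewrite <- Cexp_plus; f_equal; f_equal; apply C_eq; simpl; ring. }
(* For [eps > 0] this is the integral of the Taylor remainder without its stationary part. *)
set (G := fun eps => F (x, (- eps)%R) - sum_n (fun n => Ci ^ n / RtoC (INR (fact n)) * P n eps) N1 - c * Sf (/ x * eps)%R).
assert (BG : forall eps, (0 < eps < x)%R -> (Cmod (G eps) <= Rpower X (Re beta + 1) * (Rmax K1 0 * / lam ^ m0))%R).
{ intros eps He.
  destruct (rem_integrand_exists alpha beta (eps, x) N1 Ha) as [_ [Jv HJv]].
  { simpl; lra. }
  { rewrite S_INR in *; nra. }
  assert (E : F (x, (- eps)%R) = sum_n (fun n => Ci ^ n / RtoC (INR (fact n)) * P n eps) N1 + Jv).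
  { rewrite HFl by (simpl; lra).
    apply (F_finite_part_decomposition alpha beta eps x N1 (fun n => P n eps) Jv); auto; try lra.
    intros n Hn; apply laplace_fp_value; [lra|].
    unfold pole_exponent; pose proof (pos_INR n); simpl; unfold Re in *; simpl in *; nra. }
  pose proof (rem_integrand_scaled alpha beta eps x X lam (S N1) Jv ltac:(lra) HX HXa HxX HJv) as IJ.
  assert (Hdel : (0 < eps / x <= 1)%R).
  { split; [apply Rdiv_lt_0_compat; lra|]. apply Rmult_le_reg_r with x; [lra|]; unfold Rdiv; rewrite Rmult_assoc, Rinv_l; lra. }
  assert (BI := HK1 lam (eps / x)%R (Jv / Cpower X (beta + 1)) (Sf (eps / x)%R) Hlam Hdel IJ (HSf (eps / x)%R ltac:(lra))).
  replace (G eps) with (c * (Jv / Cpower X (beta + 1) - Sf (eps / x)%R)).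
  - rewrite Cmod_mult; unfold c; rewrite Cmod_Cpower.
    replace (Re (beta + 1)) with (Re beta + 1)%R by reflexivity.
    apply Rmult_le_compat_l; [left; apply exp_pos|].
    eapply Rle_trans; [exact BI|]; apply Rmult_le_compat_r; [left; apply Rinv_0_lt_compat, pow_lt; lra|apply Rmax_l].
  - unfold G; rewrite E; replace (/ x * eps)%R with (eps / x)%R by (unfold Rdiv; ring).
    unfold c. transitivity (Jv - Cpower X (beta + 1) * Sf (eps / x)%R); [field; apply Cpower_neq0|Cring]. }
assert (LG : Clim G at_zero (F (RtoC x) - sum_n (fun n => Ci ^ n / RtoC (INR (fact n)) * laplace_boundary (pole_exponent alpha beta n) x N1) N1 - c * Sf 0%R)).
{ unfold G; apply (Clim_minus (F := at_zero)); [apply (Clim_minus (F := at_zero))|].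
  - now apply entire_boundary_limit.
  - apply (Clim_sum_n at_zero (fun n eps => Ci ^ n / RtoC (INR (fact n)) * P n eps)
      (fun n => Ci ^ n / RtoC (INR (fact n)) * laplace_boundary (pole_exponent alpha beta n) x N1)).
    intros n _; apply (Clim_scal (F := at_zero)), Clim_laplace; lra.
  - apply (Clim_scal (F := at_zero)).
    apply (Clim_comp Sf (fun eps => / x * eps)%R at_zero at_zero); [typeclasses eauto| |exact LSf].
    apply at_zero_scale, Rinv_0_lt_compat; lra. }
assert (BL : (Cmod (F (RtoC x) - sum_n (fun n => (Ci ^ n / RtoC (INR (fact n)) * laplace_boundary (pole_exponent alpha beta n) x N1)%C) N1 - c * Sf 0%R)
   <= Rpower X (Re beta + 1) * (Rmax K1 0 * / lam ^ m0))%R).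
{ eapply (Clim_Cmod_le (F := at_zero)); [|exact LG].
  generalize (at_zero_lt x ltac:(lra)); apply filter_imp; exact BG. }
set (st := Cexp (- Ci * RtoC (lam * h alpha (s0 alpha))) * sum_n (fun n => (stationary_coef alpha beta n * Cpower lam (- half_int n))%C) N2) in *.
set (al := sum_n (fun n => (Ci ^ n / RtoC (INR (fact n)) * laplace_boundary (pole_exponent alpha beta n) x N1)%C) N1) in *.
replace (F (RtoC x) - al - c * st) with ((F (RtoC x) - al - c * Sf 0%R) + c * (Sf 0%R - st)) by Cring.
eapply Rle_trans; [apply Cmod_triangle|].
assert (Hp : (0 < Rpower X (Re beta + 1))%R) by apply exp_pos.
assert (Hlk : forall k, (0 < / lam ^ k)%R) by (intros; apply Rinv_0_lt_compat, pow_lt; lra).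
rewrite Rmult_plus_distr_r; apply Rplus_le_compat.
- eapply Rle_trans; [exact BL|].
  replace (Rpower X (Re beta + 1) * (Rmax K1 0 * / lam ^ m0))%R with (Rmax K1 0 * (Rpower X (Re beta + 1) * / lam ^ m0))%R by ring.
  apply Rmult_le_compat_l; [apply Rmax_r|now apply error_bound].
- rewrite Cmod_mult; unfold c; rewrite Cmod_Cpower; replace (Re (beta + 1)) with (Re beta + 1)%R by reflexivity.
  apply Rle_trans with (Rpower X (Re beta + 1) * (Rmax K2 0 * / lam ^ S N2))%R.
  + apply Rmult_le_compat_l; [lra|]; eapply Rle_trans; [exact B0|].
    apply Rmult_le_compat_r; [left; apply Hlk|apply Rmax_l].
  + replace (Rpower X (Re beta + 1) * (Rmax K2 0 * / lam ^ S N2))%R with (Rmax K2 0 * (Rpower X (Re beta + 1) * / lam ^ S N2))%R by ring.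
    apply Rmult_le_compat_l; [apply Rmax_r|apply error_bound; auto].
    eapply Rle_trans; [exact Hm0|now apply le_INR].
Qed.

Theorem proposition1 (alpha : R) (beta : C) (F : C -> C)
    (alpha_gt1 : (1 < alpha)%R)
    (F_entire : entire F)
    (F_lower : forall z : C, (Im z < 0)%R -> F z = F_finite_part alpha beta z) :
  exists c d : nat -> C,
    asymptotic_sum
      (fun x => F (RtoC x)
         + pair_sum (pair_bound beta) (pair_eq_dec alpha beta)
             (fun n m => Ci ^ n / Ci ^ m * RtoC x ^ m
                         / (RtoC (INR (fact n)) * RtoC (INR (fact m))))
           * (RtoC (ln x) + RtoC PI * Ci / 2))
      (fun n x => c n / Cpower x (beta + RtoC (INR n * alpha) + 1))
      (fun x => Cexp (- Ci * RtoC (Rpower alpha (- (1 / (alpha - 1)))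
                                   * (1 - 1 / alpha)
                                   * Rpower x (alpha / (alpha - 1))))
                * Cpower x ((beta + 1 - RtoC (alpha / 2)) / RtoC (alpha - 1)))
      (fun n x => d n / RtoC (Rpower x (INR n * alpha / (alpha - 1))))
    /\ (forall n : nat,
          c n = 1 / RtoC (INR (fact n))
                * Cexp (- (Ci * RtoC PI / 2)
                        * (beta + 1 + RtoC (INR n * (alpha - 1))))
                * Gamma_star (beta + RtoC (INR n * alpha) + 1))
    /\ (forall n : nat,
          d n = 1 / RtoC (INR (fact (2 * n)))
                * Cexp (Ci * RtoC (PI * (2 * INR n + 1) / 4))
                * CGamma (RtoC (INR n + 1 / 2))
                * delta_pairing alpha beta (2 * n)).
Proof.
exists (algebraic_coef alpha beta), (stationary_coef alpha beta).
split; [|split; reflexivity].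
intros M HM.
(* [lam ^ - m0] outweighs [x ^ - M]; [n1] terms reach all monomials singular at [0]; after [n2] terms
   the Taylor remainder is small enough at [0] for the integrations by parts. *)
destruct (nat_above ((Re beta + 1 + M * (alpha - 1)) / alpha)) as [m0 Hm0].
destruct (nat_above (- Re beta)) as [n1 Hn1].
destruct (nat_above ((INR m0 - Re beta) / (alpha - 1))) as [n2 Hn2].
exists (m0 + pair_bound beta + n1 + n2)%nat; intros N1 N2 HN1 HN2.
assert (L1 : (INR n1 <= INR N1)%R) by (apply le_INR; lia).
assert (L2 : (INR n2 <= INR N1)%R) by (apply le_INR; lia).
destruct (expansion_error alpha beta F M N1 N2 m0 alpha_gt1 F_entire F_lower Hm0) as [K HK]; try lia; try lra.
{ rewrite S_INR.
  assert (Q : (INR m0 - Re beta <= (alpha - 1) * INR N1)%R).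
  { apply Rle_trans with ((alpha - 1) * ((INR m0 - Re beta) / (alpha - 1)))%R; [right; field; lra|].
    apply Rmult_le_compat_l; lra. }
  lra. }
exists K, 1%R; intros x Hx.
eapply Rle_trans; [|apply (HK x); lra].
right; f_equal.
rewrite stationary_part, (algebraic_part alpha beta x N1) by (lia || lra).
Cring.
Qed.
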